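(* Let $\Sigma$ be a simply connected orientable surface (with transition functions of class at least $C^6$) and let $\nabla$ be a torsion-free affine connection of class $C^4$ on $\Sigma$. Let $I_N$, $I_S=W_{abc}$ and ${T_a}^b$ be the invariants of $\nabla$ defined in the context. Then: (1) A necessary condition for $\nabla$ to admit a linear first integral is that $I_N=0$ and $I_S=0$ on $\Sigma$. (2) For any point $p\in\Sigma$ there exists a neighbourhood $U\subset\Sigma$ of $p$ such that the conditions $I_N=I_S=0$ on $U$ are sufficient for the existence of a linear first integral on $U$. (3) There exist precisely two independent linear first integrals on $U$ if and only if the tensor ${T_a}^b$ vanishes and the skew part of the Ricci tensor of $\nabla$ is non-zero on $U$. (4) There exist three independent linear first integrals on $U$ if and only if $\nabla$ is projectively flat and its Ricci tensor is symmetric.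
   Context: Indices $a,b,c,\dots$ run over $1,2$; the summation convention is used; round (square) brackets on indices denote symmetrisation (skew-symmetrisation) with weight, e.g. $S_{[ab]}=\frac12(S_{ab}-S_{ba})$. **First integrals.** A linear first integral of $\nabla$ is a function $\kappa=K_a(X)\dot X^a$ on $T\Sigma$, with $K=K_a dX^a$ a one-form (not identically zero), which is constant along all affinely parametrised geodesics $\ddot X^a+\Gamma^a_{bc}\dot X^b\dot X^c=0$; equivalently $\nabla_{(a}K_{b)}=0$. Independence means linear independence over $\mathbb{R}$ of the solutions $K$. **Curvature.** $[\nabla_a,\nabla_b]X^c={{R_{ab}}^c}_dX^d$, Ricci tensor $R_{ab}={{R_{ca}}^c}_b$ (not necessarily symmetric), Schouten tensor $\mathrm{P}_{ab}=\frac23R_{ab}+\frac13R_{ba}$, and $B_{ab}=\mathrm{P}_{ba}-\mathrm{P}_{ab}$. **Volume form.** Fix a volume form $\epsilon_{ab}$ on $\Sigma$, and let $\epsilon^{ab}$ be the skew tensor with $\epsilon^{ab}\epsilon_{cb}=\delta^a_c$. Indices are raised and lowered by $V^a=\epsilon^{ab}V_b$, $V_a=\epsilon_{ba}V^b$; in particular ${\mathrm{P}^b}_a=\epsilon^{bc}\mathrm{P}_{ca}$. Define $\theta_a$ by $\nabla_a\epsilon_{bc}=\theta_a\epsilon_{bc}$, and set $\beta=B_{ab}\epsilon^{ab}$. **Tensors.** Put $L_b=\epsilon^{cd}\nabla_c\mathrm{P}_{db}$, $Y_{cdb}=\nabla_{[c}\mathrm{P}_{d]b}$, $$F^a=\tfrac13\epsilon^{ab}\big(L_b-\epsilon^{cd}\nabla_bB_{cd}\big),$$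 $${M_a}^b=\tfrac13\epsilon^{bc}\epsilon^{de}\big(\nabla_aY_{dec}-\nabla_a\nabla_cB_{de}\big)+\beta\,{\mathrm{P}^b}_a+\tfrac12\beta^2{\delta^b}_a,\qquad N_a=-F_a+\epsilon^{bc}\nabla_aB_{bc}.$$ **Invariants.** $$I_N=\epsilon_{cd}\,\epsilon^{be}{M_e}^c\Big(N_bF^d-\tfrac12\beta{M_b}^d\Big),\qquad {T_a}^b=N_aF^b-\beta{M_a}^b .$$ Let $E=\Lambda^1(\Sigma)\oplus\Lambda^2(\Sigma)$, with sections written $(K_b,\mu)$ (where $\mu$ is the coefficient relative to $\epsilon_{ab}$), carry the connection $$D_a\begin{pmatrix}K_b\\ \mu\end{pmatrix}=\begin{pmatrix}\nabla_aK_b-\epsilon_{ab}\mu\\ \nabla_a\mu-\big({\mathrm{P}^b}_a+\frac12\beta{\delta^b}_a\big)K_b+\mu\theta_a\end{pmatrix}.$$ The dual connection on $E^*$, acting on sections $(f^b,\varphi)$ paired with $(K_b,\mu)$ by $f^bK_b+\varphi\mu$, is also denoted $D_a$; explicitly $$D_a(f^b,\varphi)=\Big(\nabla_af^b+\big({\mathrm{P}^b}_a+\tfrac12\beta{\delta^b}_a\big)\varphi,\ \nabla_a\varphi-\theta_a\varphi-\epsilon_{ba}f^b\Big).$$ Second derivatives $D_bD_cV$ are formed by coupling $D$ with $\nabla$ on the one-form index. Let $V=(F^1,F^2,\beta)$, a section of $E^*$. Then $$I_S=W_{abc}:=\det\big(V,\ D_aV,\ D_{(b}D_{c)}V\big),$$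 the determinant of the $3\times 3$ matrix of components, and $I_S=0$ means $W_{abc}=0$ for all $a,b,c\in\{1,2\}$. (Changing $\epsilon_{ab}$ rescales these quantities, and does not affect the vanishing conditions.) **Projective flatness.** $\nabla$ is projectively flat if, locally, there is a one-form $\Upsilon_a$ such that the connection with Christoffel symbols $\Gamma^a_{bc}+\delta^a_b\Upsilon_c+\delta^a_c\Upsilon_b$ is flat; equivalently, $\nabla$ locally has the same unparametrised geodesics as a flat torsion-free connection. *)

(* Defs.v *)
From HB Require Import structures.
From mathcomp Require Import all_boot all_order all_algebra.
From mathcomp Require Import all_classical all_reals all_analysis.
Import Order.TTheory GRing.Theory Num.Theory.
Import numFieldNormedType.Exports.

Set Implicit Arguments.
Unset Strict Implicit.
Unset Printing Implicit Defensive.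

Local Open Scope classical_set_scope.
Local Open Scope ring_scope.

Section Calculus.
Context {R : realType}.

Definition pd (a : 'I_2) (f : 'rV[R]_2 -> R) : 'rV[R]_2 -> R :=
  'D_(delta_mx 0 a) f.

(* Meaningful for open [O]; on such sets it only depends on [f] restricted to
   [O], so functions on [O] are represented by total functions. *)
Fixpoint Ck (k : nat) (O : set 'rV[R]_2) (f : 'rV[R]_2 -> R) : Prop :=
  match k with
  | 0%N => forall x, O x -> {for x, continuous f}
  | k'.+1 => (forall x, O x -> forall a : 'I_2, derivable f x (delta_mx 0 a)) /\
             (forall a : 'I_2, Ck k' O (pd a f))
  end.

End Calculus.

Section Surfaces.
Context {R : realType} {S : topologicalType}.

(* Only the values of [cmap] on [cdom] and of [cinv] on the image of [cdom]
   matter. *)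
Record chart := Chart {
  cdom : set S;
  cmap : S -> 'rV[R]_2;
  cinv : 'rV[R]_2 -> S }.

Definition is_chart (c : chart) : Prop :=
  [/\ open (cdom c),
      open (cmap c @` cdom c),
      forall p, cdom c p -> cinv c (cmap c p) = p,
      forall p, cdom c p -> {for p, continuous (cmap c)} &
      forall x, (cmap c @` cdom c) x -> {for x, continuous (cinv c)}].

Definition region (c : chart) (U : set S) : set 'rV[R]_2 :=
  cmap c @` (cdom c `&` U).

Definition transition (c1 c2 : chart) (x : 'rV[R]_2) : 'rV[R]_2 :=
  cmap c2 (cinv c1 x).

Definition transition_coord (c1 c2 : chart) (d : 'I_2) : 'rV[R]_2 -> R :=
  fun x => transition c1 c2 x 0 d.

(* [jacobian c1 c2 x a d] is the partial derivative of the d-th coordinate of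
   [c2] with respect to the a-th coordinate of [c1]. *)
Definition jacobian (c1 c2 : chart) (x : 'rV[R]_2) : 'M[R]_2 :=
  \matrix_(a, d) pd a (transition_coord c1 c2 d) x.

Definition is_atlas (k : nat) (A : set chart) : Prop :=
  [/\ forall c, A c -> is_chart c,
      forall p, exists2 c, A c & cdom c p &
      forall c1 c2, A c1 -> A c2 -> forall d : 'I_2,
        Ck k (region c1 (cdom c2)) (transition_coord c1 c2 d)].

Definition is_surface (k : nat) (A : set chart) : Prop :=
  [/\ hausdorff_space S, @second_countable S & is_atlas k A].

Definition orientable (k : nat) (A : set chart) : Prop :=
  exists A' : set chart,
    [/\ is_atlas k A', is_atlas k (A `|` A') &
        forall c1 c2, A' c1 -> A' c2 -> forall x,
          region c1 (cdom c2) x -> 0 < \det (jacobian c1 c2 x)].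

End Surfaces.

Arguments chart : clear implicits.

Section SimplyConnected.
Variables (R : realType) (S : topologicalType).

Definition path_connected : Prop :=
  forall p q : S, exists g : R -> S,
    [/\ {within `[0, 1], continuous g}, g 0 = p & g 1 = q].

Definition null_homotopic (g : R -> S) : Prop :=
  exists H : R * R -> S,
    [/\ {within `[0, 1] `*` `[0, 1], continuous H},
        forall t, t \in `[0, 1] -> H (t, 0) = g t,
        forall t, t \in `[0, 1] -> H (t, 1) = g 0 &
        forall s, s \in `[0, 1] -> H (0, s) = g 0 /\ H (1, s) = g 0].

Definition simply_connected : Prop :=
  path_connected /\
  forall g : R -> S, {within `[0, 1], continuous g} -> g 0 = g 1 ->
    null_homotopic g.

End SimplyConnected.

Section LocalTensors.
Context {R : realType}.
Implicit Types (a b c d e f : 'I_2).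

Local Notation fn := ('rV[R]_2 -> R).

(* Coordinate expressions in one chart.  [G a b c] stands for Gamma^a_{bc} and
   [eps a b] for eps_{ab}; the index values 1, 2 are 0, 1 : 'I_2. *)
Variables (G : 'I_2 -> 'I_2 -> 'I_2 -> fn) (eps : 'I_2 -> 'I_2 -> fn).

(* In covariant derivatives the first index is the differentiation index. *)
Definition nabla2 (T : 'I_2 -> 'I_2 -> fn) c a b : fn := fun x =>
  pd c (T a b) x - \sum_d G d c a x * T d b x - \sum_d G d c b x * T a d x.

Definition nabla3 (T : 'I_2 -> 'I_2 -> 'I_2 -> fn) d a b c : fn := fun x =>
  pd d (T a b c) x - \sum_e G e d a x * T e b c x
  - \sum_e G e d b x * T a e c x - \sum_e G e d c x * T a b e x.

(* R_{ab}^c_d, with [nabla_a, nabla_b] X^c = R_{ab}^c_d X^d *)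
Definition curvature a b c d : fn := fun x =>
  pd a (G c b d) x - pd b (G c a d) x
  + \sum_e (G c a e x * G e b d x - G c b e x * G e a d x).

Definition ricci a b : fn := fun x => \sum_c curvature c a c b x.

Definition ricci_skew a b : fn := fun x => 2^-1 * (ricci a b x - ricci b a x).

Definition schouten a b : fn := fun x =>
  2 / 3 * ricci a b x + 1 / 3 * ricci b a x.

Definition tensorB a b : fn := fun x => schouten b a x - schouten a b x.

(* eps^{ab} is determined by eps^{ab} eps_{cb} = delta^a_c *)
Definition epsup a b : fn := fun x =>
  invmx (\matrix_(i, j) eps i j x)^T a b.

Definition lower (v : 'I_2 -> fn) a : fn := fun x =>
  \sum_b eps b a x * v b x.

(* P^b_a *)
Definition schouten_up b a : fn := fun x =>
  \sum_c epsup b c x * schouten c a x.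

(* theta_a is determined by nabla_a eps_{bc} = theta_a eps_{bc} *)
Definition theta a : fn := fun x => nabla2 eps a 0 1 x / eps 0 1 x.

Definition beta : fn := fun x => \sum_a \sum_b tensorB a b x * epsup a b x.

Definition tensorL b : fn := fun x =>
  \sum_c \sum_d epsup c d x * nabla2 schouten c d b x.

Definition tensorY c d b : fn := fun x =>
  2^-1 * (nabla2 schouten c d b x - nabla2 schouten d c b x).

Definition tensorF a : fn := fun x =>
  3^-1 * \sum_b epsup a b x *
    (tensorL b x - \sum_c \sum_d epsup c d x * nabla2 tensorB b c d x).

(* M_a^b *)
Definition tensorM a b : fn := fun x =>
  3^-1 * (\sum_c \sum_d \sum_e epsup b c x * epsup d e x *
    (nabla3 tensorY a d e c x - nabla3 (nabla2 tensorB) a c d e x))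
  + beta x * schouten_up b a x + 2^-1 * beta x ^+ 2 * (a == b)%:R.

Definition tensorN a : fn := fun x =>
  - lower tensorF a x + \sum_b \sum_c epsup b c x * nabla2 tensorB a b c x.

Definition invN : fn := fun x =>
  \sum_b \sum_c \sum_d \sum_e eps c d x * epsup b e x * tensorM e c x *
    (tensorN b x * tensorF d x - 2^-1 * beta x * tensorM b d x).

(* T_a^b *)
Definition tensorT a b : fn := fun x =>
  tensorN a x * tensorF b x - beta x * tensorM a b x.

(* Sections (f^b, phi) of the dual of E = Lambda^1 + Lambda^2. *)
Definition dual_section := (('I_2 -> fn) * fn)%type.

Definition dualD a (s : dual_section) : dual_section :=
  (fun b x => pd a (s.1 b) x + \sum_c G b a c x * s.1 c x
      + (schouten_up b a x + 2^-1 * beta x * (a == b)%:R) * s.2 x,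
   fun x => pd a s.2 x - theta a x * s.2 x - lower s.1 a x).

(* D_b D_c s, with D coupled to nabla on the one-form index c *)
Definition dualDD b c (s : dual_section) : dual_section :=
  (fun e x => (dualD b (dualD c s)).1 e x
      - \sum_d G d b c x * (dualD d s).1 e x,
   fun x => (dualD b (dualD c s)).2 x - \sum_d G d b c x * (dualD d s).2 x).

Definition dual_row (s : dual_section) (x : 'rV[R]_2) : 'rV[R]_3 :=
  row_mx (\row_(b < 2) s.1 b x) (const_mx (s.2 x) : 'rV[R]_1).

Definition sectionV : dual_section := (tensorF, beta).

Definition invS a b c : fn := fun x =>
  \det (\matrix_(i < 3)
    [:: dual_row sectionV x;
        dual_row (dualD a sectionV) x;
        2^-1 *: (dual_row (dualDD b c sectionV) x
                 + dual_row (dualDD c b sectionV) x)]`_i).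

End LocalTensors.

Section Connections.
Context {R : realType} {S : topologicalType}.
Variable A : set (chart R S).

Local Notation fn := ('rV[R]_2 -> R).

(* Fields on the surface are families of components, one for each chart of the
   atlas [A], related by the transformation law on overlaps. *)

Definition is_connection (k : nat)
    (G : chart R S -> 'I_2 -> 'I_2 -> 'I_2 -> fn) : Prop :=
  (forall c, A c -> forall a b d, Ck k (region c setT) (G c a b d)) /\
  (forall c1 c2, A c1 -> A c2 -> forall x, region c1 (cdom c2) x ->
    forall b c d,
      \sum_a G c1 a b c x * jacobian c1 c2 x a d =
      pd b (pd c (transition_coord c1 c2 d)) x +
      \sum_e \sum_f G c2 d e f (transition c1 c2 x) *
        jacobian c1 c2 x b e * jacobian c1 c2 x c f).

Definition torsion_free (G : chart R S -> 'I_2 -> 'I_2 -> 'I_2 -> fn) : Prop :=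
  forall c, A c -> forall x, region c setT x ->
    forall a b d, G c a b d x = G c a d b x.

Definition is_volume_form (k : nat)
    (eps : chart R S -> 'I_2 -> 'I_2 -> fn) : Prop :=
  [/\ forall c, A c -> forall a b, Ck k (region c setT) (eps c a b),
      forall c, A c -> forall x, region c setT x ->
        eps c 0 1 x != 0 /\ (forall a b, eps c a b x = - eps c b a x) &
      forall c1 c2, A c1 -> A c2 -> forall x, region c1 (cdom c2) x ->
        forall a b, eps c1 a b x =
          \sum_c \sum_d eps c2 c d (transition c1 c2 x) *
            jacobian c1 c2 x a c * jacobian c1 c2 x b d].

Definition is_one_form (k : nat) (U : set S)
    (K : chart R S -> 'I_2 -> fn) : Prop :=
  (forall c, A c -> forall a, Ck k (region c U) (K c a)) /\
  (forall c1 c2, A c1 -> A c2 -> forall x, region c1 (cdom c2 `&` U) x ->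
    forall b, K c1 b x =
      \sum_d K c2 d (transition c1 c2 x) * jacobian c1 c2 x b d).

Definition lin_independent (U : set S) (n : nat)
    (K : 'I_n -> chart R S -> 'I_2 -> fn) : Prop :=
  forall l : 'I_n -> R,
    (forall c, A c -> forall x, region c U x -> forall a,
      \sum_i l i * K i c a x = 0) ->
    forall i, l i = 0.

Section WithConnection.
Variable G : chart R S -> 'I_2 -> 'I_2 -> 'I_2 -> fn.

Definition curve_coord (g : R -> S) (c : chart R S) (a : 'I_2) : R -> R :=
  fun t => cmap c (g t) 0 a.

Definition is_geodesic (U : set S) (J : set R) (g : R -> S) : Prop :=
  [/\ open J, is_interval J &
      forall t, J t ->
      [/\ U (g t), {for t, continuous g} &
          forall c, A c -> cdom c (g t) -> forall a : 'I_2,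
          [/\ derivable (curve_coord g c a) t 1,
              derivable (derive1 (curve_coord g c a)) t 1 &
              derive1 (derive1 (curve_coord g c a)) t +
              \sum_b \sum_d G c a b d (cmap c (g t)) *
                derive1 (curve_coord g c b) t * derive1 (curve_coord g c d) t = 0]]].

(* kappa = K_a Xdot^a along the curve [g], computed in the chart [c] *)
Definition kappa (K : chart R S -> 'I_2 -> fn) (g : R -> S) (c : chart R S)
    (t : R) : R :=
  \sum_a K c a (cmap c (g t)) * derive1 (curve_coord g c a) t.

Definition is_first_integral (U : set S) (K : chart R S -> 'I_2 -> fn) : Prop :=
  [/\ is_one_form 1 U K,
      exists c x a, [/\ A c, region c U x & K c a x != 0] &
      forall J g, is_geodesic U J g -> forall s t, J s -> J t ->
        forall c1 c2, A c1 -> A c2 -> cdom c1 (g s) -> cdom c2 (g t) ->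
          kappa K g c1 s = kappa K g c2 t].

Definition has_independent_first_integrals (n : nat) (U : set S) : Prop :=
  exists K : 'I_n -> chart R S -> 'I_2 -> fn,
    (forall i, is_first_integral U (K i)) /\ lin_independent U K.

Definition ricci_symmetric_on (U : set S) : Prop :=
  forall c, A c -> forall x, region c U x ->
    forall a b, ricci (G c) a b x = ricci (G c) b a x.

(* the skew part of the Ricci tensor is not the zero tensor field on [U] *)
Definition ricci_skew_nonzero_on (U : set S) : Prop :=
  exists c x a b, [/\ A c, region c U x & ricci_skew (G c) a b x != 0].

Definition projective_change (Ups : chart R S -> 'I_2 -> fn) (c : chart R S)
    (a b d : 'I_2) : fn := fun x =>
  G c a b d x + (a == b)%:R * Ups c d x + (a == d)%:R * Ups c b x.

Definition projectively_flat_on (U : set S) : Prop :=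
  forall p, U p -> exists W : set S,
    [/\ open_nbhs p W, W `<=` U &
        exists2 Ups : chart R S -> 'I_2 -> fn, is_one_form 1 W Ups &
          forall c, A c -> forall x, region c W x -> forall a b d e,
            curvature (projective_change Ups c) a b d e x = 0].

Variable eps : chart R S -> 'I_2 -> 'I_2 -> fn.

Definition invN_vanishes_on (U : set S) : Prop :=
  forall c, A c -> forall x, region c U x -> invN (G c) (eps c) x = 0.

Definition invS_vanishes_on (U : set S) : Prop :=
  forall c, A c -> forall x, region c U x ->
    forall a b d, invS (G c) (eps c) a b d x = 0.

Definition tensorT_vanishes_on (U : set S) : Prop :=
  forall c, A c -> forall x, region c U x ->
    forall a b, tensorT (G c) (eps c) a b x = 0.

End WithConnection.
End Connections.

(* Main.v *)
(* A one-form K is a linear first integral exactly when it is completed by a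
   function mu to a D-parallel section of E. The curvature of D pairs with
   sections through V only, so V and all its covariant derivatives annihilate
   parallel sections; I_N and I_S are the determinants of triples of these
   covectors, which gives (1), and the dimension of the space of solutions near a
   generic point is 3 minus the rank of the span of V, D_a V. If V and D_a V are
   independent, then I_N = I_S = 0 says that this span is preserved by D, and its
   annihilator is a flat line bundle. T = 0 says that all D_a V are multiples of V
   wherever beta <> 0, so that the kernel of V is flat of rank two. V = 0 says that
   D is flat, equivalently that nabla is projectively flat with symmetric Ricci
   tensor.

   Parallel sections are obtained by radial transport. At a point p where the
   rank drops, a ball around p may carry fewer first integrals than the
   invariants predict (a first integral near a generic point need not extend to
   p); then U is the union of a small ball around p and a disjoint open set near p
   on which the missing first integrals exist. *)
From HB Require Import structures.
Require Import Defs.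
From mathcomp Require Import all_boot all_order all_algebra.
From mathcomp Require Import all_classical all_reals all_analysis.
From mathcomp Require Import ring lra.
Import Order.TTheory GRing.Theory Num.Theory.
Import numFieldNormedType.Exports.

Set Implicit Arguments.
Unset Strict Implicit.
Unset Printing Implicit Defensive.

Local Open Scope classical_set_scope.
Local Open Scope ring_scope.

(** * Partial derivatives in the plane *)

Section Differentiability.
Context {R : realType}.

(** The curvature of [D] does not vanish, so radial transport gives parallel sections only when the
    transported section stays in the kernel of [V] on the whole disc; flatness is used on such
    sections only. To keep a section there, its pairings with a [D]-closed family of covectors are
    shown to solve a homogeneous linear system along rays.

    A first integral is only assumed of class C^1, so [mu] has no evident derivatives; they come
    from the Killing equation through a Peano form of Schwarz's theorem. Passing between first
    integrals and Killing forms needs geodesics with prescribed initial velocity.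

    That a nonzero parallel section vanishes at no point, generic or not, follows from unique
    continuation.

    The equivalences must hold on [U] in both directions, so the number of integrals on [U] has to
    be exact. When [T = 0] and a ball at [p] carries one Killing form but no small ball carries two,
    the added set must carry exactly one as well: it is a half-disc away from [p]. A suitable one
    exists because two parallel sections on all such half-discs would produce two on the disc. *)

Lemma continuous_atD (T : topologicalType) (f g : T -> R) x :
  {for x, continuous f} -> {for x, continuous g} ->
  {for x, continuous (fun y => f y + g y)}.
Proof. by move=> fx gx; exact: (@cvgD R R^o T (nbhs x) _ f g). Qed.

Lemma continuous_atM (T : topologicalType) (f g : T -> R) x :
  {for x, continuous f} -> {for x, continuous g} ->
  {for x, continuous (fun y => f y * g y)}.
Proof. by move=> fx gx; exact: (@cvgM R T (nbhs x) _ f g). Qed.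

Lemma continuous_atN (T : topologicalType) (f : T -> R) x :
  {for x, continuous f} -> {for x, continuous (fun y => - f y)}.
Proof. by move=> fx; exact: (@cvgN R R^o T (nbhs x) _ f). Qed.

Lemma continuous_atV (T : topologicalType) (f : T -> R) x : f x != 0 ->
  {for x, continuous f} -> {for x, continuous (fun y => (f y)^-1)}.
Proof. by move=> fx0 fx; apply: (@cvgV R T (nbhs x) _ f). Qed.

Lemma near_eq_continuous (T U : topologicalType) (f g : T -> U) x :
  (\forall y \near x, f y = g y) ->
  {for x, continuous f} -> {for x, continuous g}.
Proof.
move=> fg; rewrite /prop_for /continuous_at => fx.
rewrite -(nbhs_singleton fg); apply: cvg_trans fx; exact: near_eq_cvg.
Qed.

Lemma differentiable_eps (V W : normedModType R) (f : V -> W)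
    (df : {linear V -> W}) x :
  continuous df ->
  (forall e, 0 < e -> \forall h \near (0 : V),
      `|f (h + x) - f x - df h| <= e * `|h|) ->
  differentiable f x /\ 'd f x = df :> (V -> W).
Proof.
move=> dfc Hf.
have dxf : f \o shift x = cst (f x) + df +o_ (0 : V) id.
  apply/eqaddoP => e e0; near=> h.
  rewrite /= opprD addrA.
  by near: h; exact: Hf.
have E : 'd f x = df :> (V -> W) by exact: diff_unique.
by split=> //; apply/diff_locallyP; rewrite E; split.
Unshelve. all: by end_near. Qed.

Lemma is_derive_line (V W : normedModType R) (f : V -> W) (x v : V) (s : R) df :
  is_derive (s *: v + x) v f df <-> is_derive s 1 (fun h : R => f (h *: v + x)) df.
Proof.
have E : (fun h : R => h^-1 *: (f (h *: v + (s *: v + x)) - f (s *: v + x))) =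
  (fun h : R => h^-1 *: (f ((h *: (1 : R^o) + s) *: v + x) - f (s *: v + x))).
  apply/funext => h; have -> : h *: (1 : R^o) = h by rewrite /GRing.scale/= mulr1.
  by rewrite scalerDl addrA.
split => -[d1 d2]; split.
- by move: d1; rewrite /derivable E.
- by move: d2; rewrite /derive E.
- by move: d1; rewrite /derivable E.
- by move: d2; rewrite /derive E.
Qed.

Section Rules.
Variables (V : normedModType R) (x v : V).
Implicit Types (f g : V -> R) (a b k : R).

Lemma is_derive_add f g a b : is_derive x v f a -> is_derive x v g b ->
  is_derive x v (fun y => f y + g y) (a + b).
Proof. exact: (@is_deriveD R V R f g x v a b). Qed.

Lemma is_derive_opp f a : is_derive x v f a -> is_derive x v (fun y => - f y) (- a).
Proof. exact: (@is_deriveN R V R f x v a). Qed.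

Lemma is_derive_sub f g a b : is_derive x v f a -> is_derive x v g b ->
  is_derive x v (fun y => f y - g y) (a - b).
Proof. by move=> fa gb; exact: is_derive_add fa (is_derive_opp gb). Qed.

Lemma is_derive_mul f g a b : is_derive x v f a -> is_derive x v g b ->
  is_derive x v (fun y => f y * g y) (a * g x + f x * b).
Proof.
move=> fa gb; have := @is_deriveM R V f g x v a b fa gb.
by rewrite /GRing.scale/= addrC (mulrC (g x)).
Qed.

Lemma is_derive_const k : is_derive x v (fun=> k) 0.
Proof. exact: is_derive_cst. Qed.

Lemma is_derive_val f a b : is_derive x v f a -> a = b -> is_derive x v f b.
Proof. by move=> ? <-. Qed.

Lemma is_derive_inv f a : f x != 0 -> is_derive x v f a ->
  is_derive x v (fun y => (f y)^-1) (- a / f x ^+ 2).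
Proof.
move=> f0 [fd <-]; split; first exact: derivableV.
by rewrite deriveV//= /GRing.scale/= mulrC mulrN mulNr.
Qed.

End Rules.

Lemma is_derive_rid (t : R) : is_derive t 1 (fun s : R => s) 1.
Proof. exact: is_derive_id. Qed.

(** Clearing the denominator of the difference quotient makes the estimate trivial at [s = 0], so no
    punctured neighbourhood has to be carried through later estimates. *)
Lemma is_derive_epsP (V : normedModType R) (f : V -> R) (x v : V) (l : R) :
  is_derive x v f l <->
  (forall e : R, 0 < e -> exists2 d : R, 0 < d &
    forall s : R, `|s| < d -> `|f (s *: v + x) - f x - s * l| <= e * `|s|).
Proof.
have E s : s != 0 -> forall e, (`|l - s^-1 *: (f (s *: v + x) - f x)| <= e) =
   (`|f (s *: v + x) - f x - s * l| <= e * `|s|).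
  move=> s0 e; rewrite -ler_pdivrMr ?normr_gt0// -normfV -normrM distrC.
  by congr (`|_| <= _); rewrite mulrBl mulrAC mulfV// mul1r /GRing.scale/= mulrC.
split.
  move=> [fd fl] e e0; move: fd; rewrite /derivable => fd.
  have : h^-1 *: (f (h *: v + x) - f x) @[h --> 0^'] --> l by rewrite -fl; exact: fd.
  move/cvgrPdist_le => /(_ e e0)/nbhs_ballP[d/= d0 H]; exists d => // s sd.
  have [->|s0] := eqVneq s 0; first by rewrite scale0r add0r subrr mul0r subrr normr0 mulr0.
  by rewrite -E//; apply: H => //; rewrite /ball/= sub0r normrN.
move=> H.
have C : h^-1 *: (f (h *: v + x) - f x) @[h --> 0^'] --> l.
  apply/cvgrPdist_le => e e0; have [d d0 Hd] := H e e0.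
  apply/nbhs_ballP; exists d => //= s; rewrite /ball/= sub0r normrN => sd s0.
  by rewrite E//; exact: Hd.
by split; [apply/cvg_ex; exists l|exact/cvg_lim].
Qed.

(** Bounds a derivative from a Lipschitz estimate at the single point [x]; the limit passage in the
    symmetry of second derivatives rests on it. *)
Lemma is_derive_le (V : normedModType R) (f : V -> R) (x v : V) (l C d : R) : 0 < d ->
  is_derive x v f l -> (forall s : R, `|s| < d -> `|f (s *: v + x) - f x| <= C * `|s|) ->
  `|l| <= C.
Proof.
move=> d0 /is_derive_epsP fl H; apply/ler_addgt0Pr => e e0.
have [d' d'0 H'] := fl e e0.
pose s := Num.min d d' / 2.
have m0 : 0 < Num.min d d' by rewrite lt_min d0.
have s0 : 0 < s by rewrite divr_gt0.
have sm : s < Num.min d d' by rewrite ltr_pdivrMr// ltr_pMr// ltr1n.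
move: sm; rewrite lt_min => /andP[sd sd'].
have := H s; have := H' s; rewrite gtr0_norm// => /(_ sd') h1 /(_ sd) h2.
have : s * `|l| <= s * (C + e).
  rewrite -{1}(gtr0_norm s0) -normrM.
  have -> : s * l = (f (s *: v + x) - f x) - (f (s *: v + x) - f x - s * l) by ring.
  by rewrite (mulrC s (C + e)) mulrDl; apply: le_trans (ler_normB _ _) (lerD h2 h1).
by rewrite ler_pM2l.
Qed.

Lemma is_derive_sub_line (f : R -> R) (l k t : R) : is_derive t 1 f l ->
  is_derive t 1 (fun s => f s - s * k) (l - k).
Proof.
move=> fl; apply: is_derive_sub fl _.
apply: is_derive_val (is_derive_mul (is_derive_rid t) (is_derive_const t 1 k)) _.
by rewrite mulr0 addr0 mul1r.
Qed.

Lemma MVT_le (f df : R -> R) (a b C : R) : a <= b ->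
  (forall x, a <= x <= b -> is_derive x 1 f (df x)) ->
  (forall x, a <= x <= b -> `|df x| <= C) ->
  `|f b - f a| <= C * (b - a).
Proof.
move=> ab fd dfC.
have [||c] := @MVT_segment R f df a b ab.
- by move=> x; rewrite in_itv/= => /andP[ax xb]; apply: fd; rewrite !ltW.
- apply: derivable_within_continuous => x; rewrite in_itv/= => xab.
  by have [] := fd x xab.
rewrite in_itv/= => cab ->.
by rewrite normrM (ger0_norm (_ : 0 <= b - a)) ?subr_ge0// ler_wpM2r ?subr_ge0// dfC.
Qed.

(** Covers [b] on either side of [a]: the conditions are imposed on the symmetric interval about
    [a], so callers never split on the sign of a displacement. *)
Lemma MVT_ball_le (f df : R -> R) (a b C : R) :
  (forall x, `|x - a| <= `|b - a| -> is_derive x 1 f (df x)) ->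
  (forall x, `|x - a| <= `|b - a| -> `|df x| <= C) ->
  `|f b - f a| <= C * `|b - a|.
Proof.
move=> fd dfC; have [ab|/ltW ba] := leP a b.
  rewrite (ger0_norm (_ : 0 <= b - a)) ?subr_ge0//.
  by apply: MVT_le ab _ _ => x /andP[ax xb]; [apply: fd|apply: dfC];
    rewrite !ger0_norm; lra.
rewrite distrC (distrC b) (ger0_norm (_ : 0 <= a - b)) ?subr_ge0//.
by apply: MVT_le ba _ _ => x /andP[ax xb]; [apply: fd|apply: dfC];
  rewrite (distrC x) (distrC b) !ger0_norm; lra.
Qed.

End Differentiability.

Section Plane.
Context {R : realType}.
Implicit Types (f g : 'rV[R]_2 -> R) (x y h : 'rV[R]_2) (O : set 'rV[R]_2).

Local Notation ee a := (delta_mx 0 a : 'rV[R]_2).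

Lemma ord2_ind (P : 'I_2 -> Prop) : P 0 -> P 1 -> forall a, P a.
Proof.
by move=> P0 P1 [[|[|//]] i]; [move: P0|move: P1]; congr (P _); apply/val_inj.
Qed.

Lemma sum_ord2 (V : nmodType) (F : 'I_2 -> V) : \sum_a F a = F 0 + F 1.
Proof.
by rewrite big_ord_recl big_ord1; congr (_ + F _); apply/val_inj.
Qed.

Lemma rV2E h : h = h 0 0 *: ee 0 + h 0 1 *: ee 1.
Proof.
apply/rowP; elim/ord2_ind; rewrite !mxE/= ?mulr0 ?mulr1 ?addr0 ?add0r//.
Qed.

Lemma rV_normP n (h : 'rV[R]_n) (e : R) : 0 <= e ->
  (`|h| <= e) <-> (forall a, `|h 0 a| <= e).
Proof.
move=> e0; rewrite (mx_normrE h : `|h| = _); split.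
  by move=> H a; apply: le_trans H; exact: (le_bigmax _ (fun ij : 'I_1 * 'I_n => `|h ij.1 ij.2|) (0, a)).
by move=> H; apply: bigmax_le => // -[i j] _ /=; rewrite ord1.
Qed.

Lemma rV_norm_lt n (h : 'rV[R]_n) (e : R) : 0 < e ->
  (`|h| < e) <-> (forall a, `|h 0 a| < e).
Proof.
move=> e0; rewrite (mx_normrE h : `|h| = _); split.
  by move=> H a; apply: le_lt_trans H; exact: (le_bigmax _ (fun ij : 'I_1 * 'I_n => `|h ij.1 ij.2|) (0, a)).
by move=> H; apply: bigmax_lt => // -[i j] _ /=; rewrite ord1.
Qed.

Lemma coord_le n (h : 'rV[R]_n) a : `|h 0 a| <= `|h|.
Proof. by have /rV_normP := lexx `|h|; apply. Qed.

Lemma norm_ee a : `|ee a| = 1.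
Proof.
apply/eqP; rewrite eq_le; apply/andP; split.
  by apply/rV_normP => // b; rewrite mxE/=; case: eqP; rewrite /= ?normr1 ?normr0.
by have := coord_le (ee a) a; rewrite mxE !eqxx normr1.
Qed.

Lemma nbhs_rVP n (x : 'rV[R]_n) (P : 'rV[R]_n -> Prop) :
  (\forall y \near x, P y) <-> exists2 d : R, 0 < d &
    forall h : 'rV[R]_n, `|h| < d -> P (h + x).
Proof.
split=> [/nbhs_ballP[d /= d0 Hd]|[d d0 Hd]].
  by exists d => // h hd; apply: Hd; rewrite -ball_normE/= opprD addrCA subrr addr0 normrN.
apply/nbhs_ballP; exists d => //= y; rewrite -ball_normE/= => xy.
by rewrite -(subrK x y); apply: Hd; rewrite distrC.
Qed.

Lemma pd_line f x a (t : R) : derivable f (t *: ee a + x) (ee a) ->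
  is_derive t 1 (fun s : R => f (s *: ee a + x)) (pd a f (t *: ee a + x)).
Proof. by move=> /derivableP/is_derive_line. Qed.

(** Goes from [x] to [h + x] along the second axis and then along the first, subtracting on each leg
    the partial derivative frozen at [x]. Only an oscillation bound [e] on the partials enters, not
    their continuity, so merely bounded partials can be fed in as well. *)
Lemma partial_estimate f x (d e : R) (h : 'rV[R]_2) :
  (forall k : 'rV[R]_2, `|k| < d -> forall a,
      derivable f (k + x) (ee a) /\ `|pd a f (k + x) - pd a f x| <= e) ->
  `|h| < d -> 0 <= e ->
  `|f (h + x) - f x - (h 0 0 * pd 0 f x + h 0 1 * pd 1 f x)| <= e *+ 2 * `|h|.
Proof.
move=> Hd hd e0.
have d0 : 0 < d by exact: le_lt_trans hd.
have HB (s t : R) : `|s| <= `|h 0 0| -> `|t| <= `|h 0 1| ->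
    `|s *: ee 0 + t *: ee 1| < d.
  move=> sh th.
  apply/rV_norm_lt => //; elim/ord2_ind; rewrite !mxE/= ?mulr0 ?mulr1 ?addr0 ?add0r;
   [apply: le_lt_trans sh _| apply: le_lt_trans th _];
   exact: le_lt_trans (coord_le _ _) hd.
pose g1 t := f (t *: ee 0 + (h 0 1 *: ee 1 + x)) - t * pd 0 f x.
pose g2 t := f (t *: ee 1 + x) - t * pd 1 f x.
have B1 : `|g1 (h 0 0) - g1 0| <= e * `|h 0 0 - 0|.
  apply: (@MVT_ball_le _ _ (fun t => pd 0 f (t *: ee 0 + (h 0 1 *: ee 1 + x)) - pd 0 f x)).
    move=> t; rewrite !subr0 => th.
    by apply: (is_derive_sub_line (f := fun s : R => f (s *: ee 0 + (h 0 1 *: ee 1 + x)))); apply: pd_line;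
       rewrite addrA; have [] := Hd _ (HB _ _ th (lexx _)) 0.
  move=> t; rewrite !subr0 => th.
  by rewrite addrA; have [] := Hd _ (HB _ _ th (lexx _)) 0.
have B2 : `|g2 (h 0 1) - g2 0| <= e * `|h 0 1 - 0|.
  have HB2 t : `|t| <= `|h 0 1| -> `|t *: ee 1| < d.
    have := HB 0 t; rewrite normr0 scale0r add0r; exact.
  apply: (@MVT_ball_le _ _ (fun t => pd 1 f (t *: ee 1 + x) - pd 1 f x)).
    move=> t; rewrite !subr0 => th.
    by apply: (is_derive_sub_line (f := fun s : R => f (s *: ee 1 + x))); apply: pd_line; have [] := Hd _ (HB2 _ th) 1.
  move=> t; rewrite !subr0 => th.
  by have [] := Hd _ (HB2 _ th) 1.
have -> : f (h + x) - f x - (h 0 0 * pd 0 f x + h 0 1 * pd 1 f x) =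
    (g1 (h 0 0) - g1 0) + (g2 (h 0 1) - g2 0).
  rewrite /g1 /g2 !scale0r !mul0r !add0r !addrA -rV2E; ring.
apply: le_trans (ler_normD _ _) _.
apply: le_trans (lerD B1 B2) _; rewrite !subr0 mulr2n mulrDl.
by apply: lerD; apply: ler_wpM2l => //; exact: coord_le.
Qed.

Lemma differentiable_partial f x :
  (\forall y \near x, forall a, derivable f y (ee a)) ->
  (forall a, {for x, continuous (pd a f)}) ->
  differentiable f x /\ forall v, 'D_v f x = v 0 0 * pd 0 f x + v 0 1 * pd 1 f x.
Proof.
move=> fd fc.
pose df0 (h : 'rV[R]_2) : R := h 0 0 * pd 0 f x + h 0 1 * pd 1 f x.
have [df dfE] : exists df : {linear 'rV[R]_2 -> R}, df = df0 :> (_ -> _).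
  have dfl : linear df0.
    move=> k u v; rewrite /df0 !mxE/= /GRing.scale/=; ring.
  pose df : {linear 'rV[R]_2 -> R} := HB.pack df0 (GRing.isLinear.Build _ _ _ _ df0 dfl).
  by exists df.
have dfc : continuous df.
  move=> h; rewrite dfE.
  have cc a : {for h, continuous (fun h : 'rV[R]_2 => h 0 a)} by exact: coord_continuous.
  have ck (k : R) : {for h, continuous (fun _ : 'rV[R]_2 => k)} by exact: cst_continuous.
  exact: (continuous_atD (continuous_atM (cc 0) (ck _)) (continuous_atM (cc 1) (ck _))).
have [|H1 H2] := @differentiable_eps R _ _ f df x dfc.
  move=> e e0.
  have e20 : 0 < e / 2 by rewrite divr_gt0.
  have c0 := fc 0; have c1 := fc 1.
  move/cvgrPdistC_le/(_ _ e20) : c0 => c0.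
  move/cvgrPdistC_le/(_ _ e20) : c1 => c1.
  have Hn : \forall y \near x, (forall a, derivable f y (ee a)) /\
      `|pd 0 f y - pd 0 f x| <= e / 2 /\ `|pd 1 f y - pd 1 f x| <= e / 2.
    exact: filterI fd (filterI c0 c1).
  move/nbhs_rVP : Hn => [d d0 Hd].
  apply/nbhs_rVP; exists d => // h; rewrite addr0 => hd.
  have Hd' k : `|k| < d -> forall a,
      derivable f (k + x) (ee a) /\ `|pd a f (k + x) - pd a f x| <= e / 2.
    move=> kd; have [h1 [h2 h3]] := Hd k kd.
    move=> a; split; first exact: h1.
    elim/ord2_ind: a; first exact: h2.
    exact: h3.
  have := @partial_estimate f x d (e / 2) h Hd' hd (ltW e20).
  have -> : e / 2 *+ 2 = e by rewrite mulr2n -splitr.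
  by rewrite dfE.
by split => // v; rewrite deriveE// H2 dfE.
Qed.

Lemma Ck_diff O f x : open O -> Ck 1 O f -> O x ->
  differentiable f x /\ forall v, 'D_v f x = v 0 0 * pd 0 f x + v 0 1 * pd 1 f x.
Proof.
move=> oO [fd fc] Ox; apply: differentiable_partial.
  have nO : nbhs x O by exact: open_nbhs_nbhs.
  by apply: filterS nO => y Oy a; exact: fd.
by move=> a; exact: fc.
Qed.

(** [Ck 1] asks for continuity of the partial derivatives but not of the function itself. That
    continuity follows from total differentiability, and it starts the induction showing that the
    classes are nested. *)
Lemma Ck1_cont O f : open O -> Ck 1 O f -> Ck 0 O f.
Proof.
by move=> oO f1 x Ox; apply: differentiable_continuous; have [] := Ck_diff oO f1 Ox.
Qed.

Lemma CkS k O f : open O -> Ck k.+1 O f -> Ck k O f.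
Proof.
move=> oO; elim: k f => [|k IH] f; first exact: Ck1_cont.
by move=> [fd fc]; split => // a; apply: IH; exact: fc.
Qed.

Lemma Ck_leq k l O f : open O -> (l <= k)%N -> Ck k O f -> Ck l O f.
Proof.
move=> oO /subnK <-; elim: (k - l)%N => [|m IH]//; rewrite addSn => /(CkS oO); exact: IH.
Qed.

Lemma Ck_cont k O f x : open O -> Ck k O f -> O x -> {for x, continuous f}.
Proof. by move=> oO /(Ck_leq oO (leq0n k)); exact. Qed.

Lemma Ck_pd k O f a : Ck k.+1 O f -> Ck k O (pd a f).
Proof. by move=> [_]; exact. Qed.

Lemma Ck_subset k O O' f : O' `<=` O -> Ck k O f -> Ck k O' f.
Proof.
move=> OO; elim: k f => [|k IH] f; first by move=> fc x /OO; exact: fc.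
by move=> [fd fc]; split => [x /OO|a]; [exact: fd|apply: IH; exact: fc].
Qed.

Lemma near_open O (P : 'rV[R]_2 -> Prop) x : open O -> O x ->
  (forall y, O y -> P y) -> \forall y \near x, P y.
Proof. by move=> oO Ox OP; apply: filterS (open_nbhs_nbhs (conj oO Ox)) => y; exact: OP. Qed.

Lemma pd_near f g a x : (\forall y \near x, f y = g y) -> pd a f x = pd a g x.
Proof. exact: near_eq_derive. Qed.

Lemma pd_eq O f g a x : open O -> (forall y, O y -> f y = g y) -> O x -> pd a f x = pd a g x.
Proof. by move=> oO fg Ox; apply: pd_near; exact: near_open fg. Qed.

Lemma Ck_eq k O f g : open O -> (forall x, O x -> f x = g x) -> Ck k O f -> Ck k O g.
Proof.
move=> oO; elim: k f g => [|k IH] f g fg.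
  by move=> fc x Ox; apply: near_eq_continuous (fc x Ox); exact: near_open fg.
move=> [fd fc]; split => [x Ox a|a].
  by apply: near_eq_derivable (fd x Ox a); exact: near_open fg.
by apply: IH (fc a) => x Ox; exact: pd_eq fg Ox.
Qed.

Lemma is_derive_pd O f a x : Ck 1 O f -> O x -> is_derive x (ee a) f (pd a f x).
Proof. by move=> [fd _] Ox; apply: derivableP; exact: fd. Qed.

Lemma pd_val f a x l : is_derive x (ee a) f l -> pd a f x = l.
Proof. by move=> []. Qed.

Lemma Ck_cst k O (c : R) : Ck k O (fun=> c).
Proof.
elim: k c => [|k IH] c; first by move=> x _; exact: cst_continuous.
split => [x _ a|a]; first exact: derivable_cst.
suff -> : pd a (fun=> c) = fun=> 0 by exact: IH.
by apply/funext => x; rewrite /pd derive_cst.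
Qed.

Lemma Ck_add k O f g : open O -> Ck k O f -> Ck k O g -> Ck k O (fun x => f x + g x).
Proof.
move=> oO; elim: k f g => [|k IH] f g.
  by move=> fc gc x Ox; exact: continuous_atD (fc x Ox) (gc x Ox).
move=> f1 g1.
have H x a : O x -> is_derive x (ee a) (fun x => f x + g x) (pd a f x + pd a g x).
  move=> Ox; apply: is_derive_add; apply: is_derive_pd Ox;
    [exact: Ck_leq f1|exact: Ck_leq g1].
split => [x Ox a|a]; first by have [] := H x a Ox.
have := IH _ _ (Ck_pd a f1) (Ck_pd a g1); apply: Ck_eq => // x Ox.
by rewrite (pd_val (H _ _ Ox)).
Qed.

Lemma Ck_mul k O f g : open O -> Ck k O f -> Ck k O g -> Ck k O (fun x => f x * g x).
Proof.
move=> oO; elim: k f g => [|k IH] f g.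
  by move=> fc gc x Ox; exact: continuous_atM (fc x Ox) (gc x Ox).
move=> f1 g1.
have H x a : O x -> is_derive x (ee a) (fun x => f x * g x) (pd a f x * g x + f x * pd a g x).
  move=> Ox; apply: is_derive_mul; apply: is_derive_pd Ox;
    [exact: Ck_leq f1|exact: Ck_leq g1].
split => [x Ox a|a]; first by have [] := H x a Ox.
have F := CkS oO f1; have G := CkS oO g1.
have := Ck_add oO (IH _ _ (Ck_pd a f1) G) (IH _ _ F (Ck_pd a g1)).
apply: Ck_eq => // x Ox.
by rewrite (pd_val (H _ _ Ox)).
Qed.

Lemma Ck_opp k O f : open O -> Ck k O f -> Ck k O (fun x => - f x).
Proof.
move=> oO fk; have := Ck_mul oO (Ck_cst k O (-1)) fk; apply: Ck_eq => // x _.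
by rewrite mulN1r.
Qed.

Lemma Ck_sub k O f g : open O -> Ck k O f -> Ck k O g -> Ck k O (fun x => f x - g x).
Proof. by move=> oO fk gk; apply: Ck_add => //; exact: Ck_opp. Qed.

Lemma Ck_inv k O f : open O -> (forall x, O x -> f x != 0) -> Ck k O f ->
  Ck k O (fun x => (f x)^-1).
Proof.
move=> oO f0; elim: k => [|k IH].
  by move=> fc x Ox; exact: continuous_atV (f0 x Ox) (fc x Ox).
move=> f1.
have H x a : O x -> is_derive x (ee a) (fun x => (f x)^-1) (- pd a f x / f x ^+ 2).
  move=> Ox; apply: is_derive_inv; first exact: f0.
  by apply: is_derive_pd Ox; exact: Ck_leq f1.
split => [x Ox a|a]; first by have [] := H x a Ox.
have F := IH (CkS oO f1).
have := Ck_mul oO (Ck_opp oO (Ck_pd a f1)) (Ck_mul oO F F); apply: Ck_eq => // x Ox.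
by rewrite (pd_val (H _ _ Ox)) expr2 invfM.
Qed.

Lemma Ck_sum2 k O (F : 'I_2 -> 'rV[R]_2 -> R) : open O -> (forall a, Ck k O (F a)) ->
  Ck k O (fun x => \sum_a F a x).
Proof.
move=> oO Fk; have := Ck_add oO (Fk 0) (Fk 1); apply: Ck_eq => // x _.
by rewrite sum_ord2.
Qed.

(* Peano's version of the symmetry of second derivatives: the existence of the
   second mixed derivative is a conclusion. *)
Lemma schwarz_peano O f a b x : open O -> O x ->
  (forall y, O y -> [/\ derivable f y (ee a), derivable f y (ee b) &
                        derivable (pd a f) y (ee b)]) ->
  {for x, continuous (pd b (pd a f))} ->
  is_derive x (ee a) (pd b f) (pd b (pd a f) x).
Proof.
move=> oO Ox fd fc; set L := pd b (pd a f) x.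
apply/is_derive_epsP => e e0.
move/cvgrPdistC_le/(_ _ e0) : fc => fc.
have nO : nbhs x O by exact: open_nbhs_nbhs.
have Hn : \forall y \near x, O y /\ `|pd b (pd a f) y - L| <= e by exact: filterI nO fc.
move/nbhs_rVP : Hn => [d d0 Hd].
have d20 : 0 < d / 2 by rewrite divr_gt0.
exists (d / 2) => // s sd.
have HB (s' t : R) : `|s'| <= `|s| -> `|t| < d / 2 ->
    O (s' *: ee a + (t *: ee b + x)) /\ `|pd b (pd a f) (s' *: ee a + (t *: ee b + x)) - L| <= e.
  move=> s's td; rewrite addrA; apply: Hd.
  apply: le_lt_trans (ler_normD _ _) _.
  by rewrite !normrZ !norm_ee !mulr1 (splitr d); apply: ltrD => //; apply: le_lt_trans sd.
have main t : `|t| < d / 2 ->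
    `|(f (s *: ee a + (t *: ee b + x)) - f (s *: ee a + x) - s * (t * L)) -
      (f (t *: ee b + x) - f x)| <= e * `|s| * `|t|.
  move=> td.
  pose phi r := f (r *: ee a + (t *: ee b + x)) - f (r *: ee a + x) - r * (t * L).
  have -> : f (t *: ee b + x) - f x = phi 0 by rewrite /phi !scale0r mul0r !add0r subr0.
  rewrite -/(phi s) -mulrA (mulrC `|s|) mulrA -{2}(subr0 s).
  apply: (@MVT_ball_le _ phi (fun r => pd a f (r *: ee a + (t *: ee b + x)) -
      pd a f (r *: ee a + x) - t * L)); move=> r; rewrite !subr0 => rs.
    apply: (is_derive_sub_line (f := fun r : R => f (r *: ee a + (t *: ee b + x)) - f (r *: ee a + x))).
    apply: (@is_derive_sub R R _ _ (fun r => f (r *: ee a + (t *: ee b + x))) (fun r => f (r *: ee a + x)));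
      apply: pd_line.
      by have [/fd[H _ _] _] := HB _ _ rs td; exact: H.
    by have := HB r 0 rs; rewrite normr0 scale0r add0r => /(_ d20)[/fd[H _ _] _]; exact: H.
  pose psi u := pd a f (r *: ee a + (u *: ee b + x)) - u * L.
  have -> : pd a f (r *: ee a + (t *: ee b + x)) - pd a f (r *: ee a + x) - t * L =
      psi t - psi 0 by rewrite /psi scale0r mul0r add0r; ring.
  rewrite -{2}(subr0 t).
  apply: (@MVT_ball_le _ psi (fun u => pd b (pd a f) (r *: ee a + (u *: ee b + x)) - L));
    move=> u; rewrite !subr0 => ut.
    apply: (is_derive_sub_line (f := fun u : R => pd a f (r *: ee a + (u *: ee b + x)))).
    have ud : `|u| < d / 2 by exact: le_lt_trans td.
    have E : (fun u : R => pd a f (r *: ee a + (u *: ee b + x))) =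
             (fun u : R => pd a f (u *: ee b + (r *: ee a + x))).
      by apply/funext => w; rewrite addrCA.
    rewrite E addrCA; apply: pd_line.
    by rewrite addrCA; have [/fd[_ _ H] _] := HB _ _ rs ud; exact: H.
  have ud : `|u| < d / 2 by exact: le_lt_trans td.
  by have [] := HB _ _ rs ud.
(* [main] bounds [h t - h 0] by [e * |s| * |t|]. Differentiating at [t = 0] turns this into the
   required estimate for [pd b f]. *)
pose h t := f (t *: ee b + (s *: ee a + x)) - t * (s * L) - f (t *: ee b + x).
have hl : is_derive (0 : R) 1 h (pd b f (0 *: ee b + (s *: ee a + x)) - s * L - pd b f (0 *: ee b + x)).
  apply: (@is_derive_sub R R _ _ (fun t => f (t *: ee b + (s *: ee a + x)) - t * (s * L)) (fun t => f (t *: ee b + x))).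
    apply: (is_derive_sub_line (f := fun t : R => f (t *: ee b + (s *: ee a + x)))); apply: pd_line.
    have := HB s 0 (lexx _); rewrite normr0 => /(_ d20)[/fd[_ H _] _].
    by rewrite addrCA; exact: H.
  apply: pd_line; have := HB 0 0; rewrite normr0 => /(_ (normr_ge0 _) d20)[/fd[_ H _] _].
  by move: H; rewrite !scale0r !add0r => H; exact: H.
have -> : pd b f (s *: ee a + x) - pd b f x - s * L =
    pd b f (0 *: ee b + (s *: ee a + x)) - s * L - pd b f (0 *: ee b + x).
  by rewrite !scale0r !add0r; ring.
apply: is_derive_le d20 hl _ => t td.
have -> : t *: (1 : R^o) + 0 = t by rewrite addr0 /GRing.scale/= mulr1.
have := main t td; congr (`|_| <= _); rewrite /h !scale0r !add0r mul0r subr0.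
rewrite (addrCA (t *: _)); ring.
Qed.

Lemma pdC O f a b x : open O -> Ck 2 O f -> O x -> pd a (pd b f) x = pd b (pd a f) x.
Proof.
move=> oO f2 Ox; apply: (pd_val (@schwarz_peano O f a b x oO Ox _ _)).
  move=> y Oy; have [fd1 fd2] := f2; have [fd3 _] := fd2 a.
  by split; [exact: fd1|exact: fd1|exact: fd3].
by apply: (Ck_cont (k := 0) oO) Ox; apply: Ck_pd; apply: Ck_pd.
Qed.

End Plane.
(** * Ordinary differential equations *)

Section Ode.
Context {R : realType}.

(** The intervals of radius [2 * C / 2 ^+ k] about [u k] are nested, so the supremum of their left
    ends lies in all of them. This gives the rate together with the limit. *)
Lemma cluster_geometric (u : nat -> R) (C : R) :
  (forall k, `|u k.+1 - u k| <= C / 2 ^+ k) ->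
  exists l, forall k, `|u k - l| <= 2 * C / 2 ^+ k.
Proof.
move=> uC.
have C0 : 0 <= C by have := le_trans (normr_ge0 _) (uC 0%N); rewrite expr0 divr1.
pose a k := u k - 2 * C / 2 ^+ k; pose b k := u k + 2 * C / 2 ^+ k.
have E k : 2 * C / 2 ^+ k = C / 2 ^+ k + 2 * C / 2 ^+ k.+1.
  have h : (2 : R) ^+ k != 0 by rewrite expf_neq0// pnatr_eq0.
  by rewrite exprS; field; rewrite h.
have aS k : a k <= a k.+1.
  by have := uC k; rewrite ler_norml /a (E k) => /andP[h _]; lra.
have bS k : b k.+1 <= b k.
  by have := uC k; rewrite ler_norml /b (E k) => /andP[_ h]; lra.
have ab k : a k <= b k.
  have : 0 <= 2 * C / 2 ^+ k by rewrite divr_ge0 ?mulr_ge0 ?exprn_ge0.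
  rewrite /a /b; lra.
have am j m : a j <= a (j + m)%N.
  by elim: m => [|m IH]; rewrite ?addn0// addnS (le_trans IH).
have bm j m : b (j + m)%N <= b j.
  by elim: m => [|m IH]; rewrite ?addn0// addnS (le_trans _ IH).
have ajb j k : a j <= b k.
  by apply: le_trans (am j k) _; apply: le_trans (ab _) _; rewrite addnC; exact: bm.
have hs : has_sup [set a k | k in setT].
  by split; [exists (a 0%N); exists 0%N|exists (b 0%N) => _ [k _ <-]].
exists (sup [set a k | k in setT]) => k.
have h1 : a k <= sup [set a k | k in setT] by apply: sup_upper_bound => //; exists k.
have h2 : sup [set a k | k in setT] <= b k.
  by apply: ge_sup; [case: hs|move=> _ [j _ <-]].
rewrite ler_norml; move: h1 h2; rewrite /a /b; lra.
Qed.

Lemma geometric_lt (C e : R) : 0 < e -> exists k, C / 2 ^+ k < e.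
Proof.
move=> e0; exists (Num.bound (`|C| / e)).
set k := Num.bound _.
have h2 : (0 : R) < 2 ^+ k by rewrite exprn_gt0.
rewrite ltr_pdivrMr//; apply: le_lt_trans (ler_norm C) _.
rewrite mulrC -ltr_pdivrMr//; apply: lt_le_trans (archi_boundP _) _.
  by rewrite divr_ge0// ltW.
by rewrite -natrX ler_nat ltnW// ltn_expl.
Qed.

Lemma uniform_limit_continuous_geometric (u : nat -> R -> R) (y : R -> R) (C : R) :
  (forall k, continuous (u k)) -> (forall k s, `|u k s - y s| <= C / 2 ^+ k) ->
  continuous y.
Proof.
move=> uc uy s; apply/cvgrPdist_lt => e e0.
have e30 : 0 < e / 3 by rewrite divr_gt0.
have [k kC] := geometric_lt C e30.
have := uc k s; move/cvgrPdist_lt => /(_ _ e30).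
apply: filterS => t; have := uy k s; have := uy k t.
have -> : y s - y t = (u k s - u k t) + (u k t - y t) - (u k s - y s) by ring.
move=> h1 h2 h3; apply: le_lt_trans (ler_normB _ _) _.
have := ler_normD (u k s - u k t) (u k t - y t); lra.
Qed.

Lemma primitive (g : R -> R) (a b : R) : a < b -> continuous g ->
  exists G : R -> R, forall x, a < x < b -> is_derive x 1 G (g x).
Proof.
move=> ab gc.
have gi : lebesgue_measure.-integrable `[a, b] (EFin \o g).
  apply: continuous_compact_integrable; first exact: segment_compact.
  exact: continuous_subspaceT.
exists (fun x => \int[lebesgue_measure]_(t in `[a, x]) g t)%R => x /andP[ax xb].
have [d1 d2] := continuous_FTC1_closed xb gi ax (gc x).
by split; [exact: d1|rewrite -derive1E; exact: d2].
Qed.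

(** The retraction of the line onto [[a, b]]. It replaces data controlled only on an interval or a
    box by globally controlled data, as Picard iteration on the whole line requires. *)
Definition clamp (a b s : R) : R := Num.max a (Num.min b s).

Lemma clamp_id a b s : a <= s <= b -> clamp a b s = s.
Proof. by move=> /andP[as' sb]; rewrite /clamp min_r// max_r. Qed.

Lemma clamp_itv a b s : a <= b -> a <= clamp a b s <= b.
Proof.
by move=> ab; rewrite /clamp le_max lexx/= ge_max ab ge_min lexx.
Qed.

Lemma clamp_le a b s t : `|clamp a b s - clamp a b t| <= `|s - t|.
Proof.
rewrite /clamp !maxEle !minEle ler_norml.
have := ler_norm (s - t); have := ler_norm (t - s); rewrite (distrC t).
case: (leP b s) => ?; case: (leP b t) => ?; do ?case: (leP a _) => ?; move=> ? ?;
  apply/andP; split; lra.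
Qed.

Lemma clamp_continuous a b : continuous (clamp a b).
Proof.
move=> s; apply/cvgrPdist_lt => e e0; near=> t.
apply: le_lt_trans (clamp_le _ _ _ _) _.
by near: t; exact: cvgr_dist_lt.
Unshelve. all: by end_near. Qed.

(** If [m] is the maximum of all [|Y i|] on [[0, 1]], the growth rate gives [m <= m0 + m / 2 + e].
    This replaces the exponential of the usual Gronwall inequality; radii are later chosen so that
    the rate 1/2 is available. *)
Lemma gronwall_half n (Y dY : 'I_n -> R -> R) (m0 e : R) : 0 <= m0 -> 0 <= e ->
  (forall i (s : R), 0 <= s <= 1 -> is_derive s 1 (Y i) (dY i s)) ->
  (forall (s m : R), 0 <= s <= 1 -> (forall j, `|Y j s| <= m) ->
     forall i, `|dY i s| <= m / 2 + e) ->
  (forall i, `|Y i 0| <= m0) ->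
  forall i (s : R), 0 <= s <= 1 -> `|Y i s| <= 2 * (m0 + e).
Proof.
move=> m00 e0 YD dYle Y0.
have H i : exists2 c, 0 <= c <= 1 & forall s, 0 <= s <= 1 -> `|Y i s| <= `|Y i c|.
  have [||c] := @EVT_max R (fun s => `|Y i s|) 0 1; first exact: ler01.
    apply: continuous_in_subspaceT => x; rewrite inE/= in_itv/= => /(YD i)[h _].
    have c : {for x, continuous (Y i)}.
      by apply: differentiable_continuous; apply/derivable1_diffP; exact: h.
    exact: (continuous_comp c (@norm_continuous R R^o (Y i x))).
  rewrite in_itv/= => c01 Hc; exists c; first exact: c01.
  by move=> s s01; apply: Hc; rewrite in_itv.
have {}H i := cid2 (H i).
pose m := \big[Num.max/0]_i `|Y i (sval (H i))|.
have Ym i s : 0 <= s <= 1 -> `|Y i s| <= m.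
  move=> s01; apply: le_trans (le_bigmax _ (fun i => `|Y i (sval (H i))|) i).
  by case: (H i) => c /= _; apply.
have mm : m <= m0 + (m / 2 + e).
  have m_ge0 : 0 <= m by exact: bigmax_ge_id.
  apply: bigmax_le => [|i _]; first by lra.
  case: (H i) => c /= c01 _.
  have c0 : 0 <= c by case/andP: c01.
  have : `|Y i c - Y i 0| <= (m / 2 + e) * (c - 0).
    apply: (MVT_le (df := dY i)) => // x /andP[x0 xc].
      by apply: YD; rewrite x0/=; apply: le_trans xc _; case/andP: c01.
    have x01 : 0 <= x <= 1 by rewrite x0/=; apply: le_trans xc _; case/andP: c01.
    by apply: dYle => // j; exact: Ym.
  have : (m / 2 + e) * (c - 0) <= m / 2 + e.
    by rewrite subr0 ler_piMr//; [lra|case/andP: c01].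
  have := Y0 i; have := ler_normD (Y i 0) (Y i c - Y i 0).
  have -> : Y i 0 + (Y i c - Y i 0) = Y i c by ring.
  lra.
by move=> i s s01; apply: le_trans (Ym i s s01) _; lra.
Qed.

(** * Picard iteration *)

Section Picard.
Variables (n : nat) (f : R -> ('I_n -> R) -> 'I_n -> R) (y0 : 'I_n -> R) (M : R).
Hypothesis f_continuous : forall y : 'I_n -> R -> R, (forall i, continuous (y i)) ->
  forall i, continuous (fun s => f s (fun j => y j s) i).
Hypothesis f_lipschitz : forall s y z (d : R), (forall j, `|y j - z j| <= d) ->
  forall i, `|f s y i - f s z i| <= d / 4.
Hypothesis f_bounded : forall s i, `|f s y0 i| <= M.

(** One step [y -> y'] of the iteration. The iterate is frozen outside [[-2, 2]], so that distances
    are suprema over the whole line. It may fail to be differentiable at the two ends; [G] agrees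
    with it on [[-2, 2]] and is a primitive on the larger interval []-3, 3[]. *)
Let picard_spec (y y' : 'I_n -> R -> R) := [/\ forall i, continuous (y' i),
  forall i, y' i 0 = y0 i,
  forall i s, y' i s = y' i (clamp (-2) 2 s) &
  forall i (s : R), -3 < s < 3 -> exists2 G : R -> R,
    (forall t : R, -2 <= t <= 2 -> G t = y' i t) &
    forall t : R, -3 < t < 3 -> is_derive t 1 G (f t (fun j => y j t) i)].

Let picard_step (y : 'I_n -> R -> R) : (forall i, continuous (y i)) ->
  exists y', picard_spec y y'.
Proof.
move=> yc.
have n33 : (-3 : R) < 3 by lra.
have H i := primitive n33 (@f_continuous y yc i).
have {}H i := cid (H i).
pose G i := sval (H i).
have GD i (t : R) : -3 < t < 3 -> is_derive t 1 (G i) (f t (fun j => y j t) i).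
  by rewrite /G; case: (H i) => g /= Hg; exact: Hg.
pose F i t := y0 i + (G i t - G i 0).
have FD i (t : R) : -3 < t < 3 -> is_derive t 1 (F i) (f t (fun j => y j t) i).
  move=> /(GD i) Gt; rewrite /F.
  apply: is_derive_val (is_derive_add (is_derive_const _ _ (y0 i))
    (is_derive_sub Gt (is_derive_const _ _ (G i 0)))) _.
  by rewrite add0r subr0.
exists (fun i s => F i (clamp (-2) 2 s)); split.
- move=> i s.
  have cs : -2 <= clamp (-2) 2 s <= 2 by apply: clamp_itv; lra.
  have Fc : {for clamp (-2) 2 s, continuous (F i)}.
    have [|h _] := FD i (clamp (-2) 2 s); first by lra.
    by apply: differentiable_continuous; apply/derivable1_diffP; exact: h.
  exact: (continuous_comp (@clamp_continuous (-2) 2 s) Fc).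
- by move=> i; rewrite clamp_id ?/F; [rewrite subrr addr0|lra].
- move=> i s; rewrite [in RHS]clamp_id//; apply: clamp_itv; lra.
- move=> i s _; exists (F i); last exact: FD.
  by move=> t t2; rewrite clamp_id.
Qed.

Let Phi (y : {y : 'I_n -> R -> R | forall i, continuous (y i)}) :
    {y : 'I_n -> R -> R | forall i, continuous (y i)} :=
  let H := cid (picard_step (svalP y)) in
  exist _ (sval H) (let: And4 c _ _ _ := svalP H in c).

Let PhiP y : picard_spec (sval y) (sval (Phi y)).
Proof. by rewrite /Phi /=; case: cid. Qed.

(** A Lipschitz constant 1/4 over a time of at most 2 gives the contraction factor 1/2. *)
Let Phi_contract y z (d : R) : 0 <= d -> (forall i s, `|sval y i s - sval z i s| <= d) ->
  forall i s, `|sval (Phi y) i s - sval (Phi z) i s| <= d / 2.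
Proof.
move=> d0 yz i s.
have [_ y'0 y'c y'D] := PhiP y; have [_ z'0 z'c z'D] := PhiP z.
rewrite y'c z'c; set t := clamp (-2) 2 s.
have t2 : -2 <= t <= 2 by apply: clamp_itv; lra.
have [|G GE GD] := y'D i 0; first by lra.
have [|H HE HD] := z'D i 0; first by lra.
rewrite -GE// -HE//.
have t2' : `|t - 0| <= 2 by rewrite subr0 ler_norml.
have h : `|(G t - H t) - (G 0 - H 0)| <= d / 4 * `|t - 0|.
  apply: (@MVT_ball_le R (fun t => G t - H t)
    (fun t => f t (fun j => sval y j t) i - f t (fun j => sval z j t) i)) => x xt.
    have x3 : -3 < x < 3 by move: (le_trans xt t2'); rewrite subr0 ler_norml; lra.
    by apply: is_derive_sub; [exact: GD|exact: HD].
  by apply: f_lipschitz => j; exact: yz.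
have z2 : -2 <= (0 : R) <= 2 by lra.
move: h; rewrite (GE 0 z2) (HE 0 z2) y'0 z'0 subrr subr0 => h.
have : d / 4 * `|t - 0| <= d / 4 * 2 by apply: ler_wpM2l => //; lra.
lra.
Qed.

Let u0 : {y : 'I_n -> R -> R | forall i, continuous (y i)} :=
  exist (fun y : 'I_n -> R -> R => forall i, continuous (y i)) (fun i _ => y0 i) (fun i => @cst_continuous R R (y0 i)).

Let u k := iter k Phi u0.

(** Successive iterates differ by at most [2 * M / 2 ^+ k], which sums to the displacement [4 * M].
    The interval []-2, 2[] leaves a margin around [[0, 1]], where values at time 1 are later
    taken. *)
Lemma picard : exists y : 'I_n -> R -> R, [/\ forall i, y i 0 = y0 i,
  forall i (s : R), -2 < s < 2 -> is_derive s 1 (y i) (f s (fun j => y j s) i) &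
  forall i s, `|y i s - y0 i| <= 4 * M].
Proof.
have u1 i s : `|sval (u 1) i s - sval (u 0) i s| <= 2 * M.
  have [_ h0 hc hD] := PhiP u0; change (`|sval (Phi u0) i s - y0 i| <= 2 * M).
  rewrite hc; set t := clamp (-2) 2 s.
  have t2 : -2 <= t <= 2 by apply: clamp_itv; lra.
  have [|G GE GD] := hD i 0; first by lra.
  rewrite -GE//.
  have t2' : `|t - 0| <= 2 by rewrite subr0 ler_norml.
  have h : `|G t - G 0| <= M * `|t - 0|.
    apply: (@MVT_ball_le _ G (fun t => f t (fun j => sval u0 j t) i)) => x xt.
      by apply: GD; move: (le_trans xt t2'); rewrite subr0 ler_norml; lra.
    exact: f_bounded.
  have z2 : -2 <= (0 : R) <= 2 by lra.
  move: h; rewrite (GE 0 z2) h0 => h; apply: le_trans h _; rewrite mulrC ler_wpM2r//.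
  by apply: le_trans (normr_ge0 _) (f_bounded 0 i).
have uk k i s : `|sval (u k.+1) i s - sval (u k) i s| <= 2 * M / 2 ^+ k.
  have M0 : 0 <= M by apply: le_trans (normr_ge0 _) (f_bounded 0 i).
  elim: k i s => [|k IH] i s; first by rewrite expr0 divr1.
  have h2 : (2 : R) ^+ k != 0 by rewrite expf_neq0// pnatr_eq0.
  have -> : 2 * M / 2 ^+ k.+1 = 2 * M / 2 ^+ k / 2 by rewrite exprS; field; rewrite h2.
  by apply: (Phi_contract _ IH i s); rewrite divr_ge0 ?mulr_ge0 ?exprn_ge0.
have H i s := cid (cluster_geometric (fun k => uk k i s)).
pose y i s := sval (H i s).
have yu k i s : `|sval (u k) i s - y i s| <= 4 * M / 2 ^+ k.
  rewrite /y; case: (H i s) => l /= /(_ k); congr (_ <= _ / _); ring.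
have yc i : continuous (y i).
  apply: (@uniform_limit_continuous_geometric (fun k => sval (u k) i) (y i) (4 * M)).
    by move=> k; exact: (svalP (u k)).
  by move=> k s; exact: yu.
pose y' : {y : 'I_n -> R -> R | forall i, continuous (y i)} := exist (fun y : 'I_n -> R -> R => forall i, continuous (y i)) y yc.
(* The limit and its image are both within a multiple of [M / 2 ^+ k] of the iterate [u k.+1], for
   every [k]. *)
have fixy i s : sval (Phi y') i s = y i s.
  have M0 : 0 <= M by apply: le_trans (normr_ge0 _) (f_bounded 0 i).
  apply/eqP; rewrite -subr_eq0 -normr_le0; apply/ler_addgt0Pr => e e0; rewrite add0r.
  have [k ke] := geometric_lt (8 * M) e0.
  have h2 : (0 : R) < 2 ^+ k by rewrite exprn_gt0.
  have d0 : 0 <= 4 * M / 2 ^+ k by rewrite divr_ge0 ?mulr_ge0 // ltW.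
  have h1 := @Phi_contract (u k) y' _ d0 (yu k) i s.
  have h3 := yu k.+1 i s.
  have h4 : 4 * M / 2 ^+ k.+1 = 4 * M / 2 ^+ k / 2 by rewrite exprS; field; rewrite gt_eqF.
  have h5 : 8 * M / 2 ^+ k = 2 * (4 * M / 2 ^+ k) by field; rewrite gt_eqF.
  rewrite h4 -[u k.+1]/(Phi (u k)) in h3.
  have -> : sval (Phi y') i s - y i s = sval (Phi (u k)) i s - y i s -
    (sval (Phi (u k)) i s - sval (Phi y') i s) by ring.
  apply: le_trans (ler_normB _ _) _; lra.
have [_ h0 hc hD] := PhiP y'.
exists y; split.
- by move=> i; rewrite -fixy h0.
- move=> i s s2; have [|G GE GD] := hD i 0; first by lra.
  apply: near_eq_is_derive (GD s _); last by lra.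
  have s2' : s \in `]-2, 2[%R by rewrite in_itv.
  by apply: filterS (near_in_itvoo s2') => t; rewrite in_itv/= => t2; rewrite -fixy; apply: GE; lra.
- by move=> i s; have := yu 0%N i s; rewrite expr0 divr1 distrC.
Qed.

End Picard.

End Ode.
(** * Linear connections and radial transport *)

Section Transport.
Context {R : realType}.
Local Notation ee a := (delta_mx 0 a : 'rV[R]_2).

Lemma continuous_at_rVP m (f : 'rV[R]_m -> R) x :
  {for x, continuous f} <-> (forall e : R, 0 < e -> exists2 d : R, 0 < d &
    forall h : 'rV[R]_m, `|h| < d -> `|f (h + x) - f x| < e).
Proof.
split=> [fc e e0|H].
  move/cvgrPdistC_lt/(_ _ e0) : fc => fc.
  have {}fc : \forall y \near x, `|f y - f x| < e by exact: fc.
  by move/nbhs_rVP : fc.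
apply: (iffRL (@cvgrPdistC_lt R R^o _ (nbhs x) _ f (f x))) => e e0.
have {}H := H e e0.
by have : \forall y \near x, `|f y - f x| < e by apply/nbhs_rVP.
Qed.

Lemma differentiable_dir (f : 'rV[R]_2 -> R) (x v : 'rV[R]_2) : differentiable f x ->
  is_derive x v f (v 0 0 * pd 0 f x + v 0 1 * pd 1 f x).
Proof.
move=> fd; split; first exact: diff_derivable.
by rewrite deriveE// {1}(rV2E v) linearD !linearZ/= /pd !deriveE.
Qed.

Lemma is_derive_ray (f : 'rV[R]_2 -> R) (x v : 'rV[R]_2) (s : R) :
  differentiable f (s *: v + x) ->
  is_derive s 1 (fun t : R => f (t *: v + x))
    (v 0 0 * pd 0 f (s *: v + x) + v 0 1 * pd 1 f (s *: v + x)).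
Proof. by move=> fd; have /is_derive_line := differentiable_dir v fd. Qed.

Lemma taylor1 (f : 'rV[R]_2 -> R) (a : 'I_2) (x : 'rV[R]_2) (h C : R) :
  (forall t : R, `|t| <= `|h| -> derivable f (t *: ee a + x) (ee a) /\
     `|pd a f (t *: ee a + x)| <= C) ->
  `|f (h *: ee a + x) - f x| <= C * `|h|.
Proof.
move=> H.
have := @MVT_ball_le R (fun t => f (t *: ee a + x)) (fun t => pd a f (t *: ee a + x)) 0 h C.
rewrite !subr0 scale0r add0r; apply => t; rewrite !subr0 => th; have [h1 h2] := H t th.
  exact: pd_line h1.
exact: h2.
Qed.

Lemma taylor2 (f : 'rV[R]_2 -> R) (a : 'I_2) (x : 'rV[R]_2) (h C : R) :
  (forall t : R, `|t| <= `|h| -> [/\ derivable f (t *: ee a + x) (ee a),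
     derivable (pd a f) (t *: ee a + x) (ee a) &
     `|pd a (pd a f) (t *: ee a + x)| <= C]) ->
  `|f (h *: ee a + x) - f x - h * pd a f x| <= C * h ^+ 2.
Proof.
move=> H.
have C0 : 0 <= C.
  have /H[_ _] : `|0 : R| <= `|h| by rewrite normr0.
  exact: le_trans.
have := @MVT_ball_le R (fun t => f (t *: ee a + x) - t * pd a f x)
  (fun t => pd a f (t *: ee a + x) - pd a f x) 0 h (C * `|h|).
rewrite !subr0 scale0r add0r mul0r subr0.
rewrite -mulrA -normrM -expr2 ger0_norm ?sqr_ge0//.
rewrite (addrAC _ (- f x)); apply => t; rewrite !subr0 => th; have [h1 h2 h3] := H t th.
  by apply: (is_derive_sub_line (f := fun s : R => f (s *: ee a + x))); exact: pd_line h1.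
apply: le_trans (_ : C * `|t| <= _); last by apply: ler_wpM2l.
apply: taylor1 => u ut.
have [h4 h5 h6] := H u (le_trans ut th); split; [exact: h5|exact: h6].
Qed.

Section Lin.
Variable n : nat.
Implicit Types (M : 'I_n -> 'I_n -> R) (y : 'I_n -> R).

Definition lin M y i := \sum_j M i j * y j.

Lemma lin_le M y (c m : R) : (forall i j, `|M i j| <= c) -> (forall j, `|y j| <= m) ->
  forall i, `|lin M y i| <= n%:R * (c * m).
Proof.
move=> Mc ym i; apply: le_trans (ler_norm_sum _ _ _) _.
rewrite -[n in n%:R]card_ord mulr_natl -sumr_const; apply: ler_sum => j _.
by rewrite normrM; apply: ler_pM.
Qed.

Lemma linDr M y z i : lin M (fun j => y j + z j) i = lin M y i + lin M z i.
Proof. by rewrite /lin -big_split/=; apply: eq_bigr => j _; rewrite mulrDr. Qed.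

Lemma linZr M y c i : lin M (fun j => c * y j) i = c * lin M y i.
Proof. by rewrite /lin big_distrr/=; apply: eq_bigr => j _; rewrite mulrCA. Qed.

Lemma linBr M y z i : lin M (fun j => y j - z j) i = lin M y i - lin M z i.
Proof. by rewrite /lin -sumrB; apply: eq_bigr => j _; rewrite mulrBr. Qed.

Lemma linBl M N y i : lin (fun i j => M i j - N i j) y i = lin M y i - lin N y i.
Proof. by rewrite /lin -sumrB; apply: eq_bigr => j _; rewrite mulrBl. Qed.

Lemma linZl M y c i : lin (fun i j => c * M i j) y i = c * lin M y i.
Proof. by rewrite /lin big_distrr/=; apply: eq_bigr => j _; rewrite mulrA. Qed.

Lemma lin_sum m M (y : 'I_m -> 'I_n -> R) (c : 'I_m -> R) i :
  lin M (fun j => \sum_k c k * y k j) i = \sum_k c k * lin M (y k) i.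
Proof.
rewrite /lin (eq_bigr _ (fun j _ => big_distrr _ _ _)) exchange_big/=; apply: eq_bigr => k _.
by rewrite big_distrr/=; apply: eq_bigr => j _; rewrite mulrCA.
Qed.

End Lin.

Variables (n : nat) (A : 'I_2 -> 'I_n -> 'I_n -> 'rV[R]_2 -> R).
Implicit Types (W : set 'rV[R]_2) (Y : 'I_n -> 'rV[R]_2 -> R) (x q : 'rV[R]_2).

Definition conn a x : 'I_n -> 'I_n -> R := fun i j => A a i j x.

(** Sign convention: [A] is minus the connection form, so [D = pd - A]. *)
Definition parallel W Y := forall x, W x -> forall i, differentiable (Y i) x /\
  forall a, pd a (Y i) x = lin (conn a x) (fun j => Y j x) i.

Definition ray q x (s : R) := s *: (x - q) + q.

Lemma ray0 q x : ray q x 0 = q. Proof. by rewrite /ray scale0r add0r. Qed.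
Lemma ray1 q x : ray q x 1 = x. Proof. by rewrite /ray scale1r subrK. Qed.

Definition radial_rhs (v p : 'rV[R]_2) (y : 'I_n -> R) i :=
  v 0 0 * lin (conn 0 p) y i + v 0 1 * lin (conn 1 p) y i.

(** The parallel equation in the direction of the rays from [q] only. This is a family of linear
    ordinary differential equations, solvable without any integrability condition. *)
Definition radial q W Y := forall x, W x -> forall i (s : R), 0 <= s <= 1 ->
  is_derive s 1 (fun t => Y i (ray q x t))
    (radial_rhs (x - q) (ray q x s) (fun j => Y j (ray q x s)) i).

Definition star q W := forall x, W x -> forall s : R, 0 <= s <= 1 -> W (ray q x s).

Lemma parallel_radial q W Y : star q W -> parallel W Y -> radial q W Y.
Proof.
move=> st pY x Wx i s s01; have [d1 d2] := pY _ (st x Wx s s01) i.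
by apply: is_derive_val (is_derive_ray d1) _; rewrite !d2.
Qed.

Lemma radial_rhs_le v p y i (C m r : R) : (forall a i j, `|A a i j p| <= C) ->
  (forall j, `|y j| <= m) -> `|v| <= r -> `|radial_rhs v p y i| <= 2 * r * (n%:R * (C * m)).
Proof.
move=> AC ym vr; rewrite /radial_rhs; apply: le_trans (ler_normD _ _) _.
rewrite !normrM.
have h0 : `|lin (conn 0 p) y i| <= n%:R * (C * m) by apply: lin_le => // k l; exact: AC.
have h1 : `|lin (conn 1 p) y i| <= n%:R * (C * m) by apply: lin_le => // k l; exact: AC.
have v0 := le_trans (coord_le v 0) vr; have v1 := le_trans (coord_le v 1) vr.
have -> : 2 * r * (n%:R * (C * m)) = r * (n%:R * (C * m)) + r * (n%:R * (C * m)) by ring.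
by apply: lerD; apply: ler_pM.
Qed.

(** Along a ray the right-hand side is at most [2 * r * n * C] times the maximum of the components,
    and [4 * n * C * r <= 1] makes this factor at most 1/2. *)
Lemma radial_bound q W Y (C r m : R) : star q W -> radial q W Y ->
  (forall x, W x -> forall a i j, `|A a i j x| <= C) ->
  (forall x, W x -> `|x - q| <= r) -> 4 * n%:R * C * r <= 1 ->
  0 <= m -> (forall i, `|Y i q| <= m) ->
  forall x, W x -> forall i, `|Y i x| <= 2 * m.
Proof.
move=> st rY AC Wr nCr m0 Yq x Wx i.
have := @gronwall_half R n (fun i s => Y i (ray q x s))
  (fun i s => radial_rhs (x - q) (ray q x s) (fun j => Y j (ray q x s)) i) m 0 m0 (lexx 0).
move=> /(_ _ _ _ i 1); rewrite ray1 addr0; apply.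
- by move=> j s s01; exact: rY.
- move=> s m' s01 Ym' j.
  have m'0 : 0 <= m' by apply: le_trans (Ym' j).
  apply: le_trans (radial_rhs_le _ (AC _ (st x Wx s s01)) Ym' (Wr x Wx)) _.
  rewrite addr0; have -> : 2 * r * (n%:R * (C * m')) = (4 * n%:R * C * r) * (m' / 2) by field.
  by rewrite ler_piMl// divr_ge0.
- by move=> j; rewrite ray0.
- by rewrite ler01 lexx.
Qed.

Lemma radial_lin q W m (Y : 'I_m -> 'I_n -> 'rV[R]_2 -> R) (c : 'I_m -> R) :
  (forall k, radial q W (Y k)) -> radial q W (fun i x => \sum_k c k * Y k i x).
Proof.
move=> rY x Wx i s s01.
have -> : (fun t => \sum_k c k * Y k i (ray q x t)) =
          \sum_k (c k *: (fun t : R => Y k i (ray q x t))).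
  by apply/funext => t; rewrite fct_sumE.
have H k : is_derive s 1 (c k *: (fun t : R => Y k i (ray q x t)))
    (c k *: radial_rhs (x - q) (ray q x s) (fun j => Y k j (ray q x s)) i).
  by apply: is_deriveZ; exact: rY.
apply: is_derive_val (is_derive_sum H) _.
rewrite /radial_rhs !lin_sum !big_distrr/= -big_split/=; apply: eq_bigr => k _.
rewrite /GRing.scale/=; ring.
Qed.

Definition disc q (r : R) : set 'rV[R]_2 := [set x | `|x - q| < r].

Lemma star_disc q r : star q (disc q r).
Proof.
move=> x qx s /andP[s0 s1]; rewrite /disc /ray/= addrK normrZ ger0_norm//.
by apply: le_lt_trans qx; rewrite ler_piMl.
Qed.

Lemma continuous_at_sum (T : topologicalType) m (F : 'I_m -> T -> R) (t : T) :
  (forall k, {for t, continuous (F k)}) -> {for t, continuous (fun s => \sum_k F k s)}.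
Proof.
move=> Fc; have : forall r : seq 'I_m, {for t, continuous (fun s => \sum_(k <- r) F k s)}.
  elim=> [|k r IH].
    have -> : (fun s => \sum_(k <- [::]) F k s) = fun=> 0 by apply/funext => s; rewrite big_nil.
    exact: cst_continuous.
  have -> : (fun s => \sum_(k0 <- k :: r) F k0 s) = fun s => F k s + \sum_(k <- r) F k s.
    by apply/funext => s; rewrite big_cons.
  exact: continuous_atD (Fc k) IH.
exact.
Qed.

(** Picard iteration solves the equation along each direction [X], and the solution at time 1 is
    taken as the value at [q + X]. The factor 8 makes the Lipschitz constant 1/4, and the radius
    [2 * r] is needed because the solutions run over [-2 < s < 2]. *)
Lemma radial_exists q (r C : R) (psi : 'I_n -> R) : 0 < r ->
  (forall x, disc q (2 * r) x -> forall a i j,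
      `|A a i j x| <= C /\ {for x, continuous (A a i j)}) ->
  8 * n%:R * C * r <= 1 ->
  exists Y, (forall i, Y i q = psi i) /\ radial q (disc q r) Y.
Proof.
move=> r0 AC nCr.
pose pt (X : 'rV[R]_2) s := clamp (-2) 2 s *: X + q.
have ptB X s : `|X| < r -> disc q (2 * r) (pt X s).
  move=> Xr; rewrite /disc /pt/= addrK normrZ.
  have : -2 <= clamp (-2) 2 s <= 2 by apply: clamp_itv; lra.
  rewrite -ler_norml => h; apply: le_lt_trans (_ : 2 * `|X| < _); first exact: ler_wpM2r.
  by rewrite ltr_pM2l.
pose M := \sum_i `|psi i|.
have psiM j : `|psi j| <= M by rewrite /M (bigD1 j)//= lerDl sumr_ge0.
have H X : exists y : 'I_n -> R -> R, `|X| < r -> (forall i, y i 0 = psi i) /\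
    forall i (s : R), -2 < s < 2 ->
      is_derive s 1 (y i) (radial_rhs X (s *: X + q) (fun j => y j s) i).
  have [Xr|_] := boolP (`|X| < r); last by exists (fun _ _ => 0).
  have := @picard R n (fun s y i => radial_rhs X (pt X s) y i) psi (2 * r * (n%:R * (C * M))).
  move=> /(_ _ _ _)[||| y [y0 yD _]].
  - move=> y yc i s.
    have cA a j : {for s, continuous (fun t => A a i j (pt X t))}.
      have c1 : {for s, continuous (pt X)}.
        move=> B /nbhs_rVP [d d0 HB].
        have X0' : 0 < `|X| + 1 by rewrite ltr_wpDl.
        have := @clamp_continuous R (-2) 2 s.
        move/cvgrPdistC_lt => /(_ (d / (`|X| + 1))); rewrite divr_gt0// => /(_ isT).
        apply: filterS => t; rewrite ltr_pdivlMr// => tX.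
        have /HB : `|(clamp (-2) 2 t - clamp (-2) 2 s) *: X| < d.
          by apply: le_lt_trans tX; rewrite normrZ ler_wpM2l// lerDl.
        by rewrite scalerBl /pt addrA subrK.
      exact: (continuous_comp c1 (AC _ (ptB X s Xr) a i j).2).
    have cl a : {for s, continuous (fun t => lin (conn a (pt X t)) (fun j => y j t) i)}.
      apply: continuous_at_sum => j; apply: continuous_atM; [exact: cA|exact: yc].
    have ck (k : R) : {for s, continuous (fun _ : R => k)} by exact: cst_continuous.
    exact: continuous_atD (continuous_atM (ck _) (cl 0)) (continuous_atM (ck _) (cl 1)).
  - move=> s y z d yz i.
    have -> : radial_rhs X (pt X s) y i - radial_rhs X (pt X s) z i =
        radial_rhs X (pt X s) (fun j => y j - z j) i.
      by rewrite /radial_rhs !linBr; ring.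
    have d0 : 0 <= d by apply: le_trans (yz i).
    apply: le_trans (radial_rhs_le _ (fun a i j => (AC _ (ptB X s Xr) a i j).1) yz (ltW Xr)) _.
    have -> : 2 * r * (n%:R * (C * d)) = (8 * n%:R * C * r) * (d / 4) by field.
    by rewrite ler_piMl// divr_ge0.
  - move=> s i.
    exact: radial_rhs_le (fun a i j => (AC _ (ptB X s Xr) a i j).1) psiM (ltW Xr).
  exists y => _; split => // i s s2; apply: is_derive_val (yD i s s2) _.
  by rewrite /pt clamp_id//; lra.
have {}H X := cid (H X).
pose y X := sval (H X).
have y0 X i : `|X| < r -> y X i 0 = psi i.
  by move=> Xr; rewrite /y; case: (H X) => z /= /(_ Xr)[].
have yD X i (s : R) : `|X| < r -> -2 < s < 2 ->
    is_derive s 1 (y X i) (radial_rhs X (s *: X + q) (fun j => y X j s) i).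
  move=> Xr s2; rewrite /y; case: (H X) => z /= /(_ Xr)[_ h]; exact: h.
(* Homogeneity: [t -> y X i (s * t)] and [y (s *: X) i] satisfy the same linear equation with the
   same initial value. This is what makes the values at time 1 a solution along each ray. *)
have yE X (s : R) i : `|X| < r -> `|s *: X| < r -> -2 < s < 2 -> y (s *: X) i 1 = y X i s.
  move=> Xr sXr s2.
  apply/eqP; rewrite -subr_eq0 -normr_le0.
  have st2 (t : R) : 0 <= t <= 1 -> -2 < s * t < 2.
    rewrite -!ltr_norml normrM => /andP[t0 t1]; rewrite (ger0_norm t0).
    have : `|s| < 2 by rewrite ltr_norml.
    by apply: le_lt_trans; rewrite ler_piMr.
  have dD j (t : R) : 0 <= t <= 1 -> is_derive t 1 (fun t => y (s *: X) j t - y X j (s * t))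
     (radial_rhs (s *: X) (t *: (s *: X) + q) (fun j => y (s *: X) j t - y X j (s * t)) j).
    move=> t01.
    have h1 := yD (s *: X) j t sXr; have h2 := yD X j (s * t) Xr (st2 t t01).
    have h3 : is_derive t 1 (fun t => y X j (s * t))
        (s * radial_rhs X ((s * t) *: X + q) (fun j => y X j (s * t)) j).
      have h4 : is_derive t 1 (fun t : R => s * t) s.
        apply: is_derive_val (is_derive_mul (is_derive_const t 1 s) (is_derive_rid t)) _.
        by rewrite mul0r add0r mulr1.
      have := @is_derive1_comp R (y X j) (fun t => s * t) t _ _ h2 h4.
      by rewrite /GRing.scale/= mulrC.
    have {}h1 := h1 (_ : -2 < t < 2).
    have t2 : -2 < t < 2 by lra.
    apply: is_derive_val (is_derive_sub (h1 t2) h3) _.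
    rewrite /radial_rhs !linBr scalerA (mulrC t) !mxE; ring.
  have := @gronwall_half R n (fun j t => y (s *: X) j t - y X j (s * t)) _ 0 0 (lexx 0) (lexx 0)
     dD _ _ i 1.
  rewrite addr0 !mulr0 mulr1; apply; last by rewrite ler01 lexx.
  - move=> t m /andP[t0 t1] Dm j.
    have m0 : 0 <= m by apply: le_trans (Dm j).
    have B : disc q (2 * r) (t *: (s *: X) + q).
      rewrite /disc/= addrK normrZ (ger0_norm t0).
      have : t * `|s *: X| <= `|s *: X| by rewrite ler_piMl.
      have := normr_ge0 X; lra.
    apply: le_trans (radial_rhs_le _ (fun a i j => (AC _ B a i j).1) Dm (ltW sXr)) _.
    rewrite addr0; have -> : 2 * r * (n%:R * (C * m)) = (8 * n%:R * C * r) * (m / 4) by field.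
    apply: le_trans (_ : m / 4 <= _); last by lra.
    by rewrite ler_piMl// divr_ge0.
  - by move=> j; rewrite !y0// subrr normr0.
exists (fun i x => y (x - q) i 1); split.
  move=> i; rewrite subrr; have n0 : `|0 : 'rV[R]_2| < r by rewrite normr0.
  by have := @yE 0 0 i n0; rewrite scaler0 => /(_ n0) ->; [exact: y0|lra].
move=> x qx i s s01; set X := x - q.
have Xr : `|X| < r by [].
have sX : `|s *: X| < r by have := star_disc qx s01; rewrite /disc /ray/= addrK.
have rayK t : ray q x t - q = t *: X by rewrite /ray addrK.
have nearE : \forall t \near s, y X i t = y (ray q x t - q) i 1.
  have X0' : 0 < `|X| + 1 by rewrite ltr_wpDl.
  pose e := Num.min 1 ((r - `|s *: X|) / (`|X| + 1)).
  have e0 : 0 < e by rewrite lt_min ltr01 divr_gt0// subr_gt0.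
  apply/nbhs_ballP; exists e => // t; rewrite /ball/= lt_min => /andP[t1 t2].
  rewrite rayK yE//; last by move: t1; rewrite ltr_norml; lra.
  have -> : t *: X = s *: X - (s - t) *: X by rewrite scalerBl opprB addrC subrK.
  apply: le_lt_trans (ler_normB _ _) _; rewrite -ltrBrDl.
  apply: le_lt_trans (_ : `|s - t| * (`|X| + 1) < _); last by rewrite -ltr_pdivlMr.
  by rewrite normrZ ler_wpM2l// lerDl.
have s2 : -2 < s < 2 by lra.
apply: near_eq_is_derive nearE _; apply: is_derive_val (yD X i s Xr s2) _.
congr (radial_rhs _ _ _ _); apply/funext => j; rewrite rayK yE//.
Qed.

Lemma bounded_partial_continuous (f : 'rV[R]_2 -> R) x (d C : R) : 0 < d ->
  (forall k : 'rV[R]_2, `|k| < d -> forall a, derivable f (k + x) (ee a) /\ `|pd a f (k + x)| <= C) ->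
  {for x, continuous f}.
Proof.
move=> d0 H.
have n0 : `|0 : 'rV[R]_2| < d by rewrite normr0.
have H0 a : `|pd a f x| <= C by have [_] := H 0 n0 a; rewrite add0r.
have C0 : 0 <= C by apply: le_trans (H0 0).
have H' k : `|k| < d -> forall a, derivable f (k + x) (ee a) /\ `|pd a f (k + x) - pd a f x| <= C *+ 2.
  move=> kd a; have [h1 h2] := H k kd a; split; first exact: h1.
  by apply: le_trans (ler_normB _ _) _; rewrite mulr2n lerD.
have E k : `|k| < d -> `|f (k + x) - f x| <= 6 * C * `|k|.
  move=> kd; have := partial_estimate H' kd (mulrn_wge0 _ C0).
  set p := k 0 0 * _ + _ => h.
  have hp : `|p| <= 2 * C * `|k|.
    apply: le_trans (ler_normD _ _) _; rewrite !normrM.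
    have -> : 2 * C * `|k| = `|k| * C + `|k| * C by ring.
    by apply: lerD; apply: ler_pM => //; exact: coord_le.
  have := ler_normD (f (k + x) - f x - p) p; rewrite subrK => h'.
  have -> : 6 * C * `|k| = C *+ 2 *+ 2 * `|k| + 2 * C * `|k| by ring.
  exact: le_trans h' (lerD h hp).
apply/continuous_at_rVP => e e0.
exists (Num.min d (e / (6 * C + 1))); first by rewrite lt_min d0/= divr_gt0// ltr_wpDl// mulr_ge0.
move=> k; rewrite lt_min => /andP[kd]; rewrite ltr_pdivlMr; last by rewrite ltr_wpDl// mulr_ge0.
move=> ke; apply: le_lt_trans (E k kd) _; apply: le_lt_trans ke.
by rewrite mulrC ler_wpM2l// lerDl.
Qed.

Definition dconn b a x : 'I_n -> 'I_n -> R := fun i j => pd b (A a i j) x.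

Section RadialParallel.
Variables (q : 'rV[R]_2) (r C m : R) (Y : 'I_n -> 'rV[R]_2 -> R).
Let W := disc q r.
Hypotheses (r0 : 0 < r) (C0 : 0 <= C) (m0 : 0 <= m).
Hypothesis A_deriv : forall x, W x -> forall a i j, differentiable (A a i j) x /\
  forall b, derivable (pd b (A a i j)) x (ee b).
Hypothesis A_bound : forall x, W x -> forall a i j, `|A a i j x| <= C /\
  forall b, `|pd b (A a i j) x| <= C /\ `|pd b (pd b (A a i j)) x| <= C.
Hypothesis nCr : 8 * n%:R * C * r <= 1.
Hypothesis rY : radial q W Y.
Hypothesis Ym : forall x, W x -> forall i, `|Y i x| <= m.
(** Zero curvature is required only on the vectors [Y x] themselves. The prolongation connection has
    curvature, and in this form it does no harm to sections annihilated by [V]. *)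
Hypothesis flat : forall x, W x -> forall i,
  lin (dconn 1 0 x) (fun j => Y j x) i + lin (conn 0 x) (lin (conn 1 x) (fun j => Y j x)) i =
  lin (dconn 0 1 x) (fun j => Y j x) i + lin (conn 1 x) (lin (conn 0 x) (fun j => Y j x)) i.

Let w a i x := lin (conn a x) (fun j => Y j x) i.

Let w_ray a x i (s : R) : W x -> 0 <= s <= 1 ->
  is_derive s 1 (fun t => w a i (ray q x t))
   (let z := ray q x s in let X := x - q in let y := fun j => Y j z in
    X 0 0 * (lin (dconn 0 a z) y i + lin (conn a z) (lin (conn 0 z) y) i) +
    X 0 1 * (lin (dconn 1 a z) y i + lin (conn a z) (lin (conn 1 z) y) i)).
Proof.
move=> Wx s01 /=; set z := ray q x s; set X := x - q.
have -> : (fun t => w a i (ray q x t)) =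
          \sum_j (fun t : R => A a i j (ray q x t) * Y j (ray q x t)).
  by apply/funext => t; rewrite fct_sumE.
have H j : is_derive s 1 (fun t : R => A a i j (ray q x t) * Y j (ray q x t))
    ((X 0 0 * pd 0 (A a i j) z + X 0 1 * pd 1 (A a i j) z) * Y j z +
     A a i j z * radial_rhs X z (fun k => Y k z) j).
  apply: is_derive_mul; last exact: rY.
  by apply: is_derive_ray; have [] := A_deriv (star_disc Wx s01) a i j.
apply: is_derive_val (is_derive_sum H) _.
rewrite /lin !mulrDr !big_distrr/= -!big_split/=; apply: eq_bigr => j _.
rewrite /radial_rhs /dconn /conn /lin; ring.
Qed.

Let flat_dir a b x i : W x ->
  lin (dconn b a x) (fun j => Y j x) i + lin (conn a x) (lin (conn b x) (fun j => Y j x)) i =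
  lin (dconn a b x) (fun j => Y j x) i + lin (conn b x) (lin (conn a x) (fun j => Y j x)) i.
Proof.
move=> Wx; elim/ord2_ind: a; elim/ord2_ind: b => //; first exact: flat.
by rewrite flat.
Qed.

(** [K0] and [K1] bound [A Y] and [A A Y]; [E] collects the coefficients of [h ^+ 2] in the estimate
    of [dD]. *)
Let K0 := n%:R * (C * m).
Let K1 := n%:R * (C * K0).
Let E := 2 * r * K0 + K0 + 2 * r * K1 + K1.

Let K0_ge0 : 0 <= K0. Proof. by rewrite /K0 !mulr_ge0. Qed.
Let K1_ge0 : 0 <= K1. Proof. by rewrite /K1 !mulr_ge0. Qed.
Let E_ge0 : 0 <= E. Proof. by rewrite /E !addr_ge0// !mulr_ge0// ltW. Qed.

Section Increment.
Variables (a : 'I_2) (x : 'rV[R]_2) (h : R).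
Hypotheses (Wx : W x) (hr : `|h| + `|x - q| < r).
Let x' := h *: ee a + x.
Let X := x - q.
Let X' := x' - q.

Let X'E : X' = h *: ee a + X. Proof. by rewrite /X' /x' addrA. Qed.

Let Wx' : W x'.
Proof.
rewrite /W /disc/= -/X' X'E; apply: le_lt_trans (ler_normD _ _) _.
by rewrite normrZ norm_ee mulr1.
Qed.

Let z s := ray q x s.
Let z' s := ray q x' s.

Let z'E s : z' s = (s * h) *: ee a + z s.
Proof. by rewrite /z' /z /ray -/X' X'E scalerDr scalerA addrA. Qed.

Let Wz (s t : R) : 0 <= s <= 1 -> `|t| <= `|s * h| -> W (t *: ee a + z s).
Proof.
move=> /andP[s0 s1] th; rewrite /W /disc/= /z /ray addrA addrK.
apply: le_lt_trans (ler_normD _ _) _; rewrite !normrZ norm_ee mulr1 (ger0_norm s0).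
apply: le_lt_trans hr; apply: lerD; last by rewrite ler_piMl.
by apply: le_trans th _; rewrite normrM (ger0_norm s0) ler_piMl.
Qed.

Let A1 b i j (s : R) : 0 <= s <= 1 -> `|A b i j (z' s) - A b i j (z s)| <= C * `|h|.
Proof.
move=> s01; rewrite z'E; apply: le_trans (_ : C * `|s * h| <= _).
  apply: taylor1 => t th; have Wt := Wz s01 th; split.
    by apply: diff_derivable; have [h1 _] := A_deriv Wt b i j; exact: h1.
  by have [_ h1] := A_bound Wt b i j; have [] := h1 a.
by rewrite ler_wpM2l// normrM ler_piMl// ger0_norm; lra.
Qed.

Let A2 b i j (s : R) : 0 <= s <= 1 ->
  `|A b i j (z' s) - A b i j (z s) - s * h * pd a (A b i j) (z s)| <= C * h ^+ 2.
Proof.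
move=> s01; rewrite z'E; apply: le_trans (_ : C * (s * h) ^+ 2 <= _).
  apply: taylor2 => t th; have Wt := Wz s01 th.
  have [h1 h2] := A_deriv Wt b i j; split.
  - by apply: diff_derivable; exact: h1.
  - exact: h2.
  - by have [_ h3] := A_bound Wt b i j; have [] := h3 a.
rewrite ler_wpM2l// exprMn ler_piMl ?sqr_ge0// expr_le1//; lra.
Qed.

(** Defect of the first-order prediction on the displaced ray. At time [s] the ray to [x'] is off
    the ray to [x] by [s * h] in the direction [e_a], hence this factor. *)
Let D i s := Y i (z' s) - Y i (z s) - s * h * w a i (z s).

Let dD i s := radial_rhs X' (z' s) (fun j => D j s) i +
  (let y := fun j => Y j (z s) in let wv := lin (conn a (z s)) y in
   let p b := lin (conn b (z' s)) y i in let q b := lin (conn b (z s)) y i in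
   let u b := lin (conn b (z' s)) wv i in let v b := lin (conn b (z s)) wv i in
   let t b := lin (dconn a b (z s)) y i in
   X 0 0 * (p 0 - q 0 - s * h * t 0) + X 0 1 * (p 1 - q 1 - s * h * t 1) +
   h * (p a - q a) + s * h * (X 0 0 * (u 0 - v 0) + X 0 1 * (u 1 - v 1)) +
   s * h * (h * u a)).

(** Differentiating [w a] along the ray produces [d_b A_a + A_a A_b], which flatness trades for
    [d_a A_b + A_b A_a]. The latter is the first-order variation of the radial equation under the
    displacement, so besides a linear term in [D] only terms of second order in [h] remain. *)
Let D_deriv i (s : R) : 0 <= s <= 1 -> is_derive s 1 (D i) (dD i s).
Proof.
move=> s01; rewrite /D.
have Wzs : W (z s) by exact: star_disc Wx _ s01.
have h1 := rY Wx' i s01; have h2 := rY Wx i s01; have h3 := w_ray a i Wx s01.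
have h4 : is_derive s 1 (fun s : R => s * h) h.
  apply: is_derive_val (is_derive_mul (is_derive_rid s) (is_derive_const s 1 h)) _.
  by rewrite mulr0 addr0 mul1r.
apply: is_derive_val (is_derive_sub (is_derive_sub h1 h2) (is_derive_mul h4 h3)) _.
rewrite -/(z s) -/(z' s) -/X -/X' /= !(flat_dir a _ i Wzs) /dD /=.
set y := fun j => Y j (z s); set wv := lin (conn a (z s)) y.
have E1 : (fun j => Y j (z' s)) = (fun j => D j s + (y j + s * h * wv j)).
  by apply/funext => j; rewrite /D /y /wv /w; ring.
rewrite /radial_rhs E1 !linDr !linZr {1 2}X'E {1 2}X'E !mxE /w -/y -/wv.
by elim/ord2_ind: a => /=; ring.
Qed.

Let dD_le i s m' : 0 <= s <= 1 -> (forall j, `|D j s| <= m') ->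
  `|dD i s| <= m' / 2 + E * h ^+ 2.
Proof.
move=> s01 Dm.
have m'0 : 0 <= m' by apply: le_trans (Dm i).
have Wzs : W (z s) by exact: star_disc Wx _ s01.
have Wz's : W (z' s) by exact: star_disc Wx' _ s01.
rewrite /dD /=; set y := fun j => Y j (z s); set wv := lin (conn a (z s)) y.
have ym j : `|y j| <= m by exact: Ym.
have wK j : `|wv j| <= K0 by apply: lin_le => // k l; have [] := A_bound Wzs a k l.
have b1 b : `|lin (conn b (z' s)) y i - lin (conn b (z s)) y i -
    s * h * lin (dconn a b (z s)) y i| <= h ^+ 2 * K0.
  rewrite -linBl -linZl -linBl.
  have -> : h ^+ 2 * K0 = n%:R * (C * h ^+ 2 * m) by rewrite /K0; ring.
  by apply: lin_le => // k l; exact: A2.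
have b2 b v0 : (forall j, `|v0 j| <= K0) ->
   `|lin (conn b (z' s)) v0 i - lin (conn b (z s)) v0 i| <= `|h| * K1.
  move=> vK; rewrite -linBl; have -> : `|h| * K1 = n%:R * (C * `|h| * K0) by rewrite /K1; ring.
  by apply: lin_le => // k l; exact: A1.
have b3 : `|lin (conn a (z' s)) y i - lin (conn a (z s)) y i| <= `|h| * K0.
  rewrite -linBl; have -> : `|h| * K0 = n%:R * (C * `|h| * m) by rewrite /K0; ring.
  by apply: lin_le => // k l; exact: A1.
have b4 : `|lin (conn a (z' s)) wv i| <= K1.
  by apply: lin_le => // k l; have [] := A_bound Wz's a k l.
have b5 : `|radial_rhs X' (z' s) (fun j => D j s) i| <= m' / 2.
  apply: le_trans (radial_rhs_le i (fun b k l => (A_bound Wz's b k l).1) Dm (ltW Wx')) _.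
  have -> : 2 * r * (n%:R * (C * m')) = (8 * n%:R * C * r) * (m' / 4) by field.
  apply: le_trans (_ : m' / 4 <= _); last by lra.
  by rewrite ler_piMl// divr_ge0.
have Xr b : `|X 0 b| <= r by apply: le_trans (coord_le X b) (ltW Wx).
have sh : `|s * h| <= `|h| by rewrite normrM ler_piMl// ger0_norm; lra.
have h2 : `|h| * `|h| = h ^+ 2 by rewrite -expr2 real_normK// num_real.
apply: le_trans (ler_normD _ _) _; apply: lerD b5 _.
have -> : E * h ^+ 2 = r * (h ^+ 2 * K0) + r * (h ^+ 2 * K0) + `|h| * (`|h| * K0) +
    `|h| * (r * (`|h| * K1) + r * (`|h| * K1)) + `|h| * (`|h| * K1).
  by rewrite /E -h2; ring.
have addle u v k l : `|u| <= k -> `|v| <= l -> `|u + v| <= k + l :> R.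
  by move=> uk vl; apply: le_trans (ler_normD _ _) (lerD uk vl).
have mulle u v k l : `|u| <= k -> `|v| <= l -> `|u * v| <= k * l :> R.
  by move=> uk vl; rewrite normrM; apply: ler_pM.
apply: (addle); last by apply: (mulle); [exact: sh|apply: (mulle)].
apply: (addle); last first.
  by apply: (mulle); [exact: sh|apply: (addle); apply: (mulle); [exact: Xr|exact: b2|exact: Xr|exact: b2]].
apply: (addle); last by apply: (mulle).
by apply: (addle); apply: (mulle).
Qed.

(** The defect is 0 at [s = 0], so the Gronwall bound at [s = 1] leaves twice the source term. *)
Lemma radial_increment i : `|Y i x' - Y i x - h * w a i x| <= 2 * (E * h ^+ 2).
Proof.
have := @gronwall_half R n D dD 0 (E * h ^+ 2) (lexx 0).
move=> /(_ _ _ _ _ i 1); rewrite add0r /D /z /z' !ray1 mul1r; apply.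
- by rewrite mulr_ge0// sqr_ge0.
- by move=> j s; exact: D_deriv.
- by move=> s m' s01 Dm j; exact: dD_le.
- by move=> j; rewrite !ray0 subrr mul0r mul0r subr0 normr0.
- by rewrite ler01 lexx.
Qed.

End Increment.

Let partial a i x : W x -> is_derive x (ee a) (Y i) (w a i x).
Proof.
move=> Wx; apply/is_derive_epsP => e e0.
have E1 : 0 < 2 * E + 1 by rewrite ltr_wpDl// mulr_ge0.
exists (Num.min (r - `|x - q|) (e / (2 * E + 1))).
  by rewrite lt_min subr_gt0 divr_gt0// andbT.
move=> h; rewrite lt_min ltrBrDr ltr_pdivlMr// => /andP[hr he].
apply: le_trans (radial_increment a Wx hr i) _.
have -> : 2 * (E * h ^+ 2) = `|h| * (2 * E) * `|h|.
  have -> : h ^+ 2 = `|h| * `|h| by rewrite -expr2 real_normK// num_real.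
  ring.
apply: ler_wpM2r => //; apply: le_trans (ltW he); apply: ler_wpM2l => //; lra.
Qed.

Let nearW x : W x -> exists2 d, 0 < d & forall k : 'rV[R]_2, `|k| < d -> W (k + x).
Proof.
move=> Wx; exists (r - `|x - q|); first by rewrite subr_gt0.
move=> k kd; rewrite /W /disc/= -addrA; apply: le_lt_trans (ler_normD _ _) _.
by rewrite -ltrBrDr.
Qed.

(* Along the rays to [x] and to [x + h e_a], flatness makes [Y (x + h e_a)] and
   [Y x + h w_a x] satisfy the same equation up to [O(h^2)], hence they differ
   by [O(h^2)]. *)
Lemma radial_parallel : parallel W Y.
Proof.
have wK a i x : W x -> `|w a i x| <= K0.
  move=> Wx; apply: lin_le => [k l|j]; last exact: Ym.
  by have [] := A_bound Wx a k l.
have Yc x : W x -> forall i, {for x, continuous (Y i)}.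
  move=> Wx i; have [d d0 Hd] := nearW Wx.
  apply: (@bounded_partial_continuous _ x d K0 d0) => k kd a.
  have [h1 h2] := partial a i (Hd k kd); split; first exact: h1.
  by rewrite /pd h2; apply: wK; exact: Hd.
move=> x Wx i; have [d d0 Hd] := nearW Wx.
have nW : \forall y \near x, W y by apply/nbhs_rVP; exists d.
have wE a y : W y -> pd a (Y i) y = w a i y by move=> Wy; have [] := partial a i Wy.
split; last by move=> a; exact: wE.
have [|a|h1 h2] := @differentiable_partial R (Y i) x.
- by apply: filterS nW => y Wy a; have [h1 h2] := partial a i Wy; exact: h1.
- have wc : {for x, continuous (w a i)}.
    apply: continuous_at_sum => j; apply: continuous_atM; last exact: Yc.
    by apply: differentiable_continuous; have [h1 _] := A_deriv Wx a i j; exact: h1.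
  by apply: near_eq_continuous wc; apply: filterS nW => y Wy; rewrite wE.
- exact: h1.
Qed.

End RadialParallel.

End Transport.
(** * Sections of the prolongation bundle *)

(* The fibre of [E]: [idx b] indexes the component K_b and [idx2] the component mu. *)
Section Index3.

Definition dec (T : Type) (f : 'I_2 -> T) (p : T) (i : 'I_3) : T :=
  match fintype.split (i : 'I_(2 + 1)) with inl b => f b | inr _ => p end.

Definition idx (b : 'I_2) : 'I_3 := lshift 1 b.
Definition idx2 : 'I_3 := rshift 2 ord0.

Lemma dec_idx T (f : 'I_2 -> T) p b : dec f p (idx b) = f b.
Proof. by rewrite /dec /idx (unsplitK (inl b) : fintype.split (lshift 1 b) = _). Qed.

Lemma dec_idx2 T (f : 'I_2 -> T) p : dec f p idx2 = p.
Proof. by rewrite /dec /idx2 (unsplitK (inr ord0) : fintype.split (rshift 2 ord0) = _). Qed.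

Lemma sum_ord3 (V : nmodType) (F : 'I_3 -> V) :
  \sum_i F i = F (idx 0) + F (idx 1) + F idx2.
Proof. by rewrite (@big_split_ord _ _ _ 2 1) sum_ord2 big_ord1. Qed.

Lemma ord3_ind (P : 'I_3 -> Prop) : (forall b, P (idx b)) -> P idx2 -> forall i, P i.
Proof.
move=> Pb P2 i; rewrite -(splitK (i : 'I_(2 + 1))).
by case: (fintype.split _) => [b|k]; [exact: Pb|rewrite ord1; exact: P2].
Qed.

End Index3.

(** * Cross products and determinants in the three-dimensional fibre *)

Section CrossProduct.
Context {R : realType}.
Implicit Types (u v w y : 'I_3 -> R).

Definition det3 u v w : R :=
  u (idx 0) * (v (idx 1) * w idx2 - v idx2 * w (idx 1)) -
  u (idx 1) * (v (idx 0) * w idx2 - v idx2 * w (idx 0)) +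
  u idx2 * (v (idx 0) * w (idx 1) - v (idx 1) * w (idx 0)).

Definition cross u v : 'I_3 -> R :=
  dec (fun b => if b == 0 then u (idx 1) * v idx2 - u idx2 * v (idx 1)
                else u idx2 * v (idx 0) - u (idx 0) * v idx2)
      (u (idx 0) * v (idx 1) - u (idx 1) * v (idx 0)).

Definition dot u v : R := \sum_j u j * v j.

Lemma crossE u v : [/\ cross u v (idx 0) = u (idx 1) * v idx2 - u idx2 * v (idx 1),
  cross u v (idx 1) = u idx2 * v (idx 0) - u (idx 0) * v idx2 &
  cross u v idx2 = u (idx 0) * v (idx 1) - u (idx 1) * v (idx 0)].
Proof. by split; rewrite /cross ?dec_idx ?dec_idx2. Qed.

Lemma dotE u v : dot u v = u (idx 0) * v (idx 0) + u (idx 1) * v (idx 1) + u idx2 * v idx2.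
Proof. exact: sum_ord3. Qed.

Lemma eq_ord3 u v : u (idx 0) = v (idx 0) -> u (idx 1) = v (idx 1) -> u idx2 = v idx2 -> u =1 v.
Proof. by move=> h0 h1 h2; elim/ord3_ind => //; elim/ord2_ind. Qed.

Lemma crossC u v j : cross v u j = - cross u v j.
Proof.
have [E0 E1 E2] := crossE u v; have [F0 F1 F2] := crossE v u.
by move: j; apply: ord3_ind => [b|]; [elim/ord2_ind: b|]; rewrite ?E0 ?E1 ?E2 ?F0 ?F1 ?F2; ring.
Qed.

Lemma cross_self u j : cross u u j = 0.
Proof. by have := crossC u u j; lra. Qed.

Lemma dotCross u v : dot u (cross u v) = 0 /\ dot v (cross u v) = 0.
Proof. by rewrite !dotE; have [-> -> ->] := crossE u v; split; ring. Qed.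

Lemma sqr_sum3_neq0 u : (exists j, u j != 0) -> 0 < dot u u.
Proof.
move=> [j uj]; rewrite lt_neqAle sumr_ge0 ?andbT; last by move=> i _; rewrite -expr2 sqr_ge0.
apply: contra uj; rewrite eq_sym psumr_eq0 => [|i _]; last by rewrite -expr2 sqr_ge0.
by move/allP/(_ j); rewrite mem_index_enum mulf_eq0 orbb => /(_ isT).
Qed.

(** Coefficient of [u] in the expansion of [w] over [u] and [v]; that of [v] is [cramer v u w].
    Dividing by the squared norm of the cross product gives one formula, continuous wherever [u] and
    [v] are independent, without the choice of a nonzero minor. *)
Definition cramer u v w : R := dot (cross w v) (cross u v) / dot (cross u v) (cross u v).

(** From the identity [|u x v|^2 w = ((w x v).(u x v)) u + ((w x u).(v x u)) v + det(u, v, w) (u x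
    v)]. *)
Lemma cramerP u v w j : (exists j, cross u v j != 0) -> det3 u v w = 0 ->
  w j = cramer u v w * u j + cramer v u w * v j.
Proof.
move=> /sqr_sum3_neq0 n0 d0.
have E : forall j, w j * dot (cross u v) (cross u v) = dot (cross w v) (cross u v) * u j +
    dot (cross w u) (cross v u) * v j + det3 u v w * cross u v j.
  apply: eq_ord3; rewrite !dotE /det3; have [-> -> ->] := crossE u v;
  have [-> -> ->] := crossE w v; have [-> -> ->] := crossE w u;
  have [-> -> ->] := crossE v u; ring.
have E2 : dot (cross v u) (cross v u) = dot (cross u v) (cross u v).
  by rewrite !dotE; have [-> -> ->] := crossE u v; have [-> -> ->] := crossE v u; ring.
rewrite /cramer E2; apply: (mulIf (lt0r_neq0 n0)); rewrite E d0 mul0r addr0.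
by field; rewrite lt0r_neq0.
Qed.

(** [y_j det(u, v, w)] equals [(u.y) (v x w)_j + (v.y) (w x u)_j + (w.y) (u x v)_j], so one nonzero
    component of [y] suffices. *)
Lemma det3_annihilated u v w y : dot u y = 0 -> dot v y = 0 -> dot w y = 0 ->
  (exists j, y j != 0) -> det3 u v w = 0.
Proof.
rewrite !dotE => hu hv hw [j yj]; apply: (mulIf yj); rewrite mul0r; elim/ord3_ind: j {yj} => [b|].
  elim/ord2_ind: b.
    transitivity ((u (idx 0) * y (idx 0) + u (idx 1) * y (idx 1) + u idx2 * y idx2) *
        cross v w (idx 0) + (v (idx 0) * y (idx 0) + v (idx 1) * y (idx 1) + v idx2 * y idx2) *
        cross w u (idx 0) + (w (idx 0) * y (idx 0) + w (idx 1) * y (idx 1) + w idx2 * y idx2) *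
        cross u v (idx 0)); last by rewrite hu hv hw !mul0r !addr0.
    by have [-> _ _] := crossE v w; have [-> _ _] := crossE w u; have [-> _ _] := crossE u v;
      rewrite /det3; ring.
  transitivity ((u (idx 0) * y (idx 0) + u (idx 1) * y (idx 1) + u idx2 * y idx2) *
        cross v w (idx 1) + (v (idx 0) * y (idx 0) + v (idx 1) * y (idx 1) + v idx2 * y idx2) *
        cross w u (idx 1) + (w (idx 0) * y (idx 0) + w (idx 1) * y (idx 1) + w idx2 * y idx2) *
        cross u v (idx 1)); last by rewrite hu hv hw !mul0r !addr0.
  by have [_ -> _] := crossE v w; have [_ -> _] := crossE w u; have [_ -> _] := crossE u v;
      rewrite /det3; ring.
transitivity ((u (idx 0) * y (idx 0) + u (idx 1) * y (idx 1) + u idx2 * y idx2) *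
        cross v w idx2 + (v (idx 0) * y (idx 0) + v (idx 1) * y (idx 1) + v idx2 * y idx2) *
        cross w u idx2 + (w (idx 0) * y (idx 0) + w (idx 1) * y (idx 1) + w idx2 * y idx2) *
        cross u v idx2); last by rewrite hu hv hw !mul0r !addr0.
by have [_ _ ->] := crossE v w; have [_ _ ->] := crossE w u; have [_ _ ->] := crossE u v;
      rewrite /det3; ring.
Qed.

Definition independent n (y : 'I_n -> 'I_3 -> R) :=
  forall l : 'I_n -> R, (forall j, \sum_k l k * y k j = 0) -> forall k, l k = 0.

(** If both vectors were parallel to [n], they would satisfy [y_1j y_0 - y_0j y_1 = 0]. Independence
    kills the coefficients, and as [n_j] is nonzero both vectors would then vanish. *)
Lemma independent2_neq0 (y : 'I_2 -> 'I_3 -> R) j (n : 'I_3 -> R) : independent y ->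
  n j != 0 -> ~ (forall k m, cross (y k) n m = 0).
Proof.
move=> yi nj H; have par k m : y k j * n m = y k m * n j.
  have H0 := H k (idx 0); have H1 := H k (idx 1); have H2 := H k idx2.
  have [E0 E1 E2] := crossE (y k) n; rewrite E0 in H0; rewrite E1 in H1; rewrite E2 in H2.
  by elim/ord3_ind: j {nj} => [b|]; elim/ord3_ind: m => [b'|]; try elim/ord2_ind: b;
    try elim/ord2_ind: b'; lra.
pose l (k : 'I_2) : R := if k == 0 then y 1 j else - y 0 j.
have l0 : forall k, l k = 0.
  apply: yi => m; apply: (mulIf nj); rewrite mul0r sum_ord2 /l/=.
  by rewrite mulrDl -!mulrA -!par; ring.
have y0 k : y k j = 0.
  by elim/ord2_ind: k; [have := l0 1; rewrite /l/= => /eqP; rewrite oppr_eq0 => /eqP|have := l0 0].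
have : (1 : R) = 0 by apply: (yi (fun=> 1) _ 0) => m; apply: (mulIf nj);
  rewrite mul0r sum_ord2 !mul1r mulrDl -!par !y0; ring.
by move/eqP; rewrite oner_eq0.
Qed.

(** [y_k x (u x v) = (y_k.v) u - (y_k.u) v] vanishes, so a nonzero [u x v] would be parallel to both
    of the independent vectors [y_k]. *)
Lemma dot_annihilated2 u v (y : 'I_2 -> 'I_3 -> R) i : independent y ->
  (forall k, dot u (y k) = 0) -> (forall k, dot v (y k) = 0) -> cross u v i = 0.
Proof.
move=> yi hu hv; apply/eqP/negPn/negP => n0.
apply: (independent2_neq0 yi n0) => k m.
have [E0 E1 E2] := crossE (y k) (cross u v); have [F0 F1 F2] := crossE u v.
have A m' : u m' * dot v (y k) - v m' * dot u (y k) = 0 by rewrite hu hv !mulr0 subrr.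
have := A m; rewrite !dotE => <-.
elim/ord3_ind: m => [b|]; last by rewrite E2 F0 F1; ring.
by elim/ord2_ind: b; rewrite ?E0 ?E1 ?F0 ?F1 ?F2; ring.
Qed.

Lemma independent_full (y : 'I_3 -> 'I_3 -> R) : independent y ->
  forall z : 'I_3 -> R, exists l : 'I_3 -> R, forall j, \sum_k l k * y k j = z j.
Proof.
move=> yi z; pose M : 'M[R]_3 := \matrix_(k, j) y k j.
have Mu : M \in unitmx.
  rewrite -row_free_unit; apply/inj_row_free => l lM.
  apply/rowP => k; rewrite mxE; apply: (yi (fun k => l 0 k)) => j.
  have := congr1 (fun A : 'rV_3 => A 0 j) lM; rewrite !mxE; apply: etrans.
  by apply: eq_bigr => i _; rewrite !mxE.
exists (fun k => (\row_j z j *m invmx M) 0 k) => j.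
have := congr1 (fun A : 'rV_3 => A 0 j) (mulmxKV Mu (\row_j z j)); rewrite [RHS]mxE => <-; rewrite mxE.
by apply: eq_bigr => i _; rewrite [M i j]mxE.
Qed.

Lemma dot_annihilated3 v (y : 'I_3 -> 'I_3 -> R) : independent y ->
  (forall k, dot v (y k) = 0) -> forall j, v j = 0.
Proof.
move=> yi hv j; have [l hl] := independent_full yi (fun i => (i == j)%:R).
have -> : v j = dot v (fun i => (i == j)%:R).
  by rewrite /dot (bigD1 j)//= eqxx mulr1 big1 ?addr0// => i /negPf ->; rewrite mulr0.
rewrite /dot; under eq_bigr do rewrite -hl big_distrr/=.
rewrite exchange_big/= big1// => k _; rewrite (eq_bigr (fun i => l k * (v i * y k i))).
  by rewrite -big_distrr/=; have := hv k; rewrite /dot => ->; rewrite mulr0.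
by move=> i _; ring.
Qed.

Lemma kernel2 v : exists2 y : 'I_2 -> 'I_3 -> R, independent y & forall k, dot v (y k) = 0.
Proof.
pose M : 'cV[R]_3 := \col_j v j; pose N := row_base (kermx M).
have r2 : (2 <= \rank (kermx M))%N.
  by rewrite mxrank_ker; have := rank_leq_col M; case: (\rank M) => [|[|]].
exists (fun k j => N (widen_ord r2 k) j) => [l hl k|k].
  pose L : 'rV[R]__ := \sum_k l k *: delta_mx 0 (widen_ord r2 k).
  have LN : L *m N = 0.
    apply/rowP => j; rewrite mulmx_suml summxE [RHS]mxE -[RHS](hl j); apply: eq_bigr => i _.
    by rewrite -scalemxAl -rowE !mxE.
  have /(congr1 (fun A : 'rV[R]__ => A 0 (widen_ord r2 k))) : L = 0.
    by apply: (row_free_inj (row_base_free (kermx M))); rewrite LN mul0mx.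
  rewrite summxE !mxE (bigD1 k)//= !mxE !eqxx mulr1 big1 ?addr0// => i ik.
  by rewrite !mxE eqxx/= -val_eqE/= eq_sym (negPf ik : (i == k :> nat) = false) mulr0.
have NM : N *m M = 0 by apply/sub_kermxP; rewrite eq_row_base.
have := congr1 (fun A : 'M[R]_(_, 1) => A (widen_ord r2 k) 0) NM; rewrite !mxE; apply: etrans.
by apply: eq_bigr => j _; rewrite [M _ _]mxE mulrC.
Qed.

End CrossProduct.

(** * Pairing sections with covectors *)

Section Pairing.
Context {R : realType}.
Local Notation fn := ('rV[R]_2 -> R).
Local Notation ee a := (delta_mx 0 a : 'rV[R]_2).
Variables (O : set 'rV[R]_2) (A : 'I_2 -> 'I_3 -> 'I_3 -> fn).
Hypothesis oO : open O.
Implicit Types (s Psi : 'I_3 -> fn) (W : set 'rV[R]_2).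

(* The dual of the connection whose parallel sections solve [pd a Psi = A a Psi]. *)
Definition cov a s (j : 'I_3) : fn := fun x => pd a (s j) x + \sum_i s i x * A a i j x.

Lemma cov_eq a s t j x : (forall i y, O y -> s i y = t i y) -> O x ->
  cov a s j x = cov a t j x.
Proof.
move=> st Ox; rewrite /cov (pd_eq a oO (st j) Ox); congr (_ + _).
by apply: eq_bigr => i _; rewrite st.
Qed.

Lemma pd_pairing a s Psi x : O x -> (forall i, Ck 1 O (s i)) ->
  (forall i, differentiable (Psi i) x) ->
  (forall i, pd a (Psi i) x = lin (conn A a x) (fun j => Psi j x) i) ->
  is_derive x (ee a) (fun y => \sum_j s j y * Psi j y) (\sum_j cov a s j x * Psi j x).
Proof.
move=> Ox s1 Pd PE.
have -> : (fun y => \sum_j s j y * Psi j y) = \sum_j (fun y => s j y * Psi j y).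
  by apply/funext => y; rewrite fct_sumE.
have H j : is_derive x (ee a) (fun y => s j y * Psi j y)
   (pd a (s j) x * Psi j x + s j x * pd a (Psi j) x).
  apply: is_derive_mul; first exact: is_derive_pd (s1 j) Ox.
  by apply: derivableP; exact: diff_derivable.
apply: is_derive_val (is_derive_sum H) _.
rewrite big_split/= /cov (eq_bigr _ (fun j _ => mulrDl _ _ _)) big_split/=; congr (_ + _).
rewrite (eq_bigr _ (fun j _ => big_distrl _ _ _)) exchange_big/=; apply: eq_bigr => i _.
by rewrite PE /lin big_distrr/=; apply: eq_bigr => j _; rewrite /conn mulrA.
Qed.

(** Along a ray the Leibniz rule needs only the radial equation for [Psi]. This allows pairings to
    be controlled before [Psi] is known to be parallel. *)
Lemma radial_pairing q W s Psi x (t : R) : W `<=` O -> star q W -> radial A q W Psi ->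
  (forall i, Ck 1 O (s i)) -> W x -> 0 <= t <= 1 ->
  is_derive t 1 (fun t : R => \sum_j s j (ray q x t) * Psi j (ray q x t))
    (let z := ray q x t in
     \sum_j ((x - q) 0 0 * cov 0 s j z + (x - q) 0 1 * cov 1 s j z) * Psi j z).
Proof.
move=> WO st rP s1 Wx t01 /=; set z := ray q x t.
have Oz : O z by apply: WO; exact: st.
have -> : (fun t : R => \sum_j s j (ray q x t) * Psi j (ray q x t)) =
          \sum_j (fun t => s j (ray q x t) * Psi j (ray q x t)).
  by apply/funext => y; rewrite fct_sumE.
have H j : is_derive t 1 (fun t : R => s j (ray q x t) * Psi j (ray q x t))
   (((x - q) 0 0 * pd 0 (s j) z + (x - q) 0 1 * pd 1 (s j) z) * Psi j z +
    s j z * radial_rhs A (x - q) z (fun k => Psi k z) j).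
  apply: is_derive_mul; last exact: rP.
  by apply: is_derive_ray; have [d _] := Ck_diff oO (s1 j) Oz; exact: d.
apply: is_derive_val (is_derive_sum H) _.
rewrite !sum_ord3 /cov !sum_ord3 /radial_rhs /lin !sum_ord3 /conn; ring.
Qed.

Lemma annihilated_cov W s Psi a x : open W -> W `<=` O -> parallel A W Psi ->
  (forall i, Ck 1 O (s i)) -> (forall y, W y -> \sum_j s j y * Psi j y = 0) -> W x ->
  \sum_j cov a s j x * Psi j x = 0.
Proof.
move=> oW WO pP s1 s0 Wx.
have H : is_derive x (ee a) (fun y => \sum_j s j y * Psi j y) (\sum_j cov a s j x * Psi j x).
  by apply: pd_pairing => // [|i|i]; [exact: WO|have [] := pP x Wx i|have [_] := pP x Wx i; apply].
by rewrite -(pd_val H) (pd_eq a oW s0 Wx) /pd derive_cst.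
Qed.

End Pairing.

(** * Local existence of parallel sections *)

Section LocalExistence.
Context {R : realType}.
Local Notation fn := ('rV[R]_2 -> R).
Variables (O : set 'rV[R]_2) (A : 'I_2 -> 'I_3 -> 'I_3 -> fn) (V : 'I_3 -> fn).
Implicit Types (s Psi Y : 'I_3 -> fn) (W : set 'rV[R]_2) (q x : 'rV[R]_2).
Hypotheses (oO : open O) (A3 : forall a i j, Ck 3 O (A a i j)) (V2 : forall j, Ck 2 O (V j)).
Hypothesis flat : forall (y : 'I_3 -> R) x, O x -> \sum_j V j x * y j = 0 -> forall i,
  lin (dconn A 1 0 x) y i + lin (conn A 0 x) (lin (conn A 1 x) y) i =
  lin (dconn A 0 1 x) y i + lin (conn A 1 x) (lin (conn A 0 x) y) i.

Lemma bounded_near (K : finType) (f : K -> fn) q : (forall k, {for q, continuous (f k)}) ->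
  exists2 C : R, 0 <= C & \forall x \near q, forall k, `|f k x| <= C.
Proof.
move=> fc; exists (\sum_k (`|f k q| + 1)); first by apply: sumr_ge0 => k _; rewrite addr_ge0.
apply: (@filter_forall _ K (fun k x => `|f k x| <= \sum_k (`|f k q| + 1)) (nbhs q)) => k.
have /cvgrPdist_lt/(_ 1 ltr01) := fc k; apply: filterS => x; rewrite distrC => h.
apply: le_trans (_ : `|f k q| + 1 <= _).
  by rewrite -(subrK (f k q) (f k x)) (le_trans (ler_normD _ _))// addrC lerD2l ltW.
by rewrite (bigD1 k)//= lerDl sumr_ge0// => j _; rewrite addr_ge0.
Qed.

(* On a ball of this size a radial section at most doubles its initial norm. *)
Definition good q (r : R) := [/\ 0 < r, disc q (2 * r) `<=` O &
  exists2 C : R, 0 <= C & 24 * C * r <= 1 /\ forall x, disc q (2 * r) x ->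
    forall a i j, `|A a i j x| <= C /\
    forall b, `|pd b (A a i j) x| <= C /\ `|pd b (pd b (A a i j)) x| <= C].

(** The number 24 in [good] is 8 times the rank 3, as radial existence requires. It is also
    [4 * 3 * 2], which serves the norm bound about centres other than [q], whose distance to the
    points of the disc can reach [2 * r]. *)
Lemma good_exists q : O q -> exists2 r0 : R, 0 < r0 & forall r, 0 < r -> r <= r0 -> good q r.
Proof.
move=> Oq.
have [C0 C00 H0] : exists2 C : R, 0 <= C & \forall x \near q, forall k : 'I_2 * 'I_3 * 'I_3,
    `|A k.1.1 k.1.2 k.2 x| <= C.
  by apply: bounded_near => -[[a i] j]/=; apply: Ck_cont Oq.
have [C1 C10 H1] : exists2 C : R, 0 <= C & \forall x \near q, forall k : 'I_2 * 'I_2 * 'I_3 * 'I_3,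
    `|pd k.1.1.1 (A k.1.1.2 k.1.2 k.2) x| <= C.
  by apply: bounded_near => -[[[b a] i] j]/=; apply: Ck_cont Oq => //; apply: Ck_pd.
have [C2 C20 H2] : exists2 C : R, 0 <= C & \forall x \near q, forall k : 'I_2 * 'I_2 * 'I_3 * 'I_3,
    `|pd k.1.1.1 (pd k.1.1.1 (A k.1.1.2 k.1.2 k.2)) x| <= C.
  by apply: bounded_near => -[[[b a] i] j]/=; apply: (@Ck_cont _ 1) Oq => //; do 2!apply: Ck_pd.
pose C := C0 + C1 + C2.
have C_ge0 : 0 <= C by rewrite !addr_ge0.
have [d d0 H] : exists2 d : R, 0 < d & forall x, disc q d x -> O x /\
    forall a i j, `|A a i j x| <= C /\
    forall b, `|pd b (A a i j) x| <= C /\ `|pd b (pd b (A a i j)) x| <= C.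
  have Oq' := near_open oO Oq (fun y Oy => Oy : O y).
  have [d d0 H] := (nbhs_rVP q _).1 (filterI Oq' (filterI H0 (filterI H1 H2))).
  exists d => // x xd; have := H (x - q) xd; rewrite subrK => -[Ox [h0 [h1 h2]]].
  split=> // a i j; split; first by have := h0 (a, i, j); rewrite /C/=; lra.
  by move=> b; split; [have := h1 (b, a, i, j)|have := h2 (b, a, i, j)]; rewrite /C/=; lra.
have c1 : 0 < 24 * C + 1 by lra.
exists (Num.min (d / 2) (24 * C + 1)^-1); first by rewrite lt_min invr_gt0 c1 divr_gt0.
move=> r r0; rewrite le_min => /andP[rd rC]; split=> //.
  by move=> x xr; apply: (H x _).1; apply: lt_le_trans xr _; lra.
exists C => //; split.
  apply: (@le_trans _ _ ((24 * C + 1) * (24 * C + 1)^-1)); last by rewrite divff// lt0r_neq0.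
  by apply: ler_pM => //; [rewrite mulr_ge0|exact: ltW|lra].
by move=> x xr; apply: (H x _).2; apply: lt_le_trans xr _; lra.
Qed.

Lemma good_disc q r : good q r -> disc q r `<=` O.
Proof. by move=> [r0 rO _] x xr; apply: rO; apply: lt_le_trans xr _; lra. Qed.

Lemma good_bound q r W q' Y (m : R) : good q r -> W `<=` disc q r -> star q' W -> W q' ->
  radial A q' W Y -> 0 <= m -> (forall i, `|Y i q'| <= m) ->
  forall x, W x -> forall i, `|Y i x| <= 2 * m.
Proof.
move=> [r0 rO [C C0 [Cr H]]] Wr st Wq' rY m0 Ym.
have Wr2 x : W x -> disc q (2 * r) x by move=> /Wr xr; apply: lt_le_trans xr _; lra.
apply: (radial_bound st rY (C := C) (r := 2 * r)) => //.
- by move=> x /Wr2 /H h a i j; have [] := h a i j.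
- move=> x Wx; have -> : x - q' = (x - q) - (q' - q) by rewrite opprB addrA subrK.
  by apply: le_trans (ler_normB _ _) _; have := Wr _ Wx; have := Wr _ Wq'; rewrite /disc/=; lra.
- lra.
Qed.

Lemma good_unique q r W q' Y : good q r -> W `<=` disc q r -> star q' W -> W q' ->
  radial A q' W Y -> (forall i, Y i q' = 0) -> forall x, W x -> forall i, Y i x = 0.
Proof.
move=> g Wr st Wq' rY Y0 x Wx i; apply/eqP; rewrite -normr_le0 -(mulr0 2).
by apply: (good_bound g Wr st Wq' rY) => // j; rewrite Y0 normr0.
Qed.

Lemma good_transport q r m (psi : 'I_m -> 'I_3 -> R) : good q r ->
  exists Y : 'I_m -> 'I_3 -> fn, forall k, (forall i, Y k i q = psi k i) /\ radial A q (disc q r) (Y k).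
Proof.
move=> [r0 rO [C C0 [Cr H]]].
have /choice[Y HY] : forall k, exists Y, (forall i, Y i q = psi k i) /\ radial A q (disc q r) Y.
  move=> k; apply: (radial_exists (C := C)) => //; last lra.
  move=> x xr a i j; split; first by have [] := H x xr a i j.
  by apply: Ck_cont (A3 a i j) _ => //; exact: rO.
by exists Y.
Qed.

Lemma good_parallel q r Y : good q r -> radial A q (disc q r) Y ->
  (forall x, disc q r x -> \sum_j V j x * Y j x = 0) -> parallel A (disc q r) Y.
Proof.
move=> g rY VY; have rO := good_disc g.
have m0 : 0 <= \sum_j `|Y j q| by exact: sumr_ge0.
have Wq : disc q r q by case: g => r0 _ _; rewrite /disc/= subrr normr0.
have Yb : forall x, disc q r x -> forall i, `|Y i x| <= 2 * \sum_j `|Y j q|.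
  apply: (good_bound g _ (@star_disc _ _ _) Wq rY) => // i.
  by rewrite (bigD1 i)//= lerDl sumr_ge0.
case: g => [r0 _ [C C0 [Cr H]]].
apply: (radial_parallel r0 C0 (m := 2 * \sum_j `|Y j q|)) => //.
- by rewrite mulr_ge0.
- move=> x /rO Ox a i j; have A1 : Ck 1 O (A a i j) by apply: Ck_leq (A3 a i j).
  split; first by have [] := Ck_diff oO A1 Ox.
  move=> b; have A2 : Ck 2 O (pd b (A a i j)) by apply: Ck_pd.
  by case: A2 => + _; apply.
- by move=> x xr; apply: H; apply: lt_le_trans xr _; lra.
- lra.
- by move=> x xr; apply: flat; [exact: rO|exact: VY].
Qed.

(** Independence is that of functions on [W]; for general [W] it is weaker than independence at a
    point. *)
Definition has_par n W := exists Psi : 'I_n -> 'I_3 -> fn,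
  (forall k, parallel A W (Psi k)) /\
  forall l : 'I_n -> R, (forall x, W x -> forall i, \sum_k l k * Psi k i x = 0) -> forall k, l k = 0.

(** Independent vectors are transported from the centre, where the independence of the resulting
    sections can be read off. What is left to the caller is that [V] annihilates the transported
    sections on the whole disc. *)
Lemma has_par_kernel q r n (psi : 'I_n -> 'I_3 -> R) : good q r -> independent psi ->
  (forall Y, radial A q (disc q r) Y -> (exists k, forall i, Y i q = psi k i) ->
     forall x, disc q r x -> \sum_j V j x * Y j x = 0) -> has_par n (disc q r).
Proof.
move=> g ip H; have [Y HY] := good_transport psi g.
exists Y; split=> [k|l hl].
  by apply: good_parallel => //; [exact: (HY k).2|apply: H; [exact: (HY k).2|exists k; exact: (HY k).1]].
apply: ip => i; rewrite -[RHS](hl q _ i); last by case: g => r0 _ _; rewrite /disc/= subrr normr0.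
by apply: eq_bigr => k _; rewrite (HY k).1.
Qed.

Lemma has_par3 q r : good q r -> (forall x, disc q r x -> forall j, V j x = 0) ->
  has_par 3 (disc q r).
Proof.
move=> g V0; apply: (@has_par_kernel _ _ _ (fun k i => (k == i)%:R)) => // [l hl k|Y _ _ x xr].
  by rewrite -[RHS](hl k) (bigD1 k)//= eqxx mulr1 big1 ?addr0// => i /negPf ->; rewrite mulr0.
by rewrite big1// => j _; rewrite V0// mul0r.
Qed.

(* The pairings of a radially parallel section with a family of covectors whose
   derivatives lie in its span solve a homogeneous linear system along rays. *)
Lemma closed_annihilated q r m (s : 'I_m -> 'I_3 -> fn) (lam : 'I_2 -> 'I_m -> 'I_m -> fn)
    (L : R) Y : disc q r `<=` O -> (forall i j, Ck 1 O (s i j)) ->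
  (forall x, disc q r x -> forall b i j, cov A b (s i) j x = \sum_k lam b i k x * s k j x) ->
  (forall x, disc q r x -> forall b i k, `|lam b i k x| <= L) -> 4 * m%:R * L * r <= 1 ->
  radial A q (disc q r) Y -> (forall i, \sum_j s i j q * Y j q = 0) ->
  forall x, disc q r x -> forall i, \sum_j s i j x * Y j x = 0.
Proof.
move=> rO s1 sl lL Lr rY s0 x xr i.
pose f i t := \sum_j s i j (ray q x t) * Y j (ray q x t).
have dr t : 0 <= t <= 1 -> disc q r (ray q x t) by exact: star_disc.
have fd k (t : R) : 0 <= t <= 1 ->
    is_derive t 1 (f k) (radial_rhs lam (x - q) (ray q x t) (fun k => f k t) k).
  move=> t01; apply: is_derive_val (radial_pairing oO rO (@star_disc _ _ _) rY (s1 k) xr t01) _.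
  rewrite /= (eq_bigr (fun j => (x - q) 0 0 * (\sum_l lam 0 k l (ray q x t) *
      (s l j (ray q x t) * Y j (ray q x t))) + (x - q) 0 1 * (\sum_l lam 1 k l (ray q x t) *
      (s l j (ray q x t) * Y j (ray q x t))))); last first.
    move=> j _; rewrite !sl; try exact: dr.
    rewrite mulrDl -!mulrA; congr (_ * _ + _ * _); rewrite big_distrl/=;
      by apply: eq_bigr => l _; rewrite mulrA.
  rewrite big_split/= -!big_distrr/= /radial_rhs /lin /conn; congr (_ * _ + _ * _);
    by rewrite exchange_big/=; apply: eq_bigr => l _; rewrite -big_distrr.
have H01 : 0 <= (1 : R) <= 1 by rewrite ler01 lexx.
have := gronwall_half (lexx 0) (lexx 0) fd _ _ i H01; rewrite addr0 mulr0 normr_le0.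
have <- : f i 1 = \sum_j s i j x * Y j x by rewrite /f /ray scale1r subrK.
move=> h; apply/eqP; apply: h => [t M t01 fM k|k]; last first.
  by rewrite /f /ray scale0r add0r s0 normr0.
have M0 : 0 <= M by exact: le_trans (normr_ge0 _) (fM i).
rewrite addr0; apply: le_trans (radial_rhs_le (C := L) (m := M) (r := r) _ _ _ _) _ => //.
- by move=> a j l; apply: lL; exact: dr.
- exact: ltW.
- by have := ler_wpM2r M0 Lr; lra.
Qed.

Let V1 j : Ck 1 O (V j). Proof. exact: CkS. Qed.

Lemma Ck_cov k a s j : (k <= 3)%N -> (forall i, Ck k.+1 O (s i)) -> Ck k O (cov A a s j).
Proof.
move=> k3 sk.
have H : forall r : seq 'I_3, Ck k O (fun x => \sum_(i <- r) s i x * A a i j x).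
  elim=> [|i r IH].
    by apply: Ck_eq (Ck_cst k O 0) => // x _; rewrite big_nil.
  have := Ck_add oO (Ck_mul oO (CkS oO (sk i)) (Ck_leq oO k3 (A3 a i j))) IH.
  by apply: Ck_eq => // x _; rewrite big_cons.
by apply: Ck_add => //; exact: Ck_pd.
Qed.

Lemma near_disc q (P : 'rV[R]_2 -> Prop) : (\forall x \near q, P x) <->
  exists2 d : R, 0 < d & forall x, disc q d x -> P x.
Proof.
rewrite nbhs_rVP; split=> -[d d0 H]; exists d => // x xd.
  by have := H (x - q) xd; rewrite subrK.
by apply: H; rewrite /disc/= addrK.
Qed.

Lemma neq0_near (f : fn) q : {for q, continuous f} -> f q != 0 -> \forall x \near q, f x != 0.
Proof. by move=> fc fq; apply: (cvgr_neq0 _ fc). Qed.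

(** The disc is shrunk until both the transport bound and [4 * m * L * r <= 1] hold, where [L]
    bounds the coefficients [lam]. Since [V] belongs to the family, annihilation by the family at
    [q] spreads to annihilation by [V] on the disc. *)
Lemma closed_has_par q d m n (s : 'I_m -> 'I_3 -> fn) (lam : 'I_2 -> 'I_m -> 'I_m -> fn)
    (psi : 'I_n -> 'I_3 -> R) (i0 : 'I_m) (r0 : R) : O q -> 0 < d -> 0 < r0 ->
  (forall i j, Ck 1 O (s i j)) -> s i0 = V ->
  (forall x, disc q d x -> forall b i j, cov A b (s i) j x = \sum_k lam b i k x * s k j x) ->
  (forall b i k, {for q, continuous (lam b i k)}) ->
  independent psi -> (forall k i, \sum_j s i j q * psi k j = 0) ->
  exists2 r, 0 < r <= r0 & good q r /\ has_par n (disc q r).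
Proof.
move=> Oq d0 r00 s1 s0 sl lc ip sp.
have [L L0 /near_disc[d' d'0 lL]] : exists2 C : R, 0 <= C & \forall x \near q,
    forall k : 'I_2 * 'I_m * 'I_m, `|lam k.1.1 k.1.2 k.2 x| <= C.
  by apply: bounded_near => -[[b i] k]/=; apply: lc.
have [r1 r10 gr] := good_exists Oq.
have c1 : 0 < 4 * m%:R * L + 1 by apply: ltr_wpDl => //; rewrite !mulr_ge0.
pose r := Num.min (Num.min r0 r1) (Num.min (Num.min d d') (4 * m%:R * L + 1)^-1).
have rr : 0 < r by rewrite !lt_min r00 r10 d0 d'0 invr_gt0 c1.
have [rr0 rr1 rd rd' rL] : [/\ r <= r0, r <= r1, r <= d, r <= d' & r <= (4 * m%:R * L + 1)^-1].
  by split; rewrite !ge_min lexx ?orbT.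
have g : good q r by exact: gr.
exists r; first by rewrite rr.
split=> //; apply: (has_par_kernel g ip) => Y rY [k Yk] x xr.
rewrite -s0; move: x xr i0 {s0}.
suff H : forall x, disc q r x -> forall i, \sum_j s i j x * Y j x = 0 by move=> x /H.
apply: (closed_annihilated (L := L) (lam := lam) (good_disc g) s1 _ _ _ rY).
- by move=> y yr; apply: sl; exact: lt_le_trans yr _.
- by move=> y yr b i j; apply: (lL y _ (b, i, j)); exact: lt_le_trans yr _.
- apply: (@le_trans _ _ ((4 * m%:R * L + 1) * (4 * m%:R * L + 1)^-1)); last by rewrite divff// lt0r_neq0.
  by apply: ler_pM => //; [rewrite !mulr_ge0|exact: ltW|rewrite lerDl].
- by move=> i; rewrite -[RHS](sp k i); apply: eq_bigr => j _; rewrite Yk.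
Qed.

(** Here [V] alone is a closed family: [D_a V] is proportional to [V], with the quotient of the [mu]
    components as factor. This factor is continuous at [q] because that component of [V] is nonzero
    there. *)
Lemma has_par2_near q (d r0 : R) : O q -> 0 < d -> 0 < r0 -> V idx2 q != 0 ->
  (forall x, disc q d x -> forall a j, cov A a V idx2 x * V j x = cov A a V j x * V idx2 x) ->
  exists2 r, 0 < r <= r0 & good q r /\ has_par 2 (disc q r).
Proof.
move=> Oq d0 r00 V0 H.
have Vc j : {for q, continuous (V j)} by apply: Ck_cont (V1 j) Oq.
have [d' d'0 Vn] := (near_disc q _).1 (neq0_near (Vc idx2) V0).
have [psi ip Vpsi] := kernel2 (fun j => V j q).
apply: (@closed_has_par q (Num.min d d') 1 2 (fun=> V)
  (fun a _ _ x => cov A a V idx2 x / V idx2 x) psi ord0) => //.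
- by rewrite lt_min d0.
- move=> x xr b _ j; rewrite big_ord1.
  have xd : disc q d x by apply: lt_le_trans xr _; rewrite ge_min lexx.
  have xd' : disc q d' x by apply: lt_le_trans xr _; rewrite ge_min lexx orbT.
  by rewrite mulrAC H// mulfK//; exact: Vn.
- move=> b _ _; apply: continuous_atM; last by apply: continuous_atV.
  have c1 : Ck 1 O (cov A b V idx2) by apply: Ck_cov.
  exact: Ck_cont c1 Oq.
- by move=> k _; exact: Vpsi.
Qed.

Lemma continuous_dot (u v : 'I_3 -> fn) q : (forall j, {for q, continuous (u j)}) ->
  (forall j, {for q, continuous (v j)}) ->
  {for q, continuous (fun x => dot (fun j => u j x) (fun j => v j x))}.
Proof. by move=> uc vc; apply: continuous_at_sum => j; apply: continuous_atM. Qed.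

Lemma continuous_cross (u v : 'I_3 -> fn) j q : (forall j, {for q, continuous (u j)}) ->
  (forall j, {for q, continuous (v j)}) ->
  {for q, continuous (fun x => cross (fun j => u j x) (fun j => v j x) j)}.
Proof.
move=> uc vc.
have H i i' k k' : {for q, continuous (fun x => u i x * v i' x - u k x * v k' x)}.
  by apply: continuous_atD; [|apply: continuous_atN]; apply: continuous_atM.
elim/ord3_ind: j => [b|]; rewrite /cross.
  have -> : (fun x => dec (fun b => if b == 0 then u (idx 1) x * v idx2 x - u idx2 x * v (idx 1) x
                else u idx2 x * v (idx 0) x - u (idx 0) x * v idx2 x)
      (u (idx 0) x * v (idx 1) x - u (idx 1) x * v (idx 0) x) (idx b)) =
    if b == 0 then (fun x => u (idx 1) x * v idx2 x - u idx2 x * v (idx 1) x)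
                else (fun x => u idx2 x * v (idx 0) x - u (idx 0) x * v idx2 x).
    by apply/funext => x; rewrite dec_idx; case: ifP.
  by case: ifP => _; exact: H.
rewrite (_ : (fun x => _) = (fun x => u (idx 0) x * v (idx 1) x - u (idx 1) x * v (idx 0) x)).
  exact: H.
by apply/funext => x; rewrite dec_idx2.
Qed.

Lemma continuous_cramer (u v w : 'I_3 -> fn) q : (forall j, {for q, continuous (u j)}) ->
  (forall j, {for q, continuous (v j)}) -> (forall j, {for q, continuous (w j)}) ->
  (exists j, cross (fun j => u j q) (fun j => v j q) j != 0) ->
  {for q, continuous (fun x => cramer (fun j => u j x) (fun j => v j x) (fun j => w j x))}.
Proof.
move=> uc vc wc n0; rewrite /cramer.
have cc (a b : 'I_3 -> fn) : (forall j, {for q, continuous (a j)}) ->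
    (forall j, {for q, continuous (b j)}) ->
    {for q, continuous (fun x => dot (cross (fun j => a j x) (fun j => b j x))
                                     (cross (fun j => u j x) (fun j => v j x)))}.
  move=> ac bc; apply: (@continuous_dot (fun j x => cross (fun j => a j x) (fun j => b j x) j)
    (fun j x => cross (fun j => u j x) (fun j => v j x) j)) => j; exact: continuous_cross.
apply: continuous_atM; first exact: cc.
apply: continuous_atV; last exact: cc.
by rewrite lt0r_neq0// sqr_sum3_neq0.
Qed.

(** The family [V], [D_a V] is closed: the two determinants put [D_b V] and [D_b D_a V] in its span,
    with the coefficients [cramer], continuous at [q]. The cross product of the two covectors at [q]
    spans their common kernel and is the initial value. *)
Lemma has_par1_near q (d r0 : R) a : O q -> 0 < d -> 0 < r0 ->
  (exists j, cross (fun j => V j q) (fun j => cov A a V j q) j != 0) ->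
  (forall x, disc q d x -> forall b,
    det3 (fun j => V j x) (fun j => cov A a V j x) (fun j => cov A b V j x) = 0 /\
    det3 (fun j => V j x) (fun j => cov A a V j x) (fun j => cov A b (cov A a V) j x) = 0) ->
  exists2 r, 0 < r <= r0 & good q r /\ has_par 1 (disc q r).
Proof.
move=> Oq d0 r00 [j0 n0] H.
have W1 j : Ck 1 O (cov A a V j) by apply: Ck_cov.
have Vc j : {for q, continuous (V j)} by apply: Ck_cont (V1 j) Oq.
have Wc j : {for q, continuous (cov A a V j)} by apply: Ck_cont (W1 j) Oq.
have [d' d'0 Vn] := (near_disc q _).1 (neq0_near (continuous_cross (j := j0) Vc Wc) n0).
pose s (k : 'I_2) := if k == 0 then V else cov A a V.
have sc (k : 'I_2) b j : {for q, continuous (cov A b (s k) j)}.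
  have c0 : Ck 0 O (cov A b (s k) j).
    by apply: Ck_cov => // i; rewrite /s; case: ifP => _; [exact: V1|exact: W1].
  exact: Ck_cont c0 Oq.
pose lam (b i k : 'I_2) x := if k == 0
  then cramer (fun j => V j x) (fun j => cov A a V j x) (fun j => cov A b (s i) j x)
  else cramer (fun j => cov A a V j x) (fun j => V j x) (fun j => cov A b (s i) j x).
apply: (@closed_has_par q (Num.min d d') 2 1 s lam
  (fun=> cross (fun j => V j q) (fun j => cov A a V j q)) 0) => //.
- by rewrite lt_min d0.
- by move=> i j; rewrite /s; case: ifP => _; [exact: V1|exact: W1].
- move=> x xr b i j; rewrite sum_ord2 /lam/=.
  have xd : disc q d x by apply: lt_le_trans xr _; rewrite ge_min lexx.
  have xd' : disc q d' x by apply: lt_le_trans xr _; rewrite ge_min lexx orbT.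
  apply: (@cramerP _ _ _ (fun j => cov A b (s i) j x)); first by exists j0; exact: Vn.
  by elim/ord2_ind: i; rewrite /s /=; [exact: (H x xd b).1|exact: (H x xd b).2].
- move=> b i; elim/ord2_ind; rewrite /lam /=.
    exact: (@continuous_cramer V (cov A a V) (cov A b (s i)) q Vc Wc (sc i b) (ex_intro _ j0 n0)).
  apply: (@continuous_cramer (cov A a V) V (cov A b (s i)) q Wc Vc (sc i b)).
  by exists j0; rewrite crossC oppr_eq0.
- move=> l hl k; rewrite (ord1 k); have := hl j0; rewrite big_ord1 => /eqP.
  by rewrite mulf_eq0 (negPf n0) orbF => /eqP; rewrite (_ : 0 = ord0).
- move=> _ i; have [h0 h1] := dotCross (fun j => V j q) (fun j => cov A a V j q).
  by elim/ord2_ind: i; rewrite /s/=; [exact: h0|exact: h1].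
Qed.

Hypothesis annV : forall W Psi x, open W -> W `<=` O -> parallel A W Psi -> W x ->
  \sum_j V j x * Psi j x = 0.

Lemma parallel_lin W n (Psi : 'I_n -> 'I_3 -> fn) (c : 'I_n -> R) :
  (forall k, parallel A W (Psi k)) -> parallel A W (fun i x => \sum_k c k * Psi k i x).
Proof.
move=> pP x Wx i.
have D k : is_diff x (Psi k i) ('d (Psi k i) x) by apply: DiffDef => //; have [] := pP k x Wx i.
have E : (fun y => \sum_k c k * Psi k i y) = \sum_k c k *: Psi k i.
  by apply/funext => y; rewrite fct_sumE.
have dE : differentiable (fun y => \sum_k c k * Psi k i y) x.
  by rewrite E; apply: differentiable_sum => k; apply: differentiableZ; have [] := pP k x Wx i.
split=> // a; apply: pd_val; rewrite E lin_sum.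
have H k : is_derive x (delta_mx 0 a) (c k *: Psi k i) (c k *: lin (conn A a x) (fun j => Psi k j x) i).
  have [dk /(_ a) <-] := pP k x Wx i; apply: is_deriveZ.
  by apply: derivableP; exact: diff_derivable.
exact: is_derive_sum H.
Qed.

(** Affine function with gradient [l] vanishing at [q]. For [t > 0] the half-plane [half q l t]
    misses a small disc about [q]. *)
Definition ell q (l x : 'rV[R]_2) : R := l 0 0 * (x - q) 0 0 + l 0 1 * (x - q) 0 1.

Definition half q (l : 'rV[R]_2) (t : R) : set 'rV[R]_2 := [set x | t < ell q l x].

Lemma ell_ray q l x y (v : R) : ell q l (ray x y v) = (1 - v) * ell q l x + v * ell q l y.
Proof. by rewrite /ell !mxE; ring. Qed.

Lemma ell_center q l : ell q l q = 0.
Proof. by rewrite /ell subrr !mxE !mulr0 addr0. Qed.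

Lemma open_disc q (r : R) : open (disc q r).
Proof.
rewrite openE => z zr; apply/near_disc; exists (r - `|z - q|); first by rewrite subr_gt0.
move=> w wz; rewrite /disc/= -(subrK z w) -addrA (le_lt_trans (ler_normD _ _))//.
by rewrite -ltrBrDr.
Qed.

Lemma open_half q l (t : R) : open (half q l t).
Proof.
rewrite openE => z zt; apply/near_disc.
pose c := `|l 0 0| + `|l 0 1| + 1.
have c0 : 0 < c by rewrite ltr_wpDl// addr_ge0.
exists ((ell q l z - t) / c); first by rewrite divr_gt0// subr_gt0.
move=> w; rewrite /disc/= ltr_pdivlMr// => wz.
have h : `|ell q l w - ell q l z| <= `|w - z| * c.
  have -> : ell q l w - ell q l z = l 0 0 * (w - z) 0 0 + l 0 1 * (w - z) 0 1.
    by rewrite /ell !mxE; ring.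
  apply: le_trans (ler_normD _ _) _; rewrite !normrM.
  have h0 := ler_wpM2l (normr_ge0 (l 0 0)) (coord_le (w - z) 0).
  have h1 := ler_wpM2l (normr_ge0 (l 0 1)) (coord_le (w - z) 1).
  by rewrite /c; have := normr_ge0 (w - z); lra.
by rewrite /half/=; have := le_lt_trans h wz; rewrite ltr_norml => /andP[+ _]; lra.
Qed.

Lemma convex_disc q (r : R) x y (v : R) : 0 <= v <= 1 -> disc q r x -> disc q r y -> disc q r (ray x y v).
Proof.
move=> /andP[v0 v1] xr yr; rewrite /disc/=.
have -> : ray x y v - q = (1 - v) *: (x - q) + v *: (y - q).
  by apply/rowP => i; rewrite !mxE; ring.
have v1' : 0 <= 1 - v by lra.
apply: le_lt_trans (ler_normD _ _) _; rewrite !normrZ !ger0_norm//.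
have h0 : (1 - v) * `|x - q| <= (1 - v) * Num.max `|x - q| `|y - q|.
  by rewrite ler_wpM2l// le_max lexx.
have h1 : v * `|y - q| <= v * Num.max `|x - q| `|y - q|.
  by rewrite ler_wpM2l// le_max lexx orbT.
have hm : Num.max `|x - q| `|y - q| < r by rewrite gt_max; apply/andP.
by apply: le_lt_trans hm; apply: le_trans (lerD h0 h1) _; lra.
Qed.

Lemma convex_half q l (t : R) x y (v : R) : 0 <= v <= 1 -> half q l t x -> half q l t y ->
  half q l t (ray x y v).
Proof.
move=> /andP[v0 v1]; rewrite /half/= ell_ray => xt yt.
have [->|v0'] := eqVneq v 0; first by rewrite subr0 mul1r mul0r addr0.
have v0'' : 0 < v by rewrite lt_neqAle eq_sym v0'.
have := ler_wpM2l (_ : 0 <= 1 - v) (ltW xt); rewrite subr_ge0 => /(_ v1).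
have : v * t < v * ell q l y by rewrite ltr_pM2l.
lra.
Qed.

Lemma parallel_increment W Psi x y (C m : R) : (forall v, 0 <= v <= 1 -> W (ray x y v)) ->
  parallel A W Psi -> (forall z, W z -> forall a i j, `|A a i j z| <= C) ->
  (forall z, W z -> forall j, `|Psi j z| <= m) ->
  forall i, `|Psi i y - Psi i x| <= 2 * `|y - x| * (3%:R * (C * m)).
Proof.
move=> Wxy pP AC Pm i; rewrite -[leRHS]mulr1 -[X in _ * X]subr0 -{1}(ray1 x y) -{2}(ray0 x y).
apply: (MVT_le (f := fun v => Psi i (ray x y v))
  (df := fun v => radial_rhs A (y - x) (ray x y v) (fun j => Psi j (ray x y v)) i) ler01) => v /Wxy Wv.
  have /(_ i)[dP PE] := pP _ Wv; rewrite /radial_rhs -!PE; exact: is_derive_ray.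
by apply: radial_rhs_le => //; [exact: AC|move=> j; exact: Pm].
Qed.

(** Gronwall on the piece of a ray between the parameters [al] and [al + de], in either direction,
    by the substitution [v -> al + v * de]. *)
Lemma ray_gronwall q r x (D : 'I_3 -> R -> R) (al de m : R) : good q r -> disc q r x ->
  `|de| <= 1 -> 0 <= m -> (forall v, 0 <= v <= 1 -> 0 <= al + v * de <= 1) ->
  (forall i (v : R), 0 <= v <= 1 -> is_derive (al + v * de) 1 (D i)
     (radial_rhs A (x - q) (ray q x (al + v * de)) (fun j => D j (al + v * de)) i)) ->
  (forall i, `|D i al| <= m) -> forall i, `|D i (al + de)| <= 2 * m.
Proof.
move=> g xr de1 m0 ad Dd Dm i.
have [r0 _ [C C0 [Cr H]]] := g.
pose E i v := D i (al + v * de).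
have Ed k (v : R) : 0 <= v <= 1 -> is_derive v 1 (E k)
    (radial_rhs A (x - q) (ray q x (al + v * de)) (fun j => E j v) k * de).
  move=> v01.
  have h : is_derive v 1 (fun v : R => al + v * de) de.
    apply: is_derive_val (is_derive_add (is_derive_const v 1 al)
      (is_derive_mul (is_derive_rid v) (is_derive_const v 1 de))) _.
    by rewrite mulr0 addr0 mul1r add0r.
  exact: (@is_derive1_comp _ _ (fun v : R => al + v * de) v _ _ (Dd k v v01) h).
have H01 : 0 <= (1 : R) <= 1 by rewrite ler01 lexx.
have := gronwall_half m0 (lexx 0) Ed _ _ i H01; rewrite addr0 /E mul1r; apply.
  move=> v M v01 EM k; have M0 : 0 <= M by exact: le_trans (normr_ge0 _) (EM i).
  rewrite addr0 normrM; apply: (@le_trans _ _ (2 * r * (3%:R * (C * M)) * 1)).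
    apply: ler_pM => //; apply: radial_rhs_le => //; last exact: ltW.
    have xv : disc q r (ray q x (al + v * de)) by apply: star_disc => //; exact: ad.
    by move=> a j l; have [] := H _ (lt_le_trans xv (_ : r <= 2 * r)) a j l; lra.
  by have := ler_wpM2r M0 Cr; lra.
by move=> k; rewrite mul0r addr0.
Qed.

(** * From half-discs to the disc *)

Section HalfPlanes.
Variables (q : 'rV[R]_2) (r : R).
Hypothesis g : good q r.
Let W0 := disc q r.

Let W0q : W0 q. Proof. by case: g => r0 _ _; rewrite /W0 /disc/= subrr normr0. Qed.
Let W0O : W0 `<=` O. Proof. exact: good_disc. Qed.

Section Pair.
Variables (x y : 'rV[R]_2) (Y : 'I_3 -> fn).
Hypotheses (W0x : W0 x) (W0y : W0 y) (rY : radial A q W0 Y).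
Hypothesis halves : forall l t, 0 < t -> (exists z, (W0 `&` half q l t) z) ->
  has_par 2 (W0 `&` half q l t).
Hypotheses (Vx : exists j, V j x != 0) (VYx : \sum_j V j x * Y j x = 0).

Variable l : 'rV[R]_2.
Hypotheses (lx : ell q l x = 1) (ly : ell q l y = 1).
Let m : R := 2 * \sum_j `|Y j q|.

Let m0 : 0 <= m. Proof. by rewrite mulr_ge0// sumr_ge0. Qed.

Let Ym z : W0 z -> forall i, `|Y i z| <= m.
Proof.
apply: (good_bound g _ (@star_disc _ _ _) W0q rY) => //; first by rewrite sumr_ge0.
by move=> i; rewrite (bigD1 i)//= lerDl sumr_ge0.
Qed.

Section Scale.
Variable s : R.
Hypothesis s01 : 0 < s < 1.
(** Since [ell] is 1 at [x] and at [y], it equals [u] at parameter [u] of either ray. The level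
    [s / 2] lies below [s], so the half-disc contains both rays from the parameter [s] on, although
    not [q]. *)
Let W := W0 `&` half q l (s / 2).
Let a : 'rV[R]_2 := ray q x s.
Let b : 'rV[R]_2 := ray q y s.

Let oW : open W. Proof. by apply: openI; [exact: open_disc|exact: open_half]. Qed.

Let conv z w (v : R) : 0 <= v <= 1 -> W z -> W w -> W (ray z w v).
Proof. by move=> v01 [z0 z1] [w0 w1]; split; [exact: convex_disc|exact: convex_half]. Qed.

Let onray u z : W0 z -> ell q l z = 1 -> s <= u <= 1 -> W (ray q z u).
Proof.
move=> zr lz /andP[su u1]; have [s0 s1] := andP s01.
split; first by apply: star_disc => //; apply/andP; split=> //; lra.
by rewrite /half/= ell_ray lz ell_center; lra.
Qed.

Let xW : W x.
Proof. by have := onray W0x lx (u := 1); rewrite /ray scale1r subrK lexx andbT; apply; have [_ /ltW] := andP s01. Qed.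

(** [V] is nonzero at [x], so its kernel there is a plane. The two sections on the half-disc are
    independent at [x] and span this plane, which contains the value of [Y]. *)
Let Psi_ex : exists Psi, parallel A W Psi /\ forall j, Psi j x = Y j x.
Proof.
have s20 : 0 < s / 2 by have [s0 _] := andP s01; lra.
have [Psi [pP iP]] := halves s20 (ex_intro _ x xW).
have WO : W `<=` O by move=> z [/W0O].
have ix : independent (fun k j => Psi k j x).
  move=> c hc; apply: iP => z Wz i.
  have st : star x W by move=> z' Wz' v v01; exact: conv.
  apply: (@good_unique q r W x (fun i z => \sum_k c k * Psi k i z)) => //; first by move=> z' [].
  by apply: parallel_radial => //; exact: parallel_lin.
have [j Vj] := Vx.
have dP k : dot (fun j => Psi k j x) (fun j => V j x) = 0.
  by rewrite /dot -[RHS](annV oW WO (pP k) xW); apply: eq_bigr => i _; rewrite mulrC.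
have dY : dot (fun j => Y j x) (fun j => V j x) = 0.
  by rewrite /dot -[RHS]VYx; apply: eq_bigr => i _; rewrite mulrC.
have n0 : exists j, cross (fun j => Psi 0 j x) (fun j => Psi 1 j x) j != 0.
  apply: contrapT => /forallNP h.
  have h' i : cross (fun j => Psi 0 j x) (fun j => Psi 1 j x) i = 0.
    by apply/eqP/negPn/negP; exact: h.
  have [j1 P0] : exists j, Psi 0 j x != 0.
    apply: contrapT => /forallNP h0.
    have : (1 : R) = 0.
      apply: (ix (fun k => (k == 0)%:R) _ 0) => i; rewrite sum_ord2 /= mul1r mul0r addr0.
      by apply/eqP/negPn/negP; exact: h0.
    by move/eqP; rewrite oner_eq0.
  apply: (independent2_neq0 (n := fun j => Psi 0 j x) ix P0) => k i; elim/ord2_ind: k.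
    exact: cross_self.
  by rewrite crossC h' oppr0.
have d0 : det3 (fun j => Psi 0 j x) (fun j => Psi 1 j x) (fun j => Y j x) = 0.
  by apply: det3_annihilated (dP 0) (dP 1) dY _; exists j.
pose c (k : 'I_2) := if k == 0 then cramer (fun j => Psi 0 j x) (fun j => Psi 1 j x) (fun j => Y j x)
                     else cramer (fun j => Psi 1 j x) (fun j => Psi 0 j x) (fun j => Y j x).
exists (fun i z => \sum_k c k * Psi k i z); split; first exact: parallel_lin.
by move=> i; rewrite sum_ord2 /c/= -(cramerP i n0 d0).
Qed.

(* The parallel section [Psi] agrees with [Y] at [x]; following both along
   [x -> a -> b -> y], where [a] and [b] are at distance [O(s)] of [q], they
   differ at [y] by [O(s)], and [V] annihilates [Psi]. *)
Lemma scale_bound : `|\sum_j V j y * Y j y| <= (\sum_j `|V j y|) * (4 * m) * s.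
Proof.
have [s0 s1] := andP s01.
have [Psi [pP Px]] := Psi_ex.
have [r0 _ [C C0 [Cr HC]]] := g.
have AC z : W0 z -> forall a i j, `|A a i j z| <= C.
  by move=> zr a' i j; have [] := HC z (lt_le_trans zr (_ : r <= 2 * r)) a' i j; lra.
have Wa : W a by apply: onray => //; rewrite lexx ltW.
have Wb : W b by apply: onray => //; rewrite lexx ltW.
have Wy : W y by have := onray W0y ly (u := 1); rewrite /ray scale1r subrK lexx andbT ltW//; apply.
have WO : W `<=` O by move=> z [/W0O].
have stW z : W z -> star z W by move=> Wz z' Wz' v v01; exact: conv.
have Pm z : W z -> forall i, `|Psi i z| <= 2 * m.
  apply: (good_bound g _ (stW x xW) xW) => //; first by move=> z' [].
    by apply: parallel_radial => //; exact: stW.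
  by move=> i; rewrite Px Ym.
have DP z (u : R) i : W (ray q z u) ->
    is_derive u 1 (fun u => Psi i (ray q z u)) (radial_rhs A (z - q) (ray q z u) (fun j => Psi j (ray q z u)) i).
  move=> /pP /(_ i)[dP PE]; rewrite /radial_rhs -!PE; exact: is_derive_ray.
pose D z i u := Psi i (ray q z u) - Y i (ray q z u).
have Dd z i (u : R) : W0 z -> ell q l z = 1 -> s <= u <= 1 -> is_derive u 1 (D z i)
    (radial_rhs A (z - q) (ray q z u) (fun j => D z j u) i).
  move=> zr lz su; have u01 : 0 <= u <= 1 by lra.
  apply: is_derive_val (is_derive_sub (DP z u i (onray zr lz su)) (rY zr i u01)) _.
  by rewrite /radial_rhs /D !linBr; ring.
have Da i : Psi i a = Y i a.
  have H (v : R) : 0 <= v <= 1 -> s <= 1 + v * (s - 1) <= 1.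
    move=> /andP[v0 v1]; have := mulr_ge0 v0 (ltW (_ : 0 < 1 - s)); rewrite subr_gt0 => /(_ s1) h.
    have := ler_wpM2r (ltW (_ : 0 < 1 - s)) v1; rewrite subr_gt0 => /(_ s1) h'; lra.
  have := @ray_gronwall q r x (D x) 1 (s - 1) 0 g W0x _ (lexx 0) _ _ _ i.
  rewrite (_ : 1 + (s - 1) = s); last by ring.
  rewrite mulr0 normr_le0 /D -/a subr_eq0 => h; apply/eqP; apply: h.
  - by rewrite ler_norml; lra.
  - by move=> v /H; lra.
  - by move=> k v /H ?; exact: Dd.
  - by move=> k; rewrite /D /ray scale1r subrK Px subrr normr0.
have ba : `|b - a| <= s * (2 * r).
  have -> : b - a = s *: ((y - q) - (x - q)) by rewrite /a /b; apply/rowP => i; rewrite !mxE; ring.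
  rewrite normrZ ger0_norm ?(ltW s0)// ler_wpM2l ?(ltW s0)//.
  by apply: le_trans (ler_normB _ _) _; move: W0x W0y; rewrite /W0 /disc/=; lra.
have ms0 : 0 <= m * s by rewrite mulr_ge0// ltW.
have Pab i : `|Psi i b - Psi i a| <= m * s.
  apply: le_trans (parallel_increment (C := C) (m := 2 * m) _ pP _ _ i) _.
  - by move=> v v01; exact: conv.
  - by move=> z [/AC].
  - exact: Pm.
  - have Cm0 : 0 <= 3%:R * (C * (2 * m)) by do 3!apply: mulr_ge0 => //.
    by have := ler_wpM2r ms0 Cr; have := ler_wpM2r Cm0 ba; lra.
have Yq z i : W0 z -> `|Y i (ray q z s) - Y i q| <= m / 4 * s.
  move=> zr; suff : `|Y i (ray q z s) - Y i (ray q z 0)| <= m / 4 * (s - 0) by rewrite ray0 subr0.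
  apply: (MVT_le (f := fun v => Y i (ray q z v))
    (df := fun v => radial_rhs A (z - q) (ray q z v) (fun j => Y j (ray q z v)) i) (ltW s0)).
    by move=> v /andP[v0 v1]; apply: rY => //; rewrite v0; lra.
  move=> v /andP[v0 v1]; have zv : W0 (ray q z v) by apply: star_disc => //; rewrite v0; lra.
  apply: le_trans (radial_rhs_le (C := C) (m := m) (r := r) _ _ _ _) _ => //.
  - exact: AC.
  - by move=> j; exact: Ym.
  - exact: ltW.
  - by have := ler_wpM2r m0 Cr; lra.
(* [Y] is parallel only along rays, so its values at [a] and [b] are compared through [q]. Each leg
   costs [m / 4 * s], and [Psi] moves by at most [m * s] between [a] and [b]. *)
have Db i : `|D y i s| <= 2 * m * s.
  have -> : D y i s = (Psi i b - Psi i a) + ((Y i a - Y i q) - (Y i b - Y i q)).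
    by rewrite Da /D -/b; ring.
  apply: le_trans (ler_normD _ _) _; have := ler_normB (Y i a - Y i q) (Y i b - Y i q).
  by have := Pab i; have := Yq x i W0x; have := Yq y i W0y; rewrite -/a -/b; lra.
have D1 i : `|D y i 1| <= 4 * m * s.
  have H (v : R) : 0 <= v <= 1 -> s <= s + v * (1 - s) <= 1.
    move=> /andP[v0 v1]; have := mulr_ge0 v0 (ltW (_ : 0 < 1 - s)); rewrite subr_gt0 => /(_ s1) h.
    have := ler_wpM2r (ltW (_ : 0 < 1 - s)) v1; rewrite subr_gt0 => /(_ s1) h'; lra.
  have -> : 4 * m * s = 2 * (2 * m * s) by ring.
  have E1 : s + (1 - s) = 1 by ring.
  rewrite -[X in D y i X]E1.
  apply: (@ray_gronwall q r y (D y) s (1 - s) (2 * m * s) g W0y) => //.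
  - by rewrite ler_norml; lra.
  - by rewrite -mulrA mulr_ge0.
  - by move=> v /H; lra.
  - by move=> k v /H ?; exact: Dd.
have -> : \sum_j V j y * Y j y = - \sum_j V j y * D y j 1.
  by have := annV oW WO pP Wy; rewrite !sum_ord3 /D !ray1; lra.
rewrite normrN; apply: le_trans (ler_norm_sum _ _ _) _; rewrite -mulrA big_distrl/=.
by apply: ler_sum => j _; rewrite normrM ler_wpM2l.
Qed.

End Scale.

(** Let [s] tend to 0 in [scale_bound], whose left-hand side does not involve [s]. *)
Lemma pair_annihilated : \sum_j V j y * Y j y = 0.
Proof.
apply/eqP/negPn/negP => f0.
set f := \sum_j _ in f0; have f0' : 0 < `|f| by rewrite normr_gt0.
pose B := (\sum_j `|V j y|) * (4 * m).
have B0 : 0 <= B by rewrite !mulr_ge0// sumr_ge0.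
have c0 : 0 < B + 1 by lra.
pose s := Num.min (1 / 2) (`|f| / (B + 1)).
have s01 : 0 < s < 1.
  rewrite lt_min divr_gt0 ?ltr01//= divr_gt0//= gt_min; apply/orP; left; lra.
have := scale_bound s01; rewrite -/f -/B; apply/negP; rewrite -ltNge.
have h1 : B * s <= B * (`|f| / (B + 1)) by rewrite ler_wpM2l// ge_min lexx orbT.
apply: le_lt_trans h1 _; rewrite mulrA ltr_pdivrMr// mulrC ltr_pM2l//; lra.
Qed.

End Pair.

Let ell_exists x y : (x - q) 0 0 * (y - q) 0 1 - (x - q) 0 1 * (y - q) 0 0 != 0 ->
  exists l, ell q l x = 1 /\ ell q l y = 1.
Proof.
set X := x - q; set Y := y - q => nc; pose d := X 0 0 * Y 0 1 - X 0 1 * Y 0 0.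
pose L : 'rV[R]_2 := \row_a (if a == 0 then (Y 0 1 - X 0 1) / d else (X 0 0 - Y 0 0) / d).
have L0 : L 0 0 = (Y 0 1 - X 0 1) / d by rewrite mxE.
have L1 : L 0 1 = (X 0 0 - Y 0 0) / d by rewrite mxE.
by exists L; rewrite /ell -/X -/Y L0 L1 /d; split; field.
Qed.

(* Take the radial sections annihilated by [V] at one point [q0 <> q]. Each half
   disc containing [q0] and a second point [y] carries parallel sections, so that
   [V] annihilates them at [y]; the points of the line [q q0] are reached in two
   steps. *)
Lemma has_par2_halves :
  (forall l t, 0 < t -> (exists z, (W0 `&` half q l t) z) -> has_par 2 (W0 `&` half q l t)) ->
  has_par 2 W0.
Proof.
move=> halves; have r0 : 0 < r by case: g.
have Vc x j : W0 x -> {for x, continuous (V j)} by move=> /W0O; exact: Ck_cont (V1 j).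
have [[z [W0z [j0 Vz]]]|/forallNP V0] := pselect (exists z, W0 z /\ exists j, V j z != 0); last first.
  (* If [V] vanishes on the whole disc there are three parallel sections, of which two are kept. *)
  have : has_par 3 W0.
    apply: has_par3 => // x xr j; apply/eqP/negPn/negP => Vx.
    by apply: (V0 x); split=> //; exists j.
  move=> [Psi [pP iP]]; exists (fun k => Psi (idx k)); split=> [k|l hl]; first exact: pP.
  have H := iP (dec l 0) _; move=> k; rewrite -(dec_idx l 0 k); apply: H => x W0x i.
  by rewrite sum_ord3 !dec_idx dec_idx2 mul0r addr0 -[RHS](hl x W0x i) sum_ord2.
have near_pt x j : W0 x -> V j x != 0 -> exists2 d : R, 0 < d & forall y, disc x d y -> W0 y /\ V j y != 0.
  move=> W0x Vx; have h1 := neq0_near (Vc x j W0x) Vx.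
  have h2 : \forall y \near x, W0 y by apply: open_nbhs_nbhs; split=> //; exact: open_disc.
  exact/near_disc/(filterI h2 h1).
have shift x (d : R) v : 0 < d -> exists2 h : R, 0 < h & disc x d (h *: v + x).
  move=> d0; exists (d / (2 * (`|v| + 1))); first by rewrite divr_gt0// mulr_gt0// ltr_wpDl.
  rewrite /disc/= addrK normrZ ger0_norm; last by rewrite divr_ge0 ?ltW// mulr_gt0// ltr_wpDl.
  rewrite mulrAC ltr_pdivrMr ?mulr_gt0// ?ltr_wpDl// ltr_pM2l//.
  by have := normr_ge0 v; lra.
have [q0 [W0q0 q0q Vq0]] : exists q0, [/\ W0 q0, q0 != q & exists j, V j q0 != 0].
  have [zq|zq] := eqVneq z q; last by exists z; split=> //; exists j0.
  have [d d0 H] := near_pt z j0 W0z Vz; have [h h0 /H[W0h Vh]] := shift z d (delta_mx 0 0) d0.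
  exists (h *: delta_mx 0 0 + z); split=> //; last by exists j0.
  rewrite zq -subr_eq0 addrK scaler_eq0 (gt_eqF h0)/=; apply/eqP => /(congr1 (fun A : 'rV[R]_2 => A 0 0)).
  by rewrite !mxE => /eqP; rewrite oner_eq0.
have [Yb HYb] := good_transport (fun k i : 'I_3 => (k == i)%:R : R) g.
(* The initial vectors at [q] are chosen among those whose transport to [q0] is annihilated by
   [V]. *)
have [psi ip vpsi] := kernel2 (fun k => \sum_j V j q0 * Yb k j q0).
apply: (has_par_kernel g ip) => Y rY [k Yk].
have Vq0Y : \sum_j V j q0 * Y j q0 = 0.
  pose Z i x := \sum_l (dec (fun c => psi k (idx c)) (psi k idx2)) l * Yb l i x.
  have psiE l : dec (fun c => psi k (idx c)) (psi k idx2) l = psi k l.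
    by elim/ord3_ind: l => [c|]; rewrite ?dec_idx ?dec_idx2.
  have rZ : radial A q W0 (fun i x => \sum_l psi k l * Yb l i x).
    by apply: radial_lin => l; exact: (HYb l).2.
  pose YZ (b : 'I_2) := if b == 0 then Y else (fun i x => \sum_l psi k l * Yb l i x).
  have rYZ : radial A q W0 (fun i x => \sum_b (if b == 0 then 1 else -1) * YZ b i x).
    by apply: radial_lin; apply: ord2_ind.
  have E := @good_unique q r W0 q _ g (@subset_refl _ _) (@star_disc _ _ _) W0q rYZ.
  have {}E i : Y i q0 = \sum_l psi k l * Yb l i q0.
    apply/eqP; rewrite -subr_eq0 -[X in _ == X](E _ q0 W0q0 i); first by rewrite sum_ord2 /YZ/= mul1r mulN1r.
    move=> l; rewrite sum_ord2 /YZ/= mul1r mulN1r Yk (bigD1 l)//= (HYb l).1 eqxx mulr1 big1 ?addr0 ?subrr//.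
    by move=> l' /negPf ll'; rewrite (HYb l').1 ll' mulr0.
  rewrite -[RHS](vpsi k) /dot (eq_bigr _ (fun j _ => congr1 (fun y => V j q0 * y) (E j))).
  under eq_bigr do rewrite big_distrr/=.
  rewrite exchange_big/=; apply: eq_bigr => l _; rewrite big_distrl/=.
  by apply: eq_bigr => j _; ring.
have VYx x y : W0 x -> W0 y -> (x - q) 0 0 * (y - q) 0 1 - (x - q) 0 1 * (y - q) 0 0 != 0 ->
    (exists j, V j x != 0) -> \sum_j V j x * Y j x = 0 -> \sum_j V j y * Y j y = 0.
  move=> W0x W0y nc Vx Vx0; have [l [lx ly]] := ell_exists nc.
  exact: (pair_annihilated W0x W0y rY halves Vx Vx0 lx ly).
have VYq x : W0 x -> x != q -> \sum_j V j x * Y j x = 0.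
  move=> W0x xq; have [Vx0|/existsNP[j /eqP Vjx]] := pselect (forall j, V j x = 0).
    by rewrite big1// => j _; rewrite Vx0 mul0r.
  have [nc|nc] := eqVneq ((q0 - q) 0 0 * (x - q) 0 1 - (q0 - q) 0 1 * (x - q) 0 0) 0; last first.
    exact: VYx nc Vq0 Vq0Y.
  have [d d0 H] := near_pt x j W0x Vjx.
  (* [n] is orthogonal to [q0 - q]. Seen from [q], a point slightly off [x] in this direction is
     collinear neither with [q0] nor with [x], so it links the two. *)
  pose n : 'rV[R]_2 := \row_a (if a == 0 then - (q0 - q) 0 1 else (q0 - q) 0 0).
  have n0 : n 0 0 = - (q0 - q) 0 1 by rewrite mxE.
  have n1 : n 0 1 = (q0 - q) 0 0 by rewrite mxE.
  have sq (w : 'rV[R]_2) : w != 0 -> 0 < w 0 0 ^+ 2 + w 0 1 ^+ 2.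
    apply: contraNT; rewrite -leNgt => h; apply/eqP/rowP => a; rewrite [RHS]mxE.
    by elim/ord2_ind: a; apply/eqP; rewrite -sqrf_eq0; apply/eqP; have := sqr_ge0 (w 0 0);
      have := sqr_ge0 (w 0 1); lra.
  have Q0 : 0 < (q0 - q) 0 0 ^+ 2 + (q0 - q) 0 1 ^+ 2 by apply: sq; rewrite subr_eq0.
  have X0 : 0 < (x - q) 0 0 ^+ 2 + (x - q) 0 1 ^+ 2 by apply: sq; rewrite subr_eq0.
  have [h h0 /H[W0h Vh]] := shift x d n d0.
  have hq a : (h *: n + x - q) 0 a = h * n 0 a + (x - q) 0 a by rewrite !mxE; ring.
  have V1' : \sum_j V j (h *: n + x) * Y j (h *: n + x) = 0.
    apply: (VYx q0) => //; rewrite !hq n0 n1.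
    rewrite (_ : _ - _ = h * ((q0 - q) 0 0 ^+ 2 + (q0 - q) 0 1 ^+ 2)).
      by rewrite mulf_neq0 ?gt_eqF.
    move: nc; set a := (q0 - q) 0 0; set b := (q0 - q) 0 1; set c := (x - q) 0 0; set e := (x - q) 0 1.
    by move=> nc; rewrite -[RHS]addr0 -nc; ring.
  apply: (VYx (h *: n + x)) => //; last by exists j.
  rewrite !hq n0 n1; apply/eqP => e0.
  move: e0 nc Q0 X0; set a := (q0 - q) 0 0; set b := (q0 - q) 0 1; set c := (x - q) 0 0; set e := (x - q) 0 1.
  move=> e0 nc Q0 X0.
  have e1 : b * e + a * c = 0.
    have : h * (b * e + a * c) = 0 by rewrite -[RHS]oppr0 -e0; ring.
    by move/eqP; rewrite mulf_eq0 gt_eqF//= => /eqP.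
  (* Lagrange's identity: two nonzero vectors cannot be both parallel and orthogonal. *)
  have : (a ^+ 2 + b ^+ 2) * (c ^+ 2 + e ^+ 2) = 0.
    by transitivity ((a * e - b * c) ^+ 2 + (b * e + a * c) ^+ 2); [ring|rewrite nc e1; ring].
  by move/eqP; rewrite mulf_eq0 !gt_eqF.
move=> x W0x; have [->|xq] := eqVneq x q; last exact: VYq.
(* At [q] itself: along the ray to [q0] the pairing vanishes for positive parameters, and it is
   differentiable at 0. *)
apply/eqP/negPn/negP => f0; set f := \sum_j _ in f0.
pose F (t : R) := \sum_j V j (ray q q0 t) * Y j (ray q q0 t).
have H00 : 0 <= (0 : R) <= 1 by rewrite lexx ler01.
have := radial_pairing oO W0O (@star_disc _ _ _) rY V1 W0q0 H00.
set F' := (let z := _ in _); move=> /is_derive_epsP/(_ 1 ltr01)[d d0 H].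
have f0' : 0 < `|f| by rewrite normr_gt0.
have c0 : 0 < `|F'| + 1 by rewrite ltr_wpDl.
pose t := Num.min (Num.min 1 (d / 2)) (`|f| / (`|F'| + 1) / 2).
have [t0 t1 td tf] : [/\ 0 < t, t <= 1, t <= d / 2 & t <= `|f| / (`|F'| + 1) / 2].
  by split; rewrite ?lt_min ?ltr01 ?divr_gt0// !ge_min lexx ?orbT.
have := H t; rewrite ger0_norm ?(ltW t0)// [t *: _]mulr1 addr0.
have -> : (\sum_j V j (ray q q0 0) * Y j (ray q q0 0)) = f.
  by rewrite /f /ray scale0r add0r.
have -> : (\sum_j V j (ray q q0 t) * Y j (ray q q0 t)) = 0.
  apply: VYq; first by apply: star_disc => //; rewrite (ltW t0).
  by rewrite /ray -subr_eq0 addrK scaler_eq0 negb_or gt_eqF//= subr_eq0.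
rewrite sub0r mul1r => /(_ ltac:(lra)) h.
have h1 : `|f| <= t * (`|F'| + 1).
  have -> : f = - (- f - t * F') - t * F' by ring.
  apply: le_trans (ler_normB _ _) _; rewrite normrN normrM (ger0_norm (ltW t0)); lra.
have : t * (`|F'| + 1) <= `|f| / 2.
  by rewrite -ler_pdivlMr// mulrAC.
lra.
Qed.

End HalfPlanes.

End LocalExistence.
(** * The prolongation connection in a chart *)

Ltac ck_step :=
  match goal with
  | H : open ?O |- Ck ?k ?O ?h =>
    lazymatch h with
    | (fun x => ?g x) => change (Ck k O g)
    | (fun x => @GRing.add _ (@?f x) (@?g x)) => apply (@Ck_add _ k O f g H)
    | (fun x => @GRing.opp _ (@?f x)) => apply (@Ck_opp _ k O f H)
    | (fun x => @GRing.mul _ (@?f x) (@?g x)) => apply (@Ck_mul _ k O f g H)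
    | (fun _ => ?c) => exact (@Ck_cst _ k O c)
    | (fun x => _) => apply: (Ck_sum2 H) => ?
    | pd _ _ => apply: Ck_pd
    end
  end.

Section Chart.
Context {R : realType}.
Local Notation fn := ('rV[R]_2 -> R).
Local Notation ee a := (delta_mx 0 a : 'rV[R]_2).
Variables (O : set 'rV[R]_2) (G : 'I_2 -> 'I_2 -> 'I_2 -> fn) (eps : 'I_2 -> 'I_2 -> fn).
Hypotheses (oO : open O) (G4 : forall a b c, Ck 4 O (G a b c))
  (Gsym : forall x, O x -> forall a b c, G a b c x = G a c b x)
  (eps4 : forall a b, Ck 4 O (eps a b))
  (eps_neq0 : forall x, O x -> eps 0 1 x != 0)
  (eps_skew : forall x, O x -> forall a b, eps a b x = - eps b a x).

Let e := eps 0 1.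
Let P := schouten G.

Lemma eps10 x : O x -> eps 1 0 x = - e x.
Proof. by move=> Ox; rewrite (eps_skew Ox). Qed.

Lemma epsaa a x : O x -> eps a a x = 0.
Proof.
move=> Ox; have := eps_skew Ox a a; lra.
Qed.

Lemma epsupE x : O x -> [/\ epsup eps 0 0 x = 0, epsup eps 0 1 x = (e x)^-1,
  epsup eps 1 0 x = - (e x)^-1 & epsup eps 1 1 x = 0].
Proof.
move=> Ox.
pose X : 'M[R]_2 := \matrix_(i, j) (if i == j then 0 else if i == 0 then (e x)^-1 else - (e x)^-1).
set E := (\matrix_(i, j) eps i j x)^T.
have e0 := eps_neq0 Ox.
have XE : X *m E = 1%:M.
  apply/matrixP => i j; rewrite !mxE sum_ord2 !mxE.
  by elim/ord2_ind: i; elim/ord2_ind: j; rewrite /= ?epsaa ?eps10// /e; field.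
have uE : E \in unitmx by case/mulmx1_unit: XE.
have -> : epsup eps = fun a b y => epsup eps a b y by [].
have iE : invmx E = X.
  by rewrite -[LHS]mul1mx -XE mulmxK.
by rewrite /epsup -/E iE !mxE.
Qed.

Lemma schouten_upE x a : O x -> schouten_up G eps 0 a x = P 1 a x / e x /\
  schouten_up G eps 1 a x = - P 0 a x / e x.
Proof.
move=> Ox; rewrite /schouten_up !sum_ord2; have [-> -> -> ->] := epsupE Ox.
by split; rewrite /P; ring.
Qed.

Lemma betaE x : O x -> beta G eps x = 2 * (P 1 0 x - P 0 1 x) / e x.
Proof.
move=> Ox; rewrite /beta !sum_ord2; have [-> -> -> ->] := epsupE Ox.
by rewrite /tensorB /P; field; exact: eps_neq0.
Qed.

Lemma thetaE x a : O x -> theta G eps a x = pd a e x / e x - (G 0 a 0 x + G 1 a 1 x).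
Proof.
move=> Ox; rewrite /theta /nabla2 !sum_ord2 !epsaa// -/e; field; exact: eps_neq0.
Qed.

Lemma lowerE (v : 'I_2 -> fn) x : O x -> lower eps v 0 x = - e x * v 1 x /\
  lower eps v 1 x = e x * v 0 x.
Proof.
by move=> Ox; rewrite /lower !sum_ord2 !epsaa// eps10// /e; split; ring.
Qed.

Lemma Ck_G k a b c : (k <= 4)%N -> Ck k O (G a b c).
Proof. by move=> k4; exact: Ck_leq (G4 a b c). Qed.

Lemma Ck_eps k a b : (k <= 4)%N -> Ck k O (eps a b).
Proof. by move=> k4; exact: Ck_leq (eps4 a b). Qed.

Lemma Ck_ricci a b : Ck 3 O (ricci G a b).
Proof. by rewrite /ricci /curvature; repeat ck_step; exact: Ck_G. Qed.

Lemma Ck_schouten k a b : (k <= 3)%N -> Ck k O (P a b).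
Proof.
move=> k3; apply: Ck_leq k3 _ => //; rewrite /P /schouten.
by repeat ck_step; exact: Ck_ricci.
Qed.

Lemma Ck_tensorB k a b : (k <= 3)%N -> Ck k O (tensorB G a b).
Proof. by move=> k3; rewrite /tensorB; repeat ck_step; exact: Ck_schouten. Qed.

Lemma Ck_einv k : (k <= 4)%N -> Ck k O (fun x => (e x)^-1).
Proof. by move=> k4; apply: Ck_inv => //; exact: Ck_eps. Qed.

Lemma Ck_epsup k a b : (k <= 4)%N -> Ck k O (epsup eps a b).
Proof.
move=> k4.
have H (c : R) f : (forall x, O x -> f x = c * (e x)^-1) -> Ck k O f.
  move=> fE; have := Ck_mul oO (Ck_cst k O c) (Ck_einv k4).
  by apply: Ck_eq => // x Ox; rewrite fE.
elim/ord2_ind: a; elim/ord2_ind: b.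
- by apply: (H 0) => x Ox; have [-> _ _ _] := epsupE Ox; rewrite mul0r.
- by apply: (H 1) => x Ox; have [_ -> _ _] := epsupE Ox; rewrite mul1r.
- by apply: (H (-1)) => x Ox; have [_ _ -> _] := epsupE Ox; rewrite mulN1r.
- by apply: (H 0) => x Ox; have [_ _ _ ->] := epsupE Ox; rewrite mul0r.
Qed.

Lemma Ck_schouten_up k a b : (k <= 3)%N -> Ck k O (schouten_up G eps a b).
Proof.
move=> k3; rewrite /schouten_up; repeat ck_step; [apply: Ck_epsup; exact: leqW|exact: Ck_schouten].
Qed.

Lemma Ck_beta k : (k <= 3)%N -> Ck k O (beta G eps).
Proof.
move=> k3; rewrite /beta; repeat ck_step; [exact: Ck_tensorB|apply: Ck_epsup; exact: leqW].
Qed.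

Lemma Ck_nabla2 k (T : 'I_2 -> 'I_2 -> fn) c a b : (k <= 4)%N ->
  (forall a b, Ck k.+1 O (T a b)) -> Ck k O (nabla2 G T c a b).
Proof.
move=> k4 Tk; rewrite /nabla2; repeat ck_step; first [exact: Ck_G|exact: Tk|exact: CkS].
Qed.

Lemma Ck_nabla3 k (T : 'I_2 -> 'I_2 -> 'I_2 -> fn) d a b c : (k <= 4)%N ->
  (forall a b c, Ck k.+1 O (T a b c)) -> Ck k O (nabla3 G T d a b c).
Proof.
move=> k4 Tk; rewrite /nabla3; repeat ck_step; first [exact: Ck_G|exact: Tk|exact: CkS].
Qed.

Lemma Ck_theta k a : (k <= 3)%N -> Ck k O (theta G eps a).
Proof.
move=> k3; rewrite /theta; apply: Ck_mul => //; last by apply: Ck_einv; exact: leqW.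
apply: Ck_nabla2; first exact: leqW.
by move=> *; apply: Ck_eps; rewrite ltnS.
Qed.

Lemma Ck_tensorF k a : (k <= 2)%N -> Ck k O (tensorF G eps a).
Proof.
move=> k2; have k4 : (k <= 4)%N by apply: leq_trans k2 _.
rewrite /tensorF /tensorL; repeat ck_step; first [exact: Ck_epsup|apply: Ck_nabla2 => // *].
  by apply: Ck_schouten; rewrite ltnS.
by apply: Ck_tensorB; rewrite ltnS.
Qed.

Lemma Ck_tensorY k c d b : (k <= 2)%N -> Ck k O (tensorY G c d b).
Proof.
move=> k2; have k4 : (k <= 4)%N by apply: leq_trans k2 _.
by rewrite /tensorY; repeat ck_step; apply: Ck_nabla2 => // *; apply: Ck_schouten; rewrite ltnS.
Qed.

Lemma Ck_tensorM k a b : (k <= 1)%N -> Ck k O (tensorM G eps a b).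
Proof.
move=> k1; have k4 : (k <= 4)%N by apply: leq_trans k1 _.
have k3 : (k <= 3)%N by apply: leq_trans k1 _.
have E : (fun x => beta G eps x ^+ 2) = (fun x => beta G eps x * beta G eps x).
  by apply/funext => x; rewrite expr2.
have b2 : Ck k O (fun x => beta G eps x ^+ 2) by rewrite E; apply: Ck_mul => //; exact: Ck_beta.
rewrite /tensorM; repeat ck_step; first [exact: b2|exact: Ck_epsup|exact: Ck_beta|exact: Ck_schouten_up|
  apply: Ck_nabla3 => // *].
  by apply: Ck_tensorY; rewrite ltnS.
by apply: Ck_nabla2 => // *; apply: Ck_tensorB; rewrite !ltnS.
Qed.

Lemma Ck_tensorN k a : (k <= 2)%N -> Ck k O (tensorN G eps a).
Proof.
move=> k2; have k4 : (k <= 4)%N by apply: leq_trans k2 _.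
rewrite /tensorN /lower; repeat ck_step; first [exact: Ck_eps|exact: Ck_tensorF|exact: Ck_epsup|
  apply: Ck_nabla2 => // *].
by apply: Ck_tensorB; rewrite ltnS.
Qed.

(* [parallel prol] is the equation D(K, mu) = 0. *)
Definition prol a i j : fn :=
  dec (fun b => dec (fun c => G c a b) (eps a b) j)
      (dec (fun b x => schouten_up G eps b a x + 2^-1 * beta G eps x * (a == b)%:R)
           (fun x => - theta G eps a x) j) i.

Lemma Ck_prol k a i j : (k <= 3)%N -> Ck k O (prol a i j).
Proof.
move=> k3; have k4 : (k <= 4)%N by exact: leqW.
elim/ord3_ind: i => [b|]; elim/ord3_ind: j => [c|]; rewrite /prol ?dec_idx ?dec_idx2.
- exact: Ck_G.
- exact: Ck_eps.
- by repeat ck_step; first [exact: Ck_schouten_up|exact: Ck_beta].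
- by repeat ck_step; exact: Ck_theta.
Qed.

Lemma pd_add f g c x : Ck 1 O f -> Ck 1 O g -> O x ->
  pd c (fun x => f x + g x) x = pd c f x + pd c g x.
Proof.
by move=> f1 g1 Ox; apply: pd_val; apply: is_derive_add; apply: is_derive_pd Ox.
Qed.

Lemma pd_opp f c x : Ck 1 O f -> O x -> pd c (fun x => - f x) x = - pd c f x.
Proof. by move=> f1 Ox; apply: pd_val; apply: is_derive_opp; apply: is_derive_pd Ox. Qed.

Lemma pd_mul f g c x : Ck 1 O f -> Ck 1 O g -> O x ->
  pd c (fun x => f x * g x) x = pd c f x * g x + f x * pd c g x.
Proof.
by move=> f1 g1 Ox; apply: pd_val; apply: is_derive_mul; apply: is_derive_pd Ox.
Qed.

Lemma pd_const c (k : R) x : pd c (fun=> k) x = 0.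
Proof. by apply: pd_val; exact: is_derive_const. Qed.

Lemma pd_div f g c x : Ck 1 O f -> Ck 1 O g -> O x -> g x != 0 ->
  pd c (fun x => f x / g x) x = pd c f x / g x - f x * pd c g x / g x ^+ 2.
Proof.
move=> f1 g1 Ox g0; apply: pd_val; apply: is_derive_val.
  apply: is_derive_mul; first exact: is_derive_pd Ox.
  by apply: is_derive_inv => //; apply: is_derive_pd Ox.
by rewrite mulrA mulrN mulNr.
Qed.

Lemma pd_sub f g c x : Ck 1 O f -> Ck 1 O g -> O x ->
  pd c (fun x => f x - g x) x = pd c f x - pd c g x.
Proof.
by move=> f1 g1 Ox; apply: pd_val; apply: is_derive_sub; apply: is_derive_pd Ox.
Qed.

Lemma pd_scale (k : R) f c x : Ck 1 O f -> O x ->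
  pd c (fun x => k * f x) x = k * pd c f x.
Proof.
by move=> f1 Ox; rewrite (pd_mul c (Ck_cst 1 O k) f1 Ox) pd_const mul0r add0r.
Qed.

Lemma pd_epsaa c a x : O x -> pd c (eps a a) x = 0.
Proof.
move=> Ox; rewrite (@pd_eq _ O _ (fun=> 0) c x oO _ Ox) ?pd_const// => y Oy.
exact: epsaa.
Qed.

Lemma pd_eps10 c x : O x -> pd c (eps 1 0) x = - pd c e x.
Proof.
move=> Ox; rewrite (@pd_eq _ O _ (fun y => - e y) c x oO _ Ox) ?pd_opp//; last first.
  by move=> y Oy; exact: eps10.
exact: Ck_eps.
Qed.

Lemma pd_Gsym c a x : O x -> pd c (G a 1 0) x = pd c (G a 0 1) x.
Proof. by move=> Ox; apply: (pd_eq _ oO) Ox => y Oy; rewrite Gsym. Qed.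

Lemma pd_tensorB c a b x : O x -> pd c (tensorB G a b) x = pd c (P b a) x - pd c (P a b) x.
Proof. by move=> Ox; rewrite /tensorB pd_sub//; exact: Ck_schouten. Qed.

(** The matrix [P^b_a + beta / 2 delta^b_a] with the factor [1 / eps_01] taken out; this keeps
    derivatives of the volume form apart from those of the Schouten tensor. *)
Definition mu_coef (a b : 'I_2) : fn :=
  if a == 0 then if b == 0 then (fun x => 2 * P 1 0 x - P 0 1 x) else (fun x => - P 0 0 x)
  else if b == 0 then P 1 1 else (fun x => P 1 0 x - 2 * P 0 1 x).

Lemma prol_mu a b x : O x -> prol a idx2 (idx b) x = mu_coef a b x / e x.
Proof.
move=> Ox; rewrite /prol !dec_idx2 dec_idx betaE//; have [s0 s1] := schouten_upE a Ox.
have e0 : e x != 0 by exact: eps_neq0.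
by elim/ord2_ind: b; rewrite ?s0 ?s1; elim/ord2_ind: a {s0 s1}; rewrite /mu_coef /= /P; field.
Qed.

Lemma Ck_mu_coef k a b : (k <= 3)%N -> Ck k O (mu_coef a b).
Proof.
by move=> k3; elim/ord2_ind: a; elim/ord2_ind: b; rewrite /mu_coef /=; repeat ck_step;
  exact: Ck_schouten.
Qed.

Lemma pd_prol_mu c a b x : O x -> pd c (prol a idx2 (idx b)) x =
  pd c (mu_coef a b) x / e x - mu_coef a b x * pd c e x / e x ^+ 2.
Proof.
move=> Ox; have m1 : Ck 1 O (mu_coef a b) by exact: Ck_mu_coef.
have e1 : Ck 1 O e by exact: Ck_eps.
have e0 : e x != 0 by exact: eps_neq0.
rewrite -pd_div//.
by apply: (pd_eq _ oO) Ox => y Oy; rewrite prol_mu.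
Qed.

Lemma prol_mumu a x : O x -> prol a idx2 idx2 x = G 0 a 0 x + G 1 a 1 x - pd a e x / e x.
Proof. by move=> Ox; rewrite /prol !dec_idx2 thetaE//; ring. Qed.

Lemma pd_prol_mumu c a x : O x -> pd c (prol a idx2 idx2) x =
  pd c (G 0 a 0) x + pd c (G 1 a 1) x - (pd c (pd a e) x / e x - pd a e x * pd c e x / e x ^+ 2).
Proof.
move=> Ox; have e1 : Ck 1 O e by exact: Ck_eps.
have de1 : Ck 1 O (pd a e) by apply: Ck_pd; exact: Ck_eps.
have G1 i j k : Ck 1 O (G i j k) by exact: Ck_G.
have GG := Ck_add oO (G1 0 a 0) (G1 1 a 1).
have DE := Ck_mul oO de1 (Ck_einv (isT : (1 <= 4)%N)).
rewrite -(pd_div c de1 e1 Ox (eps_neq0 Ox)) -(pd_add c (G1 0 a 0) (G1 1 a 1) Ox).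
rewrite -(pd_sub c GG DE Ox).
by apply: (pd_eq _ oO) Ox => y Oy; rewrite prol_mumu.
Qed.

Lemma pd_mu_coef c x : O x -> [/\
  pd c (mu_coef 0 0) x = 2 * pd c (P 1 0) x - pd c (P 0 1) x,
  pd c (mu_coef 0 1) x = - pd c (P 0 0) x,
  pd c (mu_coef 1 0) x = pd c (P 1 1) x &
  pd c (mu_coef 1 1) x = pd c (P 1 0) x - 2 * pd c (P 0 1) x].
Proof.
move=> Ox; have P1 a b : Ck 1 O (P a b) by exact: Ck_schouten.
have sP k a b : Ck 1 O (fun x => k * P a b x) by apply: Ck_mul => //; exact: Ck_cst.
rewrite /mu_coef /=; split => //.
- by rewrite pd_sub ?pd_scale.
- by rewrite pd_opp.
- by rewrite pd_sub ?pd_scale.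
Qed.

Lemma tensorLE b x : O x ->
  tensorL G eps b x = (nabla2 G P 0 1 b x - nabla2 G P 1 0 b x) / e x.
Proof.
move=> Ox; rewrite /tensorL !sum_ord2 -/P; have [-> -> -> ->] := epsupE Ox; ring.
Qed.

Lemma tensorFE x : O x ->
  tensorF G eps 0 x = (nabla2 G P 0 1 1 x - nabla2 G P 1 0 1 x -
     nabla2 G (tensorB G) 1 0 1 x + nabla2 G (tensorB G) 1 1 0 x) / (3 * e x ^+ 2) /\
  tensorF G eps 1 x = - (nabla2 G P 0 1 0 x - nabla2 G P 1 0 0 x -
     nabla2 G (tensorB G) 0 0 1 x + nabla2 G (tensorB G) 0 1 0 x) / (3 * e x ^+ 2).
Proof.
move=> Ox; rewrite /tensorF !sum_ord2 !tensorLE//; have [-> -> -> ->] := epsupE Ox.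
have e0 : e x != 0 by exact: eps_neq0.
by split; field.
Qed.

Definition vecV (j : 'I_3) : fn := dec (tensorF G eps) (beta G eps) j.

(** The terms quadratic in the Christoffel symbols cancel: the skew part of the Ricci tensor is, up
    to a factor, the curl of the trace of the connection. *)
Lemma ricci_skewE x : O x ->
  P 1 0 x - P 0 1 x = 3^-1 * (pd 0 (G 0 0 1) x + pd 0 (G 1 1 1) x - pd 1 (G 0 0 0) x - pd 1 (G 1 0 1) x).
Proof.
move=> Ox; rewrite /P /schouten /ricci !sum_ord2 /curvature !sum_ord2.
rewrite !pd_Gsym// !(Gsym Ox _ 1 0); by field.
Qed.

Lemma prol_KK a b c : prol a (idx b) (idx c) = G c a b.
Proof. by rewrite /prol !dec_idx. Qed.

Lemma prol_Kmu a b : prol a (idx b) idx2 = eps a b.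
Proof. by rewrite /prol dec_idx dec_idx2. Qed.

Local Opaque prol idx idx2 schouten.

Lemma curvature_ricci d x :
  curvature G 0 1 0 d x = ricci G 1 d x /\ curvature G 0 1 1 d x = - ricci G 0 d x.
Proof.
have E a b c : curvature G a a c b x = 0.
  by rewrite /curvature subrr add0r big1// => k _; rewrite subrr.
have S c b : curvature G 1 0 c b x = - curvature G 0 1 c b x.
  by rewrite /curvature !sum_ord2; ring.
by rewrite /ricci !sum_ord2 !E addr0 add0r S opprK.
Qed.

(** This row identifies [F] and [beta] as curvature. Up to the factor [-3 e], [F] is the curl of [P]
    corrected by the derivative of [B], and [beta] combines the curl of the connection trace with
    the skew part of [P]. The second derivatives of the volume form cancel by symmetry. *)
Lemma prol_curv_mu j x : O x ->
  pd 1 (prol 0 idx2 j) x + \sum_k prol 0 idx2 k x * prol 1 k j x -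
  (pd 0 (prol 1 idx2 j) x + \sum_k prol 1 idx2 k x * prol 0 k j x) = - 3 * e x * vecV j x.
Proof.
move=> Ox; have e0 : e x != 0 by exact: eps_neq0.
have eC : pd 1 (pd 0 e) x = pd 0 (pd 1 e) x by exact: (pdC _ _ oO (Ck_eps 0 1 (isT : (2 <= 4)%N)) Ox).
rewrite !sum_ord3.
rewrite !(prol_mu _ _ Ox).
rewrite !(prol_mumu _ Ox).
elim/ord3_ind: j => [b|].
  rewrite !(pd_prol_mu _ _ _ Ox).
  rewrite !(prol_mu _ _ Ox).
  have [p1 p2 p3 p4] := pd_mu_coef 0 Ox.
  have [q1 q2 q3 q4] := pd_mu_coef 1 Ox.
  rewrite /vecV dec_idx; have [F0 F1] := tensorFE Ox.
  rewrite !prol_KK; elim/ord2_ind: b.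
    rewrite F0 p3 q1 /mu_coef /= /nabla2 !sum_ord2 !(pd_tensorB _ _ _ Ox) /tensorB -/P !(Gsym Ox _ 1 0).
    by field.
  rewrite F1 p4 q2 /mu_coef /= /nabla2 !sum_ord2 !(pd_tensorB _ _ _ Ox) /tensorB -/P !(Gsym Ox _ 1 0).
  by field.
rewrite !(pd_prol_mumu _ _ Ox) !prol_Kmu !(epsaa _ Ox) (eps10 Ox) -/e eC.
rewrite /vecV dec_idx2 (betaE Ox) (ricci_skewE Ox) /mu_coef /=.
rewrite !(prol_mumu _ Ox) !(pd_Gsym _ _ Ox) !(Gsym Ox _ 1 0).
have := ricci_skewE Ox.
set S := 3^-1 * _ => skew.
have -> : P 1 0 x = P 0 1 x + S by rewrite -skew; ring.
by rewrite /S; field.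
Qed.

(** In dimension two the Ricci tensor determines the curvature of [nabla], and the zeroth-order term
    in the derivative of [mu] is chosen so that the two cancel on the one-form components. *)
Lemma prol_curv_K b j x : O x ->
  pd 1 (prol 0 (idx b) j) x + \sum_k prol 0 (idx b) k x * prol 1 k j x -
  (pd 0 (prol 1 (idx b) j) x + \sum_k prol 1 (idx b) k x * prol 0 k j x) = 0.
Proof.
move=> Ox; have e0 : e x != 0 by exact: eps_neq0.
rewrite !sum_ord3 !prol_Kmu.
elim/ord3_ind: j => [c|].
  rewrite !prol_KK !(prol_mu _ _ Ox).
  have [R0 R1] := curvature_ricci b x; rewrite /curvature !sum_ord2 ?(pd_Gsym _ _ Ox) in R0 R1.
  have PE a d : P a d x = 2 / 3 * ricci G a d x + 1 / 3 * ricci G d a x by [].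
  elim/ord2_ind: b R0 R1 => R0 R1; rewrite !(epsaa _ Ox) ?(eps10 Ox) -/e !mul0r ?mulNr ![e x * _]mulrC !divfK//;
    elim/ord2_ind: c; rewrite /mu_coef /= !PE; rewrite ?(Gsym Ox _ 1 0) in R0 R1 *;
    [clear R1|clear R0|clear R1|clear R0]; lra.
rewrite !prol_Kmu !prol_KK !(prol_mumu _ Ox).
by elim/ord2_ind: b; rewrite !(epsaa _ Ox) ?(eps10 Ox) ?(pd_epsaa _ _ Ox) ?(pd_eps10 _ Ox) -/e
  !(Gsym Ox _ 1 0); field.
Qed.

Lemma prol_flat (y : 'I_3 -> R) x i : O x ->
  lin (dconn prol 1 0 x) y i + lin (conn prol 0 x) (lin (conn prol 1 x) y) i =
  lin (dconn prol 0 1 x) y i + lin (conn prol 1 x) (lin (conn prol 0 x) y) i +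
  (i == idx2)%:R * (- 3 * e x) * \sum_j vecV j x * y j.
Proof.
move=> Ox.
have linlin a b : lin (conn prol a x) (lin (conn prol b x) y) i =
    \sum_j (\sum_k prol a i k x * prol b k j x) * y j.
  rewrite /lin /conn (eq_bigr _ (fun k _ => big_distrr _ _ _)) exchange_big/=.
  by apply: eq_bigr => j _; rewrite big_distrl/=; apply: eq_bigr => k _; rewrite mulrA.
rewrite !linlin {1 2}/lin /dconn big_distrr/= -!big_split/=.
apply: eq_bigr => j _; rewrite -mulrDl.
have -> : pd 1 (prol 0 i j) x + \sum_k prol 0 i k x * prol 1 k j x =
    pd 0 (prol 1 i j) x + \sum_k prol 1 i k x * prol 0 k j x +
    (i == idx2)%:R * (- 3 * e x) * vecV j x.
  apply/eqP; rewrite addrC -subr_eq addrC; apply/eqP.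
  elim/ord3_ind: i {linlin} => [b|].
    have -> : (idx b == idx2) = false by elim/ord2_ind: b.
    by rewrite !mul0r subr0; apply/eqP; rewrite -subr_eq0 -[X in _ == X](prol_curv_K b j Ox) addrC.
  by rewrite eqxx mul1r -(prol_curv_mu j Ox); ring.
ring.
Qed.

(** * From the Killing equation to a parallel section *)

Section Killing.
Variables (W : set 'rV[R]_2) (K : 'I_2 -> fn).
Hypotheses (oW : open W) (WO : W `<=` O) (K1 : forall a, Ck 1 W (K a)).
Hypothesis killing : forall x, W x -> forall a b,
  pd a (K b) x + pd b (K a) x = 2 * \sum_c G c a b x * K c x.

Let S a b x := G 0 a b x * K 0 x + G 1 a b x * K 1 x.
Let mu x := (pd 0 (K 1) x - S 0 1 x) / e x.

Let GW k a b c : (k <= 4)%N -> Ck k W (G a b c).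
Proof. by move=> k4; apply: Ck_subset WO _; exact: Ck_G. Qed.

Let S1 a b : Ck 1 W (S a b).
Proof. by rewrite /S; repeat ck_step; first [exact: GW|exact: K1]. Qed.

Let pdKaa a x : W x -> pd a (K a) x = S a a x.
Proof. by move=> Wx; have := killing Wx a a; rewrite sum_ord2 /S; lra. Qed.

Let pdK01 x : W x -> pd 0 (K 1) x = S 0 1 x + e x * mu x.
Proof.
by move=> Wx; rewrite /mu mulrC divfK ?[S _ _ _ + _]addrC ?subrK//; exact: eps_neq0 (WO Wx).
Qed.

Let pdK10 x : W x -> pd 1 (K 0) x = S 0 1 x - e x * mu x.
Proof.
move=> Wx; have := killing Wx 0 1; rewrite sum_ord2 (pdK01 Wx) /S; lra.
Qed.

Let pdS c a b x : W x -> pd c (S a b) x = pd c (G 0 a b) x * K 0 x + G 0 a b x * pd c (K 0) x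
   + (pd c (G 1 a b) x * K 1 x + G 1 a b x * pd c (K 1) x).
Proof.
move=> Wx; have G1 i j k : Ck 1 W (G i j k) by exact: GW.
have GK i j k : Ck 1 W (fun x => G i j k x * K i x) by exact: Ck_mul.
apply: pd_val; apply: is_derive_add; apply: is_derive_mul;
  first [exact: is_derive_pd (G1 _ _ _) Wx|exact: is_derive_pd (K1 _) Wx].
Qed.

(** [K] is only of class C^1, but by the Killing equation [pd a (K a)] equals an expression of class
    C^1. Peano's theorem then supplies the derivative of [pd b (K a)] along [e_a]. *)
Let cross a b x : W x -> is_derive x (ee a) (pd b (K a)) (pd b (S a a) x).
Proof.
move=> Wx.
have E : forall y, W y -> pd a (K a) y = S a a y by move=> y; exact: pdKaa.
have P1 : Ck 1 W (pd a (K a)).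
  by have := S1 a a; apply: Ck_eq => // y Wy; rewrite E.
have -> : pd b (S a a) x = pd b (pd a (K a)) x by rewrite (pd_eq b oW E Wx).
apply: (@schwarz_peano R W (K a) a b x oW Wx).
  move=> y Wy; have [d1 _] := K1 a; have [d2 _] := P1.
  by split; [exact: d1|exact: d1|exact: d2].
by have [_ c] := P1; exact: c.
Qed.

(** By the Killing equation [mu] can be computed from [pd 0 (K 1)] or from [pd 1 (K 0)]. In each
    direction the expression is used whose derivative along that direction is known to exist. *)
Let mu_deriv a x : W x -> is_derive x (ee a) mu
  (lin (conn prol a x) (fun j => dec K mu j x) idx2).
Proof.
move=> Wx; have Ox := WO Wx; have e0 : e x != 0 by exact: eps_neq0.
have ed : is_derive x (ee a) (fun y => (e y)^-1) (- pd a e x / e x ^+ 2).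
  by apply: is_derive_inv => //; exact: is_derive_pd (Ck_eps 0 1 (isT : (1 <= 4)%N)) Ox.
have PE b d : P b d x = 2 / 3 * ricci G b d x + 1 / 3 * ricci G d b x by [].
have D0 b : pd 1 (G 0 0 b) x = pd 0 (G 0 1 b) x + G 0 0 0 x * G 0 1 b x - G 0 0 1 x * G 0 0 b x
    + G 0 0 1 x * G 1 1 b x - G 0 1 1 x * G 1 0 b x - ricci G 1 b x.
  by have [<- _] := curvature_ricci b x; rewrite /curvature sum_ord2 !(Gsym Ox _ 1 0); ring.
have D1 b : pd 1 (G 1 0 b) x = pd 0 (G 1 1 b) x + G 1 0 0 x * G 0 1 b x + G 1 0 1 x * G 1 1 b x
    - G 1 0 1 x * G 0 0 b x - G 1 1 1 x * G 1 0 b x + ricci G 0 b x.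
  have [_ R1] := curvature_ricci b x; rewrite -[ricci G 0 b x]opprK -R1 /curvature sum_ord2.
  by rewrite !(Gsym Ox _ 1 0); ring.
rewrite /lin sum_ord3 !dec_idx dec_idx2 /conn !(prol_mu _ _ Ox) (prol_mumu _ Ox).
elim/ord2_ind: a ed => ed.
  have nE : \forall y \near x, (S 0 1 y - pd 1 (K 0) y) / e y = mu y.
    apply: near_open oW Wx _ => y Wy; rewrite (pdK10 Wy) opprB addrC subrK mulrC mulKf//.
    exact: eps_neq0 (WO Wy).
  apply: near_eq_is_derive nE _.
  apply: is_derive_val.
    apply: is_derive_mul ed; apply: is_derive_sub; last exact: cross.
    exact: is_derive_pd (S1 0 1) Wx.
  rewrite !(pdS _ _ _ Wx) !(pdKaa _ Wx) (pdK01 Wx) (pdK10 Wx) /mu_coef /=.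
  rewrite /S !D0 !D1 !PE ?(pd_Gsym _ _ Ox) !(Gsym Ox _ 1 0).
  by field.
apply: is_derive_val.
  apply: is_derive_mul ed; apply: is_derive_sub; first exact: cross.
  exact: is_derive_pd (S1 0 1) Wx.
rewrite !(pdS _ _ _ Wx) !(pdKaa _ Wx) (pdK01 Wx) (pdK10 Wx) /mu_coef /=.
rewrite /S !D0 !D1 !PE ?(pd_Gsym _ _ Ox) !(Gsym Ox _ 1 0).
by field.
Qed.

Lemma killing_parallel : parallel prol W (fun i => dec K mu i).
Proof.
have Kc a x : W x -> {for x, continuous (K a)} by move=> Wx; exact: Ck_cont (K1 a) Wx.
have muc x : W x -> {for x, continuous mu}.
  move=> Wx; apply: continuous_atM.
    apply: continuous_atD; first by have [_ c] := K1 1; exact: c.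
    by apply: continuous_atN; exact: Ck_cont (S1 0 1) Wx.
  by apply: (Ck_cont oO (Ck_einv (isT : (0 <= 4)%N))); exact: WO.
move=> x Wx; have Ox := WO Wx; elim/ord3_ind => [b|].
  have [d1 _] := Ck_diff oW (K1 b) Wx; rewrite dec_idx; split; first exact: d1.
  move=> a; rewrite /lin sum_ord3 !dec_idx dec_idx2 /conn !prol_KK !prol_Kmu.
  by elim/ord2_ind: a; elim/ord2_ind: b {d1};
   rewrite ?(pdKaa _ Wx) ?(pdK01 Wx) ?(pdK10 Wx) /S ?(epsaa _ Ox) ?(eps10 Ox) -/e ?(Gsym Ox _ 1 0); ring.
rewrite dec_idx2.
have [|a|d1 _] := @differentiable_partial R mu x.
- apply: near_open oW Wx _ => y Wy a; have [h _] := mu_deriv a Wy; exact: h.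
- have c : {for x, continuous (fun y => lin (conn prol a y) (fun j => dec K mu j y) idx2)}.
    apply: continuous_at_sum => j; apply: continuous_atM.
      exact: Ck_cont (Ck_prol _ _ _ (isT : (0 <= 3)%N)) Ox.
    by elim/ord3_ind: j => [b|]; rewrite ?dec_idx ?dec_idx2; [exact: Kc|exact: muc].
  apply: near_eq_continuous c; apply: near_open oW Wx _ => y Wy.
  by rewrite /pd; have [_ ->] := mu_deriv a Wy.
- split; first exact: d1.
  by move=> a; rewrite /pd; have [_ ->] := mu_deriv a Wx.
Qed.

End Killing.

(** * The invariants in terms of [V] and its covariant derivatives *)

Local Notation covD := (cov prol).

Definition dvec (s : dual_section (R := R)) (j : 'I_3) : fn := dec s.1 s.2 j.

Local Transparent prol.

Lemma prol_muE a x : (forall b, prol a idx2 (idx b) x =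
    schouten_up G eps b a x + 2^-1 * beta G eps x * (a == b)%:R) /\
  prol a idx2 idx2 x = - theta G eps a x.
Proof. by split=> [b|]; rewrite /prol !dec_idx2 ?dec_idx. Qed.

Local Opaque prol.

Lemma dualD_covD a s j x : O x -> dvec (dualD G eps a s) j x = covD a (dvec s) j x.
Proof.
move=> Ox; rewrite /cov sum_ord3 /dvec !dec_idx !dec_idx2.
elim/ord3_ind: j => [b|]; rewrite ?dec_idx ?dec_idx2 /dualD /=.
  by rewrite (prol_muE a x).1 !prol_KK sum_ord2; ring.
rewrite (prol_muE a x).2.
by rewrite !prol_Kmu /lower sum_ord2; elim/ord2_ind: a;
  rewrite !(epsaa _ Ox) (eps10 Ox) -/e; ring.
Qed.

(** Dual form of the curvature identity. For second derivatives of [V] it says that the two orders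
    differ by a multiple of [V], so that symmetrising them in [I_S] loses nothing modulo [V]. *)
Lemma covD_curv (s : 'I_3 -> fn) j x : O x -> (forall i, Ck 2 O (s i)) ->
  covD 0 (covD 1 s) j x - covD 1 (covD 0 s) j x = 3 * e x * s idx2 x * vecV j x.
Proof.
move=> Ox s2.
have s1 i : Ck 1 O (s i) by exact: CkS.
have A1 a i k : Ck 1 O (prol a i k) by exact: Ck_prol.
have sA a i k : Ck 1 O (fun y => s i y * prol a i k y) by exact: Ck_mul.
have pdcov a b k : pd a (covD b s k) x = pd a (pd b (s k)) x +
    \sum_i (pd a (s i) x * prol b i k x + s i x * pd a (prol b i k) x).
  have ps : Ck 1 O (pd b (s k)) by exact: Ck_pd.
  have ss : Ck 1 O (fun y => s (idx 0) y * prol b (idx 0) k y + s (idx 1) y * prol b (idx 1) k y).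
    exact: Ck_add.
  have -> : covD b s k = fun y => pd b (s k) y + (s (idx 0) y * prol b (idx 0) k y +
      s (idx 1) y * prol b (idx 1) k y + s idx2 y * prol b idx2 k y).
    by apply/funext => y; rewrite /cov sum_ord3.
  rewrite (pd_add a ps (Ck_add oO ss (sA _ _ _)) Ox) (pd_add a ss (sA _ _ _) Ox).
  rewrite (pd_add a (sA _ _ _) (sA _ _ _) Ox) !(pd_mul a (s1 _) (A1 _ _ _) Ox).
  by rewrite sum_ord3.
rewrite {1}/cov pdcov [X in _ - X]/cov pdcov (pdC 0 1 oO (s2 j) Ox).
have C i : \sum_k prol 0 i k x * prol 1 k j x + pd 1 (prol 0 i j) x =
   \sum_k prol 1 i k x * prol 0 k j x + pd 0 (prol 1 i j) x - (i == idx2)%:R * (3 * e x) * vecV j x.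
  elim/ord3_ind: i => [b|].
    have -> : (idx b == idx2) = false by elim/ord2_ind: b.
    by rewrite !mul0r subr0; apply/eqP; rewrite -subr_eq0 -[X in _ == X](prol_curv_K b j Ox); apply/eqP; ring.
  rewrite eqxx mul1r; have := prol_curv_mu j Ox.
  move=> h; apply/eqP; rewrite -subr_eq0; apply/eqP.
  have -> : 3 * e x * vecV j x = - (- 3 * e x * vecV j x) by ring.
  by rewrite -h; ring.
have C' i : pd 0 (prol 1 i j) x = \sum_k prol 0 i k x * prol 1 k j x + pd 1 (prol 0 i j) x -
   \sum_k prol 1 i k x * prol 0 k j x + (i == idx2)%:R * (3 * e x) * vecV j x.
  by rewrite C; ring.
have i0 : (idx 0 == idx2) = false by [].
have i1 : (idx 1 == idx2) = false by [].
rewrite !sum_ord3 /cov !sum_ord3 !C' eqxx i0 i1 !sum_ord3 /=; ring.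
Qed.

Lemma Ck_vecV k j : (k <= 2)%N -> Ck k O (vecV j).
Proof.
move=> k2; elim/ord3_ind: j => [b|]; rewrite /vecV ?dec_idx ?dec_idx2; first exact: Ck_tensorF.
by apply: Ck_beta; exact: leqW.
Qed.

(** The two mixed second derivatives of the [mu] component differ by [-3 e] times the pairing with
    [V], and [e] has no zero. Differentiability of [Psi] bootstraps to class C^2 through the
    equation itself. *)
Lemma parallel_vecV W (Psi : 'I_3 -> fn) : open W -> W `<=` O -> parallel prol W Psi ->
  forall x, W x -> \sum_j vecV j x * Psi j x = 0.
Proof.
move=> oW WO pP.
have PsiC k i : (k <= 2)%N -> Ck k W (Psi i).
  have Pc x j : W x -> {for x, continuous (Psi j)}.
    by move=> Wx; apply: differentiable_continuous; have [d _] := pP x Wx j; exact: d.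
  elim: k i => [|k IH] i k2; first by move=> x Wx; exact: Pc.
  split => [x Wx a|a].
    by apply: diff_derivable; have [d _] := pP x Wx i; exact: d.
  have Ak c : Ck k W (prol a i c).
    apply: Ck_subset WO _; apply: Ck_prol; exact: leq_trans (ltnW k2) _.
  have H c := IH c (ltnW k2).
  have := Ck_add oW (Ck_add oW (Ck_mul oW (Ak (idx 0)) (H (idx 0)))
    (Ck_mul oW (Ak (idx 1)) (H (idx 1)))) (Ck_mul oW (Ak idx2) (H idx2)).
  apply: Ck_eq => // x Wx; have [_ ->] := pP x Wx i.
  by rewrite /lin sum_ord3.
have pdE a i x : W x -> pd a (Psi i) x = lin (conn prol a x) (fun j => Psi j x) i.
  by move=> Wx; have [_ h] := pP x Wx i; exact: h.
have pd2 c a i x : W x -> pd c (pd a (Psi i)) x =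
    lin (dconn prol c a x) (fun j => Psi j x) i + lin (conn prol a x) (lin (conn prol c x) (fun j => Psi j x)) i.
  move=> Wx.
  rewrite (@pd_eq _ W _ (fun x => lin (conn prol a x) (fun j => Psi j x) i) c x oW _ Wx); last first.
    by move=> y; exact: pdE.
  apply: pd_val.
  have -> : (fun x => lin (conn prol a x) (fun j => Psi j x) i) = \sum_j (fun x => prol a i j x * Psi j x).
    by apply/funext => y; rewrite fct_sumE.
  have H j : is_derive x (ee c) (fun y => prol a i j y * Psi j y)
     (pd c (prol a i j) x * Psi j x + prol a i j x * pd c (Psi j) x).
    apply: is_derive_mul; first exact: is_derive_pd (Ck_prol a i j (isT : (1 <= 3)%N)) (WO _ Wx).
    exact: is_derive_pd (PsiC 1%N j isT) Wx.
  apply: is_derive_val (is_derive_sum H) _.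
  rewrite big_split/=; congr (_ + _); apply: eq_bigr => j _; by rewrite pdE.
move=> x Wx; have Ox := WO x Wx.
have := pdC 1 0 oW (PsiC 2%N idx2 isT) Wx; rewrite !pd2// prol_flat// eqxx mul1r.
set Z := lin (dconn prol 0 1 x) _ _ + _; set c := _ * e x; set S := \sum_j _ => h.
have /eqP : c * S = 0 by lra.
rewrite mulf_eq0 => /orP[|/eqP//].
by rewrite mulf_eq0 oppr_eq0 pnatr_eq0/= (negPf (eps_neq0 Ox)).
Qed.

(* [D_a V = (M_a, N_a) - 2 theta_a V] *)
Definition vecMN a (j : 'I_3) : fn := dec (tensorM G eps a) (tensorN G eps a) j.

Lemma tensorY_skew c b : tensorY G 1 0 b = (fun x => - tensorY G 0 1 b x) /\
  tensorY G c c b = fun=> 0.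
Proof. by split; apply/funext => x; rewrite /tensorY ?subrr ?mulr0//; ring. Qed.

Lemma tensorB_skew a b x : tensorB G b a x = - tensorB G a b x.
Proof. by rewrite /tensorB opprB. Qed.

Lemma nablaB_skew c a b x : O x -> nabla2 G (tensorB G) c b a x = - nabla2 G (tensorB G) c a b x.
Proof.
move=> Ox; have B1 i j : Ck 1 O (tensorB G i j) by exact: Ck_tensorB.
rewrite /nabla2 (@pd_eq _ O _ (fun y => - tensorB G a b y) c x oO _ Ox); last first.
  by move=> y _; exact: tensorB_skew.
rewrite pd_opp// !sum_ord2 !(tensorB_skew _ a) !(tensorB_skew b _).
rewrite [tensorB G b 0 x]tensorB_skew [tensorB G b 1 x]tensorB_skew; ring.
Qed.

Lemma nablaBaa c a x : O x -> nabla2 G (tensorB G) c a a x = 0.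
Proof. by move=> Ox; have := nablaB_skew c a a Ox; lra. Qed.

(** For each [c], the one independent component of [Y_dec - nabla_c B_de]; raising the index of this
    covector gives [F] up to a scalar factor. *)
Definition curlP c : fn := fun x => tensorY G 0 1 c x - nabla2 G (tensorB G) c 0 1 x.

Lemma tensorF_curlP x : O x -> tensorF G eps 0 x = 2 / 3 * curlP 1 x / e x ^+ 2 /\
  tensorF G eps 1 x = - (2 / 3) * curlP 0 x / e x ^+ 2.
Proof.
move=> Ox; have [-> ->] := tensorFE Ox; have e0 : e x != 0 by exact: eps_neq0.
rewrite /curlP /tensorY !(nablaB_skew _ 0 1 Ox); split; by field.
Qed.

Lemma pd_tensorF a x : O x ->
  pd a (tensorF G eps 0) x = 2 / 3 * (pd a (curlP 1) x / e x ^+ 2 - 2 * curlP 1 x * pd a e x / e x ^+ 3) /\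
  pd a (tensorF G eps 1) x = - (2 / 3) * (pd a (curlP 0) x / e x ^+ 2 - 2 * curlP 0 x * pd a e x / e x ^+ 3).
Proof.
move=> Ox; have e0 : e x != 0 by exact: eps_neq0.
have z1 c : Ck 1 O (curlP c).
  apply: Ck_sub => //; first exact: Ck_tensorY.
  by apply: Ck_nabla2 => // *; exact: Ck_tensorB.
have e1 : Ck 1 O (fun y => e y * e y) by apply: Ck_mul => //; exact: Ck_eps.
have H (k : R) c f : (forall y, O y -> f y = k * curlP c y / e y ^+ 2) ->
    pd a f x = k * (pd a (curlP c) x / e x ^+ 2 - 2 * curlP c x * pd a e x / e x ^+ 3).
  move=> fE.
  rewrite (@pd_eq _ O _ (fun y => k * (curlP c y / (e y * e y))) a x oO _ Ox); last first.
    by move=> y /fE ->; rewrite expr2 mulrA.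
  rewrite pd_scale//; last first.
    by apply: Ck_mul => //; apply: Ck_inv => // y Oy; rewrite mulf_neq0// eps_neq0.
  rewrite (pd_div a (z1 c) e1 Ox) ?mulf_neq0// pd_mul//; try exact: Ck_eps.
  by field.
by split; apply: H => y Oy; have [f0 f1] := tensorF_curlP Oy; first [exact: f0|exact: f1].
Qed.

(** The term in [theta] has the same coefficient in both slots: [F] contains the inverse volume form
    twice, while [beta] contains it once and the connection on the second component brings the other
    [theta]. *)
Lemma covD_vecV a j x : O x ->
  covD a vecV j x = vecMN a j x - 2 * theta G eps a x * vecV j x.
Proof.
move=> Ox; have e0 : e x != 0 by exact: eps_neq0.
have -> : covD a vecV j x = dvec (dualD G eps a (tensorF G eps, beta G eps)) j x.
  by rewrite dualD_covD//; apply: cov_eq.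
have [F0 F1] := tensorF_curlP Ox; have [dF0 dF1] := pd_tensorF a Ox.
have B1 i k : Ck 1 O (tensorB G i k) by exact: Ck_tensorB.
have nB1 c i k : Ck 1 O (nabla2 G (tensorB G) c i k).
  by apply: Ck_nabla2 => // *; exact: Ck_tensorB.
have Y1 c d b : Ck 1 O (tensorY G c d b) by exact: Ck_tensorY.
elim/ord3_ind: j => [b|].
  rewrite /dvec /vecMN /vecV !dec_idx /dualD /= /tensorM !sum_ord2.
  have [u00 u01 u10 u11] := epsupE Ox.
  have nY c : nabla3 G (tensorY G) a 0 1 c x = nabla3 G (tensorY G) a 1 0 c x +
      2 * (pd a (tensorY G 0 1 c) x - (G 0 a 0 x + G 1 a 1 x) * tensorY G 0 1 c x -
           (G 0 a c x * tensorY G 0 1 0 x + G 1 a c x * tensorY G 0 1 1 x)).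
    rewrite /nabla3 !sum_ord2.
    have Y00 k := (tensorY_skew 0 k).2; have Y11 k := (tensorY_skew 1 k).2.
    by rewrite !(tensorY_skew 0 _).1 !Y00 !Y11 pd_opp//; ring.
  have nnB c : nabla3 G (nabla2 G (tensorB G)) a c 0 1 x = nabla3 G (nabla2 G (tensorB G)) a c 1 0 x +
      2 * (pd a (nabla2 G (tensorB G) c 0 1) x - (G 0 a 0 x + G 1 a 1 x) * nabla2 G (tensorB G) c 0 1 x -
           (G 0 a c x * nabla2 G (tensorB G) 0 0 1 x + G 1 a c x * nabla2 G (tensorB G) 1 0 1 x)).
    rewrite /nabla3 !sum_ord2 !(nablaBaa _ _ Ox).
    rewrite (@pd_eq _ O (nabla2 G (tensorB G) c 1 0) (fun y => - nabla2 G (tensorB G) c 0 1 y) a x oO _ Ox); last first.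
      by move=> y Oy; exact: nablaB_skew.
    by rewrite pd_opp// !(nablaB_skew _ 0 1 Ox); ring.
  have pz c : pd a (curlP c) x = pd a (tensorY G 0 1 c) x - pd a (nabla2 G (tensorB G) c 0 1) x.
    by rewrite /curlP pd_sub.
  rewrite (thetaE _ Ox).
  by elim/ord2_ind: b; rewrite ?dF0 ?dF1 F0 F1 !u00 !u01 !u10 !u11 !nY !nnB !pz /curlP;
    rewrite /=; field.
rewrite /dvec /vecMN /vecV !dec_idx2 /dualD /= /tensorN !sum_ord2 (thetaE _ Ox).
have [u00 u01 u10 u11] := epsupE Ox; rewrite u00 u01 u10 u11 (nablaB_skew _ 0 1 Ox).
have bE y : O y -> beta G eps y = 2 * tensorB G 0 1 y / e y.
  by move=> Oy; rewrite (betaE Oy).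
have B2 : Ck 1 O (fun y => 2 * tensorB G 0 1 y) by apply: Ck_mul => //; exact: Ck_cst.
rewrite (bE x Ox) (@pd_eq _ O _ (fun y => 2 * tensorB G 0 1 y / e y) a x oO bE Ox).
rewrite (pd_div a B2 (Ck_eps 0 1 (isT : (1 <= 4)%N)) Ox e0) (pd_scale 2 a (B1 0 1) Ox) /nabla2 !sum_ord2.
have Baa k : tensorB G k k x = 0 by rewrite /tensorB subrr.
by rewrite !Baa -/e; field.
Qed.

(** The terms [-2 theta_a V] drop out of the determinant, which leaves the rows [(M_a, N_a)]. *)
Lemma invNE x : O x -> invN G eps x =
  det3 (fun j => vecV j x) (fun j => covD 0 vecV j x) (fun j => covD 1 vecV j x).
Proof.
move=> Ox; rewrite /det3 !(covD_vecV _ _ Ox) /vecMN /vecV !dec_idx !dec_idx2.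
rewrite /invN !sum_ord2 !(epsaa _ Ox) (eps10 Ox) -/e.
have e0 : e x != 0 by exact: eps_neq0.
have [-> -> -> ->] := epsupE Ox; by field.
Qed.

(** A 2 by 2 minor of the rows [V] and [D_a V], in which the contributions of [theta] cancel. *)
Lemma tensorTE a b x : O x -> tensorT G eps a b x =
  covD a vecV idx2 x * vecV (idx b) x - covD a vecV (idx b) x * vecV idx2 x.
Proof.
move=> Ox; rewrite !(covD_vecV _ _ Ox) /vecMN /vecV !dec_idx !dec_idx2 /tensorT; ring.
Qed.

Local Transparent idx idx2.

Lemma idxE : [/\ idx 0 = ord0, idx 1 = lift ord0 ord0 & idx2 = lift ord0 (lift ord0 ord0)].
Proof. by split; apply/val_inj. Qed.

Lemma det2E (A : 'M[R]_2) : \det A = A 0 0 * A 1 1 - A 0 1 * A 1 0.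
Proof.
rewrite (expand_det_row _ 0) sum_ord2 /cofactor !det_mx11 !mxE /=.
have -> : lift (0 : 'I_2) 0 = 1 :> 'I_2 by apply/val_inj.
have -> : lift (1 : 'I_2) 0 = 0 :> 'I_2 by apply/val_inj.
by rewrite /= expr0 expr1 mul1r mulN1r mulrN.
Qed.

Lemma det_rows3 (u v w : 'rV[R]_3) :
  \det (\matrix_(i < 3) [:: u; v; w]`_i) = det3 (fun j => u 0 j) (fun j => v 0 j) (fun j => w 0 j).
Proof.
rewrite /det3; have [-> -> ->] := idxE.
rewrite (expand_det_row _ 0) !big_ord_recl big_ord0 addr0 /cofactor !det2E !mxE /=.
have E1 : lift (lift ord0 ord0) 0 = ord0 :> 'I_3 by apply/val_inj.
have E2 : lift (lift ord0 ord0) 1 = lift ord0 (lift ord0 ord0) :> 'I_3 by apply/val_inj.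
have E3 : lift (lift ord0 (lift ord0 ord0)) 0 = ord0 :> 'I_3 by apply/val_inj.
have E4 : lift (lift ord0 (lift ord0 ord0)) 1 = lift ord0 ord0 :> 'I_3 by apply/val_inj.
have E5 : lift 0 0 = lift ord0 ord0 :> 'I_3 by apply/val_inj.
have E6 : lift 0 1 = lift ord0 (lift ord0 ord0) :> 'I_3 by apply/val_inj.
have E7 : lift ord0 1 = lift ord0 (lift ord0 ord0) :> 'I_3 by apply/val_inj.
rewrite !E1 !E2 !E3 !E4 ?E5 ?E6 ?E7 /bump /=; ring.
Qed.

Lemma dual_rowE s x j : dual_row (R := R) s x 0 j = dvec s j x.
Proof.
elim/ord3_ind: j => [b|]; rewrite /dvec ?dec_idx ?dec_idx2 /dual_row.
  by apply: etrans (row_mxEl _ _ _ _) _; rewrite mxE.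
by apply: etrans (row_mxEr _ _ _ _) _; rewrite mxE.
Qed.

Local Opaque idx idx2.

Lemma dualDD_covD b c s j x : O x -> (forall i, Ck 2 O (dvec s i)) ->
  dvec (dualDD G eps b c s) j x =
  covD b (covD c (dvec s)) j x - \sum_d G d b c x * covD d (dvec s) j x.
Proof.
move=> Ox s2.
have -> : dvec (dualDD G eps b c s) j x = dvec (dualD G eps b (dualD G eps c s)) j x -
    \sum_d G d b c x * dvec (dualD G eps d s) j x.
  by elim/ord3_ind: j => [k|]; rewrite /dvec ?dec_idx ?dec_idx2 /dualDD /=;
    congr (_ - _); apply: eq_bigr => d _; rewrite ?dec_idx ?dec_idx2.
rewrite dualD_covD//; congr (_ - _).
  by apply: (cov_eq _ oO) => // i y Oy; rewrite dualD_covD.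
by apply: eq_bigr => d _; rewrite dualD_covD.
Qed.

Lemma invSE a b c x : O x -> Defs.invS G eps a b c x =
  det3 (fun j => vecV j x) (fun j => covD a vecV j x)
    (fun j => 2^-1 * (covD b (covD c vecV) j x - \sum_d G d b c x * covD d vecV j x +
                      (covD c (covD b vecV) j x - \sum_d G d c b x * covD d vecV j x))).
Proof.
move=> Ox; rewrite /Defs.invS det_rows3; congr det3; apply/funext => j.
- by rewrite dual_rowE.
- by rewrite dual_rowE dualD_covD.
- rewrite mxE mxE !dual_rowE !dualDD_covD//; move=> i; exact: Ck_vecV.
Qed.

End Chart.

(** * Parallel sections and invariants in one chart *)

Section ChartConsequences.
Context {R : realType}.
Local Notation fn := ('rV[R]_2 -> R).
Local Notation ee a := (delta_mx 0 a : 'rV[R]_2).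

Record chart_data (O : set 'rV[R]_2) (G : 'I_2 -> 'I_2 -> 'I_2 -> fn)
    (eps : 'I_2 -> 'I_2 -> fn) : Prop := ChartData {
  cd_open : open O;
  cd_G : forall a b c, Ck 4 O (G a b c);
  cd_sym : forall x, O x -> forall a b c, G a b c x = G a c b x;
  cd_eps : forall a b, Ck 4 O (eps a b);
  cd_eps_neq0 : forall x, O x -> eps 0 1 x != 0;
  cd_eps_skew : forall x, O x -> forall a b, eps a b x = - eps b a x }.

Variables (O : set 'rV[R]_2) (G : 'I_2 -> 'I_2 -> 'I_2 -> fn) (eps : 'I_2 -> 'I_2 -> fn).
Hypothesis cd : chart_data O G eps.
Implicit Types (W : set 'rV[R]_2) (q x : 'rV[R]_2).

Let oO := cd_open cd.
Let G4 := cd_G cd.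
Let Gsym := cd_sym cd.
Let eps4 := cd_eps cd.
Let eps0 := cd_eps_neq0 cd.
Let epss := cd_eps_skew cd.
Local Notation A := (prol G eps).
Local Notation V := (vecV G eps).

Let A3 a i j : Ck 3 O (A a i j). Proof. exact: Ck_prol. Qed.
Let V2 j : Ck 2 O (V j). Proof. exact: Ck_vecV. Qed.

Lemma prol_flat_ker (y : 'I_3 -> R) x : O x -> \sum_j V j x * y j = 0 -> forall i,
  lin (dconn A 1 0 x) y i + lin (conn A 0 x) (lin (conn A 1 x) y) i =
  lin (dconn A 0 1 x) y i + lin (conn A 1 x) (lin (conn A 0 x) y) i.
Proof. by move=> Ox Vy i; rewrite (prol_flat oO G4 Gsym eps4 eps0 epss)// Vy mulr0 addr0. Qed.

Lemma vecV_annihilates W (Psi : 'I_3 -> fn) x : open W -> W `<=` O -> parallel A W Psi -> W x ->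
  \sum_j V j x * Psi j x = 0.
Proof. by move=> oW WO pP Wx; apply: (parallel_vecV oO G4 Gsym eps4 eps0 epss oW WO pP Wx). Qed.

Section Rank.
Variables (W : set 'rV[R]_2).
Hypotheses (oW : open W) (WO : W `<=` O).

Lemma covD_annihilates (Psi : 'I_3 -> fn) x : parallel A W Psi -> W x ->
  [/\ dot (fun j => V j x) (fun j => Psi j x) = 0,
      forall a, dot (fun j => cov A a V j x) (fun j => Psi j x) = 0 &
      forall a b, dot (fun j => cov A a (cov A b V) j x) (fun j => Psi j x) = 0].
Proof.
move=> pP Wx.
have h0 y : W y -> \sum_j V j y * Psi j y = 0 by exact: vecV_annihilates.
have h1 a y (Wy : W y) := annihilated_cov a oW WO pP (fun i => CkS oO (V2 i)) h0 Wy.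
split=> [|a|a b]; [exact: h0|exact: h1|].
have W1 i : Ck 1 O (cov A b V i) by exact: (Ck_cov oO A3).
exact: (annihilated_cov a oW WO pP W1 (h1 b) Wx).
Qed.

Lemma parallel_invariants (Psi : 'I_3 -> fn) x : parallel A W Psi -> W x ->
  (exists j, Psi j x != 0) ->
  invN G eps x = 0 /\ forall a b c, Defs.invS G eps a b c x = 0.
Proof.
move=> pP Wx Px; have [h0 h1 h2] := covD_annihilates pP Wx.
split=> [|a b c].
  by rewrite (invNE oO G4 eps4 eps0 epss (WO Wx)); apply: (det3_annihilated h0 (h1 0) (h1 1)).
rewrite (invSE oO G4 eps4 eps0 epss a b c (WO Wx)); apply: (det3_annihilated h0 (h1 a) _ Px).
set u := fun j => cov A b (cov A c V) j x; set v := fun j => cov A c (cov A b V) j x.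
have D (g0 g1 g2 g3 : R) : dot (fun j => 2^-1 * (u j - (g0 * cov A 0 V j x + g1 * cov A 1 V j x) +
    (v j - (g2 * cov A 0 V j x + g3 * cov A 1 V j x)))) (fun j => Psi j x) =
  2^-1 * (dot u (fun j => Psi j x) - (g0 * dot (fun j => cov A 0 V j x) (fun j => Psi j x) +
    g1 * dot (fun j => cov A 1 V j x) (fun j => Psi j x)) + (dot v (fun j => Psi j x) -
    (g2 * dot (fun j => cov A 0 V j x) (fun j => Psi j x) +
    g3 * dot (fun j => cov A 1 V j x) (fun j => Psi j x)))).
  by rewrite !dotE; ring.
transitivity (dot (fun j => 2^-1 * (u j - (G 0 b c x * cov A 0 V j x + G 1 b c x * cov A 1 V j x) +
    (v j - (G 0 c b x * cov A 0 V j x + G 1 c b x * cov A 1 V j x)))) (fun j => Psi j x)).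
  by congr dot; apply/funext => j; rewrite !sum_ord2.
by rewrite D !h1 !h2; ring.
Qed.

Lemma parallel2_tensorT (Psi : 'I_2 -> 'I_3 -> fn) x : (forall k, parallel A W (Psi k)) -> W x ->
  independent (fun k j => Psi k j x) -> forall a b, tensorT G eps a b x = 0.
Proof.
move=> pP Wx ip a b; rewrite (tensorTE oO G4 eps4 eps0 epss a b (WO Wx)).
have h0 k : dot (fun j => V j x) (fun j => Psi k j x) = 0 by have [] := covD_annihilates (pP k) Wx.
have h1 k : dot (fun j => cov A a V j x) (fun j => Psi k j x) = 0.
  by have [] := covD_annihilates (pP k) Wx.
have C j := dot_annihilated2 j ip h0 h1.
have [E0 E1 _] := crossE (fun j => V j x) (fun j => cov A a V j x).
by elim/ord2_ind: b; [have := C (idx 1); rewrite E1|have := C (idx 0); rewrite E0]; lra.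
Qed.

Lemma parallel3_vecV (Psi : 'I_3 -> 'I_3 -> fn) x : (forall k, parallel A W (Psi k)) -> W x ->
  independent (fun k j => Psi k j x) -> forall j, V j x = 0.
Proof.
move=> pP Wx ip; apply: (dot_annihilated3 ip) => k.
by have [] := covD_annihilates (pP k) Wx.
Qed.

End Rank.

Lemma betaE' x : O x -> beta G eps x = 2 / 3 * (ricci G 1 0 x - ricci G 0 1 x) / eps 0 1 x.
Proof. by move=> Ox; rewrite (betaE G eps0 epss Ox) /schouten; field; exact: eps0. Qed.

Lemma beta_ricci x : O x -> (beta G eps x = 0) <-> (forall a b, ricci G a b x = ricci G b a x).
Proof.
move=> Ox; rewrite betaE'//; split=> [/eqP|->]; last by rewrite subrr mulr0 mul0r.
rewrite mulf_eq0 invr_eq0 (negPf (eps0 Ox)) orbF mulf_eq0 subr_eq0 => /orP[|/eqP h].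
  by rewrite mulf_eq0 invr_eq0 !pnatr_eq0.
by elim/ord2_ind; elim/ord2_ind.
Qed.

Lemma vecVE x : (forall j, V j x = 0) <->
  [/\ tensorF G eps 0 x = 0, tensorF G eps 1 x = 0 & beta G eps x = 0].
Proof.
split=> [h|[h0 h1 h2]].
  by have := (h (idx 0), h (idx 1), h idx2); rewrite /vecV !dec_idx dec_idx2 => -[[]].
by apply: ord3_ind => [b|]; rewrite /vecV ?dec_idx ?dec_idx2//; elim/ord2_ind: b.
Qed.

(** If [beta] vanished on [W], so would [B] and its derivative. Then [N] is minus the lowered [F],
    and [T = 0] says that all products [F_a F^b] vanish; hence [F = 0] and [V = 0]. *)
Lemma tensorT_beta_neq0 W x : open W -> W `<=` O ->
  (forall y, W y -> forall a b, tensorT G eps a b y = 0) -> W x -> (exists j, V j x != 0) ->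
  exists2 y, W y & beta G eps y != 0.
Proof.
move=> oW WO T0 Wx [j Vj]; apply: contrapT => /forall2NP b0.
have {}b0 y : W y -> beta G eps y = 0.
  by move=> Wy; apply/eqP/negPn/negP => b; case: (b0 y).
have B0 y a b : W y -> tensorB G a b y = 0.
  move=> Wy; have /(beta_ricci (WO _ Wy)) h := b0 y Wy.
  by rewrite /tensorB /schouten (h a b); ring.
have nB c a b : nabla2 G (tensorB G) c a b x = 0.
  rewrite /nabla2 (pd_eq (g := fun=> 0) c oW _ Wx) => [|y Wy]; last exact: B0.
  rewrite /pd derive_cst !sum_ord2 !B0//; ring.
have NE a : tensorN G eps a x = - lower eps (tensorF G eps) a x.
  rewrite /tensorN big1 ?addr0// => b _; rewrite big1// => c _.
  by rewrite nB mulr0.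
have TE a b : - lower eps (tensorF G eps) a x * tensorF G eps b x = 0.
  by have := T0 x Wx a b; rewrite /tensorT NE (b0 x Wx) mul0r subr0.
have [L0 L1] := lowerE epss (tensorF G eps) (WO _ Wx).
have e0 := eps0 (WO _ Wx).
have sq (f : R) : eps 0 1 x * f ^+ 2 = 0 -> f = 0.
  by move/eqP; rewrite mulf_eq0 (negPf e0) sqrf_eq0 => /eqP.
have F0 : tensorF G eps 0 x = 0 by apply: sq; rewrite -[RHS]oppr0 -(TE 1 0) L1; ring.
have F1 : tensorF G eps 1 x = 0 by apply: sq; rewrite -(TE 0 1) L0; ring.
by move/eqP: Vj; apply; move: j; apply/vecVE; split=> //; exact: b0.
Qed.

Lemma has_par2_tensorT q (d r0 : R) : O q -> 0 < d -> 0 < r0 -> beta G eps q != 0 ->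
  disc q d `<=` O -> (forall x, disc q d x -> forall a b, tensorT G eps a b x = 0) ->
  exists2 r, 0 < r <= r0 & good O A q r /\ has_par A 2 (disc q r).
Proof.
move=> Oq d0 r00 bq dO T0.
apply: (has_par2_near oO A3 V2 prol_flat_ker Oq d0 r00); first by rewrite /vecV dec_idx2.
move=> x xd a; apply: ord3_ind => [b|]; last by rewrite mulrC.
have := T0 x xd a b; rewrite (tensorTE oO G4 eps4 eps0 epss a b (dO _ xd)).
by move/eqP; rewrite subr_eq0 => /eqP.
Qed.

(** [T_a^b] is a minor, so [V] and [D_a V] are independent at [q]. [I_N] places the [D_b V] in their
    span near [q], and [I_S] does the same for the symmetrised second derivatives. *)
Lemma has_par1_invariants q (d r0 : R) a b : O q -> 0 < d -> 0 < r0 -> disc q d `<=` O ->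
  tensorT G eps a b q != 0 -> (forall x, disc q d x -> invN G eps x = 0) ->
  (forall x, disc q d x -> forall a b c, Defs.invS G eps a b c x = 0) ->
  exists2 r, 0 < r <= r0 & good O A q r /\ has_par A 1 (disc q r).
Proof.
move=> Oq d0 r00 dO Tq N0 S0.
apply: (has_par1_near oO A3 V2 prol_flat_ker (a := a) Oq d0 r00).
  rewrite (tensorTE oO G4 eps4 eps0 epss a b Oq) in Tq.
  have [E0 E1 _] := crossE (fun j => V j q) (fun j => cov A a V j q).
  elim/ord2_ind: b Tq => Tq.
    exists (idx 1); rewrite E1; apply: contra Tq => /eqP h; apply/eqP; lra.
  exists (idx 0); rewrite E0; apply: contra Tq => /eqP h; apply/eqP; lra.
move=> x xd; have Ox := dO _ xd.
have D2 c : det3 (fun j => V j x) (fun j => cov A a V j x) (fun j => cov A c V j x) = 0.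
  have := N0 x xd; rewrite (invNE oO G4 eps4 eps0 epss Ox) /det3 => h.
  by elim/ord2_ind: a {Tq}; elim/ord2_ind: c; move: h; rewrite /det3; lra.
move=> c; split=> //.
have := S0 x xd a c a; rewrite (invSE oO G4 eps4 eps0 epss a c a Ox).
(* The commutator is a multiple of [V], so the symmetrised second derivative agrees with [D_c D_a V]
   modulo [V] and the first derivatives, all of which lie in the span. *)
have C j : exists k, cov A a (cov A c V) j x = cov A c (cov A a V) j x + k * V j x /\
    k = (if a == c then 0 else if a == 0 then 3 * eps 0 1 x * V idx2 x else - (3 * eps 0 1 x * V idx2 x)).
  have h := covD_curv oO G4 Gsym eps4 eps0 epss j Ox V2.
  by eexists; split; [|reflexivity]; move: h; elim/ord2_ind: a {Tq D2}; elim/ord2_ind: c; rewrite /=; lra.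
set k := (if a == c then _ else _) in C.
have {}C j : cov A a (cov A c V) j x = cov A c (cov A a V) j x + k * V j x.
  by have [k' [-> ->]] := C j.
have DV : det3 (fun j => V j x) (fun j => cov A a V j x) (fun j => V j x) = 0 by rewrite /det3; ring.
have L (u v w z0 z1 t : 'I_3 -> R) (g0 g1 g2 g3 : R) : det3 u v w =
    det3 u v (fun j => 2^-1 * (w j - (g0 * z0 j + g1 * z1 j) + (w j + k * t j - (g2 * z0 j + g3 * z1 j)))) +
    2^-1 * ((g0 + g2) * det3 u v z0 + (g1 + g3) * det3 u v z1 - k * det3 u v t).
  by rewrite /det3; field.
move=> S; rewrite (L _ _ (fun j => cov A c (cov A a V) j x) (fun j => cov A 0 V j x) (fun j => cov A 1 V j x) (fun j => V j x)
  (G 0 c a x) (G 1 c a x) (G 0 a c x) (G 1 a c x)) DV !D2 !mulr0 addr0 subr0 mulr0 addr0.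
by rewrite -[RHS]S; congr det3; apply/funext => j; rewrite !sum_ord2 C.
Qed.

Lemma has_par3_vecV q r : good O A q r -> (forall x, disc q r x -> forall j, V j x = 0) ->
  has_par A 3 (disc q r).
Proof. exact: (has_par3 oO A3 prol_flat_ker). Qed.

Lemma has_par2_half q r : good O A q r ->
  (forall l t, 0 < t -> (exists z, (disc q r `&` half q l t) z) ->
     has_par A 2 (disc q r `&` half q l t)) -> has_par A 2 (disc q r).
Proof. exact: (has_par2_halves oO A3 V2 prol_flat_ker vecV_annihilates). Qed.

(** * Projective flatness *)

Local Notation P := (schouten G).

Lemma parallel_Ck1 W (Psi : 'I_3 -> fn) i : open W -> W `<=` O -> parallel A W Psi -> Ck 1 W (Psi i).
Proof.
move=> oW WO pP.
have Pc x j : W x -> {for x, continuous (Psi j)}.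
  by move=> Wx; apply: differentiable_continuous; have [d _] := pP x Wx j; exact: d.
split=> [x Wx a|a]; first by apply: diff_derivable; have [d _] := pP x Wx i; exact: d.
apply: (@Ck_eq _ 0 W (fun x => \sum_j A a i j x * Psi j x)) => //.
  by move=> x Wx; have [_ /(_ a) ->] := pP x Wx i.
move=> x Wx; apply: continuous_at_sum => j; apply: continuous_atM; last exact: Pc.
exact: (Ck_cont oO (A3 a i j) (WO _ Wx)).
Qed.

Lemma curvature_schouten x c b : O x -> P 1 0 x = P 0 1 x ->
  curvature G 0 1 c b x = (c == 0)%:R * P 1 b x - (c == 1)%:R * P 0 b x.
Proof.
move=> Ox Psym; have [R0 R1] := curvature_ricci G b x.
have sym : ricci G 1 0 x = ricci G 0 1 x by move: Psym; rewrite /schouten; lra.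
have PE a : P a b x = ricci G a b x.
  by rewrite /schouten; elim/ord2_ind: a; elim/ord2_ind: b {R0 R1}; rewrite ?sym; lra.
by elim/ord2_ind: c; rewrite !PE /= ?R0 ?R1; ring.
Qed.

Section ProjectiveChange.
Variables (W : set 'rV[R]_2) (U : 'I_2 -> fn).
Hypotheses (oW : open W) (WO : W `<=` O) (U1 : forall a, Ck 1 W (U a)).
Hypothesis Psym : forall x, W x -> P 1 0 x = P 0 1 x.

Definition proj_conn a b d : fn := fun x => G a b d x + (a == b)%:R * U d x + (a == d)%:R * U b x.

Let GW k a b c : (k <= 4)%N -> Ck k W (G a b c).
Proof. by move=> k4; apply: Ck_subset WO _; exact: Ck_G. Qed.

Let PW k a b : (k <= 3)%N -> Ck k W (P a b).
Proof. by move=> k3; apply: Ck_subset WO _; exact: Ck_schouten. Qed.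

Let pd_proj c a b d x : W x -> pd c (proj_conn a b d) x =
  pd c (G a b d) x + (a == b)%:R * pd c (U d) x + (a == d)%:R * pd c (U b) x.
Proof.
move=> Wx; have H k (f : fn) : Ck 1 W f -> Ck 1 W (fun x => k * f x).
  by move=> f1; apply: Ck_mul => //; exact: Ck_cst.
rewrite /proj_conn (pd_add c (Ck_add oW (GW _ _ _ _) (H _ _ (U1 d))) (H _ _ (U1 b)) Wx)//.
by rewrite (pd_add c (GW _ _ _ _) (H _ _ (U1 d)) Wx)// !(pd_scale _ _ (U1 _) Wx).
Qed.

Let curv_proj c d x : W x -> curvature proj_conn 0 1 c d x = curvature G 0 1 c d x +
  ((c == 1)%:R * pd 0 (U d) x + (c == d)%:R * pd 0 (U 1) x) -
  ((c == 0)%:R * pd 1 (U d) x + (c == d)%:R * pd 1 (U 0) x) +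
  \sum_e (proj_conn c 0 e x * proj_conn e 1 d x - proj_conn c 1 e x * proj_conn e 0 d x -
          (G c 0 e x * G e 1 d x - G c 1 e x * G e 0 d x)).
Proof. by move=> Wx; rewrite /curvature !pd_proj// !sum_ord2; ring. Qed.

(** [nabla_a U_b = P_ab + U_a U_b] says that the Schouten tensor of the changed connection vanishes,
    and in dimension two this tensor determines the curvature. *)
Lemma proj_flat : (forall x, W x -> forall a b, pd a (U b) x =
    \sum_c G c a b x * U c x + P a b x + U a x * U b x) ->
  forall x, W x -> forall a b c d, curvature proj_conn a b c d x = 0.
Proof.
move=> HU x Wx.
have H c d : curvature proj_conn 0 1 c d x = 0.
  rewrite curv_proj// curvature_schouten ?Psym//; last exact: WO.
  rewrite !HU// !sum_ord2 /proj_conn !(Gsym (WO Wx) _ 1 0).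
  by elim/ord2_ind: c; elim/ord2_ind: d; rewrite ?eqxx /= ?(Gsym (WO Wx) _ 1 0) ?(Psym Wx); ring.
elim/ord2_ind; elim/ord2_ind => c d; [|exact: H| |].
- by rewrite /curvature subrr add0r big1// => e _; rewrite subrr.
- by have := H c d; rewrite /curvature !sum_ord2; lra.
- by rewrite /curvature subrr add0r big1// => e _; rewrite subrr.
Qed.

Hypothesis flat0 : forall x, W x -> forall c d, curvature proj_conn 0 1 c d x = 0.

(** The four components of the curvature of the changed connection are affine in the four
    derivatives of [U] and determine them. *)
Let U_pd x a b : W x -> pd a (U b) x =
  G 0 a b x * U 0 x + G 1 a b x * U 1 x + P a b x + U a x * U b x.
Proof.
move=> Wx; have H c d := flat0 Wx c d.
have {}H c d := etrans (esym (curv_proj c d Wx)) (H c d).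
have H00 := H 0 0; have H01 := H 0 1; have H10 := H 1 0; have H11 := H 1 1.
move: H00 H01 H10 H11.
rewrite !(curvature_schouten _ _ (WO Wx) (Psym Wx)) !sum_ord2 /proj_conn !(Gsym (WO Wx) _ 1 0).
rewrite ?eqxx /= ?(Psym Wx) => H00 H01 H10 H11.
by elim/ord2_ind: a; elim/ord2_ind: b; rewrite ?(Gsym (WO Wx) _ 1 0) ?(Psym Wx);
  [clear H00 H01 H11|clear H01 H10|clear H01 H10|clear H00 H10 H11]; lra.
Qed.

Let UE1 a b : Ck 1 W (fun x => G 0 a b x * U 0 x + G 1 a b x * U 1 x + P a b x + U a x * U b x).
Proof.
apply: Ck_add => //; last exact: Ck_mul.
apply: Ck_add => //; last exact: PW.
by apply: Ck_add => //; apply: Ck_mul => //; exact: GW.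
Qed.

(** [U] is given of class C^1 only; the equation for its derivatives raises this to C^2, enough to
    commute mixed derivatives. *)
Let U2 b : Ck 2 W (U b).
Proof.
split=> [|a]; first by case: (U1 b).
by apply: Ck_eq (UE1 a b) => // x Wx; rewrite U_pd.
Qed.

(** The integrability condition of [nabla_a U_b = P_ab + U_a U_b]. In dimension two the curvature
    terms cancel against the quadratic ones, and only the curl of [P] is left. *)
Lemma proj_flat_cotton x b : W x -> nabla2 G P 0 1 b x = nabla2 G P 1 0 b x.
Proof.
move=> Wx; have Ox := WO Wx.
have E a c : pd c (pd a (U b)) x = pd c (G 0 a b) x * U 0 x + G 0 a b x * pd c (U 0) x +
    (pd c (G 1 a b) x * U 1 x + G 1 a b x * pd c (U 1) x) + pd c (P a b) x +
    (pd c (U a) x * U b x + U a x * pd c (U b) x).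
  rewrite (pd_eq c oW (fun y Wy => U_pd a b Wy) Wx).
  have GU k : Ck 1 W (fun x => G k a b x * U k x) by apply: Ck_mul => //; exact: GW.
  have S1 : Ck 1 W (fun x => G 0 a b x * U 0 x + G 1 a b x * U 1 x) by exact: Ck_add.
  have S2 : Ck 1 W (fun x => G 0 a b x * U 0 x + G 1 a b x * U 1 x + P a b x).
    by apply: Ck_add => //; exact: PW.
  rewrite (pd_add c S2 (Ck_mul oW (U1 a) (U1 b)) Wx) (pd_add c S1 (PW _ _ _) Wx)//.
  rewrite (pd_add c (GU 0) (GU 1) Wx) (pd_mul c (U1 a) (U1 b) Wx).
  by rewrite !(pd_mul c (GW _ _ _ _) (U1 _) Wx).
have := pdC 0 1 oW (U2 b) Wx; rewrite !E.
have C c := curvature_schouten c b Ox (Psym Wx).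
have C0 := congr1 (fun z => z * U 0 x) (C 0); have C1 := congr1 (fun z => z * U 1 x) (C 1).
move: C0 C1; rewrite /curvature !U_pd// !sum_ord2 /nabla2 !sum_ord2 ?eqxx /=.
rewrite !(Gsym Ox _ 1 0).
by elim/ord2_ind: b {E C}; rewrite ?(Gsym Ox _ 1 0) ?(Psym Wx) => C0 C1; lra.
Qed.

Lemma proj_flat_vecV x : W x -> forall j, V j x = 0.
Proof.
move=> Wx; apply/vecVE.
have B0 y a b : W y -> tensorB G a b y = 0.
  by move=> Wy; have := Psym Wy; rewrite /tensorB; elim/ord2_ind: a; elim/ord2_ind: b; lra.
have nB c a b : nabla2 G (tensorB G) c a b x = 0.
  rewrite /nabla2 (pd_eq (g := fun=> 0) c oW _ Wx) => [|y Wy]; last exact: B0.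
  rewrite /pd derive_cst !sum_ord2 !B0//; ring.
have [-> ->] := tensorFE G eps0 epss (WO Wx).
rewrite !proj_flat_cotton// !nB (betaE G eps0 epss (WO Wx)) (Psym Wx).
by split; rewrite ?subrr ?addr0 ?oppr0 ?mulr0 mul0r.
Qed.

End ProjectiveChange.

(* The projective change that flattens the connection is read off two
   parallel sections with independent one-form parts. *)
Section FlatteningForm.
Variables (W : set 'rV[R]_2) (K L : 'I_3 -> fn).
Hypotheses (oW : open W) (WO : W `<=` O) (pK : parallel A W K) (pL : parallel A W L).
Hypothesis Psym : forall x, W x -> P 1 0 x = P 0 1 x.

Let w x := K (idx 0) x * L (idx 1) x - K (idx 1) x * L (idx 0) x.
Hypothesis w0 : forall x, W x -> w x != 0.

(** Minus the logarithmic covariant derivative of the two-form [K /\ L]: as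
    [nabla_a K_b = eps_ab mu], differentiating this two-form gives [- flattening a] times it. *)
Definition flattening a : fn := fun x =>
  eps 0 1 x * (K idx2 x * L (idx a) x - L idx2 x * K (idx a) x) / w x.

Let K1 i : Ck 1 W (K i). Proof. exact: parallel_Ck1. Qed.
Let L1 i : Ck 1 W (L i). Proof. exact: parallel_Ck1. Qed.
Let e1 : Ck 1 W (eps 0 1). Proof. by apply: Ck_subset WO _; exact: Ck_eps. Qed.
Let X1 a : Ck 1 W (fun x => K idx2 x * L (idx a) x - L idx2 x * K (idx a) x).
Proof. exact: (Ck_sub oW (Ck_mul oW (K1 _) (L1 _)) (Ck_mul oW (L1 _) (K1 _))). Qed.
Let w1 : Ck 1 W w.
Proof. exact: (Ck_sub oW (Ck_mul oW (K1 _) (L1 _)) (Ck_mul oW (K1 _) (L1 _))). Qed.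

Lemma flattening_Ck1 a : Ck 1 W (flattening a).
Proof.
rewrite /flattening; apply: (Ck_mul oW (Ck_mul oW e1 (X1 a)) _).
exact: Ck_inv.
Qed.

Let pdf (Psi : 'I_3 -> fn) a b x : parallel A W Psi -> W x -> pd a (Psi (idx b)) x =
   G 0 a b x * Psi (idx 0) x + G 1 a b x * Psi (idx 1) x + eps a b x * Psi idx2 x.
Proof.
move=> pP Wx; have [_ /(_ a) ->] := pP x Wx (idx b).
by rewrite /lin /conn sum_ord3 !prol_KK prol_Kmu.
Qed.

Let pdmu (Psi : 'I_3 -> fn) a x : parallel A W Psi -> W x -> pd a (Psi idx2) x =
   mu_coef G a 0 x / eps 0 1 x * Psi (idx 0) x + mu_coef G a 1 x / eps 0 1 x * Psi (idx 1) x +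
   (G 0 a 0 x + G 1 a 1 x - pd a (eps 0 1) x / eps 0 1 x) * Psi idx2 x.
Proof.
move=> pP Wx; have [_ /(_ a) ->] := pP x Wx idx2.
by rewrite /lin /conn sum_ord3 !(prol_mu _ eps0 epss _ _ (WO Wx)) (prol_mumu _ eps0 epss _ (WO Wx)).
Qed.

Lemma flattening_pd x : W x -> forall a b, pd a (flattening b) x =
  \sum_c G c a b x * flattening c x + P a b x + flattening a x * flattening b x.
Proof.
move=> Wx a b; have Ox := WO Wx; have ex := eps0 Ox; have wx := w0 Wx.
rewrite /flattening (pd_div a (Ck_mul oW e1 (X1 b)) w1 Wx wx) (pd_mul a e1 (X1 b) Wx).
rewrite (pd_sub a (Ck_mul oW (K1 _) (L1 _)) (Ck_mul oW (L1 _) (K1 _)) Wx).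
rewrite /w (pd_sub a (Ck_mul oW (K1 _) (L1 _)) (Ck_mul oW (K1 _) (L1 _)) Wx).
rewrite !(pd_mul a (K1 _) (L1 _) Wx) !(pd_mul a (L1 _) (K1 _) Wx).
rewrite !(pdf _ _ pK Wx) !(pdf _ _ pL Wx) !(pdmu _ pK Wx) !(pdmu _ pL Wx) sum_ord2.
have E00 : eps 0 0 x = 0 by have := epss Ox 0 0; lra.
have E11 : eps 1 1 x = 0 by have := epss Ox 1 1; lra.
have E10 : eps 1 0 x = - eps 0 1 x by exact: epss.
rewrite /w in wx; move: (Psym Wx) => Ps; rewrite /mu_coef.
by elim/ord2_ind: a; elim/ord2_ind: b; rewrite /= ?E00 ?E11 ?E10 ?(Gsym Ox _ 1 0) ?Ps; field; rewrite ?ex ?wx.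
Qed.

End FlatteningForm.

End ChartConsequences.
(** * Curves and geodesics *)

Section Curves.
Context {R : realType}.
Local Notation fn := ('rV[R]_2 -> R).
Local Notation ee a := (delta_mx 0 a : 'rV[R]_2).
Implicit Types (O W : set 'rV[R]_2) (x : 'rV[R]_2) (t : R).

Lemma continuous_coord (g : R -> 'rV[R]_2) t :
  (forall a, {for t, continuous (fun s => g s 0 a)}) -> {for t, continuous g}.
Proof.
move=> gc; apply/cvgrPdist_lt => e e0.
have : \forall s \near t, forall a : 'I_2, `|g t 0 a - g s 0 a| < e.
  apply: (@filter_forall _ _ (fun (a : 'I_2) s => `|g t 0 a - g s 0 a| < e) (nbhs t)) => a.
  by have /cvgrPdist_lt/(_ e e0) := gc a.
by apply: filterS => s h; apply/rV_norm_lt => // a; rewrite !mxE; exact: h.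
Qed.

Lemma derive_coord_diff (g : R -> 'rV[R]_2) t (v : 'I_2 -> R) :
  (forall a, is_derive t 1 (fun s => g s 0 a) (v a)) ->
  differentiable g t /\ 'd g t 1 = v 0 *: ee 0 + v 1 *: ee 1.
Proof.
move=> gv.
have gE : g = (fun s => g s 0 0 *: ee 0) \+ (fun s => g s 0 1 *: ee 1).
  by apply/funext => s; rewrite {1}[g s]rV2E.
have d a : is_diff t (fun s : R => g s 0 a *: ee a) (fun h => (h * v a) *: ee a).
  have da : differentiable (fun s => g s 0 a) t.
    by apply/derivable1_diffP; have [] := gv a.
  apply: DiffDef; first exact: differentiableZl.
  rewrite diffZl//; apply/funext => h /=; congr (_ *: _).
  have <- := @derive_val _ _ _ _ _ _ _ (gv a).
  rewrite deriveE// -[in LHS](mulr1 h) -[h * 1]/(h *: (1 : R)).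
  by rewrite linearZ.
have dd := is_diffD (d 0) (d 1).
rewrite gE; split; first by case: dd.
case: dd => _ E; have := congr1 (fun f : R -> 'rV[R]_2 => f 1) E.
move=> E1; apply: (etrans E1).
by rewrite [LHS](_ : _ = (1 * v 0) *: ee 0 + (1 * v 1) *: ee 1)// !mul1r.
Qed.

Lemma curve_chain (f : fn) (g : R -> 'rV[R]_2) t (v : 'I_2 -> R) : differentiable f (g t) ->
  (forall a, is_derive t 1 (fun s => g s 0 a) (v a)) ->
  is_derive t 1 (fun s => f (g s)) (v 0 * pd 0 f (g t) + v 1 * pd 1 f (g t)).
Proof.
move=> df gv; have [dg dgE] := derive_coord_diff gv.
have dfg : differentiable (f \o g) t by exact: differentiable_comp.
have : is_derive t 1 (f \o g) ('d (f \o g) t 1).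
  by rewrite -deriveE//; apply: derivableP; exact: diff_derivable.
move=> h; apply: is_derive_val h _; rewrite diff_comp//= dgE.
have := differentiable_dir (v 0 *: ee 0 + v 1 *: ee 1) df.
move=> /(@derive_val _ _ _ _ _ _ _); rewrite deriveE// => ->.
by rewrite !mxE !eqxx /= !mulr1 !mulr0 addr0 add0r.
Qed.

Lemma pd_comp (f : fn) (T : 'rV[R]_2 -> 'rV[R]_2) x (a : 'I_2) : differentiable f (T x) ->
  (forall d, derivable (fun y => T y 0 d) x (ee a)) ->
  is_derive x (ee a) (fun y => f (T y))
    (\sum_d pd a (fun y => T y 0 d) x * pd d f (T x)).
Proof.
move=> df dT; rewrite sum_ord2.
have x0 : 0 *: ee a + x = x by rewrite scale0r add0r.
have h := @curve_chain f (fun s => T (s *: ee a + x)) 0 (fun d => pd a (fun y => T y 0 d) x).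
rewrite /= x0 in h.
have := (is_derive_line (fun y => f (T y)) x (ee a) 0 _).2 (h df _); rewrite x0; apply => d.
by have := @pd_line R (fun y => T y 0 d) x a 0; rewrite x0; apply; exact: dT.
Qed.

Lemma Ck1_comp O W (f : fn) (T : 'rV[R]_2 -> 'rV[R]_2) : open O -> open W -> Ck 1 W f ->
  (forall x, O x -> W (T x)) -> (forall x, O x -> {for x, continuous T}) ->
  (forall d, Ck 1 O (fun y => T y 0 d)) -> Ck 1 O (fun y => f (T y)).
Proof.
move=> oO oW f1 TW Tc T1.
have H x a : O x -> is_derive x (ee a) (fun y => f (T y))
    (\sum_d pd a (fun y => T y 0 d) x * pd d f (T x)).
  move=> Ox; apply: pd_comp; first by have [] := Ck_diff oW f1 (TW _ Ox).
  by move=> d; case: (T1 d) => + _; apply.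
split=> [x Ox a|a]; first by have [] := H x a Ox.
apply: (@Ck_eq _ 0 O (fun x => \sum_d pd a (fun y => T y 0 d) x * pd d f (T x))) => //.
  by move=> x Ox; rewrite (pd_val (H x a Ox)).
move=> x Ox; apply: continuous_at_sum => d; apply: continuous_atM.
  by apply: (Ck_cont oO (Ck_pd a (T1 d))).
apply: (continuous_comp (Tc x Ox)).
exact: (Ck_cont oW (Ck_pd d f1) (TW _ Ox)).
Qed.

Lemma pd_coord (a b : 'I_2) x : is_derive x (ee a) (fun y : 'rV[R]_2 => y 0 b) (a == b)%:R.
Proof.
have h : is_derive (0 : R) 1 (fun h : R => (h *: ee a + x) 0 b) (a == b)%:R.
  rewrite (_ : (fun h : R => _) = (fun h : R => h * (a == b)%:R + x 0 b)).
    apply: is_derive_val (is_derive_add (is_derive_mul (is_derive_rid 0) (is_derive_const _ _ _))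
      (is_derive_const _ _ _)) _.
    by rewrite mul1r mulr0 !addr0.
  by apply/funext => h; rewrite !mxE eqxx /= eq_sym.
by have := (is_derive_line (fun y : 'rV[R]_2 => y 0 b) x (ee a) 0 _).2 h; rewrite scale0r add0r.
Qed.

Section Ode.
Variables (n : nat) (F : ('I_n -> R) -> 'I_n -> R) (y0 : 'I_n -> R) (r L : R).
Hypotheses (r0 : 0 < r) (L0 : 0 <= L).
Let box (y : 'I_n -> R) := forall i, `|y i - y0 i| <= r.
Hypothesis F_lip : forall y z (d : R), box y -> box z -> (forall j, `|y j - z j| <= d) ->
  forall i, `|F y i - F z i| <= L * d.

(** Clamping to the box makes [F] globally Lipschitz, and rescaling time by [h] brings the constant
    below 1/4, as [picard] demands. The condition [4 * (h * M) <= r] keeps the solution inside the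
    box, where clamping changes nothing. *)
Lemma ode_local : exists2 d : R, 0 < d & exists y : 'I_n -> R -> R,
  (forall i, y i 0 = y0 i) /\ forall t, `|t| < d ->
    (forall i, `|y i t - y0 i| <= r) /\
    forall i, is_derive t 1 (y i) (F (fun j => y j t) i).
Proof.
pose M : R := \sum_i `|F y0 i|.
have M0 : 0 <= M by exact: sumr_ge0.
have [h h0 [hL hM]] : exists2 h : R, 0 < h & 4 * (h * L) <= 1 /\ 4 * (h * M) <= r.
  have c0 : 0 < 4 * L + 1 by rewrite ltr_wpDl// mulr_ge0.
  have c1 : 0 < 4 * M + 1 by rewrite ltr_wpDl// mulr_ge0.
  exists (Num.min (4 * L + 1)^-1 (r / (4 * M + 1))); first by rewrite lt_min invr_gt0 c0 divr_gt0.
  split.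
    apply: (@le_trans _ _ ((4 * L + 1) * (4 * L + 1)^-1)); last by rewrite divff// lt0r_neq0.
    rewrite mulrCA mulrC; apply: ler_pM; rewrite ?mulr_ge0 ?lerDl// ?ge_min ?lexx//.
    by rewrite le_min invr_ge0 ltW//= divr_ge0// ltW.
  apply: (@le_trans _ _ ((4 * M + 1) * (r / (4 * M + 1)))); last by rewrite mulrCA divff ?mulr1// lt0r_neq0.
  rewrite mulrCA mulrC; apply: ler_pM; rewrite ?mulr_ge0 ?lerDl// ?ge_min ?lexx ?orbT//.
  by rewrite le_min invr_ge0 ltW//= divr_ge0// ltW.
pose cl (y : 'I_n -> R) j := clamp (y0 j - r) (y0 j + r) (y j).
have clb y : box (cl y).
  move=> i; have yr : y0 i - r <= y0 i + r by rewrite lerD2l; apply: le_trans (ltW r0); rewrite oppr_le0 ltW.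
  have /andP[] := clamp_itv (y i) yr; rewrite ler_norml /cl => c1 c2.
  by rewrite lerBrDl c1 lerBlDl c2.
have y0b : box y0 by move=> i; rewrite subrr normr0 ltW.
pose f (s : R) y i := h * F (cl y) i.
have cl0 y : box y -> cl y = y.
  by move=> yb; apply/funext => i; apply: clamp_id; have := yb i; rewrite ler_norml; lra.
have lip s y z (d : R) : (forall j, `|y j - z j| <= d) -> forall i, `|f s y i - f s z i| <= d / 4.
  move=> yz i; rewrite /f -mulrBr normrM (ger0_norm (ltW h0)).
  have d0 : 0 <= d by exact: le_trans (yz i).
  have := F_lip (clb y) (clb z) (fun j => le_trans (clamp_le _ _ _ _) (yz j)) i.
  move=> /(ler_wpM2l (ltW h0)) h1; apply: le_trans h1 _.
  by have := ler_wpM2r d0 hL; lra.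
have cont (y : 'I_n -> R -> R) : (forall i, continuous (y i)) ->
    forall i, continuous (fun s => f s (fun j => y j s) i).
  move=> yc i s; apply/cvgrPdist_lt => e e0.
  have : \forall u \near s, forall j : 'I_n, `|y j s - y j u| < e.
    apply: (@filter_forall _ _ (fun (j : 'I_n) u => `|y j s - y j u| < e) (nbhs s)) => j.
    by have /cvgrPdist_lt/(_ e e0) := yc j s.
  apply: filterS => u hu; have e4 : e / 4 < e by lra.
  by apply: le_lt_trans e4; apply: (lip s) => j; exact: ltW.
have bnd s i : `|f s y0 i| <= h * M.
  rewrite /f cl0// normrM (ger0_norm (ltW h0)) ler_wpM2l ?(ltW h0)// /M (bigD1 i)//= lerDl.
  exact: sumr_ge0.
have [y [yE yd yb]] := picard cont lip bnd.
exists (2 * h); first by rewrite mulr_gt0.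
exists (fun i t => y i (t / h)); split=> [i|t th]; first by rewrite mul0r.
have {}yb i s : `|y i s - y0 i| <= r by exact: le_trans (yb i s) hM.
split=> // i.
have t2 : -2 < t / h < 2.
  by rewrite -ltr_norml normrM normfV (ger0_norm (ltW h0)) ltr_pdivrMr.
have dt : is_derive t 1 (fun t : R => t / h) (h^-1).
  apply: is_derive_val (is_derive_mul (is_derive_rid t) (is_derive_const t 1 (h^-1))) _.
  by rewrite mul1r mulr0 addr0.
have yh := @is_derive1_comp _ (y i) (fun t : R => t / h) t _ _ (yd i _ t2) dt.
apply: is_derive_val yh _; rewrite /f cl0; last by move=> j; exact: yb.
by rewrite mulrAC divff ?mul1r// lt0r_neq0.
Qed.

End Ode.

Lemma lipschitz_disc (f : fn) q (r C : R) O : open O -> Ck 1 O f -> disc q r `<=` O ->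
  (forall x, disc q r x -> forall a, `|pd a f x| <= C) ->
  forall x y, disc q r x -> disc q r y -> `|f y - f x| <= 2 * C * `|y - x|.
Proof.
move=> oO f1 rO fC x y xr yr.
suff : `|f (ray x y 1) - f (ray x y 0)| <= 2 * C * `|y - x| * (1 - 0).
  by rewrite ray1 ray0 subr0 mulr1.
apply: (MVT_le (f := fun v => f (ray x y v))
  (df := fun v => (y - x) 0 0 * pd 0 f (ray x y v) + (y - x) 0 1 * pd 1 f (ray x y v)) ler01) => v v01.
  by apply: is_derive_ray; have [] := Ck_diff oO f1 (rO _ (convex_disc v01 xr yr)).
have Dr := convex_disc v01 xr yr.
apply: le_trans (ler_normD _ _) _; rewrite !normrM.
have h0 := ler_pM (normr_ge0 _) (normr_ge0 _) (coord_le (y - x) 0) (fC _ Dr 0).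
have h1 := ler_pM (normr_ge0 _) (normr_ge0 _) (coord_le (y - x) 1) (fC _ Dr 1).
by apply: le_trans (lerD h0 h1) _; lra.
Qed.

End Curves.
(** * Killing forms on the surface *)

Section Manifold.
Context {R : realType} {S : topologicalType}.
Local Notation fn := ('rV[R]_2 -> R).
Local Notation ee a := (delta_mx 0 a : 'rV[R]_2).
Local Notation jacobian := Defs.jacobian.
Variables (A : set (chart R S)) (Gam : chart R S -> 'I_2 -> 'I_2 -> 'I_2 -> fn)
  (eps : chart R S -> 'I_2 -> 'I_2 -> fn).
Hypotheses (atlasA : is_atlas 6 A) (conG : is_connection A 4 Gam) (tfG : torsion_free A Gam)
  (volE : is_volume_form A 4 eps).
Implicit Types (c : chart R S) (U : set S) (p : S) (x : 'rV[R]_2)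
  (K : chart R S -> 'I_2 -> fn) (g : R -> S) (W : set 'rV[R]_2).

Lemma chartP c : A c -> is_chart c.
Proof. by case: atlasA => + _ _; apply. Qed.

Lemma regionP c U x : A c -> region c U x ->
  [/\ cdom c (cinv c x), U (cinv c x) & cmap c (cinv c x) = x].
Proof.
move=> Ac [p [pc pU] <-]; have [_ _ inv _ _] := chartP Ac.
by rewrite inv.
Qed.

Lemma region_map c U p : cdom c p -> U p -> region c U (cmap c p).
Proof. by move=> pc pU; exists p. Qed.

Lemma cinvK c p : A c -> cdom c p -> cinv c (cmap c p) = p.
Proof. by move=> /chartP[_ _ + _ _]; apply. Qed.

Lemma region_sub c U U' : U `<=` U' -> region c U `<=` region c U'.
Proof. by move=> UU' x [p [pc pU] <-]; exists p => //; split=> //; exact: UU'. Qed.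

Lemma regionT c : region c setT = cmap c @` cdom c.
Proof. by rewrite /region setIT. Qed.

Lemma cinv_continuous c x : A c -> region c setT x -> {for x, continuous (cinv c)}.
Proof. by move=> /chartP[_ _ _ _]; rewrite regionT; apply. Qed.

Lemma cmap_continuous c p : A c -> cdom c p -> {for p, continuous (cmap c)}.
Proof. by move=> /chartP[_ _ _ + _]; apply. Qed.

Lemma open_region c U : A c -> open U -> open (region c U).
Proof.
move=> Ac oU; have [_ oc _ _ _] := chartP Ac.
rewrite openE => x xU; have xT : region c setT x by exact: region_sub xU.
have [xc Ux _] := regionP Ac xU.
have near1 : \forall y \near x, (cmap c @` cdom c) y.
  by apply: open_nbhs_nbhs; split=> //; rewrite -regionT.
have near2 : \forall y \near x, U (cinv c y).
  by apply: (cinv_continuous Ac xT); apply: open_nbhs_nbhs.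
have : \forall y \near x, region c U y.
  move: near1 near2; apply: filterS2 => y [p pc <-]; rewrite cinvK// => Up.
  exact: region_map.
by [].
Qed.

Definition chart_set c W : set S := cdom c `&` cmap c @^-1` W.

Lemma open_chart_set c W : A c -> open W -> open (chart_set c W).
Proof.
move=> Ac oW; have [oc _ _ _ _] := chartP Ac.
rewrite openE => p [pc pW].
have n1 : \forall q \near p, cdom c q by apply: open_nbhs_nbhs.
have n2 : \forall q \near p, W (cmap c q).
  by apply: (cmap_continuous Ac pc); apply: open_nbhs_nbhs.
have H := filterI n1 n2; exact: H.
Qed.

Lemma region_chart_set c W : W `<=` region c setT -> region c (chart_set c W) = W.
Proof.
move=> Wc; apply/seteqP; split=> [_ [p [_ [_ pW]] <-]//|x Wx].
by have [p [pc _] px] := Wc x Wx; exists p => //; split=> //; split=> //=; rewrite px.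
Qed.

Lemma transition_map c1 c2 p : A c1 -> cdom c1 p -> transition c1 c2 (cmap c1 p) = cmap c2 p.
Proof. by move=> Ac pc; rewrite /transition cinvK. Qed.

Lemma region_transition c1 c2 U x : A c1 -> region c1 (cdom c2 `&` U) x ->
  region c2 (cdom c1 `&` U) (transition c1 c2 x).
Proof.
move=> Ac1 /[dup] xU /(regionP Ac1)[xc [xc2 Ux] _]; exact: region_map.
Qed.

Lemma transition_Ck c1 c2 d : A c1 -> A c2 ->
  Ck 6 (region c1 (cdom c2)) (transition_coord c1 c2 d).
Proof. by case: atlasA => _ _ + *; apply. Qed.

Lemma transition_continuous c1 c2 x : A c1 -> A c2 -> region c1 (cdom c2) x ->
  {for x, continuous (transition c1 c2)}.
Proof.
move=> Ac1 Ac2 xc; have [x1 x2 _] := regionP Ac1 xc.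
apply: (@continuous_comp _ _ _ (cinv c1) (cmap c2)).
  by apply: cinv_continuous => //; exact: region_sub xc.
exact: cmap_continuous.
Qed.

Lemma open_overlap c1 c2 : A c1 -> A c2 -> open (region c1 (cdom c2)).
Proof. by move=> A1 A2; apply: open_region => //; have [] := chartP A2. Qed.

Lemma transition_eq c1 c2 c3 x : A c1 -> A c2 -> region c1 (cdom c2) x ->
  transition c2 c3 (transition c1 c2 x) = transition c1 c3 x.
Proof. by move=> A1 A2 /(regionP A1)[_ x2 _]; rewrite {2}/transition transition_map. Qed.

Lemma jacobianE c1 c2 (a d : 'I_2) x : jacobian c1 c2 x a d = pd a (transition_coord c1 c2 d) x.
Proof. by rewrite mxE. Qed.

Lemma jacobian_id c x (a b : 'I_2) : A c -> region c setT x -> jacobian c c x a b = (a == b)%:R.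
Proof.
move=> Ac xT; have oT : open (region c setT) by apply: open_region => //; exact: openT.
rewrite jacobianE -(pd_eq (f := fun y => y 0 b) a oT _ xT); first exact: pd_val (pd_coord a b x).
by move=> y /(regionP Ac)[_ _ yE]; rewrite /transition_coord /transition yE.
Qed.

Lemma jacobian_Ck c1 c2 (a d : 'I_2) : A c1 -> A c2 ->
  Ck 5 (region c1 (cdom c2)) (fun x => jacobian c1 c2 x a d).
Proof.
move=> A1 A2; have := Ck_pd a (transition_Ck d A1 A2).
by apply: Ck_eq => // [|x _]; [exact: open_overlap|rewrite jacobianE].
Qed.

Lemma pd_transition c1 c2 (f : fn) (a : 'I_2) x : A c1 -> A c2 -> region c1 (cdom c2) x ->
  differentiable f (transition c1 c2 x) ->
  is_derive x (ee a) (fun y => f (transition c1 c2 y))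
    (\sum_d jacobian c1 c2 x a d * pd d f (transition c1 c2 x)).
Proof.
move=> A1 A2 xc df; apply: is_derive_val (pd_comp (T := transition c1 c2) (a := a) df _) _.
  by move=> d; have [+ _] := transition_Ck d A1 A2; apply.
by apply: eq_bigr => d _; rewrite jacobianE.
Qed.

Lemma jacobian_comp c1 c2 c3 x (a d : 'I_2) : A c1 -> A c2 -> A c3 -> region c1 (cdom c2 `&` cdom c3) x ->
  jacobian c1 c3 x a d = \sum_e jacobian c1 c2 x a e * jacobian c2 c3 (transition c1 c2 x) e d.
Proof.
move=> A1 A2 A3 x23; have x2 : region c1 (cdom c2) x by apply: region_sub x23 => p [].
have T3 : region c2 (cdom c3) (transition c1 c2 x).
  by have := region_transition A1 x23; apply: region_sub => p [].
have df : differentiable (transition_coord c2 c3 d) (transition c1 c2 x).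
  have T1 := Ck_leq (open_overlap A2 A3) (isT : (1 <= 6)%N) (transition_Ck d A2 A3).
  by have [] := Ck_diff (open_overlap A2 A3) T1 T3.
have o23 : open (region c1 (cdom c2 `&` cdom c3)).
  by apply: open_region => //; apply: openI; [have [] := chartP A2|have [] := chartP A3].
rewrite jacobianE -(pd_eq (f := fun y => transition_coord c2 c3 d (transition c1 c2 y)) a o23 _ x23).
  by rewrite (pd_val (pd_transition a A1 A2 x2 df)); apply: eq_bigr => e _; rewrite (jacobianE c2 c3).
move=> y y23; rewrite /transition_coord transition_eq//.
by apply: region_sub y23 => p [].
Qed.

Definition killing_at c K x := forall a b,
  pd a (K c b) x + pd b (K c a) x = 2 * \sum_d Gam c d a b x * K c d x.

Definition killing_form U K := is_one_form A 1 U K /\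
  forall c, A c -> forall x, region c U x -> killing_at c K x.

Lemma curve_coord_transition g c1 c2 (t : R) (v : 'I_2 -> R) d : A c1 -> A c2 ->
  {for t, continuous g} -> cdom c1 (g t) -> cdom c2 (g t) ->
  (forall a, is_derive t 1 (curve_coord g c1 a) (v a)) ->
  is_derive t 1 (curve_coord g c2 d) (\sum_a v a * jacobian c1 c2 (cmap c1 (g t)) a d).
Proof.
move=> A1 A2 gc g1 g2 gv.
have xc : region c1 (cdom c2) (cmap c1 (g t)) by exact: region_map.
have df : differentiable (transition_coord c1 c2 d) (cmap c1 (g t)).
  have T1 := Ck_leq (open_overlap A1 A2) (isT : (1 <= 6)%N) (transition_Ck d A1 A2).
  by have [] := Ck_diff (open_overlap A1 A2) T1 xc.
have := curve_chain (g := fun s => cmap c1 (g s)) df gv.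
rewrite -!jacobianE => H.
have E : \forall s \near t, transition_coord c1 c2 d (cmap c1 (g s)) = curve_coord g c2 d s.
  have [oc1 _ _ _ _] := chartP A1.
  have : \forall s \near t, cdom c1 (g s) by apply: gc; apply: open_nbhs_nbhs.
  by apply: filterS => s sc; rewrite /transition_coord transition_map.
have [dH vH] := H; apply: DeriveDef.
  by apply: near_eq_derivable E dH; rewrite oner_neq0.
rewrite -(near_eq_derive _ E) ?oner_neq0// vH sum_ord2.
by [].
Qed.

Lemma kappaE K g c (t : R) : kappa K g c t = K c 0 (cmap c (g t)) * derive1 (curve_coord g c 0) t +
  K c 1 (cmap c (g t)) * derive1 (curve_coord g c 1) t.
Proof. by rewrite /kappa sum_ord2. Qed.

Lemma is_derive_derive1 (f : R -> R) (t : R) : derivable f t 1 -> is_derive t 1 f (derive1 f t).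
Proof. by move=> df; rewrite derive1E; exact: derivableP. Qed.

Lemma derive1_val (f : R -> R) (t l : R) : is_derive t 1 f l -> derive1 f t = l.
Proof. by move=> fl; rewrite derive1E; exact: derive_val. Qed.

Lemma kappa_transition U K g c1 c2 (t : R) : is_one_form A 1 U K -> A c1 -> A c2 ->
  {for t, continuous g} -> U (g t) -> cdom c1 (g t) -> cdom c2 (g t) ->
  (forall a, derivable (curve_coord g c1 a) t 1) ->
  kappa K g c1 t = kappa K g c2 t.
Proof.
move=> [_ K_law] A1 A2 gc Ut g1 g2 gd.
have xc : region c1 (cdom c2 `&` U) (cmap c1 (g t)) by exact: region_map.
have D d := derive1_val (curve_coord_transition d A1 A2 gc g1 g2 (fun a => is_derive_derive1 (gd a))).
rewrite !kappaE !D !(K_law c1 c2 A1 A2 _ xc) !sum_ord2 transition_map//; ring.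
Qed.

(** The geodesic equation removes the second derivatives of the curve. The coefficients of the
    remaining quadratic form in the velocity are the components of the symmetrised derivative of
    [K]. *)
Lemma kappa_derive U K J g c (t : R) : is_one_form A 1 U K -> open U -> is_geodesic A Gam U J g -> J t ->
  A c -> cdom c (g t) ->
  is_derive t 1 (kappa K g c) (let x := cmap c (g t) in let v a := derive1 (curve_coord g c a) t in
    v 0 * v 0 * (pd 0 (K c 0) x - \sum_d Gam c d 0 0 x * K c d x) +
    v 0 * v 1 * (pd 0 (K c 1) x + pd 1 (K c 0) x - 2 * \sum_d Gam c d 0 1 x * K c d x) +
    v 1 * v 1 * (pd 1 (K c 1) x - \sum_d Gam c d 1 1 x * K c d x)).
Proof.
move=> [K1 _] oU [_ _ geo] Jt Ac gt; have [Ut gc H] := geo t Jt; have {}H := H c Ac gt.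
set x := cmap c (g t); pose v a : R := derive1 (curve_coord g c a) t.
have xU : region c U x by exact: region_map.
have xT : region c setT x by exact: region_sub xU.
have Kd b : is_derive t 1 (fun s => K c b (cmap c (g s))) (v 0 * pd 0 (K c b) x + v 1 * pd 1 (K c b) x).
  apply: (curve_chain (g := fun s => cmap c (g s))).
    by have [] := Ck_diff (open_region Ac oU) (K1 c Ac b) xU.
  by move=> a; apply: is_derive_derive1; have [] := H a.
have vd b : is_derive t 1 (derive1 (curve_coord g c b))
    (- \sum_b' \sum_d Gam c b b' d x * v b' * v d).
  have [_ d2 e2] := H b; apply: is_derive_val (is_derive_derive1 d2) _.
  by apply/eqP; rewrite -addr_eq0 e2.
have KE : kappa K g c = fun s => K c 0 (cmap c (g s)) * derive1 (curve_coord g c 0) s +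
    K c 1 (cmap c (g s)) * derive1 (curve_coord g c 1) s.
  by apply/funext => s; rewrite kappaE.
rewrite KE /=; apply: is_derive_val (is_derive_add (is_derive_mul (Kd 0) (vd 0)) (is_derive_mul (Kd 1) (vd 1))) _.
have sym a b d := tfG Ac xT a b d.
by rewrite !sum_ord2 (sym 0 1 0) (sym 1 1 0) -/(v 0) -/(v 1) -/x; ring.
Qed.

(** A geodesic may leave every single chart. At each time [kappa] is computed in a chosen chart
    around the point; its value is the same in all charts, and its derivative vanishes by the
    Killing equation in the chosen one. *)
Lemma kappa_constant U K : open U -> is_one_form A 1 U K ->
  (forall p, U p -> exists c, [/\ A c, cdom c p & killing_at c K (cmap c p)]) ->
  forall J g, is_geodesic A Gam U J g -> forall s t, J s -> J t ->
  forall c1 c2, A c1 -> A c2 -> cdom c1 (g s) -> cdom c2 (g t) ->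
    kappa K g c1 s = kappa K g c2 t.
Proof.
move=> oU K1 kil J g geo.
have /choice[cc ccP] : forall p, exists c, [/\ A c, cdom c p & U p -> killing_at c K (cmap c p)].
  move=> p; have [Up|nUp] := pselect (U p); last first.
    by case: atlasA => _ /(_ p)[c Ac pc] _; exists c; split.
  by have [c [Ac pc kc]] := kil p Up; exists c; split.
pose f u := kappa K g (cc (g u)) u.
have [oJ iJ H] := geo.
have fE u c : J u -> A c -> cdom c (g u) -> f u = kappa K g c u.
  move=> Ju Ac uc; have [Au ucc _] := ccP (g u); have [Uu gc gd] := H u Ju.
  have gd' a : derivable (curve_coord g (cc (g u)) a) u 1 by have [] := gd _ Au ucc a.
  exact: kappa_transition K1 Au Ac gc Uu ucc uc gd'.
have fd u : J u -> is_derive u 1 f 0.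
  move=> Ju; have [Au ucc kc] := ccP (g u); have [Uu gc gd] := H u Ju.
  have := kappa_derive K1 oU geo Ju Au ucc; rewrite /= => kd.
  have {}kc := kc Uu; have k00 := kc 0 0; have k01 := kc 0 1; have k11 := kc 1 1.
  have {kd} [dk vk] : is_derive u 1 (kappa K g (cc (g u))) 0.
    apply: is_derive_val kd _; move: k00 k01 k11.
    rewrite !sum_ord2 => k00 k01 k11.
    rewrite (_ : pd 0 _ _ - _ = 0); last by lra.
    rewrite (_ : pd 0 _ _ + _ - _ = 0); last by lra.
    rewrite (_ : pd 1 _ _ - _ = 0); last by lra.
    by rewrite !mulr0 !addr0.
  have E : \forall v \near u, kappa K g (cc (g u)) v = f v.
    have [ocu _ _ _ _] := chartP Au.
    have n1 : \forall v \near u, cdom (cc (g u)) (g v) by apply: gc; apply: open_nbhs_nbhs.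
    have n2 : \forall v \near u, J v by apply: open_nbhs_nbhs.
    by move: n1 n2; apply: filterS2 => v vc Jv; rewrite (fE v (cc (g u))).
  apply: DeriveDef; first by apply: near_eq_derivable E dk; rewrite oner_neq0.
  by rewrite -(near_eq_derive _ E) ?oner_neq0.
have fc (s t : R) : s <= t -> J s -> J t -> f s = f t.
  move=> st Js Jt; have Jst u : s <= u <= t -> J u by exact: iJ.
  have : `|f t - f s| <= 0 * (t - s).
    by apply: (MVT_le (df := fun=> 0)) => // u /Jst; [exact: fd|rewrite normr0].
  by rewrite mul0r normr_le0 subr_eq0 => /eqP.
move=> s t Js Jt c1 c2 A1 A2 sc tc; rewrite -(fE s c1)// -(fE t c2)//.
by have [st|/ltW ts] := leP s t; [exact: fc|rewrite (fc t s)].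
Qed.

Lemma killing_first_integral U K : open U -> is_one_form A 1 U K ->
  (forall p, U p -> exists c, [/\ A c, cdom c p & killing_at c K (cmap c p)]) ->
  (exists c x a, [/\ A c, region c U x & K c a x != 0]) -> is_first_integral A Gam U K.
Proof. by move=> oU K1 kil K0; split=> // J g geo; exact: (kappa_constant oU K1 kil geo). Qed.

Let trilinear_le (a b c a' b' c' C V d : R) : `|a - a'| <= 2 * C * d -> `|a'| <= C ->
  `|b - b'| <= d -> `|c - c'| <= d -> `|b| <= V -> `|c| <= V -> `|b'| <= V ->
  `|a * b * c - a' * b' * c'| <= (2 * C * V * V + 2 * C * V) * d.
Proof.
move=> ha ha' hb hc b0 c0 b'0.
have -> : a * b * c - a' * b' * c' = (a - a') * b * c + a' * (b - b') * c + a' * b' * (c - c') by ring.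
apply: le_trans (ler_normD _ _) _; apply: le_trans (lerD (ler_normD _ _) (lexx _)) _.
rewrite !normrM.
have h1 : `|a - a'| * `|b| * `|c| <= 2 * C * d * V * V by rewrite !ler_pM// mulr_ge0.
have h2 : `|a'| * `|b - b'| * `|c| <= C * d * V by rewrite !ler_pM// mulr_ge0.
have h3 : `|a'| * `|b'| * `|c - c'| <= C * V * d by rewrite !ler_pM// mulr_ge0.
by lra.
Qed.

(** A first-order system of size [2 + 2] for position and velocity. It is quadratic in the velocity,
    so the Lipschitz constant is taken on a box where the velocity is bounded by [VM] and the
    position stays in a disc of the chart. *)
Let geodesic_ode c U x (v : 'I_2 -> R) : open U -> A c -> region c U x ->
  exists2 d : R, 0 < d & exists X V : 'I_2 -> R -> R,
    (forall a, X a 0 = x 0 a /\ V a 0 = v a) /\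
    forall t, `|t| < d -> region c U (\row_a X a t) /\
      forall a, is_derive t 1 (X a) (V a t) /\
        is_derive t 1 (V a) (- \sum_b \sum_d Gam c a b d (\row_a X a t) * V b t * V d t).
Proof.
move=> oU Ac xU; have oO := open_region Ac oU.
have UT : region c U `<=` region c setT by exact: region_sub.
have G1 a b d : Ck 1 (region c U) (Gam c a b d).
  have [/(_ c Ac a b d) G4 _] := conG.
  by apply: Ck_subset UT _; apply: Ck_leq G4 => //; apply: open_region => //; exact: openT.
have [C0 C00 H0] : exists2 C : R, 0 <= C & \forall y \near x, forall k : 'I_2 * 'I_2 * 'I_2,
    `|Gam c k.1.1 k.1.2 k.2 y| <= C.
  by apply: bounded_near => -[[a b] d]/=; exact: (Ck_cont oO (G1 a b d) xU).
have [C1 C10 H1] : exists2 C : R, 0 <= C & \forall y \near x, forall k : 'I_2 * 'I_2 * 'I_2 * 'I_2,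
    `|pd k.1.1.1 (Gam c k.1.1.2 k.1.2 k.2) y| <= C.
  by apply: bounded_near => -[[[e a] b] d]/=; exact: (Ck_cont oO (Ck_pd e (G1 a b d)) xU).
pose C := C0 + C1.
have Oq := near_open oO xU (fun y Oy => Oy : region c U y).
have [r r0 Hr] := (near_disc x _).1 (filterI Oq (filterI H0 H1)).
have rU : disc x r `<=` region c U by move=> y /Hr[].
have rC y : disc x r y -> forall a b d, `|Gam c a b d y| <= C /\ forall e, `|pd e (Gam c a b d) y| <= C.
  move=> /Hr[_ [h0 h1]] a b d; split=> [|e].
    by apply: le_trans (h0 (a, b, d)) _; rewrite lerDl.
  by apply: le_trans (h1 (e, a, b, d)) _; rewrite lerDr.
have Cp : 0 <= C by rewrite addr_ge0.
pose r2 := r / 2; have r20 : 0 < r2 by rewrite divr_gt0.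
have r2r : r2 < r by rewrite /r2; lra.
pose VM := \sum_a `|v a| + r2.
have VM0 : 0 <= VM by rewrite addr_ge0 ?sumr_ge0// ltW.
pose pos (y : 'I_(2 + 2) -> R) : 'rV[R]_2 := \row_a y (lshift 2 a).
pose y0 (i : 'I_(2 + 2)) : R := match fintype.split i with inl a => x 0 a | inr a => v a end.
pose F (y : 'I_(2 + 2) -> R) (i : 'I_(2 + 2)) : R := match fintype.split i with
  | inl a => y (rshift 2 a)
  | inr a => - \sum_b \sum_d Gam c a b d (pos y) * y (rshift 2 b) * y (rshift 2 d) end.
have y0l a : y0 (lshift 2 a) = x 0 a by rewrite /y0 (unsplitK (inl a) : fintype.split (lshift 2 a) = _).
have y0r a : y0 (rshift 2 a) = v a by rewrite /y0 (unsplitK (inr a) : fintype.split (rshift 2 a) = _).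
have Fl y a : F y (lshift 2 a) = y (rshift 2 a).
  by rewrite /F (unsplitK (inl a) : fintype.split (lshift 2 a) = _).
have Fr y a : F y (rshift 2 a) = - \sum_b \sum_d Gam c a b d (pos y) * y (rshift 2 b) * y (rshift 2 d).
  by rewrite /F (unsplitK (inr a) : fintype.split (rshift 2 a) = _).
have posr y : (forall i, `|y i - y0 i| <= r2) -> disc x r (pos y).
  by move=> h; apply/rV_norm_lt => // a; rewrite !mxE -y0l; apply: le_lt_trans r2r.
have velr y : (forall i, `|y i - y0 i| <= r2) -> forall a, `|y (rshift 2 a)| <= VM.
  move=> h a; rewrite -(subrK (y0 (rshift 2 a)) (y (rshift 2 a))).
  apply: le_trans (ler_normD _ _) _; rewrite /VM addrC lerD// y0r (bigD1 a)//= lerDl.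
  exact: sumr_ge0.
(* A position row contributes 1; a velocity row is a sum of four trilinear terms. *)
pose L := 1 + 4 * (2 * C * VM * VM + 2 * C * VM).
have L0' : 0 <= 2 * C * VM * VM + 2 * C * VM by rewrite addr_ge0 ?mulr_ge0.
have L0 : 0 <= L by rewrite /L; lra.
have lip y z (d : R) : (forall i, `|y i - y0 i| <= r2) -> (forall i, `|z i - y0 i| <= r2) ->
    (forall j, `|y j - z j| <= d) -> forall i, `|F y i - F z i| <= L * d.
  move=> yb zb yz i; have d0 : 0 <= d by exact: le_trans (yz i).
  have Ld := mulr_ge0 L0' d0.
  rewrite -(splitK i); case: (fintype.split i) => a /=.
    by rewrite !Fl; apply: le_trans (yz _) _; rewrite /L; lra.
  rewrite !Fr opprK addrC.
  have T b e : `|Gam c a b e (pos z) * z (rshift 2 b) * z (rshift 2 e) -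
      Gam c a b e (pos y) * y (rshift 2 b) * y (rshift 2 e)| <= (2 * C * VM * VM + 2 * C * VM) * d.
    apply: trilinear_le; [|exact: (rC _ (posr _ yb) _ _ _).1| | | | |]; rewrite ?velr//.
    - apply: le_trans (lipschitz_disc oO (G1 a b e) rU _ (posr _ yb) (posr _ zb)) _.
        by move=> w wr e'; exact: (rC w wr a b e).2.
      rewrite ler_wpM2l ?mulr_ge0//; apply/rV_normP => // k; rewrite !mxE distrC; exact: yz.
    - by rewrite distrC.
    - by rewrite distrC.
  rewrite !sum_ord2.
  have := T 0 0; have := T 0 1; have := T 1 0; have := T 1 1.
  set t00 := Gam c a 0 0 _ * _ * _; set t01 := Gam c a 0 1 _ * _ * _.
  set t10 := Gam c a 1 0 _ * _ * _; set t11 := Gam c a 1 1 _ * _ * _.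
  set u00 := Gam c a 0 0 _ * _ * _; set u01 := Gam c a 0 1 _ * _ * _.
  set u10 := Gam c a 1 0 _ * _ * _; set u11 := Gam c a 1 1 _ * _ * _.
  move: Ld; rewrite /L; set k := _ * VM * VM + _ => Ld.
  rewrite !ler_norml => /andP[a1 a2] /andP[b1 b2] /andP[c1 c2] /andP[d1 d2].
  by apply/andP; split; lra.
have [d d0 [y [yE yd]]] := ode_local r20 L0 lip.
exists d => //; exists (fun a => y (lshift 2 a)), (fun a => y (rshift 2 a)); split=> [a|t td].
  by rewrite !yE y0l y0r.
have [yb yD] := yd t td; split; first exact: (rU _ (posr (fun j => y j t) yb)).
by move=> a; split; [have := yD (lshift 2 a); rewrite Fl|have := yD (rshift 2 a); rewrite Fr].
Qed.

(** The equation is solved in the chart [c], but a geodesic must satisfy it in every chart that it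
    meets. Passing to another chart differentiates the jacobian along the curve. *)
Lemma geodesic_exists c U x (v : 'I_2 -> R) : open U -> A c -> region c U x ->
  exists J g, [/\ is_geodesic A Gam U J g, J 0, cmap c (g 0) = x,
    forall t, J t -> cdom c (g t) & forall a, derive1 (curve_coord g c a) 0 = v a].
Proof.
move=> oU Ac xU; have [d d0 [X [V [XV0 XV]]]] := geodesic_ode v oU Ac xU.
pose ga t : 'rV[R]_2 := \row_a X a t; pose g t := cinv c (ga t).
pose J : set R := [set` `]-d, d[].
have Jd t : J t -> `|t| < d by rewrite /J /= in_itv/= ltr_norml.
have J0 : J 0 by rewrite /J /= in_itv/= oppr_lt0 d0.
have oJ : open J by exact: interval_open.
have gaU t : J t -> region c U (ga t) by move=> /Jd /XV[].
have gaT t : J t -> region c setT (ga t) by move=> /gaU; exact: region_sub.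
have Xd t a : J t -> is_derive t 1 (fun s => ga s 0 a) (V a t).
  move=> /Jd /XV[_ /(_ a)[Xa _]].
  by rewrite (_ : (fun s => ga s 0 a) = X a)//; apply/funext => s; rewrite mxE.
have gac t : J t -> {for t, continuous ga}.
  move=> Jt; apply: continuous_coord => a.
  by apply: differentiable_continuous; apply/derivable1_diffP; have [] := Xd t a Jt.
have gc t : J t -> {for t, continuous g}.
  by move=> Jt; apply: continuous_comp (gac t Jt) _; apply: cinv_continuous => //; exact: gaT.
have gdom t : J t -> cdom c (g t) by move=> /gaU /(regionP Ac)[].
have gE t : J t -> cmap c (g t) = ga t by move=> /gaU /(regionP Ac)[].
have cc t a : J t -> is_derive t 1 (curve_coord g c a) (V a t).
  move=> Jt; have [dX vX] := Xd t a Jt.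
  have E : \forall s \near t, ga s 0 a = curve_coord g c a s.
    have : \forall s \near t, J s by apply: open_nbhs_nbhs.
    by apply: filterS => s Js; rewrite /curve_coord gE.
  apply: DeriveDef; first by apply: near_eq_derivable E dX; rewrite oner_neq0.
  by rewrite -(near_eq_derive _ E) ?oner_neq0.
exists J, g; split=> //; last first.
- by move=> a; rewrite (derive1_val (cc 0 a J0)) (XV0 a).2.
- by rewrite gE//; apply/rowP => a; rewrite mxE (XV0 a).1.
split=> //; first exact: interval_is_interval.
move=> t Jt; split; [by have [] := regionP Ac (gaU t Jt)|exact: gc|].
move=> c2 A2 g2 a.
have cc2 s e : J s -> cdom c2 (g s) -> is_derive s 1 (curve_coord g c2 e)
    (\sum_b V b s * jacobian c c2 (ga s) b e).
  move=> Js s2; rewrite -gE//; apply: curve_coord_transition => //; [exact: gc|exact: gdom|].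
  by move=> b; exact: cc.
have near2 : \forall s \near t, J s /\ cdom c2 (g s).
  have n1 : \forall s \near t, J s by apply: open_nbhs_nbhs.
  have n2 : \forall s \near t, cdom c2 (g s).
    by apply: (gc t Jt); apply: open_nbhs_nbhs; split=> //; have [] := chartP A2.
  exact: filterI n1 n2.
have E1 e : \forall s \near t, \sum_b V b s * jacobian c c2 (ga s) b e =
    derive1 (curve_coord g c2 e) s.
  by move: near2; apply: filterS => s [Js s2]; rewrite (derive1_val (cc2 s e Js s2)).
have x2 : region c (cdom c2) (ga t) by rewrite -gE//; apply: region_map => //; exact: gdom.
have Vd b : is_derive t 1 (V b) (- \sum_b' \sum_e Gam c b b' e (ga t) * V b' t * V e t).
  by have [_ /(_ b)[]] := XV t (Jd t Jt).
have Jac b : is_derive t 1 (fun s => jacobian c c2 (ga s) b a)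
    (V 0 t * pd 0 (fun y => jacobian c c2 y b a) (ga t) + V 1 t * pd 1 (fun y => jacobian c c2 y b a) (ga t)).
  apply: (@curve_chain R (fun y => jacobian c c2 y b a) ga t (fun e => V e t)) => [|e]; last exact: Xd.
  have J1 := Ck_leq (open_overlap Ac A2) (isT : (1 <= 5)%N) (jacobian_Ck b a Ac A2).
  by have [] := Ck_diff (open_overlap Ac A2) J1 x2.
have D2 := is_derive_add (is_derive_mul (Vd 0) (Jac 0)) (is_derive_mul (Vd 1) (Jac 1)).
have E2 : \forall s \near t, V 0 s * jacobian c c2 (ga s) 0 a + V 1 s * jacobian c c2 (ga s) 1 a =
    derive1 (curve_coord g c2 a) s.
  by move: (E1 a); apply: filterS => s <-; rewrite sum_ord2.
have d2 : is_derive t 1 (derive1 (curve_coord g c2 a))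
   (- (\sum_b' \sum_e Gam c 0 b' e (ga t) * V b' t * V e t) * jacobian c c2 (ga t) 0 a +
       V 0 t * (V 0 t * pd 0 (fun y => jacobian c c2 y 0 a) (ga t) + V 1 t * pd 1 (fun y => jacobian c c2 y 0 a) (ga t)) +
    (- (\sum_b' \sum_e Gam c 1 b' e (ga t) * V b' t * V e t) * jacobian c c2 (ga t) 1 a +
       V 1 t * (V 0 t * pd 0 (fun y => jacobian c c2 y 1 a) (ga t) + V 1 t * pd 1 (fun y => jacobian c c2 y 1 a) (ga t)))).
  have [dD vD] := D2; apply: DeriveDef; first by apply: near_eq_derivable E2 dD; rewrite oner_neq0.
  by rewrite -(near_eq_derive _ E2) ?oner_neq0.
split; [by have [] := cc2 t a Jt g2|by have [] := d2|].
have S2 : \sum_b \sum_e Gam c2 a b e (cmap c2 (g t)) * derive1 (curve_coord g c2 b) t *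
    derive1 (curve_coord g c2 e) t = \sum_b \sum_e Gam c2 a b e (transition c c2 (ga t)) *
    (\sum_i V i t * jacobian c c2 (ga t) i b) * (\sum_i V i t * jacobian c c2 (ga t) i e).
  apply: eq_bigr => b _; apply: eq_bigr => e _.
  by rewrite !(derive1_val (cc2 _ _ Jt g2)).
rewrite (derive1_val d2) S2.
(* The transformation law of the connection expresses the second derivatives of the transition map
   through both sets of Christoffel symbols; substituting them turns one geodesic equation into the
   other. *)
have pdJ b e : pd b (fun y => jacobian c c2 y e a) (ga t) =
    \sum_i Gam c i b e (ga t) * jacobian c c2 (ga t) i a -
    \sum_i \sum_j Gam c2 a i j (transition c c2 (ga t)) * jacobian c c2 (ga t) b i * jacobian c c2 (ga t) e j.
  have [_ /(_ c c2 Ac A2 _ x2 b e a) ->] := conG; rewrite addrK.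
  by congr (pd b _ _); apply/funext => y; rewrite jacobianE.
have sym i := tfG Ac (gaT t Jt) i 1 0.
by rewrite !pdJ !sum_ord2 !sym; ring.
Qed.

Lemma first_integral_killing U K : open U -> is_first_integral A Gam U K -> killing_form U K.
Proof.
move=> oU [K1 _ Kc]; split=> // c Ac x xU.
have xT : region c setT x by exact: region_sub xU.
pose a := pd 0 (K c 0) x - \sum_d Gam c d 0 0 x * K c d x.
pose b := pd 0 (K c 1) x + pd 1 (K c 0) x - 2 * \sum_d Gam c d 0 1 x * K c d x.
pose e := pd 1 (K c 1) x - \sum_d Gam c d 1 1 x * K c d x.
have Q (v : 'I_2 -> R) : v 0 * v 0 * a + v 0 * v 1 * b + v 1 * v 1 * e = 0.
  have [J [g [geo J0 g0 gc gv]]] := geodesic_exists v oU Ac xU.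
  have := kappa_derive K1 oU geo J0 Ac (gc _ J0); rewrite /= !gv g0 => -[dk vk].
  rewrite -[LHS]vk; have E : \forall s \near (0 : R), kappa K g c 0 = kappa K g c s.
    have [oJ _ _] := geo.
    have : \forall s \near (0 : R), J s by apply: open_nbhs_nbhs.
    by apply: filterS => s Js; apply: (Kc J g geo 0 s J0 Js c c Ac Ac); exact: gc.
  by rewrite -(near_eq_derive _ E) ?oner_neq0// derive_cst.
(* Polarisation with the velocities (1, 0), (0, 1) and (1, 1). *)
have Q0 := Q (fun i => (i == 0)%:R); have Q1 := Q (fun i => (i == 1)%:R).
have Q2 := Q (fun=> 1); rewrite /= in Q0 Q1 Q2.
have sym i := tfG Ac xT i 1 0.
have [a0 e0] : a = 0 /\ e = 0 by split; lra.
have b0 : b = 0 by lra.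
move: a0 b0 e0; rewrite /a /b /e !sum_ord2 => a0 b0 e0.
by elim/ord2_ind; elim/ord2_ind; rewrite !sum_ord2 ?sym; lra.
Qed.

(** * Linear combinations and unique continuation *)

Lemma Ck_sum n k O (F : 'I_n -> fn) : open O -> (forall i, Ck k O (F i)) ->
  Ck k O (fun x => \sum_i F i x).
Proof.
move=> oO Fk; elim: (index_enum _) => [|i r IH].
  by apply: Ck_eq (Ck_cst k O 0) => // x _; rewrite big_nil.
by apply: Ck_eq (Ck_add oO (Fk i) IH) => // x _; rewrite big_cons.
Qed.

Lemma pd_lin n O (F : 'I_n -> fn) (l : 'I_n -> R) a x : open O -> (forall i, Ck 1 O (F i)) -> O x ->
  pd a (fun y => \sum_i l i * F i y) x = \sum_i l i * pd a (F i) x.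
Proof.
move=> oO F1 Ox; apply: pd_val.
have -> : (fun y => \sum_i l i * F i y) = \sum_i (l i *: F i) by apply/funext => y; rewrite fct_sumE.
have H i : is_derive x (ee a) (l i *: F i) (l i *: pd a (F i) x).
  by apply: is_deriveZ; exact: is_derive_pd (F1 i) Ox.
exact: is_derive_sum H.
Qed.

Definition lincomb n (l : 'I_n -> R) (K : 'I_n -> chart R S -> 'I_2 -> fn) : chart R S -> 'I_2 -> fn :=
  fun c a x => \sum_i l i * K i c a x.

Definition vanishes U K := forall c, A c -> forall x, region c U x -> forall a, K c a x = 0.

Lemma killing_form_sub U U' K : U' `<=` U -> killing_form U K -> killing_form U' K.
Proof.
move=> UU' [[K1 law] kil]; split; last by move=> c Ac x xU; apply: kil => //; exact: region_sub xU.
split=> [c Ac a|c1 c2 A1 A2 x xU]; first by apply: Ck_subset (K1 c Ac a); exact: region_sub.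
by apply: law => //; apply: region_sub xU => p [p2 /UU']; split.
Qed.

Lemma killing_form_lin U n (l : 'I_n -> R) (K : 'I_n -> chart R S -> 'I_2 -> fn) : open U ->
  (forall i, killing_form U (K i)) -> killing_form U (lincomb l K).
Proof.
move=> oU kil; split; first split=> [c Ac a|c1 c2 A1 A2 x xU b].
- apply: Ck_sum => [|i]; first exact: open_region.
  apply: Ck_mul; [exact: open_region|exact: Ck_cst|].
  by have [[+ _] _] := kil i; apply.
- rewrite /lincomb; under eq_bigr => i _.
    have [[_ law] _] := kil i; rewrite (law c1 c2 A1 A2 x xU b) big_distrr/=; over.
  rewrite exchange_big/=; apply: eq_bigr => d _; rewrite big_distrl/=.
  by apply: eq_bigr => i _; rewrite mulrA.
move=> c Ac x xU a b.
have K1 i d : Ck 1 (region c U) (K i c d) by have [[+ _] _] := kil i; apply.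
have oR := open_region Ac oU.
rewrite /lincomb (pd_lin l a oR (fun i => K1 i b) xU) (pd_lin l b oR (fun i => K1 i a) xU).
rewrite -big_split/= (eq_bigr (fun i => l i * (2 * \sum_d Gam c d a b x * K i c d x))).
  rewrite [in RHS]sum_ord2 !big_distrr/= -big_split/= big_distrr/=; apply: eq_bigr => i _.
  by rewrite sum_ord2; ring.
by move=> i _; rewrite -mulrDr; have [_ /(_ c Ac x xU a b) ->] := kil i.
Qed.

Lemma chartD c : A c -> chart_data (region c setT) (Gam c) (eps c).
Proof.
move=> Ac; have oT : open (region c setT) by apply: open_region => //; exact: openT.
have [e4 e0 _] := volE; split=> //.
- by have [+ _] := conG; apply.
- by move=> x xT a b d; exact: tfG.
- exact: e4.
- by move=> x xT; have [] := e0 c Ac x xT.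
- by move=> x xT a b; have [_ ->] := e0 c Ac x xT.
Qed.

(* mu is read off D_0 K_1 = 0. *)
Definition sect c K : 'I_3 -> fn := dec (K c) (fun x =>
  (pd 0 (K c 1) x - (Gam c 0 0 1 x * K c 0 x + Gam c 1 0 1 x * K c 1 x)) / eps c 0 1 x).

Lemma sect_parallel U K c : open U -> killing_form U K -> A c ->
  parallel (prol (Gam c) (eps c)) (region c U) (sect c K).
Proof.
move=> oU [[K1 _] kil] Ac; have [oT G4 sG e4 e0 es] := chartD Ac.
have UT : region c U `<=` region c setT by exact: region_sub.
exact: (killing_parallel oT G4 sG e4 e0 es (open_region Ac oU) UT (K1 c Ac) (kil c Ac)).
Qed.

Lemma sect_lin U n (l : 'I_n -> R) (K : 'I_n -> chart R S -> 'I_2 -> fn) c j x : open U -> A c ->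
  (forall i, killing_form U (K i)) -> region c U x ->
  sect c (lincomb l K) j x = \sum_i l i * sect c (K i) j x.
Proof.
move=> oU Ac kil xU; have K1 i d : Ck 1 (region c U) (K i c d) by have [[+ _] _] := kil i; apply.
elim/ord3_ind: j => [b|]; rewrite /sect.
  by rewrite dec_idx; apply: eq_bigr => i _; rewrite dec_idx.
rewrite dec_idx2 (pd_lin l 0 (open_region Ac oU) (fun i => K1 i 1) xU) /lincomb.
under [RHS]eq_bigr do rewrite dec_idx2.
rewrite !big_distrr/= -big_split/= -sumrB big_distrl/=.
by apply: eq_bigr => i _; ring.
Qed.

Lemma sect_zero K c x (N : set 'rV[R]_2) : open N -> N x -> (forall y, N y -> forall a, K c a y = 0) ->
  forall j, sect c K j x = 0.
Proof.
move=> oN Nx K0; elim/ord3_ind => [b|]; rewrite /sect ?dec_idx ?dec_idx2 ?K0//.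
rewrite (pd_eq (g := fun=> 0) 0 oN (fun y Ny => K0 y Ny 1) Nx) /pd derive_cst.
by rewrite !mulr0 addr0 subrr mul0r.
Qed.

Lemma vanishes_chart U K c W : is_one_form A 1 U K -> A c -> chart_set c W `<=` U ->
  (forall x, W x -> forall a, K c a x = 0) -> vanishes (chart_set c W) K.
Proof.
move=> [_ law] Ac WU K0 c' Ac' x xW a.
have x' : region c' (cdom c `&` U) x.
  by apply: region_sub xW => p pW; split; [case: pW|exact: WU].
rewrite (law c' c Ac' Ac x x') big1// => d _; rewrite K0 ?mul0r//.
by have [_ [_ ] ] := regionP Ac' xW.
Qed.

Lemma good_chart c q : A c -> region c setT q -> exists2 r0 : R, 0 < r0 &
  forall r, 0 < r -> r <= r0 -> good (region c setT) (prol (Gam c) (eps c)) q r.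
Proof.
move=> Ac qT; have [oT G4 sG e4 e0 es] := chartD Ac.
apply: good_exists => // a i j; exact: Ck_prol.
Qed.

(** The section [(K, mu)] solves a linear equation along rays, so the vanishing of [K] and [mu] at
    one point forces [K] to vanish nearby. *)
Lemma point_vanishes U K c x : open U -> killing_form U K -> A c -> region c U x ->
  (forall j, sect c K j x = 0) ->
  exists N, [/\ open N, N (cinv c x), N `<=` U & vanishes N K].
Proof.
move=> oU kil Ac xU s0; have xT : region c setT x by exact: region_sub xU.
have oR := open_region Ac oU.
have [r0 r00 gr] := good_chart Ac xT.
have [d d0 dU] := (near_disc x _).1 (near_open oR xU (fun y Oy => Oy : region c U y)).
pose r := Num.min r0 d.
have rr : 0 < r by rewrite lt_min r00.
have rU : disc x r `<=` region c U.
  by move=> y yr; apply: dU; apply: lt_le_trans yr _; rewrite ge_min lexx orbT.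
have g : good (region c setT) (prol (Gam c) (eps c)) x r by apply: gr => //; rewrite ge_min lexx.
have pP : parallel (prol (Gam c) (eps c)) (disc x r) (sect c K).
  by move=> y /rU; exact: (sect_parallel oU kil Ac).
have xr : disc x r x by rewrite /disc/= subrr normr0.
have K0 := good_unique g (@subset_refl _ _) (@star_disc _ _ _) xr (parallel_radial (@star_disc _ _ _) pP) s0.
have rS : chart_set c (disc x r) `<=` U.
  move=> p [pc /rU/(regionP Ac)[_ + _]]; by rewrite cinvK.
exists (chart_set c (disc x r)); split=> //.
- by apply: open_chart_set => //; exact: open_disc.
- by have [xc _ xE] := regionP Ac xT; split=> //=; rewrite xE.
- apply: (vanishes_chart kil.1 Ac rS) => y yr a.
  by have := K0 y yr (idx a); rewrite /sect dec_idx.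
Qed.

(** Unique continuation on [U]. It is kept as a predicate because the neighbourhoods finally chosen
    may be disconnected, where it can fail. *)
Definition rigid U := forall K, killing_form U K -> forall N, open N -> N !=set0 -> N `<=` U ->
  vanishes N K -> vanishes U K.

Lemma rigid_chart c q r W : A c -> open W -> W `<=` disc q r ->
  good (region c setT) (prol (Gam c) (eps c)) q r -> (forall x, W x -> star x W) ->
  rigid (chart_set c W).
Proof.
move=> Ac oW Wr g st K kil N oN [p Np] NW K0.
have WT : W `<=` region c setT by move=> x /Wr xr; exact: (good_disc g xr).
have oU := open_chart_set Ac oW.
have pP := sect_parallel oU kil Ac; rewrite region_chart_set// in pP.
have [pc pW] := NW p Np.
have s0 : forall j, sect c K j (cmap c p) = 0.
  apply: (sect_zero (N := region c N)); [exact: open_region|exact: region_map|].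
  by move=> y; exact: K0.
have {}K0 := good_unique g Wr (st _ pW) pW (parallel_radial (st _ pW) pP) s0.
apply: (vanishes_chart kil.1 Ac (@subset_refl _ _)) => y yW a.
by have := K0 y yW (idx a); rewrite /sect dec_idx.
Qed.

Lemma rigid_disc c q r : A c -> good (region c setT) (prol (Gam c) (eps c)) q r ->
  rigid (chart_set c (disc q r)).
Proof.
move=> Ac g; have H := rigid_chart (W := disc q r) Ac (@open_disc R q r) _ g.
by move: H; apply=> // x xr y yr v v01; exact: convex_disc.
Qed.

(** The points near which [K] vanishes form an open set. It is closed as well, since a small disc
    about a limit point is rigid and meets it. A path starting in [N] therefore stays in this
    set. *)
Lemma rigid_setT : path_connected R S -> rigid setT.
Proof.
move=> pc K kil N oN [p0 Np0] _ KN.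
pose Z : set S := [set p | exists M, [/\ open M, M p & vanishes M K]].
have oZ : open Z.
  rewrite openE => p [M [oM Mp KM]]; apply: filterS (_ : nbhs p M); last exact: open_nbhs_nbhs.
  by move=> q Mq; exists M.
have cZ : closed Z.
  rewrite -[Z]setCK; apply: open_closedC; rewrite openE => p nZ.
  have [_ /(_ p)[c Ac cp] _] := atlasA.
  have pT : region c setT (cmap c p) by exact: region_map.
  have [r r0 gr] := good_chart Ac pT; have g := gr r r0 (lexx r).
  have oB : open (chart_set c (disc (cmap c p) r)) by apply: open_chart_set => //; exact: open_disc.
  have Bp : chart_set c (disc (cmap c p) r) p by split=> //=; rewrite /disc/= subrr normr0.
  apply: filterS (_ : nbhs p (chart_set c (disc (cmap c p) r))); last exact: open_nbhs_nbhs.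
  move=> q Bq [M [oM Mq KM]]; apply: nZ; exists (chart_set c (disc (cmap c p) r)); split=> //.
  have rB := rigid_disc Ac g.
  apply: (rB K (killing_form_sub (@subsetT _ _) kil) (M `&` chart_set c (disc (cmap c p) r))).
  - exact: openI.
  - by exists q.
  - by move=> z [].
  - by move=> c' Ac' x xM a; apply: KM => //; apply: region_sub xM => z [].
move=> c Ac x xT a; have [xc _ xE] := regionP Ac xT.
have [ga [gac g0 g1]] := pc p0 (cinv c x).
have cI : connected (ga @` `[0, 1]).
  by apply: connected_continuous_connected => //; exact: segment_connected.
have ZI : ga @` `[0, 1] `&` Z = ga @` `[0, 1].
  apply: cI; [|by exists Z|by exists Z].
  exists p0; split; first by exists 0 => //; rewrite /= in_itv/= lexx ler01.
  by exists N.
have : (ga @` `[0, 1]) (cinv c x) by exists 1 => //; rewrite /= in_itv/= lexx ler01.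
rewrite -ZI => -[_ [M [_ Mx KM]]].
by apply: KM => //; rewrite -xE; exact: region_map.
Qed.

(** The Killing equation in one chart about each point passes to all charts by way of geodesics: it
    makes [kappa] constant along them, a property that refers to no particular chart. The zero form
    is treated apart because a first integral is nonzero by definition. *)
Lemma killing_form_local U K : open U -> is_one_form A 1 U K ->
  (forall p, U p -> exists c, [/\ A c, cdom c p & killing_at c K (cmap c p)]) -> killing_form U K.
Proof.
move=> oU K1 kil.
have [K0|nK] := pselect (exists c x a, [/\ A c, region c U x & K c a x != 0]).
  exact/first_integral_killing/killing_first_integral.
split=> // c Ac x xU a b.
have z y d : region c U y -> K c d y = 0.
  by move=> yU; apply/eqP/negPn/negP => Kn; apply: nK; exists c, y, d; split.
have zd e d : pd e (K c d) x = 0.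
  by rewrite (pd_eq (g := fun=> 0) e (open_region Ac oU) (fun y => @z y d) xU) /pd derive_cst.
by rewrite !zd addr0 big1 ?mulr0// => d _; rewrite z ?mulr0.
Qed.

Definition has_kil n U := exists K : 'I_n -> chart R S -> 'I_2 -> fn,
  (forall i, killing_form U (K i)) /\ lin_independent A U K.

Lemma has_kilP n U : open U -> has_independent_first_integrals A Gam n U <-> has_kil n U.
Proof.
move=> oU; split=> -[K [KF Ki]]; exists K; split=> // i.
  by apply: first_integral_killing => //; exact: KF.
have [K1 kil] := KF i; apply: killing_first_integral => // [p Up|].
  have [_ /(_ p)[c Ac cp] _] := atlasA; exists c; split=> //.
  by apply: kil => //; exact: region_map.
apply: contrapT => nK.
have : (1 : R) = 0.
  rewrite -(Ki (fun k => (k == i)%:R) _ i) ?eqxx// => c Ac x xU a.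
  rewrite (bigD1 i)//= eqxx mul1r big1 ?addr0 => [|k /negPf ->]; last by rewrite mul0r.
  by apply/eqP/negPn/negP => Kn; apply: nK; exists c, x, a; split.
by move/eqP; rewrite oner_eq0.
Qed.

(** A combination that vanishes at [x] together with its [mu] vanishes near [x], hence on all of the
    rigid set [U]. Independence of the forms thus becomes independence of the sections at every
    point, also where the rank of the invariants drops. *)
Lemma sect_independent n U (K : 'I_n -> chart R S -> 'I_2 -> fn) c x : open U -> rigid U ->
  (forall i, killing_form U (K i)) -> lin_independent A U K -> A c -> region c U x ->
  independent (fun i j => sect c (K i) j x).
Proof.
move=> oU rU kil Ki Ac xU l hl.
have kl := killing_form_lin l oU kil.
have s0 j : sect c (lincomb l K) j x = 0 by rewrite (sect_lin _ _ oU Ac kil xU).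
have [N [oN Nx NU KN]] := point_vanishes oU kl Ac xU s0.
have V := rU _ kl N oN (ex_intro _ _ Nx) NU KN.
by apply: Ki => c' Ac' y yU a; exact: V.
Qed.

Lemma region_setT U c : region c U `<=` region c setT.
Proof. exact: region_sub. Qed.

Lemma kil1_invariants U : open U -> rigid U -> has_kil 1 U ->
  invN_vanishes_on A Gam eps U /\ invS_vanishes_on A Gam eps U.
Proof.
move=> oU rU [K [kil Ki]].
have H c x : A c -> region c U x -> invN (Gam c) (eps c) x = 0 /\
    forall a b d, Defs.invS (Gam c) (eps c) a b d x = 0.
  move=> Ac xU; apply: (parallel_invariants (chartD Ac) (open_region Ac oU) (@region_setT U c)
    (sect_parallel oU (kil ord0) Ac) xU).
  have ip := sect_independent oU rU kil Ki Ac xU.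
  apply: contrapT => /forallNP n0.
  have : (1 : R) = 0.
    apply: (ip (fun=> 1) _ ord0) => j; rewrite big_ord1 mul1r.
    by apply/eqP/negPn/negP; exact: n0.
  by move/eqP; rewrite oner_eq0.
split=> c Ac x xU; first by have [] := H c x Ac xU.
by move=> a b d; have [_] := H c x Ac xU; apply.
Qed.

Lemma kil2_tensorT U : open U -> rigid U -> has_kil 2 U -> tensorT_vanishes_on A Gam eps U.
Proof.
move=> oU rU [K [kil Ki]] c Ac x xU.
apply: (parallel2_tensorT (chartD Ac) (open_region Ac oU) (@region_setT U c)
    (fun k => sect_parallel oU (kil k) Ac) xU).
exact: sect_independent oU rU kil Ki Ac xU.
Qed.

Lemma kil3_vecV U : open U -> rigid U -> has_kil 3 U ->
  forall c, A c -> forall x, region c U x -> forall j, vecV (Gam c) (eps c) j x = 0.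
Proof.
move=> oU rU [K [kil Ki]] c Ac x xU.
apply: (parallel3_vecV (chartD Ac) (open_region Ac oU) (@region_setT U c)
    (fun k => sect_parallel oU (kil k) Ac) xU).
exact: sect_independent oU rU kil Ki Ac xU.
Qed.

(** * Killing forms as parallel sections in one chart *)

Definition ext c0 (k : 'I_2 -> fn) : chart R S -> 'I_2 -> fn :=
  fun c b x => \sum_d k d (transition c c0 x) * jacobian c c0 x b d.

Section Extension.
Variables (c0 : chart R S) (W : set 'rV[R]_2) (k : 'I_2 -> fn).
Hypotheses (A0 : A c0) (oW : open W) (WT : W `<=` region c0 setT) (k1 : forall a, Ck 1 W (k a)).

Let sub0 c : region c (chart_set c0 W) `<=` region c (cdom c0).
Proof. by apply: region_sub => p []. Qed.

Let mapW c x : A c -> region c (chart_set c0 W) x -> W (transition c c0 x).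
Proof. by move=> Ac /(regionP Ac)[_ [_ +] _]. Qed.

Lemma ext_one_form : is_one_form A 1 (chart_set c0 W) (ext c0 k).
Proof.
have oU := open_chart_set A0 oW.
split=> [c Ac b|c1 c2 A1 A2 x xU b].
  have oR := open_region Ac oU.
  apply: Ck_sum2 => // d; apply: Ck_mul => //.
    apply: (Ck1_comp oR oW (k1 d) (fun x => @mapW c x Ac)).
      by move=> x /sub0; exact: transition_continuous.
    move=> e; apply: Ck_subset (@sub0 c) _.
    by apply: Ck_leq (transition_Ck e Ac A0); [exact: open_overlap|].
  apply: Ck_subset (@sub0 c) _.
  by apply: Ck_leq (jacobian_Ck b d Ac A0); [exact: open_overlap|].
have x20 : region c1 (cdom c2 `&` cdom c0) x by apply: region_sub xU => p [p2 []].
have x2 : region c1 (cdom c2) x by apply: region_sub xU => p [].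
rewrite /ext (eq_bigr (fun d => \sum_e k d (transition c1 c0 x) * (jacobian c1 c2 x b e *
    jacobian c2 c0 (transition c1 c2 x) e d))); last first.
  by move=> d _; rewrite (jacobian_comp b d A1 A2 A0 x20) big_distrr.
rewrite exchange_big/=; apply: eq_bigr => e _; rewrite big_distrl/=; apply: eq_bigr => d _.
by rewrite (transition_eq _ A1 A2 x2); ring.
Qed.

Lemma ext_self x b : W x -> ext c0 k c0 b x = k b x.
Proof.
move=> Wx; have xT := WT Wx; have [_ _ xE] := regionP A0 xT.
rewrite /ext /transition xE (eq_bigr (fun d => k d x * (b == d)%:R)); last first.
  by move=> d _; rewrite jacobian_id.
rewrite (bigD1 b)//= eqxx mulr1 big1 ?addr0// => d.
by rewrite eq_sym => /negPf ->; rewrite mulr0.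
Qed.

Lemma ext_killing_form : (forall x, W x -> forall a b,
    pd a (k b) x + pd b (k a) x = 2 * \sum_d Gam c0 d a b x * k d x) ->
  killing_form (chart_set c0 W) (ext c0 k).
Proof.
move=> kil; apply: killing_form_local; [exact: open_chart_set|exact: ext_one_form|].
move=> p [p0 pW]; exists c0; split=> // a b.
rewrite !(pd_eq _ oW (fun y Wy => ext_self _ Wy) pW) kil//; congr (_ * _).
by apply: eq_bigr => d _; rewrite ext_self.
Qed.

End Extension.

(** Nothing is lost when [mu] is forgotten: if the one-form part of a parallel section vanishes on
    [W], its equation reduces to [eps_01 mu = 0]. *)
Lemma has_kil_chart n c W : A c -> open W -> W `<=` region c setT ->
  has_kil n (chart_set c W) <-> has_par (prol (Gam c) (eps c)) n W.
Proof.
move=> Ac oW WT; have oU := open_chart_set Ac oW.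
split=> [[K [kil Ki]]|[Psi [pP Pi]]].
  exists (fun i => sect c (K i)); split=> [i|l hl].
    by have := sect_parallel oU (kil i) Ac; rewrite region_chart_set.
  have kl := killing_form_lin l oU kil.
  apply: Ki => c' Ac' x xU a.
  apply: (vanishes_chart kl.1 Ac (@subset_refl _ _)) => // y yW b.
  by rewrite /lincomb -[RHS](hl y yW (idx b)); apply: eq_bigr => i _; rewrite /sect dec_idx.
have P1 i j : Ck 1 W (Psi i j) by apply: (parallel_Ck1 (chartD Ac) _ oW WT).
have pdP (P : 'I_3 -> fn) a b x : parallel (prol (Gam c) (eps c)) W P -> W x -> pd a (P (idx b)) x =
    Gam c 0 a b x * P (idx 0) x + Gam c 1 a b x * P (idx 1) x + eps c a b x * P idx2 x.
  move=> PP Wx; have [_ /(_ a) ->] := PP x Wx (idx b).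
  by rewrite /lin /conn sum_ord3 !prol_KK prol_Kmu.
have [oT G4 sG e4 e0 es] := chartD Ac.
exists (fun i => ext c (fun b => Psi i (idx b))); split=> [i|l hl].
  apply: ext_killing_form => // x Wx a b.
  rewrite !(pdP _ _ _ _ (pP i) Wx) sum_ord2 (es x (WT _ Wx) b a) (sG x (WT _ Wx) 0 b a).
  by rewrite (sG x (WT _ Wx) 1 b a); ring.
have h1 x b : W x -> \sum_k l k * Psi k (idx b) x = 0.
  move=> Wx; have xU : region c (chart_set c W) x by rewrite region_chart_set.
  rewrite -[RHS](hl c Ac x xU b); apply: eq_bigr => i _.
  by rewrite (ext_self _ Ac WT).
have pl := parallel_lin l pP.
apply: Pi => x Wx; elim/ord3_ind => [b|]; first exact: h1.
have := pdP _ 0 1 x pl Wx; rewrite !h1// !mulr0 !add0r.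
rewrite (pd_eq (g := fun=> 0) 0 oW (fun y Wy => h1 y 1 Wy) Wx) /pd derive_cst => /esym/eqP.
by rewrite mulf_eq0 (negPf (e0 x (WT _ Wx))) => /eqP.
Qed.

(** * Gluing Killing forms over disjoint open sets *)

Lemma Ck_setU k O O' (f : fn) : Ck k O f -> Ck k O' f -> Ck k (O `|` O') f.
Proof.
elim: k f => [|k IH] f; first by move=> h h' x [/h|/h'].
move=> [d h] [d' h']; split=> [x [Ox|Ox]|a]; [exact: d|exact: d'|exact: IH (h a) (h' a)].
Qed.

Lemma region_setU c U U' : region c (U `|` U') = region c U `|` region c U'.
Proof. by rewrite /region setIUr image_setU. Qed.

Lemma killing_form_setU U U' K : killing_form U K -> killing_form U' K -> killing_form (U `|` U') K.
Proof.
move=> [[K1 law] kil] [[K1' law'] kil']; split; first split=> [c Ac a|c1 c2 A1 A2 x].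
- by rewrite region_setU; apply: Ck_setU; [exact: K1|exact: K1'].
- by rewrite setIUr region_setU => -[|]; [exact: law|exact: law'].
- by move=> c Ac x; rewrite region_setU => -[|]; [exact: kil|exact: kil'].
Qed.

Lemma killing_form_eq U K K' : open U -> (forall c, A c -> forall x, region c U x -> forall a,
    K c a x = K' c a x) -> killing_form U K -> killing_form U K'.
Proof.
move=> oU E [[K1 law] kil]; split; first split=> [c Ac a|c1 c2 A1 A2 x xU b].
- by apply: Ck_eq (K1 c Ac a); [exact: open_region|move=> x xU; exact: E].
- have x1 : region c1 U x by apply: region_sub xU => p [].
  have x2 : region c2 U (transition c1 c2 x).
    by apply: region_sub (region_transition A1 xU) => p [].
  rewrite -(E c1 A1 x x1) (law c1 c2 A1 A2 x xU b); apply: eq_bigr => d _.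
  by rewrite (E c2 A2 _ x2).
move=> c Ac x xU a b; have oR := open_region Ac oU.
rewrite -!(pd_eq _ oR (fun y yU => E c Ac y yU _) xU) (kil c Ac x xU a b); congr (_ * _).
by apply: eq_bigr => d _; rewrite E.
Qed.

Lemma glue U U' K K' : open U -> open U' -> U `&` U' = set0 ->
  killing_form U K -> killing_form U' K' -> exists L, [/\ killing_form (U `|` U') L,
    forall c, A c -> forall x, region c U x -> forall a, L c a x = K c a x &
    forall c, A c -> forall x, region c U' x -> forall a, L c a x = K' c a x].
Proof.
move=> oU oU' d kil kil'.
pose L c a x := if `[< U (cinv c x) >] then K c a x else K' c a x.
have LE c : A c -> forall x, region c U x -> forall a, L c a x = K c a x.
  by move=> Ac x /(regionP Ac)[_ /asboolT xU _] a; rewrite /L xU.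
have LE' c : A c -> forall x, region c U' x -> forall a, L c a x = K' c a x.
  move=> Ac x /(regionP Ac)[_ xU' _] a; rewrite /L asboolF// => xU.
  by have : (U `&` U') (cinv c x) by []; rewrite d.
exists L; split=> //; apply: killing_form_setU.
  by apply: killing_form_eq kil => // c Ac x xU a; rewrite LE.
by apply: killing_form_eq kil' => // c Ac x xU a; rewrite LE'.
Qed.

Lemma killing_form0 U : killing_form U (fun _ _ _ => 0).
Proof.
split; first split=> [c Ac a|c1 c2 A1 A2 x xU b]; first exact: Ck_cst.
  by rewrite big1// => d _; rewrite mul0r.
move=> c Ac x xU a b; rewrite /pd !derive_cst addr0 big1 ?mulr0// => d _.
by rewrite mulr0.
Qed.

(** * Three Killing forms and projective flatness *)

Lemma curl_algebra (J D : 'I_2 -> 'I_2 -> R) (k : 'I_2 -> R) (H : 'I_2 -> 'I_2 -> 'I_2 -> R) :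
  (forall d, H 0 1 d = H 1 0 d) ->
  \sum_d ((\sum_e J 0 e * D e d) * J 1 d + k d * H 0 1 d) -
  \sum_d ((\sum_e J 1 e * D e d) * J 0 d + k d * H 1 0 d) =
  (J 0 0 * J 1 1 - J 0 1 * J 1 0) * (D 0 1 - D 1 0).
Proof. by move=> H01; rewrite !sum_ord2 !H01; ring. Qed.

Lemma curl_transition U K c1 c2 x : open U -> is_one_form A 1 U K -> A c1 -> A c2 ->
  region c1 (cdom c2 `&` U) x ->
  pd 0 (K c1 1) x - pd 1 (K c1 0) x =
  (jacobian c1 c2 x 0 0 * jacobian c1 c2 x 1 1 - jacobian c1 c2 x 0 1 * jacobian c1 c2 x 1 0) *
  (pd 0 (K c2 1) (transition c1 c2 x) - pd 1 (K c2 0) (transition c1 c2 x)).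
Proof.
move=> oU [K1 law] A1 A2 xU.
have o2 : open (cdom c2) by have [] := chartP A2.
have oN := open_region A1 (openI o2 oU).
have x2 : region c1 (cdom c2) x by apply: region_sub xU => p [].
have TU : region c2 U (transition c1 c2 x).
  by apply: region_sub (region_transition A1 xU) => p [].
have dJ a b d : is_derive x (ee a) (fun y => jacobian c1 c2 y b d)
    (pd a (pd b (transition_coord c1 c2 d)) x).
  have J1 := Ck_leq (open_overlap A1 A2) (isT : (1 <= 5)%N) (jacobian_Ck b d A1 A2).
  apply: is_derive_val (is_derive_pd a J1 x2) _; congr (pd a _ _).
  by apply/funext => y; rewrite jacobianE.
have dK a d : is_derive x (ee a) (fun y => K c2 d (transition c1 c2 y))
    (\sum_e jacobian c1 c2 x a e * pd e (K c2 d) (transition c1 c2 x)).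
  apply: pd_transition => //.
  by have [] := Ck_diff (open_region A2 oU) (K1 c2 A2 d) TU.
have E a b : pd a (K c1 b) x = \sum_d ((\sum_e jacobian c1 c2 x a e * pd e (K c2 d) (transition c1 c2 x)) *
    jacobian c1 c2 x b d + K c2 d (transition c1 c2 x) * pd a (pd b (transition_coord c1 c2 d)) x).
  rewrite (pd_eq a oN (fun y yU => law c1 c2 A1 A2 y yU b) xU); apply: pd_val.
  rewrite sum_ord2 (_ : (fun y => _) = (fun y => K c2 0 (transition c1 c2 y) * jacobian c1 c2 y b 0 +
     K c2 1 (transition c1 c2 y) * jacobian c1 c2 y b 1)); last by apply/funext => y; rewrite sum_ord2.
  exact: (is_derive_add (is_derive_mul (dK a 0) (dJ a b 0)) (is_derive_mul (dK a 1) (dJ a b 1))).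
have C d := pdC 0 1 (open_overlap A1 A2) (Ck_leq (open_overlap A1 A2) (isT : (2 <= 6)%N)
  (transition_Ck d A1 A2)) x2.
rewrite (E 0 1) (E 1 0).
exact: (curl_algebra (fun a b => jacobian c1 c2 x a b)
  (fun e d => pd e (K c2 d) (transition c1 c2 x)) (fun d => K c2 d (transition c1 c2 x))
  (H := fun a b d => pd a (pd b (transition_coord c1 c2 d)) x) C).
Qed.

(** Antisymmetrising removes the Christoffel symbols: [eps_01 mu] is half the coefficient of [dK],
    and so transforms as a two-form. *)
Lemma sect_mu U K c x : killing_form U K -> A c -> region c U x ->
  eps c 0 1 x * sect c K idx2 x = 2^-1 * (pd 0 (K c 1) x - pd 1 (K c 0) x).
Proof.
move=> [_ kil] Ac xU; have [_ _ _ _ e0 _] := chartD Ac; have ex := e0 x (region_setT xU).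
have := kil c Ac x xU 0 1; rewrite sum_ord2 /sect dec_idx2 mulrCA divff// mulr1 => h; lra.
Qed.

(** As [eps_01 mu] is half of [dK], the numerator is built from two-forms times one-forms and the
    denominator is the two-form [K /\ L]; the jacobian determinants cancel. *)
Lemma flattening_one_form U K L (W : set S) : open U -> killing_form U K -> killing_form U L -> open W ->
  W `<=` U -> (forall c, A c -> forall x, region c W x ->
    sect c K (idx 0) x * sect c L (idx 1) x - sect c K (idx 1) x * sect c L (idx 0) x != 0) ->
  is_one_form A 1 W (fun c => flattening (eps c) (sect c K) (sect c L)).
Proof.
move=> oU kK kL oW WU w0; have kK' := killing_form_sub WU kK; have kL' := killing_form_sub WU kL.
split=> [c Ac a|c1 c2 A1 A2 x xW b].
  apply: (flattening_Ck1 (chartD Ac) (open_region Ac oW) (@region_setT W c)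
    (sect_parallel oW kK' Ac) (sect_parallel oW kL' Ac)).
  exact: w0.
have x1 : region c1 W x by apply: region_sub xW => p [].
have T2 : region c2 W (transition c1 c2 x) by apply: region_sub (region_transition A1 xW) => p [].
have w1 := w0 c1 A1 x x1; have w2 := w0 c2 A2 _ T2.
have lawK b' := kK'.1.2 c1 c2 A1 A2 x xW b'; have lawL b' := kL'.1.2 c1 c2 A1 A2 x xW b'.
have F c y a : A c -> region c W y -> flattening (eps c) (sect c K) (sect c L) a y =
    2^-1 * ((pd 0 (K c 1) y - pd 1 (K c 0) y) * L c a y - (pd 0 (L c 1) y - pd 1 (L c 0) y) * K c a y) /
    (K c 0 y * L c 1 y - K c 1 y * L c 0 y).
  move=> Ac yW; rewrite /flattening mulrBr !mulrA (sect_mu kK' Ac yW) (sect_mu kL' Ac yW).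
  by rewrite /sect !dec_idx; congr (_ / _); ring.
rewrite !F// sum_ord2 !F// (curl_transition oW kK'.1 A1 A2 xW) (curl_transition oW kL'.1 A1 A2 xW).
rewrite !lawK !lawL !sum_ord2; move: w1 w2; rewrite /sect !dec_idx !lawK !lawL !sum_ord2.
move: (jacobian c1 c2 x) => J; set k0 := K c2 0 _; set k1 := K c2 1 _; set l0 := L c2 0 _; set l1 := L c2 1 _.
move=> w1 w2.
have E : (k0 * J 0 0 + k1 * J 0 1) * (l0 * J 1 0 + l1 * J 1 1) -
    (k0 * J 1 0 + k1 * J 1 1) * (l0 * J 0 0 + l1 * J 0 1) =
    (J 0 0 * J 1 1 - J 0 1 * J 1 0) * (k0 * l1 - k1 * l0) by ring.
have D0 : J 0 0 * J 1 1 - J 0 1 * J 1 0 != 0 by apply: contra w1 => /eqP D; rewrite E D mul0r.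
by rewrite E; elim/ord2_ind: b; field; rewrite D0 w2.
Qed.

(** Three independent sections fill the fibre at [p], so two combinations of them have one-form
    parts [dx^0] and [dx^1] there. These stay independent near [p], where their flattening form is
    defined. *)
Lemma kil3_projectively_flat U : open U -> rigid U -> has_kil 3 U ->
  projectively_flat_on A Gam U /\ ricci_symmetric_on A Gam U.
Proof.
move=> oU rU k3; have V0 := kil3_vecV oU rU k3.
have sym : ricci_symmetric_on A Gam U.
  move=> c Ac x xU; apply/(beta_ricci (chartD Ac) (region_setT xU)).
  by have /vecVE[_ _ ->] := V0 c Ac x xU.
split=> // p Up; have [_ /(_ p)[c Ac cp] _] := atlasA.
have [K [kil Ki]] := k3; have xU : region c U (cmap c p) by exact: region_map.
have ip := sect_independent oU rU kil Ki Ac xU.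
have [l hl] := independent_full ip (fun j => (j == idx 0)%:R).
have [m hm] := independent_full ip (fun j => (j == idx 1)%:R).
have kl := killing_form_lin l oU kil; have km := killing_form_lin m oU kil.
pose w x := sect c (lincomb l K) (idx 0) x * sect c (lincomb m K) (idx 1) x -
  sect c (lincomb l K) (idx 1) x * sect c (lincomb m K) (idx 0) x.
have wx : w (cmap c p) != 0.
  rewrite /w !(sect_lin _ _ oU Ac kil xU) !hl !hm !eqxx.
  have -> : (idx 1 == idx 0) = false by [].
  by rewrite mul1r mul0r subr0 oner_neq0.
pose W : set 'rV[R]_2 := [set x | region c U x /\ w x != 0].
have s1 k j : Ck 1 (region c U) (sect c (lincomb k K) j).
  exact: (parallel_Ck1 (chartD Ac) _ (open_region Ac oU) (@region_setT U c)
    (sect_parallel oU (killing_form_lin k oU kil) Ac)).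
have oW : open W.
  rewrite openE => x [xR wn].
  have wc : {for x, continuous w}.
    have sc k j := Ck_cont (open_region Ac oU) (s1 k j) xR.
    apply: continuous_atD; last apply: continuous_atN; exact: continuous_atM.
  have H := filterI (near_open (open_region Ac oU) xR (fun y Oy => Oy : region c U y)) (neq0_near wc wn).
  exact: H.
have WU : chart_set c W `<=` U by move=> q [qc [/(regionP Ac)[_ + _] _]]; rewrite cinvK.
have oN := open_chart_set Ac oW.
have w0 c' : A c' -> forall x, region c' (chart_set c W) x ->
    sect c' (lincomb l K) (idx 0) x * sect c' (lincomb m K) (idx 1) x -
    sect c' (lincomb l K) (idx 1) x * sect c' (lincomb m K) (idx 0) x != 0.
  move=> Ac' x xN; have [x' [xc [xR xw]] xE] := regionP Ac' xN.
  have yN : region c (cdom c' `&` U) (cmap c (cinv c' x)).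
    by apply: region_map => //; split=> //; apply: WU; split.
  move: xw; rewrite /w /sect !dec_idx.
  have TE : transition c c' (cmap c (cinv c' x)) = x by rewrite transition_map// xE.
  rewrite !(kl.1.2 c c' Ac Ac' _ yN) !(km.1.2 c c' Ac Ac' _ yN) TE !sum_ord2.
  apply: contra => /eqP w'; apply/eqP.
  move: (jacobian c c' _) => J; move: w'.
  set k0 := lincomb l K c' 0 x; set k1 := lincomb l K c' 1 x.
  set l0 := lincomb m K c' 0 x; set l1 := lincomb m K c' 1 x => w'.
  transitivity ((J 0 0 * J 1 1 - J 0 1 * J 1 0) * (k0 * l1 - k1 * l0)); first by ring.
  by rewrite w' mulr0.
exists (chart_set c W); split; [by split; [exact: oN|split; [exact: cp|split]]|exact: WU|].
exists (fun c => flattening (eps c) (sect c (lincomb l K)) (sect c (lincomb m K))).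
  exact: (flattening_one_form oU kl km oN WU w0).
move=> c' Ac' x xN a b d e.
have oR := open_region Ac' oN.
have Ps y : region c' (chart_set c W) y -> schouten (Gam c') 1 0 y = schouten (Gam c') 0 1 y.
  move=> yN; have := sym c' Ac' y (region_sub WU yN) 1 0; rewrite /schouten => ->; ring.
have pK := sect_parallel oN (killing_form_sub WU kl) Ac'.
have pL := sect_parallel oN (killing_form_sub WU km) Ac'.
apply: (proj_flat (chartD Ac') oR (@region_setT _ c') _ Ps _ xN).
  by move=> a'; apply: (flattening_Ck1 (chartD Ac') oR (@region_setT _ c') pK pL); exact: w0.
move=> y yN a' b'.
by apply: (flattening_pd (chartD Ac') oR (@region_setT _ c') pK pL Ps _ yN); exact: w0.
Qed.

Lemma projectively_flat_vecV U : open U -> projectively_flat_on A Gam U -> ricci_symmetric_on A Gam U ->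
  forall c, A c -> forall x, region c U x -> forall j, vecV (Gam c) (eps c) j x = 0.
Proof.
move=> oU pf sym c Ac x xU; have [xc Ux xE] := regionP Ac xU.
have [W [[oW Wx] WU [Ups [Ups1 _] flat]]] := pf _ Ux.
have oR := open_region Ac oW.
have Ps y : region c W y -> schouten (Gam c) 1 0 y = schouten (Gam c) 0 1 y.
  move=> yN; have := sym c Ac y (region_sub WU yN) 1 0; rewrite /schouten => ->; ring.
have xW : region c W x by rewrite -xE; exact: region_map.
apply: (proj_flat_vecV (chartD Ac) oR (@region_setT _ c) (Ups1 c Ac) Ps _ xW) => y yW a b.
exact: (flat c Ac y yW 0 1 a b).
Qed.

Local Notation tensorT0 := (tensorT_vanishes_on A Gam eps).
Local Notation invariants0 U := (invN_vanishes_on A Gam eps U /\ invS_vanishes_on A Gam eps U).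

(** * Choice of the neighbourhood *)

Lemma has_kilS n U : has_kil n.+1 U -> has_kil n U.
Proof.
move=> [K [kil Ki]]; exists (fun i => K (lift ord0 i)); split=> [i|l hl i]; first exact: kil.
rewrite -(Ki (fun j => oapp l 0 (unlift ord0 j)) _ (lift ord0 i)) ?liftK// => c Ac x xU a.
rewrite big_ord_recl unlift_none mul0r add0r -[RHS](hl c Ac x xU a).
by apply: eq_bigr => j _; rewrite liftK.
Qed.

Lemma has_kil_sub n U U' : open U' -> U' !=set0 -> U' `<=` U -> open U -> rigid U ->
  has_kil n U -> has_kil n U'.
Proof.
move=> oU' U'0 U'U oU rU [K [kil Ki]]; exists K; split=> [i|l hl].
  exact: (killing_form_sub U'U (kil i)).
by apply: Ki; exact: (rU (lincomb l K) (killing_form_lin l oU kil) U' oU' U'0 U'U hl).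
Qed.

Lemma has_kil0 U : has_kil 0 U.
Proof. by exists (fun _ _ _ _ => 0); split=> [i|l _ i]; case: i. Qed.

Lemma has_kil1P U K : killing_form U K -> ~ vanishes U K -> has_kil 1 U.
Proof.
move=> kil nK; exists (fun=> K); split=> // l hl i; rewrite ord1; apply/eqP/negPn/negP => l0.
apply: nK => c Ac x xU a; have := hl c Ac x xU a.
by rewrite big_ord1 => /eqP; rewrite mulf_eq0 (negPf l0) => /eqP.
Qed.

Lemma vanishes_setU U U' K : vanishes U K -> vanishes U' K -> vanishes (U `|` U') K.
Proof. by move=> K0 K0' c Ac x; rewrite region_setU => -[]; [exact: K0|exact: K0']. Qed.

(** Every Killing form extends by zero to the other piece, so the numbers of independent forms
    add. *)
Lemma has_kil_setU m n U U' : open U -> open U' -> U `&` U' = set0 ->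
  has_kil m U -> has_kil n U' -> has_kil (m + n) (U `|` U').
Proof.
move=> oU oU' d [K [kil Ki]] [K' [kil' Ki']].
have [L HL] := choice (fun i => glue oU oU' d (kil i) (killing_form0 U')).
have [L' HL'] := choice (fun i => glue oU oU' d (killing_form0 U) (kil' i)).
exists (fun i => match fintype.split i with inl i => L i | inr i => L' i end); split=> [i|l hl].
  by case: fintype.splitP => j _; [have [] := HL j|have [] := HL' j].
have E c x a : A c -> region c (U `|` U') x ->
    \sum_i l (lshift n i) * L i c a x + \sum_i l (rshift m i) * L' i c a x = 0.
  move=> Ac xU; rewrite -[RHS](hl c Ac x xU a) big_split_ord/=; congr (_ + _); apply: eq_bigr => i _.
    by rewrite (unsplitK (inl i)).
  by rewrite (unsplitK (inr i)).
have l1 : forall i, l (lshift n i) = 0.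
  apply: Ki => c Ac x xU a; have xUU : region c (U `|` U') x by rewrite region_setU; left.
  rewrite -[RHS](E c x a Ac xUU) [X in _ = _ + X]big1 ?addr0 => [|i _].
    by apply: eq_bigr => i _; have [_ H _] := HL i; rewrite (H c Ac x xU).
  by have [_ H _] := HL' i; rewrite (H c Ac x xU) mulr0.
have l2 : forall i, l (rshift m i) = 0.
  apply: Ki' => c Ac x xU a; have xUU : region c (U `|` U') x by rewrite region_setU; right.
  rewrite -[RHS](E c x a Ac xUU) [X in _ = X + _]big1 ?add0r => [|i _].
    by apply: eq_bigr => i _; have [_ _ H] := HL' i; rewrite (H c Ac x xU).
  by rewrite l1 mul0r.
by move=> i; case: (fintype.split_ordP i) => j ->; [exact: l1|exact: l2].
Qed.

Lemma has_kil_setU_vanish n U U' (K : 'I_n -> chart R S -> 'I_2 -> fn) : (forall i : 'I_n, killing_form (U `|` U') (K i)) ->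
  lin_independent A (U `|` U') K -> (forall i, vanishes U (K i)) -> has_kil n U'.
Proof.
move=> kil Ki K0; exists K; split=> [i|l hl]; first exact: killing_form_sub (kil i).
apply: Ki; apply: vanishes_setU => // c Ac x xU a.
by rewrite big1// => i _; rewrite (K0 i c Ac x xU) mulr0.
Qed.

Lemma has_kil_setU0 n U U' : ~ has_kil 1 U -> ~ has_kil n U' -> ~ has_kil n (U `|` U').
Proof.
move=> n1 n2 [K [kil Ki]]; apply: n2; apply: (has_kil_setU_vanish kil Ki) => i.
apply: contrapT; move: (killing_form_sub (@subsetUl _ U U') (kil i)) => k0 k1.
exact/n1/(has_kil1P k0 k1).
Qed.

(** When restriction to [U] has rank at most one, multiples of one form that does not vanish on [U]
    can be subtracted from the other [n] to make them vanish there. The results are independent on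
    [U']. *)
Lemma has_kil_setU1 n U U' : open U -> open U' -> ~ has_kil 2 U -> ~ has_kil n U' -> ~ has_kil n.+1 (U `|` U').
Proof.
move=> oU oU' n1 n2 [K [kil Ki]]; have oUU := openU oU oU'.
have kilU i := killing_form_sub (@subsetUl _ U U') (kil i).
have [K0|/existsNP[i Kn]] := pselect (forall i, vanishes U (K i)).
  by apply: n2; apply: has_kilS; exact: (has_kil_setU_vanish kil Ki).
(* Without such an [m], the forms [K i] and [K (lift i j)] would be independent on [U]. *)
have /choice[m hm] j : exists m, vanishes U (lincomb (fun k => (k == lift i j)%:R - m * (k == i)%:R) K).
  apply: contrapT => /forallNP nm; apply: n1.
  exists (fun k : 'I_2 => K (if k == 0 then i else lift i j)); split=> [k|l hl]; first exact: kilU.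
  have E c x a : A c -> region c U x -> l 0 * K i c a x + l 1 * K (lift i j) c a x = 0.
    by move=> Ac xU; rewrite -[RHS](hl c Ac x xU a) sum_ord2.
  have l10 : l 1 = 0.
    apply: contrapT => /eqP l1; apply: (nm (- (l 0 / l 1))) => c Ac x xU a.
    rewrite /lincomb (bigD1_ord i)//= (bigD1 j)//= big1 ?addr0 => [|k kj]; last first.
      rewrite (inj_eq (@lift_inj _ i)) (negPf kj) [lift i k == i]eq_sym (negPf (neq_lift i k)).
      by rewrite mulr0 subr0 mul0r.
    rewrite !eqxx [lift i j == i]eq_sym (negPf (neq_lift i j)).
    have := E c x a Ac xU; move: (K i c a x) (K (lift i j) c a x) => u v h.
    by rewrite -[RHS](mul0r (l 1)^-1) -h /=; field.
  elim/ord2_ind => //; apply: contrapT => /eqP l0; apply: Kn => c Ac x xU a.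
  by have := E c x a Ac xU; rewrite l10 mul0r addr0 => /eqP; rewrite mulf_eq0 (negPf l0) => /eqP.
apply: n2; pose L j := lincomb (fun k => (k == lift i j)%:R - m j * (k == i)%:R) K.
have kL j : killing_form (U `|` U') (L j) by exact: killing_form_lin.
apply: (has_kil_setU_vanish kL _ hm) => l hl.
pose l' k := \sum_j l j * ((k == lift i j)%:R - m j * (k == i)%:R).
have l'0 : forall k, l' k = 0.
  apply: Ki => c Ac x xU a; rewrite -[RHS](hl c Ac x xU a) /l' /L /lincomb.
  under eq_bigr do rewrite big_distrl/=.
  rewrite exchange_big/=; apply: eq_bigr => j _; rewrite big_distrr/=; apply: eq_bigr => k _.
  by rewrite mulrA.
move=> j; rewrite -[RHS](l'0 (lift i j)) /l' (bigD1 j)//= big1 ?addr0 => [|k kj].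
  by rewrite eqxx [lift i j == i]eq_sym (negPf (neq_lift i j)) mulr0 subr0 mulr1.
rewrite (inj_eq (@lift_inj _ i)) [j == k]eq_sym (negPf kj) [lift i j == i]eq_sym.
by rewrite (negPf (neq_lift i j)) !mulr0 subr0 mulr0.
Qed.

Lemma tensorT_continuous c x (a b : 'I_2) : A c -> region c setT x ->
  {for x, continuous (tensorT (Gam c) (eps c) a b)}.
Proof.
move=> Ac xT; have [oT G4 sG e4 e0 es] := chartD Ac.
apply: (Ck_cont (k := 1) oT) => //.
by apply: Ck_sub => //; apply: Ck_mul => //;
  [exact: Ck_tensorN|exact: Ck_tensorF|exact: Ck_beta|exact: Ck_tensorM].
Qed.

(** Serves to move a generic point away from [p], so that a ball at [p] and a disc at that point can
    be made disjoint. *)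
Lemma near_shift (P : 'rV[R]_2 -> Prop) x y : (\forall z \near x, P z) -> exists2 z, z != y & P z.
Proof.
move=> /near_disc[d d0 dP]; have [xy|xy] := eqVneq x y; last first.
  by exists x => //; apply: dP; rewrite /disc/= subrr normr0.
exists (x + (d / 2) *: ee 0).
  rewrite -xy -subr_eq0 addrAC subrr add0r scaler_eq0 negb_or.
  rewrite mulf_neq0 ?invr_neq0 ?lt0r_neq0//=.
  by apply/eqP => /matrixP/(_ 0 0)/eqP; rewrite !mxE !eqxx oner_eq0.
apply: dP; rewrite /disc/= addrAC subrr add0r normrZ norm_ee mulr1 ger0_norm; lra.
Qed.

Lemma ricci_skew_sub U U' : U' `<=` U -> ricci_skew_nonzero_on A Gam U' -> ricci_skew_nonzero_on A Gam U.
Proof.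
move=> UU [c [x [a [b [Ac xU n]]]]]; exists c, x, a, b; split=> //; exact: region_sub xU.
Qed.

Lemma chart_set_region c U W : A c -> W `<=` region c U -> chart_set c W `<=` U.
Proof. by move=> Ac WU q [qc /WU/(regionP Ac)[_ + _]]; rewrite cinvK. Qed.

Lemma tensorT_vanishes_sub U U' : U' `<=` U -> tensorT0 U -> tensorT0 U'.
Proof. by move=> UU T0 c Ac x xU; apply: T0 => //; exact: region_sub xU. Qed.

Section Point.
Variables (p : S) (c0 : chart R S) (r1 : R).
Hypotheses (A0 : A c0) (p0 : cdom c0 p) (r1_gt0 : 0 < r1)
  (goodr : forall r, 0 < r -> r <= r1 -> good (region c0 setT) (prol (Gam c0) (eps c0)) (cmap c0 p) r).
Local Notation x0 := (cmap c0 p).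
Local Notation B r := (chart_set c0 (disc x0 r)).

Let discT r : 0 < r -> r <= r1 -> disc x0 r `<=` region c0 setT.
Proof. by move=> r0 r1' x; exact: (good_disc (goodr r0 r1')). Qed.

Let openB r : open (B r).
Proof. by apply: open_chart_set A0 _; exact: open_disc. Qed.

Let Bp r : 0 < r -> B r p.
Proof. by move=> r0; split=> //=; rewrite /disc/= subrr normr0. Qed.

Let rigidB r : 0 < r -> r <= r1 -> rigid (B r).
Proof. by move=> r0 r1'; exact: rigid_disc A0 (goodr r0 r1'). Qed.

Let regionB r : 0 < r -> r <= r1 -> region c0 (B r) = disc x0 r.
Proof. by move=> r0 r1'; apply: region_chart_set; exact: discT. Qed.

Let subB r r' : r' <= r -> B r' `<=` B r.
Proof. by move=> rr q [qc qr]; split=> //; exact: lt_le_trans qr rr. Qed.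

Lemma has_kil3_vecV r : 0 < r -> r <= r1 -> (forall x, disc x0 r x -> forall j, vecV (Gam c0) (eps c0) j x = 0) ->
  has_kil 3 (B r).
Proof.
move=> r0 r1' V0; apply/(has_kil_chart 3 A0 (@open_disc _ _ _) (discT r0 r1')).
exact: (has_par3_vecV (chartD A0) (goodr r0 r1') V0).
Qed.

Lemma has_kil3_flat U r : 0 < r -> r <= r1 -> open U -> B r `<=` U ->
  projectively_flat_on A Gam U -> ricci_symmetric_on A Gam U -> has_kil 3 (B r).
Proof.
move=> r0 r1' oU BU pf sym; apply: has_kil3_vecV => // x xr.
by apply: (projectively_flat_vecV oU pf sym A0); apply: region_sub BU _ _; rewrite regionB.
Qed.

Lemma beta_neq0 r : 0 < r -> r <= r1 -> tensorT0 (B r) -> ~ has_kil 3 (B r) ->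
  exists2 y, disc x0 r y & beta (Gam c0) (eps c0) y != 0.
Proof.
move=> r0 r1' T0 n3.
have /existsNP[x /not_implyP[xr /existsNP[j /eqP Vj]]] := contra_not (has_kil3_vecV r0 r1') n3.
apply: (tensorT_beta_neq0 (chartD A0) (@open_disc _ _ _) (discT r0 r1') _ xr); last by exists j.
by move=> y yr a b; apply: T0 => //; rewrite regionB.
Qed.

Lemma ricci_skew_neq0 r : 0 < r -> r <= r1 -> tensorT0 (B r) -> ~ has_kil 3 (B r) ->
  ricci_skew_nonzero_on A Gam (B r).
Proof.
move=> r0 r1' T0 n3; have [y yr b0] := beta_neq0 r0 r1' T0 n3.
apply: contrapT => nskew; move/eqP: b0; apply; apply/(beta_ricci (chartD A0) (discT r0 r1' yr)) => a b.
apply: contrapT => /eqP ab; apply: nskew; exists c0, y, a, b; split=> //; first by rewrite regionB.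
by rewrite /ricci_skew mulf_neq0 ?invr_neq0 ?subr_eq0.
Qed.

(* [U] need not be connected. When the ball at [p] carries fewer Killing forms
   than the ranks at its generic points allow, the missing ones are supplied by a
   disjoint open set close to [p]. *)
Definition characterised U := [/\ open_nbhs p U,
  invariants0 U -> has_kil 1 U,
  (has_kil 2 U /\ ~ has_kil 3 U) <-> (tensorT0 U /\ ricci_skew_nonzero_on A Gam U) &
  has_kil 3 U <-> (projectively_flat_on A Gam U /\ ricci_symmetric_on A Gam U)].

Lemma characterised3 r : 0 < r -> r <= r1 -> has_kil 3 (B r) -> characterised (B r).
Proof.
move=> r0 r1' k3; have [pf sym] := kil3_projectively_flat (openB r) (rigidB r0 r1') k3.
split=> //; first by split=> //; exact: Bp.
- by move=> _; exact/has_kilS/has_kilS.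
- by split=> [[_ /(_ k3)]|[_ [c [x [a [b [Ac xU]]]]]]]; rewrite // /ricci_skew (sym c Ac x xU) subrr mulr0 eqxx.
Qed.

Hypothesis no3 : forall r, 0 < r -> r <= r1 -> ~ has_kil 3 (B r).

Lemma characterised_flat U r : 0 < r -> r <= r1 -> open U -> B r `<=` U -> ~ has_kil 3 U ->
  has_kil 3 U <-> (projectively_flat_on A Gam U /\ ricci_symmetric_on A Gam U).
Proof.
move=> r0 r1' oU BU n3; split=> // -[pf sym].
by case: (no3 r0 r1'); exact: (has_kil3_flat r0 r1' oU BU).
Qed.

(** The condition on the Ricci tensor is automatic: [T] vanishes and no small ball at [p] carries
    three Killing forms, so [beta] is nonzero somewhere in [B r]. *)
Lemma characterised2 U r : 0 < r -> r <= r1 -> open U -> B r `<=` U -> has_kil 2 U -> ~ has_kil 3 U ->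
  tensorT0 U -> characterised U.
Proof.
move=> r0 r1' oU BU k2 n3 T0; split.
- by split=> //; apply: BU; exact: Bp.
- by move=> _; exact: has_kilS.
- split=> // _; split=> //; apply: (ricci_skew_sub BU); apply: ricci_skew_neq0 => //; last exact: no3.
  exact: tensorT_vanishes_sub T0.
- exact: (characterised_flat r0 r1' oU BU).
Qed.

(** Neither side of the equivalence about two integrals holds: [U] does not carry two, and [T] is
    nonzero already on [B r]. *)
Lemma characterised1 U r : 0 < r -> r <= r1 -> open U -> B r `<=` U -> ~ has_kil 2 U -> ~ tensorT0 (B r) ->
  (invariants0 U -> has_kil 1 U) -> characterised U.
Proof.
move=> r0 r1' oU BU n2 nT k1; split=> //.
- by split=> //; apply: BU; exact: Bp.
- split=> [[/n2]//|[T0 _]]; case: nT; exact: tensorT_vanishes_sub T0.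
- by apply: (characterised_flat r0 r1' oU BU) => /has_kilS.
Qed.

(** The generic point may have been found in a chart [c] other than [c0], so its disc lives in [c]
    while the ball at [p] lives in [c0]. Disjointness is arranged in [c0], by halving the distance
    between the two points. *)
Lemma separated c r x : A c -> 0 < r -> region c (B r) x -> cinv c x <> p ->
  exists r' d : R, [/\ 0 < r', r' <= r, 0 < d, disc x d `<=` region c (B r) &
    B r' `&` chart_set c (disc x d) = set0].
Proof.
move=> Ac r0 xB xp; have [xc [x0c xr] xE] := regionP Ac xB.
pose y := cmap c0 (cinv c x); have yx : 0 < `|y - x0|.
  rewrite normr_gt0 subr_eq0; apply/eqP => yE; apply: xp.
  by rewrite -(cinvK A0 x0c) -/y yE cinvK.
pose r' := Num.min r (`|y - x0| / 2).
have oN : open (B r `&` chart_set c0 (disc y (`|y - x0| / 2))).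
  by apply: openI => //; apply: open_chart_set => //; exact: open_disc.
have xN : region c (B r `&` chart_set c0 (disc y (`|y - x0| / 2))) x.
  rewrite -xE; apply: region_map => //; split=> //; split=> //=.
  by rewrite /disc/= subrr normr0 divr_gt0.
have [d d0 dN] := (near_disc x _).1 (near_open (open_region Ac oN) xN (fun y Oy => Oy)).
have sN : chart_set c (disc x d) `<=` B r `&` chart_set c0 (disc y (`|y - x0| / 2)).
  exact: chart_set_region.
exists r', d; split=> //.
- by rewrite lt_min r0 divr_gt0.
- by rewrite ge_min lexx.
- by move=> z /dN; apply: region_sub => q [].
- apply/seteqP; split=> // q [[_ qr'] /sN[_ [_ qy]]]; move: qr' qy; rewrite /disc/= lt_min => /andP[_ h1] h2.
  have := ler_distD (cmap c0 q) y x0; rewrite (distrC y (cmap c0 q)); lra.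
Qed.

(** The count on the union is 0 + 2: near a point with [beta] nonzero, [T = 0] yields two Killing
    forms. Three are excluded because [V] does not vanish on the added disc. *)
Lemma characterised_no1_tensorT r : 0 < r -> r <= r1 ->
  (forall r, 0 < r -> r <= r1 -> ~ has_kil 1 (B r)) -> tensorT0 (B r) -> exists U, characterised U.
Proof.
move=> r0 r1' n1 T0; have [y yr by0] := beta_neq0 r0 r1' T0 (no3 r0 r1').
have [oT G4 sG e4 e0 es] := chartD A0.
have bc : {for y, continuous (beta (Gam c0) (eps c0))}.
  by apply: (Ck_cont (k := 1) oT); [exact: Ck_beta|exact: discT yr].
have [x xx0 [xr bx]] := near_shift x0 (filterI (near_open (@open_disc _ _ _) yr (fun z Oz => Oz : disc x0 r z))
  (neq0_near bc by0)).
have xB : region c0 (B r) x by rewrite regionB.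
have [xc _ xE] := regionP A0 xB.
have xp : cinv c0 x <> p by move=> h; move/eqP: xx0; rewrite -xE h.
have [r' [d [r'0 r'r d0 dB BW]]] := separated A0 r0 xB xp.
have WB := chart_set_region A0 dB; have dT : disc x d `<=` region c0 setT by move=> z /dB; exact: region_sub.
have [s /andP[s0 sd] [gs k2]] := has_par2_tensorT (chartD A0) (discT r0 r1' xr) d0 d0 bx dT
  (fun z zd a b => T0 c0 A0 z (dB z zd) a b).
have sub : disc x s `<=` disc x d by move=> z zs; exact: lt_le_trans zs sd.
have subT : disc x s `<=` region c0 setT by move=> z /sub; exact: dT.
have oW : open (chart_set c0 (disc x s)) by apply: open_chart_set => //; exact: open_disc.
have subW : chart_set c0 (disc x s) `<=` chart_set c0 (disc x d) by move=> q [qc qs]; split=> //; exact: sub.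
have {}k2 : has_kil 2 (chart_set c0 (disc x s)).
  by apply/(has_kil_chart 2 A0 (@open_disc _ _ _) subT).
have r'1 : r' <= r1 by exact: le_trans r'r r1'.
exists (B r' `|` chart_set c0 (disc x s)); apply: (characterised2 r'0 r'1).
- exact: openU.
- exact: subsetUl.
- apply: (@has_kil_setU 0 2) => //; last exact: has_kil0.
  by apply/seteqP; split=> // q [q1 /subW q2]; rewrite -BW.
- apply: has_kil_setU0; first exact: n1.
  move=> /(kil3_vecV oW (rigid_disc A0 gs)) V0.
  have xs : region c0 (chart_set c0 (disc x s)) x.
    by rewrite region_chart_set//= /disc/= subrr normr0.
  have /vecVE[_ _ b0] := V0 c0 A0 x xs; by rewrite b0 eqxx in bx.
- apply: tensorT_vanishes_sub T0 => q [|/subW/WB//]; exact: subB.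
Qed.

(** The count on the union is 0 + 1. The added disc is centred at a point where [T] is nonzero,
    which yields one form and excludes a second. *)
Lemma characterised_no1_invariants r : 0 < r -> r <= r1 ->
  (forall r, 0 < r -> r <= r1 -> ~ has_kil 1 (B r)) -> (forall r, 0 < r -> r <= r1 -> ~ tensorT0 (B r)) ->
  invariants0 (B r) -> exists U, characterised U.
Proof.
move=> r0 r1' n1 nT [N0 S0].
have /existsNP[c /not_implyP[Ac /existsNP[y /not_implyP[yB /existsNP[a /existsNP[b /eqP Ty]]]]]] := nT r r0 r1'.
have oB := open_region Ac (openB r).
have [x xp' [xB Tx]] := near_shift (cmap c p) (filterI (near_open oB yB (fun z Oz => Oz : region c (B r) z))
  (neq0_near (tensorT_continuous Ac (region_setT yB)) Ty)).
have [xc _ xE] := regionP Ac xB.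
have xp : cinv c x <> p by move=> h; move/eqP: xp'; rewrite -xE h.
have [r' [d [r'0 r'r d0 dB BW]]] := separated Ac r0 xB xp.
have WB := chart_set_region Ac dB; have dT : disc x d `<=` region c setT by move=> z /dB; exact: region_sub.
have [s /andP[s0 sd] [gs k1]] := has_par1_invariants (chartD Ac) (region_setT xB) d0 d0 dT Tx
  (fun z zd => N0 c Ac z (dB z zd)) (fun z zd => S0 c Ac z (dB z zd)).
have sub : disc x s `<=` disc x d by move=> z zs; exact: lt_le_trans zs sd.
have subT : disc x s `<=` region c setT by move=> z /sub; exact: dT.
have oW : open (chart_set c (disc x s)) by apply: open_chart_set => //; exact: open_disc.
have subW : chart_set c (disc x s) `<=` chart_set c (disc x d) by move=> q [qc qs]; split=> //; exact: sub.
have {}k1 : has_kil 1 (chart_set c (disc x s)).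
  by apply/(has_kil_chart 1 Ac (@open_disc _ _ _) subT).
have r'1 : r' <= r1 by exact: le_trans r'r r1'.
exists (B r' `|` chart_set c (disc x s)); apply: (characterised1 r'0 r'1).
- exact: openU.
- exact: subsetUl.
- apply: has_kil_setU0; first exact: n1.
  move=> /(kil2_tensorT oW (rigid_disc Ac gs)) T0.
  have xs : region c (chart_set c (disc x s)) x.
    by rewrite region_chart_set//= /disc/= subrr normr0.
  by move/eqP: Tx; apply; exact: T0.
- exact: nT.
- move=> _; apply: (@has_kil_setU 0 1) => //; last exact: has_kil0.
  by apply/seteqP; split=> // q [q1 /subW q2]; rewrite -BW.
Qed.

(** The count on the union is 1 + 1. The added half-disc inherits a form from the ball by rigidity;
    it can be chosen without a second one, since two on every half-disc would give two on the
    ball. *)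
Lemma characterised_tensorT r : 0 < r -> r <= r1 -> has_kil 1 (B r) ->
  (forall r, 0 < r -> r <= r1 -> ~ has_kil 2 (B r)) -> tensorT0 (B r) -> exists U, characterised U.
Proof.
move=> r0 r1' k1 n2 T0.
have n2' : ~ has_par (prol (Gam c0) (eps c0)) 2 (disc x0 r).
  by move/(has_kil_chart 2 A0 (@open_disc _ _ _) (discT r0 r1')); exact: n2.
have := contra_not (has_par2_half (chartD A0) (goodr r0 r1')) n2'.
move=> /existsNP[l /existsNP[t /not_implyP[t0 /not_implyP[[z zW] nW]]]].
pose W := disc x0 r `&` half x0 l t.
have oW : open W by apply: openI; [exact: open_disc|exact: open_half].
have WT : W `<=` region c0 setT by move=> y [yr _]; exact: discT yr.
have WB : chart_set c0 W `<=` B r by move=> q [qc [qr _]].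
have oCW := open_chart_set A0 oW.
have cW x : W x -> star x W.
  by move=> [x1 x2] y [y1 y2] v v01; split; [exact: convex_disc|exact: convex_half].
have rW : rigid (chart_set c0 W).
  by apply: (rigid_chart A0 oW _ (goodr r0 r1') cW) => y [].
(* [ell] is at most [m] times the distance to the centre, so the disc of radius [t / m] misses the
   half-plane. *)
pose m := 1 + `|l 0 0| + `|l 0 1|; have m0 : 0 < m by rewrite /m -addrA ltr_pwDl.
pose r' := Num.min r (t / m).
have r'0 : 0 < r' by rewrite lt_min r0 divr_gt0.
have r'r : r' <= r by rewrite ge_min lexx.
have r'1 : r' <= r1 by exact: le_trans r'r r1'.
have BW : B r' `&` chart_set c0 W = set0.
  apply/seteqP; split=> // q [[_ qr'] [_ [_ qh]]]; move: qr' qh; rewrite /disc /half /ell/= lt_min => /andP[_].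
  set h := cmap c0 q - x0; rewrite ltr_pdivlMr// => hm tl.
  have h0 := coord_le h 0; have h1 := coord_le h 1.
  have b0 : l 0 0 * h 0 0 <= `|l 0 0| * `|h|.
    by apply: le_trans (ler_norm _) _; rewrite normrM ler_wpM2l.
  have b1 : l 0 1 * h 0 1 <= `|l 0 1| * `|h|.
    by apply: le_trans (ler_norm _) _; rewrite normrM ler_wpM2l.
  have := normr_ge0 h; move: hm; rewrite /m; nra.
have k1B' := has_kil_sub (openB r') (ex_intro _ p (Bp r'0)) (subB r'r) (openB r) (rigidB r0 r1') k1.
have W0 : chart_set c0 W !=set0.
  by have [q [qc _] qz] := WT z zW; exists q; split=> //=; rewrite qz.
have k1W := has_kil_sub oCW W0 WB (openB r) (rigidB r0 r1') k1.
exists (B r' `|` chart_set c0 W); apply: (characterised2 r'0 r'1).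
- exact: openU.
- exact: subsetUl.
- exact: (@has_kil_setU 1 1).
- apply: has_kil_setU1 => //; first exact: n2.
  by move/(has_kil_chart 2 A0 oW WT).
- apply: tensorT_vanishes_sub T0 => q [|/WB//]; exact: subB.
Qed.

End Point.

(** A classical case distinction on how many Killing forms some small ball at [p] carries, and on
    whether [T] vanishes on one of these balls. *)
Lemma characterised_exists p : exists U, characterised p U.
Proof.
have [_ /(_ p)[c0 A0 p0] _] := atlasA.
have [r1 r10 g] := good_chart A0 (region_map p0 (I : setT p)).
pose B r := chart_set c0 (disc (cmap c0 p) r).
have oB r : open (B r) by apply: open_chart_set A0 _; exact: open_disc.
have Bp r : 0 < r -> B r p by move=> r0; split=> //=; rewrite /disc/= subrr normr0.
have rB r : 0 < r -> r <= r1 -> rigid (B r) by move=> r0 r1'; exact: rigid_disc A0 (g r r0 r1').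
have [[r [r0 r1' k3]]|n3] := pselect (exists r, [/\ 0 < r, r <= r1 & has_kil 3 (B r)]).
  by exists (B r); exact: (characterised3 A0 p0 g r0 r1' k3).
have {}n3 r : 0 < r -> r <= r1 -> ~ has_kil 3 (B r) by move=> r0 r1' k; apply: n3; exists r.
have [[r [r0 r1' k2]]|n2] := pselect (exists r, [/\ 0 < r, r <= r1 & has_kil 2 (B r)]).
  exists (B r); apply: (characterised2 A0 p0 g n3 r0 r1' (oB r) (@subset_refl _ _) k2 (n3 r r0 r1')).
  exact: (kil2_tensorT (oB r) (rB r r0 r1') k2).
have {}n2 r : 0 < r -> r <= r1 -> ~ has_kil 2 (B r) by move=> r0 r1' k; apply: n2; exists r.
have [[r [r0 r1' k1]]|n1] := pselect (exists r, [/\ 0 < r, r <= r1 & has_kil 1 (B r)]).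
  have [[s [s0 sr T0]]|nT] := pselect (exists s, [/\ 0 < s, s <= r & tensorT0 (B s)]).
    have s1 : s <= r1 by exact: le_trans sr r1'.
    apply: (characterised_tensorT A0 p0 g n3 s0 s1 _ n2 T0).
    have sB : B s `<=` B r by move=> q [qc qs]; split=> //; exact: lt_le_trans qs sr.
    exact: (has_kil_sub (oB s) (ex_intro _ p (Bp s s0)) sB (oB r) (rB r r0 r1') k1).
  exists (B r); apply: (characterised1 A0 p0 g n3 r0 r1' (oB r) (@subset_refl _ _) (n2 r r0 r1')) => // T0.
  by apply: nT; exists r.
have {}n1 r : 0 < r -> r <= r1 -> ~ has_kil 1 (B r) by move=> r0 r1' k; apply: n1; exists r.
have [[r [r0 r1' T0]]|nT] := pselect (exists r, [/\ 0 < r, r <= r1 & tensorT0 (B r)]).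
  exact: (characterised_no1_tensorT A0 p0 g n3 r0 r1' n1 T0).
have {}nT r : 0 < r -> r <= r1 -> ~ tensorT0 (B r) by move=> r0 r1' k; apply: nT; exists r.
have [inv|ninv] := pselect (invariants0 (B r1)).
  exact: (characterised_no1_invariants A0 p0 g n3 r10 (lexx _) n1 nT inv).
(* The invariants do not both vanish on this ball, so sufficiency holds vacuously. *)
exists (B r1); apply: (characterised1 A0 p0 g n3 r10 (lexx _) (oB r1) (@subset_refl _ _)) => //.
- exact: n2.
- exact: nT.
Qed.

End Manifold.

Theorem theorem1p1 (R : realType) (Sigma : topologicalType)
    (A : set (chart R Sigma))
    (surfaceA : is_surface 6 A)
    (simply_connectedSigma : simply_connected R Sigma)
    (orientableA : orientable 6 A)
    (Gamma : chart R Sigma -> 'I_2 -> 'I_2 -> 'I_2 -> 'rV[R]_2 -> R)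
    (connectionGamma : is_connection A 4 Gamma)
    (torsion_freeGamma : torsion_free A Gamma)
    (eps : chart R Sigma -> 'I_2 -> 'I_2 -> 'rV[R]_2 -> R)
    (volume_eps : is_volume_form A 4 eps) :
  ((exists K, is_first_integral A Gamma setT K) ->
     invN_vanishes_on A Gamma eps setT /\ invS_vanishes_on A Gamma eps setT)
  /\
  (forall p : Sigma, exists U : set Sigma,
    [/\ open_nbhs p U,
        invN_vanishes_on A Gamma eps U /\ invS_vanishes_on A Gamma eps U ->
          exists K, is_first_integral A Gamma U K,
        (has_independent_first_integrals A Gamma 2 U /\
         ~ has_independent_first_integrals A Gamma 3 U) <->
          (tensorT_vanishes_on A Gamma eps U /\
           ricci_skew_nonzero_on A Gamma U) &
        has_independent_first_integrals A Gamma 3 U <->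
          (projectively_flat_on A Gamma U /\ ricci_symmetric_on A Gamma U)]).
Proof.
have [_ _ atlasA] := surfaceA; have [pc _] := simply_connectedSigma.
split=> [[K KF]|p].
  have [_ [c [x [a [Ac xT Kn]]]] _] := KF.
  have kil := first_integral_killing atlasA connectionGamma torsion_freeGamma (@openT _) KF.
  have rT := rigid_setT atlasA connectionGamma torsion_freeGamma volume_eps pc.
  apply: (kil1_invariants atlasA connectionGamma torsion_freeGamma volume_eps (@openT _) rT).
  by apply: (has_kil1P kil) => K0; rewrite (K0 c Ac x xT) eqxx in Kn.
have [U [pU inv two three]] :=
  characterised_exists atlasA connectionGamma torsion_freeGamma volume_eps p.
have oU : open U by case: pU.
have P n := has_kilP atlasA connectionGamma torsion_freeGamma n oU.
exists U; split=> // [/inv/(P 1%N)[K [KF _]]||].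
- by exists (K ord0).
- by rewrite -two; split=> -[h2 h3]; split; try (by apply/P); move=> h; apply: h3; apply/P.
- by rewrite -three; exact: P.
Qed.
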